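(* Let $N\geq3$, let $G$ be a closed subgroup of the group $O(N)$ of linear isometries of $\mathbb{R}^N$, let $\Omega$ be a bounded smooth open subset of $\mathbb{R}^N$, and let $\lambda\in(-\Lambda_\Omega,0]$. If $\Omega$ is $G$-invariant and if $\#Gx=\infty$ for all $x\in\overline{\Omega}$, then the problem $$-\Delta u+\lambda\mathds{1}_\Omega u=Q_\Omega(x)|u|^{2^*-2}u,\qquad u\in D^{1,2}(\mathbb{R}^N),$$ has infinitely many $G$-invariant solutions.
   Context: $\Omega$ is not necessarily connected. $2^*:=\frac{2N}{N-2}$; $\mathds{1}_\Omega$ is the characteristic function of $\Omega$; $Q_\Omega(x):=1$ if $x\in\Omega$ and $Q_\Omega(x):=-1$ if $x\in\mathbb{R}^N\smallsetminus\Omega$. $D^{1,2}(\mathbb{R}^N)=\{u\in L^{2^*}(\mathbb{R}^N):\nabla u\in L^2(\mathbb{R}^N;\mathbb{R}^N)\}$, and $$\Lambda_\Omega:=\inf_{u\in D^{1,2}(\mathbb{R}^N),\,u\neq0}\frac{\int_{\mathbb{R}^N}|\nabla u|^2}{\int_\Omega u^2}$$ (the quotient being $+\infty$ if the denominator vanishes). Solutions are the critical points of $J_\lambda(u):=\frac12\int_{\mathbb{R}^N}(|\nabla u|^2+\lambda\mathds{1}_\Omega u^2)-\frac1{2^*}\int_{\mathbb{R}^N}Q_\Omega|u|^{2^*}$ on $D^{1,2}(\mathbb{R}^N)$. The $G$-orbit of $x\in\mathbb{R}^N$ is $Gx:=\{gx:g\in G\}$, and $\#Gx$ denotes its cardinality.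 $\Omega$ is $G$-invariant if $Gx\subset\Omega$ for all $x\in\Omega$; a function $u:\mathbb{R}^N\to\mathbb{R}$ is $G$-invariant if it is constant on every $G$-orbit. *)

(* Defs.v *)
From HB Require Import structures.
From mathcomp Require Import all_boot all_order all_algebra.
From mathcomp Require Import all_classical all_reals all_analysis.

Set Implicit Arguments.
Unset Strict Implicit.
Unset Printing Implicit Defensive.

Import Order.TTheory GRing.Theory Num.Theory.
Import numFieldNormedType.Exports.

Local Open Scope classical_set_scope.
Local Open Scope ring_scope.

(* R^n is 'rV[R]_n. Its sigma-algebra is the one generated by the coordinates,
   as for n.-tuple R. *)
Section measurable_rV.
Context {R : realType} (n : nat).

Let coords : 'I_n -> 'rV[R]_n -> measurableTypeR R := fun i x => x ord0 i.

Let rV_set0 : g_sigma_preimage coords set0.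
Proof. exact: sigma_algebra0. Qed.

Let rV_setC A : g_sigma_preimage coords A -> g_sigma_preimage coords (~` A).
Proof. exact: sigma_algebraC. Qed.

Let rV_bigcup (F : _^nat) : (forall i, g_sigma_preimage coords (F i)) ->
  g_sigma_preimage coords (\bigcup_i (F i)).
Proof. exact: sigma_algebra_bigcup. Qed.

HB.instance Definition _ := @isMeasurable.Build default_measure_display
  'rV[R]_n (g_sigma_preimage coords) rV_set0 rV_setC rV_bigcup.

Lemma measurable_coord (i : 'I_n) :
  measurable_fun [set: 'rV[R]_n] (fun x => x ord0 i : measurableTypeR R).
Proof.
move=> _ Y mY; rewrite setTI; apply: sub_sigma_algebra => /=.
rewrite -bigcup_seq/=; exists i => /=; first by rewrite mem_index_enum.
by exists Y => //; rewrite setTI.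
Qed.

Lemma measurable_fun_coordP d (T : measurableType d) (f : T -> 'rV[R]_n) :
  (forall i, measurable_fun setT (fun x => f x ord0 i : measurableTypeR R)) ->
  measurable_fun setT f.
Proof.
move=> mf _ A mA; rewrite setTI.
suff : g_sigma_preimage coords `<=` [set A | measurable (f @^-1` A)] by exact.
apply: smallest_sub.
  split => /=.
  - by rewrite preimage_set0.
  - by move=> B mB; rewrite setTD preimage_setC; exact: measurableC.
  - by move=> F mF; rewrite preimage_bigcup; exact: bigcup_measurable.
move=> B; rewrite -bigcup_seq => -[i /= _ [C mC <-]].
by rewrite setTI /=; have := mf i measurableT C mC; rewrite setTI.
Qed.

End measurable_rV.

Section lebesgue_rV.
Context {R : realType}.

Definition consrV n (p : measurableTypeR R * 'rV[R]_n) : 'rV[R]_n.+1 :=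
  row_mx (const_mx p.1 : 'rV[R]_1) p.2.

Definition unconsrV n (x : 'rV[R]_n.+1) : measurableTypeR R * 'rV[R]_n :=
  (x ord0 ord0, rsubmx (x : 'rV[R]_(1 + n))).

Lemma consrVK n : cancel (@consrV n) (@unconsrV n).
Proof.
move=> [t v]; rewrite /unconsrV /consrV row_mxKr; congr pair => /=.
rewrite (_ : ord0 = lshift n (ord0 : 'I_1)); last exact/val_inj.
by rewrite (@row_mxEl _ 1 1 n) mxE.
Qed.

Lemma unconsrVK n : cancel (@unconsrV n) (@consrV n).
Proof.
move=> x; apply: etrans (@hsubmxK _ 1 1 n x); congr (@row_mx _ 1 1 n _ _).
by apply/rowP => i; rewrite !mxE ord1; congr (x _ _); apply/val_inj.
Qed.

Lemma measurable_consrV n : measurable_fun setT (@consrV n).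
Proof.
apply: measurable_fun_coordP => i; case: (split_ordP (m := 1) (n := n) i) => j ->.
  under eq_fun do rewrite (@row_mxEl _ 1 1 n) mxE.
  exact: measurable_fst.
under eq_fun do rewrite (@row_mxEr _ 1 1 n).
exact: (measurableT_comp (measurable_coord j)).
Qed.

Lemma measurable_unconsrV n : measurable_fun setT (@unconsrV n).
Proof.
apply/measurable_fun_pairP; split; first exact: measurable_coord.
apply: measurable_fun_coordP => i /=.
under eq_fun do rewrite mxE.
exact: measurable_coord.
Qed.

Section step.
Variables (n : nat) (mu : {sigma_finite_measure set 'rV[R]_n -> \bar R}).

Definition leb_step := pushforward (@lebesgue_measure R \x mu)%E (@consrV n).

Let step0 : leb_step set0 = 0%E.
Proof. by rewrite /leb_step /pushforward preimage_set0 measure0. Qed.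

Let step_ge0 A : (0 <= leb_step A)%E.
Proof. exact: (measure_ge0 (@lebesgue_measure R \x mu)%E). Qed.

Let step_sigma_additive : semi_sigma_additive leb_step.
Proof.
move=> F mF tF mUF; rewrite /leb_step /pushforward preimage_bigcup.
apply: measure_semi_sigma_additive.
- by move=> k; rewrite -[X in measurable X]setTI; exact: measurable_consrV.
- apply/trivIsetP => /= i j _ _ ij; rewrite -preimage_setI.
  by move/trivIsetP : tF => /(_ _ _ _ _ ij) ->//; rewrite preimage_set0.
- rewrite -preimage_bigcup -[X in measurable X]setTI.
  exact: measurable_consrV.
Qed.

HB.instance Definition _ :=
  isMeasure.Build _ _ _ leb_step step0 step_ge0 step_sigma_additive.

Let step_sigma_finite : sigma_finite setT leb_step.
Proof.
have /sigma_finiteP[F [TF ndF Foo]] := sigma_finiteT (@lebesgue_measure R).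
have /sigma_finiteP[G [TG ndG Goo]] := sigma_finiteT mu.
exists (fun k => @unconsrV n @^-1` (F k `*` G k)).
  rewrite -preimage_bigcup; apply/esym; rewrite -subTset => x _ /=.
  have [k _ Fk] : (\bigcup_k F k) (unconsrV x).1 by rewrite -TF.
  have [l _ Gl] : (\bigcup_k G k) (unconsrV x).2 by rewrite -TG.
  exists (maxn k l) => //; split.
    by move: Fk; exact/subsetPset/ndF/leq_maxl.
  by move: Gl; exact/subsetPset/ndG/leq_maxr.
move=> k; have [mF Fk] := Foo k; have [mG Gk] := Goo k; split.
  rewrite -[X in measurable X]setTI.
  by apply: measurable_unconsrV => //; exact: measurableX.
rewrite /= /leb_step /pushforward -comp_preimage.
rewrite (_ : _ \o _ = id); last by apply/funext => p /=; rewrite consrVK.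
by rewrite preimage_id product_measure1E// lte_mul_pinfty// ge0_fin_numE.
Qed.

HB.instance Definition _ :=
  Measure_isSigmaFinite.Build _ _ _ leb_step step_sigma_finite.

End step.

Fixpoint lebesgue_rV (n : nat) : {sigma_finite_measure set 'rV[R]_n -> \bar R} :=
  if n is n'.+1 then leb_step (lebesgue_rV n') else \d_(0 : 'rV[R]_0).

End lebesgue_rV.

Lemma lebesgue_rV_box {R : realType} n (A : 'I_n -> set (measurableTypeR R)) :
  (forall i, measurable (A i)) ->
  lebesgue_rV n [set x | forall i, A i (x ord0 i)] =
  (\prod_(i < n) lebesgue_measure (A i))%E.
Proof.
elim: n A => [|n IH] A mA.
  by rewrite big_ord0 /= /dirac indicE mem_set// => -[].
rewrite big_ord_recl -(IH (fun i => A (lift ord0 i)))//=.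
rewrite /leb_step /pushforward /=.
rewrite [X in (_ \x _)%E X](_ : _ =
    A ord0 `*` [set x : 'rV[R]_n | forall i : 'I_n, A (lift ord0 i) (x ord0 i)]); last first.
  have lift0 (i : 'I_n) : lift ord0 i = rshift 1 i by exact/val_inj.
  have ord0l : ord0 = lshift n (ord0 : 'I_1) by exact/val_inj.
  apply/seteqP; split => -[t v] /=.
    move=> H; split=> [|i].
      by have := H ord0; rewrite /consrV ord0l (@row_mxEl _ 1 1 n) mxE.
    by have := H (lift ord0 i); rewrite /consrV lift0 (@row_mxEr _ 1 1 n).
  move=> [At Av] i; rewrite /consrV.
  case: (unliftP ord0 i) => [j ->|->].
    by rewrite {2}lift0 (@row_mxEr _ 1 1 n).
  by rewrite {2}ord0l (@row_mxEl _ 1 1 n) mxE.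
rewrite product_measure1E//.
rewrite (_ : [set x | _] = \bigcap_(i in [set: 'I_n])
    (fun x : 'rV[R]_n => x ord0 i) @^-1` A (lift ord0 i)); last first.
  by apply/seteqP; split => [x H i _|x H i]; [exact: H|exact: (H i Logic.I)].
apply: fin_bigcap_measurable => // i _.
by rewrite -[X in measurable X]setTI; exact: measurable_coord.
Qed.

Section smooth.
Context {R : realType} (n : nat).
Implicit Type f : 'rV[R]_n -> R.

Definition partial (i : 'I_n) f : 'rV[R]_n -> R :=
  fun x => 'D_(delta_mx ord0 i) f x.

Definition smooth f : Prop := forall s : seq 'I_n,
  let g := foldr partial f s in
  continuous g /\ forall i x, derivable g x (delta_mx ord0 i).

Definition test_function f : Prop :=
  smooth f /\ compact (closure [set x | f x != 0]).

End smooth.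

(* Locally, after relabelling and reorienting the coordinate axes, the set is
   the region above the graph of a C^oo function of the other coordinates. *)
Definition smooth_boundary {R : realType} n (O : set 'rV[R]_n) : Prop :=
  forall x0, (closure O `\` O°) x0 ->
    exists (i : 'I_n) (s : bool) (gamma : 'rV[R]_n.-1 -> R), smooth gamma /\
      \forall x \near x0, O x <-> gamma (col' i x) < (-1) ^+ s * x ord0 i.

Section D12.
Context {R : realType} (N : nat).
Implicit Types (u v w : 'rV[R]_N -> R) (O : set 'rV[R]_N) (lam : R).

Local Notation mu := (lebesgue_rV N).

Definition crit_exp : R := 2 * N%:R / (N%:R - 2).

Definition weak_partial (i : 'I_N) u w : Prop :=
  w \in Lfun mu 2%:E /\
  forall phi, test_function phi ->
    \int[mu]_x (u x * partial i phi x) = - \int[mu]_x (w x * phi x).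

Definition D12 u : Prop :=
  u \in Lfun mu crit_exp%:E /\ forall i, exists w, weak_partial i u w.

Definition wpartial (i : 'I_N) u : 'rV[R]_N -> R :=
  xget (cst 0) [set w | weak_partial i u w].

Definition grad_sq u : 'rV[R]_N -> R :=
  fun x => \sum_(i < N) wpartial i u x ^+ 2.

Definition D12_norm u : R := Num.sqrt (\int[mu]_x grad_sq u x).

Definition rayleigh O u : \bar R :=
  let d := (\int[mu]_(x in O) ((u x) ^+ 2)%:E)%E in
  if d == 0%E then +oo%E else ((\int[mu]_x (grad_sq u x)%:E) / d)%E.

Definition Lambda O : \bar R :=
  ereal_inf [set rayleigh O u | u in [set u | D12 u /\ ~ u = cst 0 %[ae mu]]].

Definition Q O : 'rV[R]_N -> R := fun x => if x \in O then 1 else -1.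

Definition J O lam u : R :=
  2^-1 * \int[mu]_x (grad_sq u x + lam * \1_O x * u x ^+ 2)
  - crit_exp^-1 * \int[mu]_x (Q O x * `|u x| `^ crit_exp).

(* u is a point of D^{1,2} at which the Frechet derivative of J vanishes. *)
Definition solution O lam u : Prop :=
  D12 u /\ forall eps, 0 < eps -> exists2 delta, 0 < delta &
    forall v, D12 v -> D12_norm v <= delta ->
      `|J O lam (u \+ v) - J O lam u| <= eps * D12_norm v.

(* An element of D^{1,2} is a class of functions modulo a.e. equality. *)
Definition ae_class u : set ('rV[R]_N -> R) := [set v | v = u %[ae mu]].

End D12.

Section symmetry.
Context {R : realType} (N : nat).

Definition closed_subgroup_O (G : set 'M[R]_N) : Prop :=
  [/\ forall g, G g -> g *m g^T = 1%:M,
      G 1%:M,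
      forall g h, G g -> G h -> G (g *m h),
      forall g, G g -> G (invmx g) &
      closed G].

(* Vectors are rows, so gx is x *m g^T. *)
Definition Gorbit (G : set 'M[R]_N) (x : 'rV[R]_N) : set 'rV[R]_N :=
  [set x *m g^T | g in G].

Definition invariant_set (G : set 'M[R]_N) (O : set 'rV[R]_N) : Prop :=
  forall x, O x -> Gorbit G x `<=` O.

Definition invariant_fun (G : set 'M[R]_N) (u : 'rV[R]_N -> R) : Prop :=
  forall x y, Gorbit G x y -> u y = u x.

End symmetry.

(* Main.v *)
From HB Require Import structures.
Require Import Defs.
From mathcomp Require Import all_boot all_order all_algebra.
From mathcomp Require Import all_classical all_reals all_analysis.
From mathcomp Require Import ring lra zify measurable_realfun.
Import Order.TTheory GRing.Theory Num.Theory.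
Import numFieldNormedType.Exports.
Set Implicit Arguments.
Unset Strict Implicit.
Unset Printing Implicit Defensive.
Local Open Scope classical_set_scope.
Local Open Scope ring_scope.

(** Write p = 2N/(N-2), let <u,v> be the form [ipD], the integral of grad u . grad v + lambda
    1_Omega u v, and let B = [Bf] be the integral of Q|u|^p. Because -Lambda < lambda <= 0, the form
    controls the Dirichlet form ([coercive]) and is a complete semidefinite scalar product. If y is
    a unit vector, critical for B on the unit sphere, with B(y) > 0, then u = t y with t^(p-2) B(y)
    = 1 is a critical point of J, and B(u) = t^2. Critical values of B on the sphere that are
    positive and arbitrarily small therefore give solutions with B(u) unbounded, hence infinitely
    many ([minmax_small_critical_value], [high_energy_solution]).

    The search takes place among G-invariant functions. The exponent p is critical, yet on Omega
    compactness is regained: every point of the closure has an infinite orbit, so a small ball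
    around it has m disjoint copies under G which all carry the same energy. Each carries at most
    1/m of the total, with m as large as desired, and a local Sobolev inequality turns this into
    smallness of the L^p norm on Omega outside finitely many conditions ([local_energy],
    [averaged_sobolev], [compact_embedding]). Outside Omega nothing is compact, but there Q = -1 and
    the monotonicity of t -> |t|^(p-2) t has the right sign. Hence dB(u)(u-v) - dB(v)(u-v) is
    bounded by a contribution of Omega alone ([dB_compact]), and it is small once finitely many
    bounded linear functionals L_1, ..., L_n are small on u - v (field [ef_compact]).

    This inequality serves twice. For almost critical points at a level c > 0 its left side is
    nearly p c |u-v|^2, which gives the Palais-Smale property ([palais_smale]). With v = 0 it reads
    B(u) <= eps/2 as soon as all L_i are small on u. By the Borsuk-Ulam theorem ([odd_map_small],
    deduced from Ky Fan's combinatorial lemma) every odd continuous map from the n-sphere into the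
    unit sphere passes through such a u. So the supremum over these maps of the minimum of B is at
    most eps/2. It is positive, because functions supported in Omega provide subspaces of every
    dimension on which B > 0 ([test_family]). It is critical, because an odd gradient ascent step
    ([ascent_step]) applied to nearly optimal maps yields a Palais-Smale sequence.

    A point critical among invariant functions is critical among all functions
    ([symmetric_criticality]). The analysis required, namely invariance of Lebesgue measure under
    isometries, mollification, the Gagliardo-Nirenberg-Sobolev inequality and a Rellich estimate, is
    derived on the way. *)

(** * Simplicial chains modulo 2, boundaries and cones *)

Section Chains.
Variable V : Type.
Implicit Types (s t : seq V) (c : seq (seq V)) (phi : seq V -> bool).

Definition ev phi c : bool := \big[addb/false]_(s <- c) phi s.
(** A chain over F_2 is a list of simplices, and two lists are the same chain when no cochain
    separates them: the order is forgotten and equal simplices cancel in pairs. *)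
Definition chain_eq c c' := forall phi, ev phi c = ev phi c'.

(** The complex is augmented: the boundary of a vertex is the empty simplex [[::]], whose own
    boundary is zero. The recursion reads [v :: s'] as the cone with apex [v] over [s']. *)
Fixpoint bd s : seq (seq V) := if s is v :: s' then s' :: map (cons v) (bd s') else [::].
Definition lift_chain (F : seq V -> seq (seq V)) c := flatten (map F c).

Lemma ev_cat phi c c' : ev phi (c ++ c') = ev phi c (+) ev phi c'.
Proof. by rewrite /ev big_cat. Qed.

Lemma ev_lift phi F c : ev phi (lift_chain F c) = ev (fun s => ev phi (F s)) c.
Proof. by rewrite /ev big_flatten big_map. Qed.

Lemma ev_map (W : Type) phi (F : seq W -> seq V) (c : seq (seq W)) :
  ev phi (map F c) = \big[addb/false]_(s <- c) phi (F s).
Proof. by rewrite /ev big_map. Qed.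

Lemma eq_ev phi psi c : phi =1 psi -> ev phi c = ev psi c.
Proof. by move=> e; apply: eq_bigr. Qed.

Lemma ev_add phi psi c : ev (fun s => phi s (+) psi s) c = ev phi c (+) ev psi c.
Proof. by rewrite /ev big_split. Qed.

(** Cone formula: the boundary of the cone over c is c plus the cone over the boundary of c. *)
Lemma bd_cone phi v c :
  ev phi (lift_chain bd (map (cons v) c)) =
  ev phi c (+) ev (phi \o cons v) (lift_chain bd c).
Proof.
rewrite !ev_lift ev_map -[X in X = _]/(ev (fun s => ev phi (bd (v :: s))) c) -ev_add; apply: eq_ev => s /=.
by rewrite /ev big_cons big_map.
Qed.

(** By the cone formula the base contributes its boundary twice, which cancels modulo 2, and what is
    left is a cone over a double boundary of lower dimension. *)
Lemma bd_bd phi s : ev phi (lift_chain bd (bd s)) = false.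
Proof.
elim: s phi => [|v s IH] phi; first by rewrite /ev big_nil.
rewrite /= -cat1s /lift_chain map_cat flatten_cat ev_cat -/(lift_chain _ _).
rewrite -/(lift_chain _ _) bd_cone IH /lift_chain /= cats0.
by rewrite addbF addbb.
Qed.


End Chains.
Arguments bd {V}.

(** * Signed labels and alternating simplices (Ky Fan's counting) *)

Section Fan.
Implicit Types (l : seq bool).

(* [alt true] is the cup product of the sign cochain with a power of its
   coboundary; its own coboundary is the symmetrised [alt] one degree up. *)
Fixpoint alt (b : bool) l : bool :=
  if l is x :: l' then (x == b) && alt (~~ b) l' else true.

(** A word alternating from [b] or from [~~ b] has exactly one facet alternating from [b], obtained
    by dropping its last letter in the first case and its first letter in the second. Any other word
    has an even number of such facets. *)
Lemma alt_bd b x l : ev (alt b) (bd (x :: l)) = alt b (x :: l) (+) alt (~~ b) (x :: l).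
Proof.
elim: l b x => [|y l IH] b x.
  by rewrite /ev /= big_cons big_nil; case: x b => [] [].
have -> : bd (x :: y :: l) = (y :: l) :: map (cons x) (bd (y :: l)) by [].
rewrite /ev big_cons -/(ev _ _) ev_map.
rewrite -/(ev (alt b \o cons x) (bd (y :: l))).
have -> : ev (alt b \o cons x) (bd (y :: l)) = (x == b) && ev (alt (~~ b)) (bd (y :: l)).
  case: eqP => xb /=; first by apply: eq_ev => s /=; rewrite xb eqxx.
  by rewrite /ev big1 // => s _ /=; case: eqP xb.
rewrite IH negbK /= -/(alt _ _) ; case: x b y => [] [] [] //=; by case: alt.
Qed.

Lemma alt_neigh b l i : (i.+1 < size l)%N -> nth true l i = nth true l i.+1 -> alt b l = false.
Proof.
elim: l b i => [//|x l IH] b [|i] /=.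
  by case: l {IH} => [//|y l] _ /= ->; case: y; case: b.
by move=> h e; rewrite (IH _ i) ?andbF.
Qed.

(** For a cochain blind to the order of the vertices it does not matter which copy of a repeated
    vertex is deleted, so the boundary becomes a sum over [rem]. In this form its invariance under
    permutations is visible ([bd_perm]). *)
Lemma bd_rem (V : eqType) (phi : seq V -> bool) (s : seq V) :
  (forall t t', perm_eq t t' -> phi t = phi t') ->
  ev phi (bd s) = \big[addb/false]_(x <- s) phi (rem x s).
Proof.
move=> hphi.
elim: s phi hphi => [|v s IH] phi hphi; first by rewrite /ev !big_nil.
rewrite /= /ev big_cons big_cons /= eqxx; congr addb.
rewrite -/(ev _ _) ev_map -/(ev (phi \o cons v) (bd s)) IH; last by move=> t t' tt'; apply: hphi; rewrite perm_cons.
apply: eq_big_seq => x xs; rewrite /=; case: eqP => [->|//].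
by apply: hphi; rewrite perm_sym; exact: perm_to_rem.
Qed.

Lemma bd_perm (V : eqType) (phi : seq V -> bool) (s s' : seq V) :
  (forall t t', perm_eq t t' -> phi t = phi t') -> perm_eq s s' ->
  ev phi (bd s) = ev phi (bd s').
Proof.
move=> hphi ss'; rewrite !bd_rem// (perm_big _ ss') /=.
apply: eq_bigr => x _; apply: hphi.
have [xs|xs] := boolP (x \in s); last by rewrite !rem_id// -(perm_mem ss').
rewrite -(perm_cons x) -(permPl (perm_to_rem xs)) (permPl ss').
by apply: perm_to_rem; rewrite -(perm_mem ss').
Qed.

Lemma map_bd (V W : Type) (f : V -> W) (s : seq V) : map (map f) (bd s) = bd (map f s).
Proof.
elim: s => //= v s <-; congr cons; rewrite -!map_comp; by apply: eq_map.
Qed.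

Lemma bd_subseq (V : eqType) (s t : seq V) : t \in bd s -> subseq t s.
Proof.
elim: s t => [//|v s IH] t /=; rewrite inE => /orP[/eqP ->|/mapP[t' /IH h ->]].
  exact: subseq_cons.
by rewrite /= eqxx.
Qed.

Lemma size_bd (V : eqType) (s t : seq V) : t \in bd s -> size s = (size t).+1.
Proof.
elim: s t => [//|v s IH] t /=; rewrite inE => /orP[/eqP -> //|/mapP[t' /IH h ->]].
by rewrite /= h.
Qed.

(** A pair (i, sign) is the signed label +i or -i. Coherence forbids opposite labels +i and -i in
    the same simplex. *)
Definition coherent (s : seq (nat * bool)) :=
  forall x y, x \in s -> y \in s -> x.1 = y.1 -> x = y.

Definition le1 (x y : nat * bool) := (x.1 <= y.1)%N.
(** Signs are read in increasing order of the absolute label. In a coherent simplex a repeated label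
    puts two equal signs side by side, so that only distinct labels can alternate. *)
Definition falt b (s : seq (nat * bool)) := alt b (map snd (sort le1 s)).

Lemma le1_total : total le1. Proof. by move=> x y; exact: leq_total. Qed.
Lemma le1_trans : transitive le1. Proof. by move=> x y z; exact: leq_trans. Qed.

Definition negl (x : nat * bool) := (x.1, ~~ x.2).

Lemma falt_neg b s : falt b (map negl s) = falt (~~ b) s.
Proof.
rewrite /falt sort_map -map_comp -[sort _ s]/(sort le1 s).
elim: (sort le1 s) b => [//|x l IH] b /=; rewrite IH; case: x.2; by case: b.
Qed.

Lemma falt_perm b s s' : coherent s -> perm_eq s s' -> falt b s = falt b s'.
Proof.
move=> cs ss'; rewrite /falt; congr (alt _ (map _ _)).
apply/perm_sort_inP => //.
- by move=> x y _ _; exact: le1_total.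
- by move=> x y z _ _ _; exact: le1_trans.
- by move=> x y xs ys; rewrite /le1 -eqn_leq => /eqP; exact: cs.
Qed.

Lemma subseq_coherent s t : subseq t s -> coherent s -> coherent t.
Proof. by move=> /mem_subseq ts cs x y /ts xs /ts; exact: cs. Qed.

Lemma falt_bd s : coherent s -> s != [::] ->
  ev (falt true) (bd s) = falt true s (+) falt false s.
Proof.
move=> cs s0.
(* On incoherent lists [falt] may depend on the order. Putting false there gives a cochain invariant
   under all permutations that agrees with [falt true] on the faces of a coherent simplex. *)
pose phi t := if pselect (coherent t) is left _ then falt true t else false.
have hphi t t' : perm_eq t t' -> phi t = phi t'.
  move=> tt'; rewrite /phi; case: pselect => ct; case: pselect => ct' //.
  - exact: falt_perm.
  - by case: ct' => x y; rewrite -!(perm_mem tt'); exact: ct.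
  - by case: ct => x y; rewrite !(perm_mem tt'); exact: ct'.
have phiE r : coherent r -> ev (falt true) (bd r) = ev phi (bd r).
  move=> cr; apply: eq_big_seq => t /bd_subseq/subseq_coherent/(_ cr) ct.
  by rewrite /phi; case: pselect.
have pss : perm_eq s (sort le1 s) by rewrite perm_sym perm_sort.
rewrite phiE// (bd_perm hphi pss) -phiE; last first.
  by move=> x y; rewrite !mem_sort; exact: cs.
have -> : ev (falt true) (bd (sort le1 s)) = ev (alt true) (bd (map snd (sort le1 s))).
  rewrite -map_bd ev_map; apply: eq_big_seq => t /bd_subseq ts.
  rewrite /falt /= sorted_sort//; first exact: le1_trans.
  by apply: (subseq_sorted _ ts); [exact: le1_trans|exact: sort_sorted le1_total _].
rewrite /falt; case E: (sort le1 s) => [|x l]; last exact: alt_bd.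
by move: s0; rewrite -size_eq0 -(size_sort le1) E.
Qed.

(** Pigeonhole: with more vertices than labels two neighbours in the sorted list carry the same
    label, and a sign repeats. *)
Lemma falt_big b s n : coherent s -> (forall x, x \in s -> (x.1 < n)%N) ->
  (n < size s)%N -> falt b s = false.
Proof.
move=> cs sn ns; rewrite /falt.
set t := sort le1 s.
have ct : coherent t by move=> x y; rewrite !mem_sort; exact: cs.
have tn x : x \in t -> (x.1 < n)%N by rewrite mem_sort; exact: sn.
have nt : (n < size t)%N by rewrite size_sort.
have st : sorted le1 t by exact: sort_sorted le1_total _.
suff [i it e] : exists2 i, (i.+1 < size t)%N & nth (0%N,true) t i = nth (0%N,true) t i.+1.
  apply: (@alt_neigh _ _ i); rewrite ?size_map//.
  by rewrite !(nth_map (0%N,true)) ?e//; exact: ltnW.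
apply: contrapT => H.
(* If sorted neighbours always differed, the labels would increase strictly, so the i-th one would
   be at least i and the n-th one out of range. *)
have inc i : (i < size t)%N -> (i <= (nth (0%N,true) t i).1)%N.
  elim: i => [//|i IH] it; apply: leq_ltn_trans (IH (ltnW it)) _.
  rewrite ltn_neqAle; apply/andP; split.
    apply/eqP => e; apply: H; exists i => //; apply: ct => //.
      exact/mem_nth/ltnW.
    exact/mem_nth.
  exact: (sortedP (0%N,true) st).
have := inc n nt; rewrite leqNgt; apply/negP; rewrite negbK.
exact/tn/mem_nth.
Qed.

End Fan.

(** * Barycentric subdivision, the cross-polytope, and Tucker's lemma *)

Section Subdivision.
Context {R : realType} {V : normedModType R}.
Implicit Types (s t : seq V) (c : seq (seq V)) (phi : seq V -> bool).

Definition bary s : V := (size s)%:R^-1 *: \sum_(x <- s) x.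

(* [sd n] is meant for simplices with [n] vertices; the empty simplex is kept
   as an augmentation, which makes the cone formula uniform. *)
Fixpoint sd n s : seq (seq V) :=
  if n is m.+1 then map (cons (bary s)) (lift_chain (sd m) (bd s)) else [:: [::]].

(** Subdivision is a chain map. A subdivided simplex is the cone from its barycentre over its
    subdivided boundary, and the latter is a cycle by induction and [bd_bd]. *)
Lemma bd_sd n s phi : size s = n.+1 ->
  ev phi (lift_chain bd (sd n.+1 s)) = ev phi (lift_chain (sd n) (bd s)).
Proof.
elim: n s phi => [|n IH] s phi ss /=; rewrite bd_cone.
  case: s ss => [//|x [|//]] _.
  by rewrite /= /ev !big_cons !big_nil /= addbF.
suff -> : ev (phi \o cons (bary s)) (lift_chain bd (lift_chain (sd n.+1) (bd s))) = false.
  by rewrite addbF.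
set psi := phi \o _; rewrite !ev_lift.
transitivity (\big[addb/false]_(t <- bd s) ev psi (lift_chain (sd n) (bd t))).
  rewrite /ev; apply: eq_big_seq => t ts.
  rewrite -/(ev _ _) -ev_lift; apply: IH.
  by have := size_bd ts; rewrite ss => -[].
under eq_bigr do rewrite ev_lift.
by rewrite -/(ev (fun t => ev (fun s0 => ev psi (sd n s0)) (bd t)) (bd s)) -ev_lift bd_bd.
Qed.

Lemma mem_lift (F : seq V -> seq (seq V)) c' t :
  t \in lift_chain F c' -> exists2 s, s \in c' & t \in F s.
Proof. by move=> /flattenP[x /mapP[s sc ->] tx]; exists s. Qed.

Lemma size_sd n s t : size s = n -> t \in sd n s -> size t = n.
Proof.
elim: n s t => [|n IH] s t ss /=; first by rewrite inE => /eqP ->.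
move=> /mapP[t' /mem_lift[r rs t'r] ->] /=; congr S; apply: IH t'r.
by have := size_bd rs; rewrite ss => -[].
Qed.

(** A stand-in for convexity: such a property passes from the vertices of a simplex to all vertices
    of its subdivisions. *)
Definition bary_closed (P : V -> Prop) :=
  forall s, s != [::] -> (forall x, x \in s -> P x) -> P (bary s).

Lemma sd_closed n s (P : V -> Prop) : bary_closed P -> size s = n ->
  (forall x, x \in s -> P x) -> forall t, t \in sd n s -> forall x, x \in t -> P x.
Proof.
move=> cP; elim: n s => [|n IH] s ss Ps t /=; first by rewrite inE => /eqP ->.
move=> /mapP[t' /mem_lift[r rs t'r] ->] x; rewrite inE => /orP[/eqP ->|].
  by apply: cP => //; rewrite -size_eq0 ss.
have sr : size r = n by have := size_bd rs; rewrite ss => -[].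
apply: (IH r) => // y yr; apply: Ps.
exact: (mem_subseq (bd_subseq rs)).
Qed.

Lemma bary_sub s a : s != [::] -> bary s - a = (size s)%:R^-1 *: \sum_(x <- s) (x - a).
Proof.
move=> s0; rewrite sumrB scalerBr; congr (_ - _).
have -> : \sum_(i <- s) a = (size s)%:R *: a.
  by rewrite big_const_seq count_predT iter_addr_0 scaler_nat.
by rewrite scalerA mulVf ?scale1r// pnatr_eq0 size_eq0.
Qed.

Lemma ball_bary_closed a r : bary_closed (fun x => `|x - a| <= r).
Proof.
move=> s s0 h; rewrite bary_sub// normrZ ger0_norm ?invr_ge0//.
rewrite mulrC ler_pdivrMr ?ltr0n ?lt0n ?size_eq0//.
apply: le_trans (ler_norm_sum _ _ _) _.
apply: le_trans (_ : \sum_(x <- s) r <= _).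
  by rewrite big_seq [leRHS]big_seq; apply: ler_sum => x /h.
by rewrite big_const_seq count_predT iter_addr_0 mulr_natr.
Qed.

(** The classical contraction of the mesh. An edge of the subdivision either lies over a facet,
    where induction applies, or ends at the barycentre, whose distance to every vertex is controlled
    by averaging. *)
Lemma sd_mesh (k n : nat) s (D : R) : size s = n -> (n <= k.+1)%N -> 0 <= D ->
  (forall x y, x \in s -> y \in s -> `|x - y| <= D) ->
  forall t, t \in sd n s -> forall x y, x \in t -> y \in t ->
  `|x - y| <= (k%:R / k.+1%:R) * D.
Proof.
elim: n s => [|n IH] s ss nk D0 hD t /=; first by rewrite inE => /eqP ->.
move=> /mapP[t' /mem_lift[r rs t'r] ->].
have sr : size r = n by have := size_bd rs; rewrite ss => -[].
have rss := mem_subseq (bd_subseq rs).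
have s0 : s != [::] by rewrite -size_eq0 ss.
have K0 : 0 <= (k%:R / k.+1%:R) * D by rewrite mulr_ge0// divr_ge0.
have bv v : v \in s -> `|v - bary s| <= (k%:R / k.+1%:R) * D.
  move=> vs; rewrite distrC bary_sub// normrZ ger0_norm ?invr_ge0//.
  rewrite mulrC ler_pdivrMr ?ltr0n ?ss//.
  apply: le_trans (ler_norm_sum _ _ _) _.
  (* The summand of [v] itself vanishes, so the average of the n+1 distances is at most n/(n+1)
     times [D]. *)
  rewrite (perm_big _ (perm_to_rem vs)) big_cons /= subrr normr0 add0r.
  apply: le_trans (_ : \sum_(x <- rem v s) D <= _).
    by rewrite big_seq [leRHS]big_seq; apply: ler_sum => x /mem_rem xs; exact: hD.
  rewrite big_const_seq count_predT iter_addr_0 size_rem// ss /= -[D *+ n]mulr_natr.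
  rewrite [leRHS]mulrAC [leRHS]mulrC ler_wpM2l//.
  rewrite mulrAC ler_pdivlMr ?ltr0n// -!natrM ler_nat; lia.
have bt x : x \in t' -> `|x - bary s| <= (k%:R / k.+1%:R) * D.
  apply: (sd_closed (@ball_bary_closed (bary s) _) sr) t'r x => y yr.
  exact/bv/rss.
move=> x y; rewrite !inE => /orP[/eqP ->|xt] /orP[/eqP ->|yt].
- by rewrite subrr normr0.
- by rewrite distrC; exact: bt.
- exact: bt.
apply: (IH r) t'r x y xt yt => //; first exact: ltnW.
by move=> u v /rss us /rss vs; exact: hD.
Qed.

Lemma sd_opp n s : map (map -%R) (sd n s) = sd n (map -%R s).
Proof.
elim: n s => [//|n IH] s /=.
rewrite -map_bd /lift_chain !map_flatten -!map_comp; congr flatten.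
apply: eq_map => t /=; rewrite -IH -!map_comp; apply: eq_map => r /=.
congr cons; rewrite /bary size_map big_map -scalerN; congr (_ *: _).
by rewrite sumrN.
Qed.

Definition sdn n k (c : seq (seq V)) := iter k (lift_chain (sd n)) c.

Lemma sdn_ext n k c c' : chain_eq c c' -> chain_eq (sdn n k c) (sdn n k c').
Proof. by move=> cc'; elim: k => [//|k IH] phi /=; rewrite !ev_lift IH. Qed.

Lemma size_sdn n k c t : (forall s, s \in c -> size s = n) -> t \in sdn n k c -> size t = n.
Proof.
move=> hc; elim: k t => [|k IH] t /=; first exact: hc.
by move=> /mem_lift[s /IH ss]; exact: size_sd.
Qed.

Lemma bd_sdn n k c phi : (forall s, s \in c -> size s = n.+1) ->
  ev phi (lift_chain bd (sdn n.+1 k c)) = ev phi (sdn n k (lift_chain bd c)).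
Proof.
move=> hc; elim: k phi => [//|k IH] phi /=.
rewrite !ev_lift -IH ev_lift; apply: eq_big_seq => t /(size_sdn hc) ts.
by rewrite -ev_lift bd_sd// ev_lift.
Qed.

Lemma sdn_cat n k c c' : chain_eq (sdn n k (c ++ c')) (sdn n k c ++ sdn n k c').
Proof.
elim: k => [//|k IH] phi /=; rewrite ev_lift IH !ev_cat.
by rewrite !ev_lift.
Qed.

Lemma sdn_opp n k c : map (map -%R) (sdn n k c) = sdn n k (map (map -%R) c).
Proof.
elim: k => [//|k IH] /=; rewrite -IH /lift_chain map_flatten -!map_comp.
by congr flatten; apply: eq_map => t /=; exact: sd_opp.
Qed.

Lemma sdn_closed n k c (P : V -> Prop) : bary_closed P ->
  (forall s, s \in c -> size s = n) ->
  (forall s, s \in c -> forall x, x \in s -> P x) ->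
  forall t, t \in sdn n k c -> forall x, x \in t -> P x.
Proof.
move=> cP sc hc; elim: k => [|k IH] t /=; first exact: hc.
by move=> /mem_lift[s sk]; apply: sd_closed (IH _ sk) _ => //; exact: size_sdn sk.
Qed.

Lemma sdn_mem n k c t : t \in sdn n k c -> exists2 s, s \in c & t \in sdn n k [:: s].
Proof.
elim: k t => [|k IH] t /= tc; first by exists t; rewrite ?inE.
have [r /IH[s sc rs] tr] := mem_lift tc; exists s => //.
by apply/flattenP; exists (sd n r) => //; apply/mapP; exists r.
Qed.

Lemma sdn_mesh m n k c (D : R) : (n <= m.+1)%N -> 0 <= D ->
  (forall s, s \in c -> size s = n) ->
  (forall s, s \in c -> forall x y, x \in s -> y \in s -> `|x - y| <= D) ->
  forall t, t \in sdn n k c -> forall x y, x \in t -> y \in t ->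
  `|x - y| <= (m%:R / m.+1%:R) ^+ k * D.
Proof.
move=> nm D0 sc hc; elim: k => [|k IH] t /=; first by rewrite mul1r; exact: hc.
move=> /mem_lift[s sk] ts x y xt yt; rewrite exprS -mulrA.
apply: (sd_mesh (size_sdn sc sk) nm _ (IH _ sk)) ts _ _ xt yt.
by rewrite mulr_ge0// exprn_ge0// divr_ge0.
Qed.

Variable e : nat -> V.

(** The boundary sphere of the cross-polytope on the vertices e_i and -e_i with i < n, built by
    successive suspensions: a simplex is a choice of one sign for each index. *)
Fixpoint cross n : seq (seq V) :=
  if n is m.+1 then map (cons (e m)) (cross m) ++ map (cons (- e m)) (cross m)
  else [:: [::]].

(** A disc bounded by [cross n]. With its antipode it makes up the next sphere [cross n.+1], which
    is what drives the induction on the dimension. *)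
Definition hemi n := map (cons (e n)) (cross n).

Lemma size_cross n s : s \in cross n -> size s = n.
Proof.
elim: n s => [|n IH] s /=; first by rewrite inE => /eqP ->.
by rewrite mem_cat => /orP[] /mapP[t /IH <- ->].
Qed.

Lemma size_hemi n s : s \in hemi n -> size s = n.+1.
Proof. by move=> /mapP[t /size_cross <- ->]. Qed.

Lemma bd_cross n phi : ev phi (lift_chain bd (cross n)) = false.
Proof.
elim: n phi => [|n IH] phi /=; first by rewrite ev_lift /ev !big_cons !big_nil.
rewrite /lift_chain map_cat flatten_cat ev_cat -!/(lift_chain _ _) !bd_cone !IH.
by rewrite !addbF addbb.
Qed.

Lemma bd_hemi n : chain_eq (lift_chain bd (hemi n)) (cross n).
Proof. by move=> phi; rewrite bd_cone bd_cross addbF. Qed.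

Lemma opp_cross n : chain_eq (map (map -%R) (cross n)) (cross n).
Proof.
elim: n => [//|n IH] phi /=; rewrite map_cat !ev_cat.
have step a : ev phi (map (map -%R) (map (cons a) (cross n))) =
    ev phi (map (cons (- a)) (cross n)).
  rewrite -map_comp ev_map [RHS]ev_map.
  rewrite -/(ev (phi \o cons (- a)) (cross n)) -IH ev_map.
  by apply: eq_bigr => s _.
by rewrite !step opprK addbC.
Qed.

Lemma cross_hemi n : chain_eq (cross n.+1) (hemi n ++ map (map -%R) (hemi n)).
Proof.
move=> phi; rewrite /= !ev_cat; congr addb.
rewrite -map_comp ev_map [RHS]ev_map.
rewrite -/(ev (phi \o cons (- e n)) (cross n)) -opp_cross ev_map.
by apply: eq_bigr => s _.
Qed.

Lemma cross_coord n s x : s \in cross n -> x \in s -> exists2 i, (i < n)%N & x = e i \/ x = - e i.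
Proof.
elim: n s => [|n IH] s /=; first by rewrite inE => /eqP ->.
rewrite mem_cat => /orP[] /mapP[t tn ->]; rewrite inE => /orP[/eqP ->|/(IH _ tn)[i ni h]].
- by exists n => //; left.
- by exists i => //; exact: ltnW.
- by exists n => //; right.
- by exists i => //; exact: ltnW.
Qed.

(* Ky Fan's parity count: [s_d], the number of alternating simplices in the
   d-th hemisphere modulo 2, does not depend on d. *)
Lemma fan_parity (lab : V -> nat * bool) k n :
  (forall d, (d <= n)%N -> forall s, s \in sdn d.+1 k (hemi d) ->
    coherent (map lab s) /\ (forall x, x \in s -> lab (- x) = negl (lab x))) ->
  ev (fun s => falt true (map lab s) (+) falt false (map lab s)) (sdn n.+1 k (hemi n)).
Proof.
elim: n => [|n IH] H.
  have {}H := H 0%N (leqnn _).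
  have -> : sdn 1 k (hemi 0) = [:: [:: e 0%N]].
    elim: k {H} => [//|k IH] /=; rewrite IH /lift_chain /= /bary /=.
    by rewrite invr1 scale1r big_seq1.
  by rewrite /ev big_cons big_nil /falt /=; case: (lab _).2.
have {}IH := IH (fun d dn => H d (leqW dn)).
have {}Hn := H n.+1 (leqnn _).
(* By [falt_bd] the count over the hemisphere is a count over its boundary sphere. That sphere
   consists of the previous hemisphere and its antipode, on which [falt true] reads as [falt false],
   so the parity is that of the previous dimension. *)
set phi := (fun s => _); rewrite (_ : ev _ _ = ev (fun s => ev (falt true \o map lab) (bd s))
    (sdn n.+2 k (hemi n.+1))); last first.
  apply: eq_big_seq => s sn; have [cs _] := Hn s sn.
  have ss : size s = n.+2 := size_sdn (@size_hemi n.+1) sn.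
  rewrite /phi -falt_bd// -?map_bd ?ev_map//.
  by rewrite -size_eq0 size_map ss.
rewrite -ev_lift bd_sdn; last exact: size_hemi.
rewrite (sdn_ext _ _ (@bd_hemi n.+1)) (sdn_ext _ _ (@cross_hemi n)) sdn_cat ev_cat -sdn_opp.
rewrite ev_map -/(ev (falt true \o map lab \o map -%R) _) -ev_add.
move: IH; congr is_true; apply: eq_big_seq => s sn /=; congr addb.
have [_ h] := H n (leqnSn _) s sn.
have -> : map lab (map -%R s) = map negl (map lab s).
  by rewrite -!map_comp; apply/eq_in_map => x /h.
by rewrite falt_neg.
Qed.

(** Tucker's lemma. With only n labels no simplex on n+1 vertices alternates, so the count of
    [fan_parity] would be zero as well as odd. *)
Lemma fan (lab : V -> nat * bool) k n :
  (forall d, (d <= n)%N -> forall s, s \in sdn d.+1 k (hemi d) ->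
    coherent (map lab s) /\ (forall x, x \in s ->
      lab (- x) = negl (lab x) /\ ((lab x).1 < n)%N)) -> False.
Proof.
move=> H.
have /fan_parity : forall d, (d <= n)%N -> forall s, s \in sdn d.+1 k (hemi d) ->
    coherent (map lab s) /\ (forall x, x \in s -> lab (- x) = negl (lab x)).
  by move=> d dn s sd; have [? h] := H d dn s sd; split=> // x /h[].
rewrite /ev big_seq big1 // => s sn; have [cs h] := H n (leqnn _) s sn.
have ss : size s = n.+1 := size_sdn (@size_hemi n) sn.
by rewrite !(@falt_big _ _ n)// ?size_map ?ss// => x /mapP[y /h[_ ?] ->].
Qed.

End Subdivision.

(** * The Borsuk-Ulam theorem in quantitative form *)

Section OddMaps.
Context {R : realType} (n : nat).
Local Notation V := 'rV[R]_n.+1.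

Definition octahedron : set V := [set x | \sum_i `|x ord0 i| = 1].

Lemma octahedron_opp x : octahedron x -> octahedron (- x).
Proof.
by move=> ox; rewrite /octahedron /= -[RHS]ox; apply: eq_bigr => i _; rewrite mxE normrN.
Qed.

Let e (d : nat) : V := delta_mx ord0 (inord d).

(** The vertices of one simplex of the cross-polytope agree in their signs, so the simplex lies in a
    closed orthant. *)
Let cross_sign d s : s \in cross e d -> exists2 eps : nat -> R,
  (forall i, `|eps i| = 1) & forall x, x \in s -> exists2 i, (i < d)%N & x = eps i *: e i.
Proof.
elim: d s => [|d IH] s /=.
  by rewrite inE => /eqP ->; exists (fun=> 1) => [i|//]; rewrite normr1.
have ext (a : R) t : `|a| = 1 -> t \in cross e d -> exists2 eps : nat -> R,
    (forall i, `|eps i| = 1) &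
    forall x, x \in (a *: e d) :: t -> exists2 i, (i < d.+1)%N & x = eps i *: e i.
  move=> a1 /IH[eps eps1 h]; exists (fun i => if i == d then a else eps i).
    by move=> i; case: ifP.
  move=> x; rewrite inE => /orP[/eqP ->|/h[i id ->]].
    by exists d; rewrite // eqxx.
  by exists i; [exact: ltnW|rewrite ltn_eqF].
rewrite mem_cat => /orP[] /mapP[t tn ->].
  by rewrite -[e d]scale1r; apply: ext => //; rewrite normr1.
by rewrite -scaleN1r; apply: ext => //; rewrite normrN1.
Qed.

(** The flat piece of the octahedron in the orthant of signs [eps]. Being convex it is stable under
    barycentres, so every vertex of the subdivided sphere stays on the octahedron. *)
Let face (eps : nat -> R) (x : V) :=
  (forall i : 'I_n.+1, 0 <= eps i * x ord0 i) /\ \sum_i eps (val i) * x ord0 i = 1.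

Let face_closed eps : bary_closed (face eps).
Proof.
move=> s s0 h.
have E i : eps (val i) * (bary s) ord0 i =
    (size s)%:R^-1 * \sum_(x <- s) eps (val i) * x ord0 i.
  by rewrite mxE summxE mulrCA -mulr_sumr.
split=> [i|].
  rewrite E mulr_ge0 ?invr_ge0// big_seq sumr_ge0// => x /h[+ _]; exact.
under eq_bigr do rewrite E.
rewrite -mulr_sumr exchange_big /= big_seq.
under eq_bigr => x xs do rewrite (proj2 (h x xs)).
rewrite -big_seq big_const_seq count_predT iter_addr_0 mulVf//.
by rewrite pnatr_eq0 size_eq0.
Qed.

Let face_oct eps x : (forall i, `|eps i| = 1) -> face eps x -> octahedron x.
Proof.
move=> e1 [h0 h1]; rewrite /octahedron /= -h1; apply: eq_bigr => i _.
by rewrite -[RHS](ger0_norm (h0 i)) normrM e1 mul1r.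
Qed.

Let cross_face eps d s x : (forall i, `|eps i| = 1) ->
  (d <= n.+1)%N ->
  (exists2 i, (i < d)%N & x = eps i *: e i) -> s \in cross e d -> face eps x.
Proof.
move=> e1 dn [i id ->] _.
have val_i : val (inord i : 'I_n.+1) = i by rewrite /= inordK// (leq_trans id).
have ee : eps i * eps i = 1.
  by have := e1 i; rewrite -expr2 => h; rewrite -(real_normK (num_real _)) h expr1n.
split=> [j|].
  rewrite !mxE eqxx /=; case: eqP => [ji|_]; last by rewrite !mulr0.
  by rewrite mulr1 ji val_i ee.
rewrite (bigD1 (inord i))//= big1 => [|j ji].
  by rewrite !mxE !eqxx mulr1 addr0 val_i.
by rewrite !mxE eqxx /= (negbTE ji) !mulr0.
Qed.

(** Borsuk-Ulam for n odd functions on an n-sphere. If at every point some |f_i| exceeded 1,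
    labelling the point by such an i with the sign of f_i would give, on a fine subdivision, an odd
    coherent labelling by n labels, against [fan]. *)
Lemma odd_map_small (f : 'I_n -> V -> R) delta :
  (forall i x, octahedron x -> f i (- x) = - f i x) ->
  0 < delta ->
  (forall x y, octahedron x -> octahedron y -> `|x - y| < delta ->
     forall i, `|f i x - f i y| <= 1) ->
  exists2 x, octahedron x & forall i, `|f i x| <= 1.
Proof.
move=> fodd d0 fuc; apply: contrapT => H.
have big x : octahedron x -> exists i, 1 < `|f i x|.
  move=> ox; apply: contrapT => h; apply: H; exists x => // i.
  by rewrite leNgt; apply/negP => hi; apply: h; exists i.
(* The index is picked from the moduli |f_i x| alone, so antipodal points receive the same index and
   opposite signs. *)
pose lab x : nat * bool := if [pick i | 1 < `|f i x|] is Some i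
  then (val i, 0 < f i x) else (0%N, true).
have labP x : octahedron x -> exists2 i, 1 < `|f i x| &
    lab x = (val i, 0 < f i x) /\ lab (- x) = negl (lab x).
  move=> ox; have [i0 hi0] := big x ox.
  have E : [pick i | 1 < `|f i (- x)|] = [pick i | 1 < `|f i x|].
    by apply: eq_pick => j; rewrite /= fodd// normrN.
  rewrite /lab E; case: pickP => [i hi|/(_ i0)]; last by rewrite hi0.
  exists i => //; split=> //; rewrite /negl /= fodd// oppr_gt0 -leNgt le_eqVlt.
  by case: eqP => // h; move: hi; rewrite h normr0 ltr10.
(* The factor 2 bounds the diameter of a simplex of the cross-polytope in the max norm; k
   subdivisions bring neighbouring vertices closer than [delta]. *)
have [k hk] : exists k, (n%:R / n.+1%:R) ^+ k * 2 < delta :> R.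
  have : ((fun k => (n%:R / n.+1%:R) ^+ k * 2) @ \oo --> (0:R) * 2)%classic.
    apply: cvgMl; apply: cvg_expr.
    by rewrite ger0_norm ?divr_ge0// ltr_pdivrMr ?ltr0n// mul1r ltr_nat.
  rewrite mul0r => /cvgrPdist_lt/(_ _ d0)[k _ /(_ k (leqnn _))] hk; exists k.
  by move: hk; rewrite /= sub0r normrN; apply: le_lt_trans; exact: ler_norm.
apply: (@fan R V e lab k n) => d dn s sd.
have octs : forall x, x \in s -> octahedron x.
  have [s0 s0h ss0] := sdn_mem sd.
  have [t td s0E] := mapP s0h.
  have : s0 \in cross e d.+1 by rewrite /= mem_cat s0h.
  move=> s0c; have [eps e1 heps] := cross_sign s0c.
  move=> x xs; apply: (face_oct e1).
  apply: (@sdn_closed _ _ d.+1 k [:: s0] _ (@face_closed eps)) ss0 x xs.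
    by move=> s1; rewrite inE => /eqP ->; exact: size_cross s0c.
  move=> s1; rewrite inE => /eqP -> x /heps h.
  by apply: (cross_face e1 _ h s0c).
have mesh x y : x \in s -> y \in s -> `|x - y| < delta.
  move=> xs ys; apply: le_lt_trans hk.
  apply: (sdn_mesh _ _ (@size_hemi _ _ e d)) sd x y xs ys => //.
  have n1 s0 x : s0 \in hemi e d -> x \in s0 -> `|x| <= 1.
    move=> s0h xs0; have s0c : s0 \in cross e d.+1 by rewrite /= mem_cat s0h.
    have [i id h] := cross_coord s0c xs0.
    have en : `|e i| <= 1.
      suff : mx_norm (e i) <= 1 by [].
      rewrite mx_normrE; apply: bigmax_le => // -[a b] _.
      by rewrite mxE; case: andP => _; rewrite ?normr1 ?normr0.
    by case: h => ->; rewrite ?normrN.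
  move=> s0 s0h x y xs0 ys0; rewrite (le_trans (ler_normB _ _))//.
  by rewrite -[2]/(1 + 1) lerD// ?(n1 s0).
split.
  move=> a b /mapP[x xs ->] /mapP[y ys ->].
  have [i hi [-> _]] := labP x (octs x xs).
  have [j hj [-> _]] := labP y (octs y ys).
  move=> /= /val_inj ij; subst j; congr pair.
  (* Two neighbours labelled +i and -i would have values of f_i more than 2 apart, while closeness
     allows 1. *)
  have := fuc x y (octs _ xs) (octs _ ys) (mesh _ _ xs ys) i.
  case: (ltrP 0 (f i x)) hi => hx; case: (ltrP 0 (f i y)) hj => hy //.
    rewrite (gtr0_norm hx) (ler0_norm hy) => h1 h2.
    rewrite ler_norml => /andP[_ h3]; exfalso; lra.
  rewrite (ler0_norm hx) (gtr0_norm hy) => h1 h2.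
  rewrite ler_norml => /andP[h3 _]; exfalso; lra.
move=> x /octs ox; have [i hi [E En]] := labP x ox; split=> //.
by rewrite E /=.
Qed.

End OddMaps.

(** * Complete semidefinite scalar products and Riesz representation *)

(** Only semidefinite, because the vectors will be functions not identified almost everywhere.
    Completeness therefore asserts a limit without uniqueness. *)
Record semi_hilbert (R : realType) (V : lmodType R) (ip : V -> V -> R) : Prop := {
  ipC : forall u v, ip u v = ip v u;
  ipDl : forall u v w, ip (u + v) w = ip u w + ip v w;
  ipZl : forall a u w, ip (a *: u) w = a * ip u w;
  ip_ge0 : forall u, 0 <= ip u u;
  ip_complete : forall u : nat -> V,
    (forall e, 0 < e -> exists n0, forall m n, (n0 <= m)%N -> (n0 <= n)%N ->
       ip (u m - u n) (u m - u n) <= e) ->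
    exists l, forall e, 0 < e -> exists n0, forall n, (n0 <= n)%N ->
       ip (u n - l) (u n - l) <= e }.

Section SemiHilbert.
Context {R : realType} {V : lmodType R} (ip : V -> V -> R).
Hypothesis HS : semi_hilbert ip.
Implicit Types (u v w : V) (a b : R).

Lemma ipDr u v w : ip w (u + v) = ip w u + ip w v.
Proof. by rewrite (ipC HS) (ipDl HS) !(ipC HS w). Qed.
Lemma ipZr a u w : ip w (a *: u) = a * ip w u.
Proof. by rewrite (ipC HS) (ipZl HS) !(ipC HS w). Qed.
Lemma ipNl u w : ip (- u) w = - ip u w.
Proof. by rewrite -scaleN1r (ipZl HS) mulN1r. Qed.
Lemma ipNr u w : ip w (- u) = - ip w u.
Proof. by rewrite -scaleN1r ipZr mulN1r. Qed.
Lemma ipBl u v w : ip (u - v) w = ip u w - ip v w.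
Proof. by rewrite (ipDl HS) ipNl. Qed.
Lemma ipBr u v w : ip w (u - v) = ip w u - ip w v.
Proof. by rewrite ipDr ipNr. Qed.
Lemma ip0l w : ip 0 w = 0.
Proof. by rewrite -(subrr w) ipBl subrr. Qed.
Definition ipE := (ipDl HS, ipDr, ipZl HS, ipZr, ipBl, ipBr, ipNl, ipNr).

Definition ipn u := Num.sqrt (ip u u).
Local Notation nrm := ipn.

Lemma ipn_ge0 u : 0 <= nrm u. Proof. exact: sqrtr_ge0. Qed.
Lemma ipn_sqr u : nrm u ^+ 2 = ip u u. Proof. by rewrite sqr_sqrtr// (ip_ge0 HS). Qed.

Lemma cauchy_schwarz u v : `|ip u v| <= nrm u * nrm v.
Proof.
rewrite -ler_sqr ?nnegrE ?normr_ge0 ?mulr_ge0 ?ipn_ge0//.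
rewrite real_normK ?num_real// exprMn !ipn_sqr.
have P a b : 0 <= a ^+ 2 * ip u u + 2 * a * b * ip u v + b ^+ 2 * ip v v.
  have := ip_ge0 HS (a *: u + b *: v).
  by rewrite !ipE (ipC HS v u); congr (_ <= _); ring.
have := ip_ge0 HS v; rewrite le_eqVlt => /predU1P[v0|v0].
  (* If [v] is a null vector, these coefficients give the form the value -(ip u v)^2 (ip u u + 2),
     which forces [ip u v] to vanish. *)
  have h := P (ip u v) (- (ip u u + 1)).
  rewrite -v0 !mulr0 in h *.
  have := ip_ge0 HS u; nra.
have := P (ip v v) (- ip u v).
have -> : ip v v ^+ 2 * ip u u + 2 * ip v v * - ip u v * ip u v + (- ip u v) ^+ 2 * ip v v =
  ip v v * (ip u u * ip v v - ip u v ^+ 2) by ring.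
by rewrite pmulr_rge0// subr_ge0.
Qed.

Lemma ipn_triangle u v : nrm (u + v) <= nrm u + nrm v.
Proof.
rewrite -ler_sqr ?nnegrE ?addr_ge0 ?ipn_ge0//.
rewrite ipn_sqr sqrrD !ipn_sqr !ipE (ipC HS v u).
have := le_trans (ler_norm _) (cauchy_schwarz u v); lra.
Qed.

Lemma ipnZ a u : nrm (a *: u) = `|a| * nrm u.
Proof. by rewrite /nrm !ipE mulrA -expr2 sqrtrM ?sqr_ge0// sqrtr_sqr. Qed.
Lemma ipnN u : nrm (- u) = nrm u.
Proof. by rewrite /nrm !ipE opprK. Qed.
Lemma ipn0 : nrm 0 = 0. Proof. by rewrite /nrm ip0l sqrtr0. Qed.
Lemma ipnB u v : nrm (u - v) = nrm (v - u).
Proof. by rewrite -ipnN opprB. Qed.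
Lemma ipn_dist u v : `|nrm u - nrm v| <= nrm (u - v).
Proof.
rewrite ler_norml; have := ipn_triangle (u - v) v; have := ipn_triangle (v - u) u.
rewrite !subrK (ipnB v u) => h1 h2; apply/andP; split; lra.
Qed.

Lemma ipn_le u a : 0 <= a -> (forall v, `|ip u v| <= a * nrm v) -> nrm u <= a.
Proof.
move=> a0 /(_ u); rewrite ger0_norm ?(ip_ge0 HS)// -ipn_sqr expr2.
have := ipn_ge0 u; rewrite le_eqVlt => /predU1P[<-//|u0].
by rewrite ler_pM2r.
Qed.

Lemma ipn_complete (u : nat -> V) :
  (forall e, 0 < e -> exists n0, forall m n, (n0 <= m)%N -> (n0 <= n)%N ->
     nrm (u m - u n) <= e) ->
  exists l, forall e, 0 < e -> exists n0, forall n, (n0 <= n)%N -> nrm (u n - l) <= e.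
Proof.
move=> h; have [|l hl] := ip_complete HS (u := u).
  move=> e e0; have [|n0 hn] := h (Num.sqrt e); first by rewrite sqrtr_gt0.
  exists n0 => m n mn nn; have := hn m n mn nn.
  by rewrite /nrm ler_sqrt// ltW.
exists l => e e0; have [|n0 hn] := hl (e ^+ 2); first by rewrite exprn_gt0.
exists n0 => n nn; have := hn n nn.
by rewrite -ipn_sqr ler_sqr ?nnegrE ?ipn_ge0// ltW.
Qed.

(** Minimise F(v) = |v|^2/2 - l(v): the parallelogram identity makes minimising sequences Cauchy,
    and the vanishing first variation at a limit g says that l = ip g. The representative is
    determined only up to null vectors. *)
Lemma riesz (l : V -> R) (K : R) :
  (forall u v, l (u + v) = l u + l v) -> (forall a u, l (a *: u) = a * l u) ->
  (forall u, `|l u| <= K * nrm u) ->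
  exists g, forall v, l v = ip g v.
Proof.
move=> lD lZ lK.
pose F v := ip v v / 2 - l v.
have lN u : l (- u) = - l u by rewrite -scaleN1r lZ mulN1r.
have Flb v : - (K ^+ 2 / 2) <= F v.
  rewrite /F -ipn_sqr; have := le_trans (ler_norm _) (lK v).
  have := sqr_ge0 (nrm v - K); nra.
pose E := range F.
have hE : has_inf E.
  split; first by exists (F 0), 0.
  by exists (- (K ^+ 2 / 2)) => _ [v _ <-].
have Fd v : inf E <= F v by apply: ge_inf; [exact: hE.2|exists v].
have /choice[u hu] : forall n : nat, exists u, F u <= inf E + n.+1%:R^-1.
  move=> n; have [|_ [u _ <-] h] := @inf_adherent _ E n.+1%:R^-1 _ hE.
    by rewrite invr_gt0.
  by exists u; exact: ltW.
(* Parallelogram identity: the midpoint of u_m and u_n still has F at least the infimum. *)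
have par m n : ip (u m - u n) (u m - u n) <= 4 * (m.+1%:R^-1 + n.+1%:R^-1).
  have := Fd (2^-1 *: (u m + u n)); have := hu m; have := hu n; rewrite /F.
  rewrite lZ lD !ipE (ipC HS (u n) (u m)). by move: (m.+1%:R^-1) (n.+1%:R^-1) => r s h1 h2 h3; lra.
have [|g hg] := ip_complete HS (u := u).
  move=> e e0; have [n0 hn0] : exists n0, forall n, (n0 <= n)%N -> n.+1%:R^-1 <= e / 8.
    have e8 : 0 < e / 8 by rewrite divr_gt0.
    have [N _ hN] := near_infty_natSinv_lt (PosNum e8).
    by exists N => n /hN /ltW.
  exists n0 => m n mn nn; apply: le_trans (par m n) _.
  by have := hn0 m mn; have := hn0 n nn; move: (m.+1%:R^-1) (n.+1%:R^-1) => r s; lra.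
have Fg : F g <= inf E.
  apply/ler_addgt0Pr => e e0.
  have gn := ipn_ge0 g.
  have [d d0 hd] : exists2 d, 0 < d & d * (nrm g + `|K|) <= e / 2.
    have M0 : 0 < nrm g + `|K| + 1 by rewrite ltr_wpDl// addr_ge0.
    exists (e / 2 / (nrm g + `|K| + 1)); first by rewrite divr_gt0// divr_gt0.
    by rewrite mulrAC ler_pdivrMr// ler_wpM2l ?lerDl// divr_ge0// ltW.
  have [n0 hn0] := hg (d ^+ 2) (exprn_gt0 _ d0).
  have [N _ hN] := near_infty_natSinv_lt (PosNum (divr_gt0 e0 (ltr0n _ 2))).
  pose n := maxn n0 N.
  have := hu n; have : n.+1%:R^-1 < e / 2 by apply: hN; rewrite /= leq_maxr.
  move: (n.+1%:R^-1) => r h2 h1.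
  have h3 : nrm (u n - g) <= d.
    by have := hn0 n (leq_maxl _ _); rewrite -ipn_sqr ler_sqr ?nnegrE ?ipn_ge0// ltW.
  have h4 : F g <= F (u n) + nrm (u n - g) * (nrm g + `|K|).
    have -> : F (u n) = F g + ip g (u n - g) - l (u n - g) + ip (u n - g) (u n - g) / 2.
      by rewrite /F lD lN !ipE (ipC HS g (u n)); field.
    have c1 := cauchy_schwarz g (u n - g); rewrite ler_norml in c1.
    have c2 := lK (u n - g); rewrite ler_norml in c2.
    have c3 := ip_ge0 HS (u n - g); have c4 := ler_norm K; have c5 := ipn_ge0 (u n - g).
    move: c1 c2 => /andP[c1 _] /andP[_ c2].
    have : K * nrm (u n - g) <= `|K| * nrm (u n - g) by rewrite ler_wpM2r.
    rewrite mulrDr [_ * nrm g]mulrC [_ * `|K|]mulrC; lra.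
  have h5 : nrm (u n - g) * (nrm g + `|K|) <= d * (nrm g + `|K|).
    by rewrite ler_wpM2r// addr_ge0.
  lra.
exists g => v.
have P t : 0 <= t * (ip g v - l v) + t ^+ 2 * (ip v v / 2).
  have := le_trans Fg (Fd (g + t *: v)); rewrite /F lD lZ !ipE (ipC HS v g).
  by rewrite -subr_ge0; congr (_ <= _); field.
apply/eqP; rewrite -subr_eq0; apply/eqP.
set A := ip v v / 2; set D := ip g v - l v.
have A0 : 0 <= A by rewrite divr_ge0// (ip_ge0 HS).
suff : D = 0 by rewrite /D; lra.
(* A nonnegative polynomial t D + t^2 A has D = 0. The +1 keeps the test value meaningful when A =
   0. *)
have := P (- D / (A + 1)).
rewrite -/A -/D.
have -> : - D / (A + 1) * D + (- D / (A + 1)) ^+ 2 * A = - (D / (A + 1)) ^+ 2.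
  by field; lra.
rewrite oppr_ge0 => h.
have : (D / (A + 1)) ^+ 2 == 0 by rewrite eq_le h sqr_ge0.
rewrite sqrf_eq0 mulf_eq0 invr_eq0 => /orP[/eqP//|/eqP]; lra.
Qed.

End SemiHilbert.

(** * Even functionals on the unit sphere and an odd gradient ascent step *)

Lemma near_dist_lt (R : realType) (V : normedModType R) (x : V) (d : R) :
  0 < d -> \forall y \near x, `|x - y| < d.
Proof. by move=> d0; apply/nbhs_ballP; exists d => //= y; rewrite -ball_normE. Qed.

Lemma continuous_sum (R : realType) (T : topologicalType) (I : Type) (r : seq I)
    (f : I -> T -> R) :
  (forall i, continuous (f i)) -> continuous (fun x => \sum_(i <- r) f i x).
Proof.
move=> cf x; elim: r => [|i r IH].
  rewrite (_ : (fun x => _) = cst 0); first exact: cvg_cst.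
  by apply/funext => y; rewrite big_nil.
rewrite (_ : (fun x => _) = f i \+ (fun x => \sum_(i <- r) f i x)).
  by apply: cvgD => //; exact: cf.
by apply/funext => y; rewrite big_cons.
Qed.

Lemma octahedron_min (R : realType) n (g : 'rV[R]_n.+1 -> R) :
  (forall x, octahedron x -> 0 < g x) ->
  (forall x, octahedron x -> forall e : R, 0 < e -> exists2 d : R, 0 < d &
     forall y, octahedron y -> `|x - y| < d -> `|g x - g y| <= e) ->
  exists2 m, 0 < m & forall x, octahedron x -> m <= g x.
Proof.
move=> g0 gc.
have ne : (@octahedron R n) !=set0.
  exists (delta_mx ord0 ord0); rewrite /octahedron /= (bigD1 ord0)//= big1 => [|i /negbTE i0].
    by rewrite mxE !eqxx normr1 addr0.
  by rewrite mxE i0 andbF normr0.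
have cpt : compact (@octahedron R n).
  apply: bounded_closed_compact.
    exists 1; split; first exact: num_real.
    move=> M M1 x ox /=; apply: (@le_trans _ _ 1); last exact: ltW.
    suff : mx_norm x <= 1 by [].
    rewrite mx_normrE; apply: bigmax_le => // -[a b] _ /=.
    rewrite ord1 -[leRHS]ox (bigD1 b)//= lerDl sumr_ge0//.
  have cc : continuous (fun x : 'rV[R]_n.+1 => \sum_i `|x ord0 i|).
    apply: continuous_sum => i x.
    exact: (cvg_norm (@coord_continuous R 1 n.+1 ord0 i x)).
  rewrite (_ : @octahedron R n = (fun x : 'rV[R]_n.+1 => \sum_i `|x ord0 i|) @^-1` [set 1])//.
  by apply: closed_comp => [x _|]; [exact: cc|exact: closed_eq].
have [|c co cm] := EVT_min_rV ne cpt (f := g).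
  apply/subspace_continuousP => x ox; apply/cvgrPdist_le => e e0.
  have [d d0 hd] := gc x ox e e0.
  near=> y; apply: hd; last first. near: y. apply: cvg_within; exact: (@near_dist_lt R _ x d d0).
  by near: y; exact: withinT.
exists (g c) => [|x ox]; first by apply: g0; rewrite inE in co.
by apply: cm; rewrite inE.
Unshelve. all: by end_near.
Qed.

(** An abstract form of the integral of Q|u|^p on the invariant functions, with the estimates asked
    on the unit ball only. The crux is [ef_compact]: once finitely many bounded functionals are
    small on the difference, the derivative is monotone decreasing up to [d]. The field [ef_pos]
    provides spaces of every dimension on which [B] is positive. *)
Record even_functional (R : realType) (V : lmodType R) (ip : V -> V -> R) (p C : R)
    (B : V -> R) (dB : V -> V -> R) : Prop := {
  ef_p : 0 < p;
  ef_C : 0 <= C;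
  ef_even : forall u, B (- u) = B u;
  ef_odd : forall u v, dB (- u) v = - dB u v;
  ef_D : forall w u v, dB w (u + v) = dB w u + dB w v;
  ef_Z : forall w a u, dB w (a *: u) = a * dB w u;
  ef_euler : forall u, dB u u = p * B u;
  ef_lip : forall u w v, ipn ip u <= 1 -> ipn ip w <= 1 ->
    `|dB u v - dB w v| <= C * ipn ip (u - w) * ipn ip v;
  ef_taylor : forall u v, ipn ip u <= 1 -> ipn ip v <= 1 ->
    `|B (u + v) - B u - dB u v| <= C * ipn ip v ^+ 2;
  ef_compact : forall d, 0 < d -> exists M (L : 'I_M -> V -> R),
    [/\ forall i u v, L i (u - v) = L i u - L i v,
        forall i, exists K, forall u, `|L i u| <= K * ipn ip u &
        forall u v, ipn ip u <= 1 -> ipn ip v <= 1 -> (forall i, `|L i (u - v)| <= 1) ->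
          dB u (u - v) - dB v (u - v) <= d];
  ef_pos : forall k, exists psi : 'I_k -> V, forall x : 'rV[R]_k, x != 0 ->
    0 < B (\sum_i x ord0 i *: psi i) }.

Section MinMax.
Context {R : realType} {V : lmodType R} (ip : V -> V -> R) (p C : R)
  (B : V -> R) (dB : V -> V -> R).
Hypothesis HS : semi_hilbert ip.
Hypothesis EF : even_functional ip p C B dB.
Local Notation nrm := (ipn ip).
Implicit Types (u v w y : V).
Definition ipE' := (ipDl HS, ipDr HS, ipZl HS, ipZr HS, ipBl HS, ipBr HS, ipNl HS, ipNr HS).

Let p0 := ef_p EF.
Let C0 := ef_C EF.

Lemma ef_dB0 v : dB 0 v = 0.
Proof. by have := ef_odd EF 0 v; rewrite oppr0; lra. Qed.

Lemma ef_B0 : B 0 = 0.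
Proof.
have /esym/eqP := ef_euler EF 0; rewrite ef_dB0 mulf_eq0 => /orP[/eqP|/eqP//].
by have := p0; lra.
Qed.

Let dB_le u v : nrm u <= 1 -> `|dB u v| <= C * nrm u * nrm v.
Proof.
move=> u1; have := ef_lip EF v u1 (w := 0); rewrite ef_dB0 !subr0; apply.
by rewrite (ipn0 HS).
Qed.

Let B_le u : nrm u <= 1 -> `|B u| <= C / p.
Proof.
move=> u1; rewrite ler_pdivlMr// -[X in _ * X]gtr0_norm// -normrM mulrC -(ef_euler EF).
apply: le_trans (dB_le u u1) _; rewrite -mulrA -[leRHS]mulr1 ler_wpM2l//.
by rewrite mulr_ile1// ipn_ge0.
Qed.

Lemma ef_B_lip u w : nrm u <= 1 -> nrm (w - u) <= 1 -> `|B w - B u| <= 2 * C * nrm (w - u).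
Proof.
move=> u1 d1; have := ef_taylor EF u1 d1; rewrite [u + _]addrC subrK => h1.
have h2 := dB_le (w - u) u1; have n0 := ipn_ge0 ip (w - u).
rewrite -[_ - B u](subrK (dB u (w - u))); apply: le_trans (ler_normD _ _) _.
have h3 : C * nrm (w - u) ^+ 2 <= C * nrm (w - u).
  by rewrite ler_wpM2l//; nra.
have h4 : C * nrm u * nrm (w - u) <= C * nrm (w - u).
  by rewrite -mulrA ler_wpM2l// ler_piMl.
lra.
Qed.

Let gradP u : exists g, nrm u <= 1 -> forall v, dB u v = ip g v.
Proof.
have [u1|u1] := pselect (nrm u <= 1); last by exists 0.
have [|||g hg] := riesz HS (l := dB u) (K := C * nrm u).
- exact: (ef_D EF).
- exact: (ef_Z EF).
- by move=> v; exact: dB_le.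
- by exists g.
Qed.

Let grad u := sval (cid (gradP u)).
Let gradE u v : nrm u <= 1 -> dB u v = ip (grad u) v.
Proof. by move=> u1; rewrite /grad; case: cid => g /= ->. Qed.

(** The gradient of [B] along the sphere. By Euler's relation the normal component of the gradient
    at a unit vector u is p B(u) u. *)
Let gs u := grad u - (p * B u) *: u.

Let gs_ip u v : nrm u <= 1 -> ip (gs u) v = dB u v - p * B u * ip u v.
Proof. by move=> u1; rewrite /gs !ipE' gradE. Qed.

Let eq_ler u : nrm u = 1 -> nrm u <= 1. Proof. by move->. Qed.

Let ip1 u : nrm u = 1 -> ip u u = 1.
Proof. by move=> u1; rewrite -(ipn_sqr HS) u1 expr1n. Qed.

Let gs_orth u : nrm u = 1 -> ip (gs u) u = 0.
Proof. by move=> u1; rewrite gs_ip ?u1// ip1// (ef_euler EF) mulr1 subrr. Qed.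

Let gs_le u : nrm u = 1 -> nrm (gs u) <= 2 * C.
Proof.
move=> u1; apply: (ipn_le HS); first by rewrite mulr_ge0.
move=> v; rewrite gs_ip ?u1//; apply: le_trans (ler_normB _ _) _.
have h1 := dB_le v (eq_ler u1); rewrite u1 mulr1 in h1.
have h2 := cauchy_schwarz HS u v; rewrite u1 mul1r in h2.
have h3 := B_le (eq_ler u1); rewrite ler_pdivlMr// in h3.
rewrite [X in _ + X]normrM; have : `|p * B u| * `|ip u v| <= C * nrm v.
  by rewrite ler_pM// normrM gtr0_norm// mulrC.
lra.
Qed.

Let gs_lip u w : nrm u = 1 -> nrm w = 1 -> nrm (u - w) <= 1 ->
  nrm (gs u - gs w) <= (2 + 2 * p) * C * nrm (u - w).
Proof.
move=> u1 w1 d1; have dn := ipn_ge0 ip (u - w).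
apply: (ipn_le HS); first by rewrite !mulr_ge0// addr_ge0 ?mulr_ge0// ltW.
move=> v; rewrite (ipBl HS) !gs_ip ?u1 ?w1//.
have h1 := ef_lip EF v (eq_ler u1) (eq_ler w1).
have h2 := ef_B_lip (eq_ler w1) d1.
have h3 := B_le (eq_ler u1).
have vn := ipn_ge0 ip v.
have h4 := cauchy_schwarz HS w v; rewrite w1 mul1r in h4.
have h5 := cauchy_schwarz HS (u - w) v.
have -> : dB u v - p * B u * ip u v - (dB w v - p * B w * ip w v) =
  (dB u v - dB w v) - (p * B u * ip (u - w) v + p * (B u - B w) * ip w v).
  by rewrite (ipBl HS); ring.
apply: le_trans (ler_normB _ _) _; apply: le_trans (lerD h1 (ler_normD _ _)) _.
have a1 : `|p * B u * ip (u - w) v| <= C * nrm (u - w) * nrm v.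
  rewrite normrM -mulrA ler_pM// normrM gtr0_norm// mulrC.
  by rewrite ler_pdivlMr// in h3.
have a2 : `|p * (B u - B w) * ip w v| <= p * (2 * C * nrm (u - w)) * nrm v.
  by rewrite normrM ler_pM// normrM gtr0_norm// ler_wpM2l// ltW.
lra.
Qed.

Lemma normalize_lip u w : 1 <= nrm u -> 1 <= nrm w ->
  nrm ((nrm u)^-1 *: u - (nrm w)^-1 *: w) <= 2 * nrm (u - w).
Proof.
move=> u1 w1; have u0 : 0 < nrm u by lra. have w0 : 0 < nrm w by lra.
have -> : (nrm u)^-1 *: u - (nrm w)^-1 *: w =
    (nrm u)^-1 *: (u - w) + ((nrm w - nrm u) / (nrm u * nrm w)) *: w.
  have -> : (nrm w - nrm u) / (nrm u * nrm w) = (nrm u)^-1 - (nrm w)^-1.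
    by field; rewrite !gt_eqF.
  by rewrite scalerBr scalerBl addrA subrK.
apply: le_trans (ipn_triangle HS _ _) _; rewrite !(ipnZ HS).
have d0 := ipn_ge0 ip (u - w).
rewrite normfV (gtr0_norm u0) normrM normfV (gtr0_norm (mulr_gt0 u0 w0)).
have h1 : (nrm u)^-1 * nrm (u - w) <= nrm (u - w) by rewrite ler_piMl// invf_le1.
have h2 : `|nrm w - nrm u| / (nrm u * nrm w) * nrm w = (nrm u)^-1 * `|nrm w - nrm u|.
  by field; rewrite !gt_eqF.
rewrite h2; have h3 := ipn_dist HS w u; rewrite (ipnB HS) in h3.
have : (nrm u)^-1 * `|nrm w - nrm u| <= nrm (u - w).
  by apply: le_trans h3; rewrite ler_piMl// invf_le1.
lra.
Qed.

(** The inverse of the step length [t], large enough for t C <= 1/64 in the ascent estimate and for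
    t (2 + 2p) C <= 1 in the Lipschitz bound of the step. *)
Let Kt := 64 * (1 + C) * (1 + p).
Let t := Kt^-1.
Let Kt0 : 0 < Kt. Proof. by rewrite !mulr_gt0// ltr_pwDl// ltW. Qed.
Let t0 : 0 < t. Proof. by rewrite invr_gt0. Qed.
Let tC : t * C <= 64^-1.
Proof.
rewrite /t mulrC ler_pdivrMr// /Kt; have := mulr_ge0 C0 (ltW p0); have := p0; lra.
Qed.

(** [zs] moves along the tangential gradient and [T] projects back to the sphere. A single such step
    does the work of a deformation flow. *)
Let zs u := u + t *: gs u.
Let T u := (nrm (zs u))^-1 *: zs u.

Let zs_sqr u : nrm u = 1 -> nrm (zs u) ^+ 2 = 1 + t ^+ 2 * nrm (gs u) ^+ 2.
Proof.
move=> u1; rewrite !(ipn_sqr HS) /zs; move: (gs_orth u1); move: (gs u) => g g0.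
by rewrite !ipE' (ipC HS u g) g0 ip1//; ring.
Qed.

Let zs_ge1 u : nrm u = 1 -> 1 <= nrm (zs u).
Proof.
move=> u1; rewrite -[leLHS]sqrtr1 /nrm ler_sqrt ?(ip_ge0 HS)// -(ipn_sqr HS) zs_sqr//.
by rewrite lerDl mulr_ge0// sqr_ge0.
Qed.

Let T1 u : nrm u = 1 -> nrm (T u) = 1.
Proof.
move=> u1; have z1 := zs_ge1 u1; have z0 : 0 < nrm (zs u) by lra.
by rewrite /T (ipnZ HS) gtr0_norm ?invr_gt0// mulVf// gt_eqF.
Qed.

Let T_lip u w : nrm u = 1 -> nrm w = 1 -> nrm (u - w) <= 1 ->
  nrm (T u - T w) <= 4 * nrm (u - w).
Proof.
move=> u1 w1 d1; apply: le_trans (normalize_lip (zs_ge1 u1) (zs_ge1 w1)) _.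
have -> : zs u - zs w = (u - w) + t *: (gs u - gs w).
  rewrite /zs; move: (gs u) (gs w) => a b; by rewrite scalerBr opprD addrACA.
have h := ipn_triangle HS (u - w) (t *: (gs u - gs w)).
rewrite (ipnZ HS) gtr0_norm// in h.
have h2 := gs_lip u1 w1 d1; have d0 := ipn_ge0 ip (u - w).
have : t * nrm (gs u - gs w) <= nrm (u - w).
  rewrite /t mulrC ler_pdivrMr//; apply: le_trans h2 _.
  rewrite [leRHS]mulrC ler_wpM2r// /Kt.
  have := mulr_ge0 C0 (ltW p0); have := p0; have := C0; lra.
lra.
Qed.

(** Oddness holds only up to null vectors: gradients are chosen representatives, and those at u and
    -u are opposite merely modulo the kernel of the form. *)
Let T_odd u w : nrm u = 1 -> nrm w = 1 -> nrm (u + w) = 0 -> nrm (T u + T w) = 0.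
Proof.
move=> u1 w1 uw; have wN : nrm (- w) = 1 by rewrite (ipnN HS).
have e1 : nrm (u - - w) <= 1 by rewrite opprK uw.
have h := gs_lip u1 wN e1; rewrite opprK uw mulr0 in h.
have h2 : nrm (gs (- w) + gs w) <= 0.
  apply: (ipn_le HS) => // v; rewrite (ipDl HS) !gs_ip ?wN ?w1// (ef_odd EF) (ef_even EF).
  by rewrite (ipNl HS) mul0r normr_le0; apply/eqP; ring.
have h3 : nrm (gs u + gs w) = 0.
  apply/eqP; rewrite eq_le ipn_ge0 andbT.
  have -> : gs u + gs w = (gs u - gs (- w)) + (gs (- w) + gs w).
    by move: (gs u) (gs w) (gs (- w)) => a b c; rewrite addrA subrK.
  by apply: le_trans (ipn_triangle HS _ _) _; lra.
have h4 : nrm (zs u + zs w) = 0.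
  apply/eqP; rewrite eq_le ipn_ge0 andbT /zs addrACA -scalerDr.
  by apply: le_trans (ipn_triangle HS _ _) _; rewrite (ipnZ HS) h3 uw mulr0 addr0.
have h5 : nrm (zs u) = nrm (zs w).
  by apply/eqP; rewrite -subr_eq0 -normr_le0 -(ipnN HS (zs w)) -h4
    -{2}[zs w]opprK; exact: ipn_dist.
by rewrite /T h5 -scalerDr (ipnZ HS) h4 mulr0.
Qed.

(** Expand [B] at u along v = T u - u. The tangential part gains at least 3/4 t |gs|^2.
    Renormalisation and the Taylor remainder cost at most C x and 2 C x with C x <= t |gs|^2 / 64,
    so a quarter of t |gs|^2 survives. *)
Let T_ascent u : nrm u = 1 -> B u + t / 4 * nrm (gs u) ^+ 2 <= B (T u).
Proof.
move=> u1; have z1 := zs_ge1 u1; have z0 : 0 < nrm (zs u) by lra.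
set g2 := nrm (gs u) ^+ 2; set s := (nrm (zs u))^-1.
have g20 : 0 <= g2 by exact: sqr_ge0.
have g2C : g2 <= 4 * C ^+ 2.
  have := gs_le u1; have := ipn_ge0 ip (gs u); rewrite /g2 => h1 h2.
  have -> : 4 * C ^+ 2 = (2 * C) ^+ 2 by ring.
  by rewrite ler_sqr ?nnegrE// mulr_ge0.
(* [x] is the excess of |zs u|^2 over 1, since the tangential gradient is orthogonal to u. It
   governs both 1 - s and |v|^2. *)
pose x := t ^+ 2 * g2.
have x0 : 0 <= x by rewrite mulr_ge0// sqr_ge0.
have x1 : x <= 1 / 4.
  have : x <= 4 * (t * C) ^+ 2.
    have -> : 4 * (t * C) ^+ 2 = t ^+ 2 * (4 * C ^+ 2) by ring.
    by rewrite /x ler_wpM2l// sqr_ge0.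
  have := tC; have : 0 <= t * C by rewrite mulr_ge0// ltW.
  move: (t * C) => a; nra.
have zx : nrm (zs u) ^+ 2 = 1 + x by rewrite zs_sqr.
have s1 : s <= 1 by rewrite invf_le1.
have sx : 1 - x <= s.
  have : nrm (zs u) <= 1 + x.
    by rewrite -ler_sqr ?nnegrE ?(ltW z0)//; last lra; rewrite zx; nra.
  move=> h; apply: (@le_trans _ _ (1 + x)^-1); last by rewrite lef_pV2 ?posrE//; lra.
  rewrite -[leRHS]mul1r ler_pdivlMr; [nra|lra].
have s34 : 3 / 4 <= s by lra.
pose v := (s - 1) *: u + (s * t) *: gs u.
have Tv : T u = u + v.
  rewrite /T -/s /zs /v scalerDr scalerA addrA; congr (_ + _).
  by rewrite -{2}[u]scale1r -scalerDl addrCA subrr addr0.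
have v2 : nrm v ^+ 2 <= 2 * x.
  have -> : nrm v ^+ 2 = (s - 1) ^+ 2 + s ^+ 2 * t ^+ 2 * g2.
    rewrite /v /g2 !(ipn_sqr HS); move: (gs_orth u1); move: (gs u) => g g0.
    by rewrite !ipE' (ipC HS u g) g0 ip1//; ring.
  have : s ^+ 2 * x <= x by rewrite ler_piMl// expr_le1//; lra.
  have : (s - 1) ^+ 2 <= x by nra.
  by rewrite /x; lra.
have v1 : nrm v <= 1.
  by rewrite -ler_sqr ?nnegrE ?ipn_ge0// expr1n; lra.
have := ef_taylor EF (eq_ler u1) v1; rewrite -Tv ler_norml => /andP[h1 _].
have dv : dB u v = (s - 1) * (p * B u) + s * t * g2.
  rewrite /v (ef_D EF) !(ef_Z EF) (ef_euler EF) [dB u (gs u)]gradE ?u1//.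
  have -> : ip (grad u) (gs u) = g2; last by [].
  have -> : grad u = gs u + (p * B u) *: u by rewrite /gs subrK.
  rewrite /g2 (ipn_sqr HS); move: (gs_orth u1); move: (gs u) => g g0.
  by rewrite !ipE' (ipC HS u g) g0 mulr0 addr0.
have pB : `|p * B u| <= C.
  by rewrite normrM gtr0_norm// mulrC; have := B_le (eq_ler u1); rewrite ler_pdivlMr.
have h2 : - (C * x) <= (s - 1) * (p * B u).
  move: pB; rewrite ler_norml => /andP[b1 b2].
  have [b|b] := lerP 0 (p * B u); nra.
have h3 : C * nrm v ^+ 2 <= 2 * C * x by rewrite [2 * C]mulrC -mulrA ler_wpM2l.
have h4 : C * x <= t * g2 / 64.
  have -> : C * x = (t * C) * (t * g2) by rewrite /x; ring.
  have -> : t * g2 / 64 = 64^-1 * (t * g2) by rewrite mulrC.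
  by rewrite ler_wpM2r// mulr_ge0// ltW.
have h5 : 3 / 4 * (t * g2) <= s * t * g2.
  by rewrite -[s * t * g2]mulrA ler_wpM2r// mulr_ge0// ltW.
have tg : 0 <= t * g2 by rewrite mulr_ge0// ltW.
lra.
Qed.

(** What the minmax argument uses of [T]: it maps odd families on the sphere to odd families and
    never lowers [B]. Where it gains little, the point is almost critical. *)
Lemma ascent_step : exists2 r : R, 0 < r & exists T' : V -> V,
  [/\ forall u, nrm u = 1 -> nrm (T' u) = 1,
      forall u w, nrm u = 1 -> nrm w = 1 -> nrm (u - w) <= 1 ->
        nrm (T' u - T' w) <= 4 * nrm (u - w),
      forall u w, nrm u = 1 -> nrm w = 1 -> nrm (u + w) = 0 -> nrm (T' u + T' w) = 0 &
      forall u, nrm u = 1 -> B u <= B (T' u) /\ forall v,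
        `|dB u v - p * B u * ip u v| <= Num.sqrt ((B (T' u) - B u) / r) * nrm v].
Proof.
exists (t / 4); first by rewrite divr_gt0.
exists T; split=> // u u1; have h := T_ascent u1.
have h0 : 0 <= t / 4 * nrm (gs u) ^+ 2 by rewrite mulr_ge0 ?sqr_ge0// divr_ge0// ltW.
split=> [|v]; first lra.
rewrite -gs_ip ?u1//; apply: le_trans (cauchy_schwarz HS _ _) _.
rewrite ler_wpM2r ?ipn_ge0//.
rewrite -[leLHS]ger0_norm ?ipn_ge0// -sqrtr_sqr ler_wsqrtr// ler_pdivlMr ?divr_gt0//.
by rewrite mulrC; lra.
Qed.

End MinMax.

(** * Palais-Smale sequences and small positive critical values *)

(** Along an ultrafilter every bounded sequence converges, so any finite number of functionals
    converge simultaneously, uniformly in how that number varies with the precision. *)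
Lemma ultra_bounded_cvg (R : realType) (U : set_system nat) (a : nat -> R) K :
  UltraFilter U -> (forall n, `|a n| <= K) ->
  exists l, forall d, 0 < d -> U [set n | `|l - a n| < d].
Proof.
move=> UU aK.
have PF : ProperFilter (a @ U) by apply: fmap_proper_filter; exact: ultra_proper.
have [|l [_ hl]] := @segment_compact R (- K) K (a @ U) PF.
  rewrite (_ : [set` _] = [set x | `|x| <= K]); last by apply/seteqP; split=> x /=; rewrite in_itv /= ler_norml.
  rewrite /fmap /= (_ : _ @^-1` _ = setT); first exact: filterT.
  by apply/seteqP; split=> // n _ /=; exact: aK.
exists l => d d0; have [//|h] := in_ultra_setVsetC [set n | `|l - a n| < d] UU.
exfalso; have [] := hl [set x | ~ (`|l - x| < d)] [set x | `|l - x| < d].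
- exact: h.
- by apply/nbhs_ballP; exists d => //= y; rewrite -ball_normE.
- by move=> x [].
Qed.

Lemma coord_le_norm (R : realType) n (x : 'rV[R]_n) i : `|x ord0 i| <= `|x|.
Proof.
suff : `|x ord0 i| <= mx_norm x by [].
by rewrite mx_normrE; apply: (le_bigmax _ (fun k => `|x k.1 k.2|) (ord0, i)).
Qed.

Section MinMaxEnd.
Context {R : realType} {V : lmodType R} (ip : V -> V -> R) (p C : R)
  (B : V -> R) (dB : V -> V -> R).
Hypothesis HS : semi_hilbert ip.
Hypothesis EF : even_functional ip p C B dB.
Local Notation nrm := (ipn ip).

Definition critical_on_sphere (y : V) :=
  nrm y = 1 /\ forall v, dB y v = p * B y * ip y v.

(** With D = y_m - y_n, almost criticality at level c makes p c |D|^2 nearly dB(y_m) D - dB(y_n) D,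
    and [ef_compact] bounds the latter when the functionals nearly agree on y_m and y_n. Positivity
    of c then makes a subsequence Cauchy. *)
Lemma palais_smale (y : nat -> V) (c : R) (e : nat -> R) :
  0 < c -> (forall d, 0 < d -> exists N, forall n, (N <= n)%N -> e n <= d) ->
  (forall n, nrm (y n) = 1) -> (forall n, `|B (y n) - c| <= e n) ->
  (forall n v, `|dB (y n) v - p * B (y n) * ip (y n) v| <= e n * nrm v) ->
  exists2 l, critical_on_sphere l & B l = c.
Proof.
move=> c0 e0 y1 yc yg; have p0 := ef_p EF; have C0 := ef_C EF; have p0' := ltW p0.
have [U [UU sU]] := ultraFilterLemma (F := \oo) _.
have pc : 0 < p * c by rewrite mulr_gt0.
have n2 m n : nrm (y m - y n) <= 2.
  by apply: le_trans (ipn_triangle HS _ _) _; rewrite (ipnN HS) !y1.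
have cauchy d : 0 < d -> exists2 S, U S &
    forall m n, S m -> S n -> nrm (y m - y n) ^+ 2 <= d.
  move=> d0; pose d' := p * c * d / 2.
  have d'0 : 0 < d' by rewrite divr_gt0// mulr_gt0.
  have [M [L [Ladd Lb Lc]]] := ef_compact EF d'0.
  have /choice[l hl] : forall i, exists l, forall d, 0 < d -> U [set n | `|l - L i (y n)| < d].
    move=> i; have [K hK] := Lb i; apply: (@ultra_bounded_cvg _ _ _ K UU) => n.
    by have := hK (y n); rewrite y1 mulr1.
  have h2 : (0 : R) < 2^-1 by rewrite invr_gt0.
  (* Chosen so that replacing dB(y) D by p c <y,D> costs at most p c d/8 at each of the two points.
     Together with d' = p c d/2 the total stays below p c d. *)
  pose d2 := p * c * d / (16 * (1 + p)).
  have p1 : 0 < 1 + p by rewrite ltr_pwDl// ltW.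
  have d20 : 0 < d2 by rewrite divr_gt0// mulr_gt0.
  have [N hN] := e0 d2 d20.
  exists ([set n | forall i, `|l i - L i (y n)| < 2^-1] `&` [set n | (N <= n)%N]).
    apply: filterI; last by apply: sU; exists N.
    by apply: (@filter_forall _ _ (fun i n => `|l i - L i (y n)| < 2^-1)) => i; exact: hl.
  move=> m n [Sm /hN em] [Sn /hN en].
  have Lmn i : `|L i (y m - y n)| <= 1.
    rewrite Ladd; have a2 := Sm i; have a1 := Sn i.
    have := ler_normB (l i - L i (y n)) (l i - L i (y m)); rewrite opprB addrC.
    by rewrite addrA subrK => /le_trans -> //; lra.
  have := Lc (y m) (y n) _ _ Lmn; rewrite !y1 => /(_ (lexx _) (lexx _)).
  set D := y m - y n => hd.
  have gm := yg m D; have gn := yg n D; have bm := yc m; have bn := yc n.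
  have Dn := ipn_ge0 ip D; have D2 : nrm D <= 2 := n2 m n.
  have sq : nrm D ^+ 2 = ip (y m) D - ip (y n) D.
    by rewrite (ipn_sqr HS) /D (ipBl HS).
  have im := cauchy_schwarz HS (y m) D; rewrite y1 mul1r in im.
  have inn := cauchy_schwarz HS (y n) D; rewrite y1 mul1r in inn.
  have am : `|dB (y m) D - p * c * ip (y m) D| <= 2 * (1 + p) * d2.
    have -> : dB (y m) D - p * c * ip (y m) D =
      (dB (y m) D - p * B (y m) * ip (y m) D) + p * (B (y m) - c) * ip (y m) D by ring.
    apply: le_trans (ler_normD _ _) _; rewrite [X in _ + X]normrM normrM (gtr0_norm p0).
    have q1 : e m * nrm D <= d2 * 2.
      by rewrite ler_pM//; exact: le_trans (normr_ge0 _) bm.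
    have q2 : p * `|B (y m) - c| * `|ip (y m) D| <= p * d2 * 2.
      rewrite ler_pM ?mulr_ge0//; last lra.
      by rewrite ler_wpM2l//; lra.
    lra.
  have an : `|dB (y n) D - p * c * ip (y n) D| <= 2 * (1 + p) * d2.
    have -> : dB (y n) D - p * c * ip (y n) D =
      (dB (y n) D - p * B (y n) * ip (y n) D) + p * (B (y n) - c) * ip (y n) D by ring.
    apply: le_trans (ler_normD _ _) _; rewrite [X in _ + X]normrM normrM (gtr0_norm p0).
    have q1 : e n * nrm D <= d2 * 2.
      by rewrite ler_pM//; exact: le_trans (normr_ge0 _) bn.
    have q2 : p * `|B (y n) - c| * `|ip (y n) D| <= p * d2 * 2.
      rewrite ler_pM ?mulr_ge0//; last lra.
      by rewrite ler_wpM2l//; lra.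
    lra.
  have d2E : 2 * (1 + p) * d2 = p * c * d / 8 by rewrite /d2; field; lra.
  rewrite d2E !ler_norml in am an; move: am an => /andP[am1 am2] /andP[an1 an2].
  have : p * c * nrm D ^+ 2 <= p * c * d.
    by rewrite sq mulrBr; rewrite /d' in hd; lra.
  by rewrite ler_pM2l.
have /choice[S hS] : forall j : nat, exists S, U S /\
    forall m n, S m -> S n -> nrm (y m - y n) ^+ 2 <= j.+1%:R^-1 ^+ 2.
  move=> j; have [|S US h] := cauchy (j.+1%:R^-1 ^+ 2).
    by rewrite exprn_gt0// invr_gt0.
  by exists S.
(* Diagonal extraction: nu j is taken in the intersection of S 0, ..., S j, which belongs to the
   ultrafilter and hence meets every tail. *)
have /choice[nu hnu] : forall j, exists n, (j <= n)%N /\ forall i, (i <= j)%N -> S i n.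
  move=> j.
  have : U ([set n | forall i : 'I_j.+1, S i n] `&` [set n | (j <= n)%N]).
    apply: filterI; last by apply: sU; exists j.
    by apply: (@filter_forall _ _ (fun (i : 'I_j.+1) n => S i n)) => i; case: (hS i).
  move=> /filter_ex[n [h1 h2]]; exists n; split=> // i ij.
  exact: (h1 (Ordinal (ij : (i < j.+1)%N))).
have inv0 d : 0 < d :> R -> exists N, forall n, (N <= n)%N -> n.+1%:R^-1 <= d.
  by move=> d0; have [N _ hN] := near_infty_natSinv_lt (PosNum d0); exists N => n /hN /ltW.
have [l hl] : exists l, forall d, 0 < d -> exists n0, forall n, (n0 <= n)%N ->
    nrm (y (nu n) - l) <= d.
  apply: (ipn_complete HS (u := y \o nu)) => d d0; have [N hN] := inv0 d d0; exists N => m n mn nn.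
  apply: le_trans (hN N (leqnn _)); rewrite -ler_sqr ?nnegrE ?ipn_ge0 ?invr_ge0//.
  by apply: (hS N).2; apply: (hnu _).2.
have lim d : 0 < d -> exists2 n, nrm (l - y n) <= d & e n <= d.
  move=> d0; have [n0 h0] := hl d d0; have [N hN] := e0 d d0.
  exists (nu (maxn n0 N)); first by rewrite (ipnB HS); apply: h0; rewrite leq_maxl.
  by apply: hN; apply: leq_trans (hnu _).1; rewrite leq_maxr.
have l1 : nrm l = 1.
  apply/eqP; rewrite eq_le; apply/andP; split; apply/ler_addgt0Pr => d d0;
  have [n h _] := lim d d0; have := ipn_dist HS l (y n); rewrite y1 ler_norml => /andP[]; lra.
have Bl : B l = c.
  apply/eqP; rewrite -subr_eq0 -normr_le0; apply/ler_addgt0Pr => d d0; rewrite add0r.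
  pose d1 := Num.min 1 (d / (1 + 2 * C)).
  have C1 : 0 < 1 + 2 * C by rewrite ltr_pwDl// mulr_ge0.
  have d10 : 0 < d1 by rewrite lt_min ltr01 divr_gt0.
  have [n h1 h2] := lim d1 d10.
  have d11 : d1 <= 1 by rewrite ge_min lexx.
  have d1d : d1 * (1 + 2 * C) <= d by rewrite -ler_pdivlMr// ge_min lexx orbT.
  have := ef_B_lip HS EF (u := y n) (w := l); rewrite y1 => /(_ (lexx _)) h3.
  have := h3 (le_trans h1 d11) => h4.
  have := ler_normD (B l - B (y n)) (B (y n) - c); rewrite addrA subrK => /le_trans; apply.
  have := yc n; have : 2 * C * nrm (l - y n) <= 2 * C * d1 by rewrite ler_wpM2l// mulr_ge0.
  lra.
exists l => //; split=> // v; rewrite Bl.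
apply/eqP; rewrite -subr_eq0 -normr_le0; apply/ler_addgt0Pr => d d0; rewrite add0r.
have vn := ipn_ge0 ip v.
pose K := (C + 1 + p * C + p + p * c + 1) * (nrm v + 1).
have K0 : 0 < K.
  rewrite mulr_gt0// ?ltr_wpDl// ?addr_ge0 ?mulr_ge0//; try exact: ltW.
have [n h1 h2] := lim (d / K) (divr_gt0 d0 K0).
have dK : d / K * K = d by rewrite mulfVK// gt_eqF.
have -> : dB l v - p * c * ip l v = (dB l v - dB (y n) v) +
   (dB (y n) v - p * B (y n) * ip (y n) v) + p * (B (y n) - c) * ip (y n) v
   - p * c * ip (l - y n) v.
  by rewrite (ipBl HS); ring.
set r := d / K in h1 h2 dK *.
have r0 : 0 <= r by rewrite divr_ge0// ltW.
have a1 : `|dB l v - dB (y n) v| <= C * r * nrm v.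
  have := ef_lip EF v (u := l) (w := y n); rewrite l1 y1 => /(_ (lexx _) (lexx _)) /le_trans; apply.
  by rewrite ler_wpM2r// ler_wpM2l.
have a2 : `|dB (y n) v - p * B (y n) * ip (y n) v| <= r * nrm v.
  by apply: le_trans (yg n v) _; rewrite ler_wpM2r.
have a3 : `|p * (B (y n) - c) * ip (y n) v| <= p * r * nrm v.
  rewrite normrM normrM (gtr0_norm p0) ler_pM ?mulr_ge0//.
    by rewrite ler_wpM2l//; exact: le_trans (yc n) h2.
  by have := cauchy_schwarz HS (y n) v; rewrite y1 mul1r.
have a4 : `|p * c * ip (l - y n) v| <= p * c * (r * nrm v).
  rewrite normrM (gtr0_norm pc); apply: ler_wpM2l; first exact: ltW.
  by apply: le_trans (cauchy_schwarz HS _ _) _; rewrite ler_wpM2r.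
apply: le_trans (ler_normB _ _) _; apply: le_trans (lerD (ler_normD _ _) a4) _.
have := ler_normD (dB l v - dB (y n) v) (dB (y n) v - p * B (y n) * ip (y n) v).
have rv : 0 <= r * nrm v by rewrite mulr_ge0.
suff : (C + 1 + p + p * c) * (r * nrm v) <= d by lra.
rewrite -dK /K [leRHS]mulrCA ler_pM//.
- by rewrite !addr_ge0// ?mulr_ge0// ltW.
- by have := mulr_ge0 (ltW p0) C0; lra.
- by rewrite ler_wpM2l// lerDl.
Qed.

(** The competitors of the minmax: uniformly continuous maps from the octahedron to the unit sphere,
    odd modulo null vectors. *)
Let adm n (f : 'rV[R]_n.+1 -> V) := [/\ forall x, octahedron x -> nrm (f x) = 1,
  forall x, octahedron x -> nrm (f (- x) + f x) = 0 &
  forall e : R, 0 < e -> exists2 d : R, 0 < d & forall x y, octahedron x -> octahedron y ->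
    `|x - y| < d -> nrm (f x - f y) <= e].

(** A linear embedding into a space where [B] is positive, normalised radially; compactness of the
    octahedron turns positivity into a positive minimum. *)
Let adm_base n : exists2 f : 'rV[R]_n.+1 -> V, adm f &
  exists2 m, 0 < m & forall x, octahedron x -> m <= B (f x).
Proof.
have [psi hpsi] := ef_pos EF n.+1.
pose w (x : 'rV[R]_n.+1) := \sum_i x ord0 i *: psi i.
have wN x : w (- x) = - w x.
  by rewrite /w -sumrN; apply: eq_bigr => i _; rewrite mxE scaleNr.
have wB x y : w x - w y = w (x - y).
  by rewrite /w -sumrB; apply: eq_bigr => i _; rewrite !mxE scalerBl.
pose S := \sum_i nrm (psi i).
have S0 : 0 <= S by apply: sumr_ge0 => i _; exact: ipn_ge0.
have wS x : nrm (w x) <= S * `|x|.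
  rewrite /w /S mulr_suml.
  have : forall r : seq 'I_n.+1, nrm (\sum_(i <- r) x ord0 i *: psi i) <= \sum_(i <- r) nrm (psi i) * `|x|.
    elim => [|i r IH]; first by rewrite !big_nil (ipn0 HS).
    rewrite !big_cons; apply: le_trans (ipn_triangle HS _ _) _; apply: lerD => //.
    rewrite (ipnZ HS) mulrC ler_wpM2l ?ipn_ge0//.
    have := coord_le_norm x i; exact.
  exact.
have oct0 x : octahedron x -> x != 0.
  move=> ox; apply/eqP => x0; move: ox; rewrite /octahedron /= x0 big1.
    by move/eqP; rewrite eq_sym oner_eq0.
  by move=> i _; rewrite mxE normr0.
have wpos x : octahedron x -> 0 < nrm (w x).
  move=> ox; rewrite lt_neqAle ipn_ge0 andbT eq_sym; apply/eqP => w0.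
  have : 0 < B (w x) by exact/hpsi/oct0.
  (* Taylor's estimate at 0 gives B = 0 on null vectors, so w x, where [B] is positive, is not null
     and can be normalised. *)
  have := ef_taylor EF (u := 0) (v := w x); rewrite (ipn0 HS) w0 => /(_ ler01 ler01).
  rewrite expr0n mulr0 add0r normr_le0 (ef_dB0 EF) (ef_B0 EF) !subr0 => /eqP ->.
  by rewrite ltxx.
have [m m0 hm] : exists2 m, 0 < m & forall x, octahedron x -> m <= nrm (w x).
  apply: octahedron_min => // x ox e e0; have S1 : 0 < S + 1 by rewrite ltr_wpDl.
  exists (e / (S + 1)) => [|y oy xy]; first by rewrite divr_gt0.
  apply: le_trans (ipn_dist HS _ _) _; rewrite wB; apply: le_trans (wS _) _.
  apply: le_trans (_ : (S + 1) * (e / (S + 1)) <= _); last by rewrite mulrC mulfVK// gt_eqF.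
  by rewrite ler_pM// ?lerDl// ltW.
pose f x := (nrm (w x))^-1 *: w x.
have f1 x : octahedron x -> nrm (f x) = 1.
  by move=> /wpos wx; rewrite /f (ipnZ HS) gtr0_norm ?invr_gt0// mulVf// gt_eqF.
have fl x y : octahedron x -> octahedron y -> nrm (f x - f y) <= 2 * S / m * `|x - y|.
  move=> ox oy; rewrite /f.
  have hx := hm x ox; have hy := hm y oy.
  have h := normalize_lip HS (u := m^-1 *: w x) (w := m^-1 *: w y).
  rewrite !(ipnZ HS) gtr0_norm ?invr_gt0// in h.
  rewrite ![m^-1 * _]mulrC !ler_pdivlMr// !mul1r in h.
  have {h} := h hx hy; rewrite !invf_div !scalerA -scalerBr wB (ipnZ HS) gtr0_norm ?invr_gt0//.
  have E z : nrm (w z) != 0 -> m / nrm (w z) * m^-1 = (nrm (w z))^-1.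
    by move=> z0; rewrite mulrAC divff ?mul1r// gt_eqF.
  rewrite !E ?gt_eqF ?wpos// => /le_trans; apply.
  have -> : 2 * S / m * `|x - y| = 2 * (m^-1 * (S * `|x - y|)) by ring.
  by rewrite ler_wpM2l// ler_wpM2l// invr_ge0 ltW.
exists f.
  split=> // [x ox|e e0].
    by rewrite /f wN (ipnN HS) scalerN addNr (ipn0 HS).
  have S1 : 0 < 2 * S / m + 1 by rewrite ltr_wpDl// divr_ge0 ?mulr_ge0// ltW.
  exists (e / (2 * S / m + 1)) => [|x y ox oy xy]; first by rewrite divr_gt0.
  apply: le_trans (fl x y ox oy) _.
  apply: le_trans (_ : (2 * S / m + 1) * (e / (2 * S / m + 1)) <= _);
    last by rewrite mulrC mulfVK// gt_eqF.
  by rewrite ler_pM// ?lerDl// ?divr_ge0 ?mulr_ge0// ltW.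
apply: octahedron_min => [x ox|x ox e e0].
  have -> : f x = w ((nrm (w x))^-1 *: x).
    by rewrite /f {2 3}/w scaler_sumr; apply: eq_bigr => i _; rewrite mxE scalerA.
  by apply: hpsi; rewrite scaler_eq0 negb_or oct0// andbT invr_eq0 gt_eqF ?wpos.
have C0 := ef_C EF.
pose K := 2 * S / m; have K0 : 0 <= K by rewrite divr_ge0 ?mulr_ge0// ltW.
pose d := Num.min (K + 1)^-1 (e / ((2 * C + 1) * (K + 1))).
have K1 : 0 < K + 1 by rewrite ltr_wpDl.
have C1 : 0 < 2 * C + 1 by rewrite ltr_wpDl// mulr_ge0.
exists d => [|y oy xy]; first by rewrite lt_min invr_gt0 K1 divr_gt0// mulr_gt0.
have h1 := fl y x oy ox; rewrite -/K distrC in h1.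
have h2 : `|x - y| * (K + 1) <= 1.
  by rewrite -ler_pdivlMr// mul1r ltW// (lt_le_trans xy)// ge_min lexx.
have h3 : `|x - y| * ((2 * C + 1) * (K + 1)) <= e.
  by rewrite -ler_pdivlMr ?mulr_gt0// ltW// (lt_le_trans xy)// ge_min lexx orbT.
have n0 : 0 <= `|x - y| by [].
have := ef_B_lip HS EF (u := f x) (w := f y); rewrite f1// => /(_ (lexx _)).
rewrite distrC => h4; apply: le_trans (h4 _) _; first by lra.
have : 2 * C * nrm (f y - f x) <= 2 * C * (K * `|x - y|) by rewrite ler_wpM2l// mulr_ge0.
have : 0 <= C * `|x - y| by rewrite mulr_ge0.
have : 0 <= K * `|x - y| by rewrite mulr_ge0.
lra.
Qed.

(** The value c is the supremum over the competitors f of the minimum of B o f. It is positive by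
    [adm_base] and at most eps/2 by Borsuk-Ulam, and the ascent step together with [palais_smale]
    makes it critical. *)
Lemma minmax_small_critical_value (eps : R) : 0 < eps ->
  exists y, [/\ critical_on_sphere y, 0 < B y & B y < eps].
Proof.
move=> eps0; have p0 := ef_p EF; have C0 := ef_C EF; have p0' := ltW p0.
(* The number n of functionals attached to eps fixes the dimension of the sphere: n odd functions on
   an n-sphere are small together somewhere. *)
have [n [L [Ladd Lb Lc]]] := ef_compact EF (mulr_gt0 p0 (divr_gt0 eps0 (ltr0n _ 2))).
have L0 i : L i 0 = 0 by rewrite -(subrr 0) Ladd subrr.
have LN i u : L i (- u) = - L i u by rewrite -[- u]add0r Ladd L0 sub0r.
have LD i u v : L i (u + v) = L i u + L i v by rewrite -{1}[v]opprK Ladd LN opprK.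
have adm_small f : @adm n f -> exists2 x, octahedron x & B (f x) <= eps / 2.
  move=> [f1 fodd fuc].
  have /choice[K hK] := Lb.
  pose KK := \sum_i `|K i| + 1.
  have KK0 : 0 < KK by rewrite ltr_wpDl// sumr_ge0.
  have hKK i u : `|L i u| <= KK * nrm u.
    apply: le_trans (hK i u) _; rewrite ler_wpM2r ?ipn_ge0//.
    apply: le_trans (ler_norm _) _; rewrite /KK (bigD1 i)//= -addrA lerDl.
    by rewrite addr_ge0// sumr_ge0.
  have [|d d0 hd] := fuc KK^-1; first by rewrite invr_gt0.
  have [i x ox|x y ox oy xy i|x ox hx] := @odd_map_small R n (fun i x => L i (f x)) d _ d0.
  - have := hKK i (f (- x) + f x); rewrite fodd// mulr0 normr_le0 LD addr_eq0.
    by move=> /eqP.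
  - rewrite -Ladd; apply: le_trans (hKK _ _) _.
    have := hd x y ox oy xy => /(ler_wpM2l (ltW KK0)) /le_trans; apply.
    by rewrite divff// gt_eqF.
  (* Compare f x with the origin: the inequality of [ef_compact] becomes p B(f x) <= p eps/2. *)
  exists x => //; have := Lc (f x) 0; rewrite (ipn0 HS) f1// => /(_ (lexx _) ler01).
  rewrite subr0 (ef_dB0 EF) subr0 (ef_euler EF) => /(_ hx).
  by rewrite ler_pM2l.
pose E := [set c | exists2 f, @adm n f & forall x, octahedron x -> c <= B (f x)].
have [f0 af0 [m m0 hm]] := adm_base n.
have Em : E m by exists f0.
have Eub : ubound E (eps / 2).
  move=> c [f af hf]; have [x ox h] := adm_small f af; exact: le_trans (hf x ox) h.
have hE : has_sup E by split; [exists m|exists (eps / 2)].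
set c := sup E.
have c0 : 0 < c by apply: lt_le_trans m0 _; exact: (sup_upper_bound hE).
have c_eps : c < eps.
  apply: (@le_lt_trans _ _ (eps / 2)); last lra.
  by apply: ge_sup => //; exists m.
have [t t0 [T [T1 TL Todd Tasc]]] := ascent_step HS EF.
have step e : 0 < e -> exists y, [/\ nrm y = 1, `|B y - c| <= e &
    forall v, `|dB y v - p * B y * ip y v| <= e * nrm v].
  (* The point found below gains less than 2d in one ascent step, and d <= e^2 t/2 makes sqrt(2d/t)
     at most e. *)
  move=> e0; pose d := Num.min e (e ^+ 2 * t / 2).
  have d0 : 0 < d by rewrite lt_min e0 divr_gt0// mulr_gt0// exprn_gt0.
  have de : d <= e by rewrite ge_min lexx.
  have de2 : d <= e ^+ 2 * t / 2 by rewrite ge_min lexx orbT.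
  have [a [f af hf] ha] := sup_adherent d0 hE.
  have [f1 fodd fuc] := af.
  have aT : @adm n (T \o f).
    split=> [x ox|x ox|r r0].
    - by apply: T1; exact: f1.
    - apply: Todd; [exact/f1/octahedron_opp|exact: f1|exact: fodd].
    have e1 : 0 < Num.min 1 (r / 4) by rewrite lt_min ltr01 divr_gt0.
    have [r' r'0 hr] := fuc _ e1; exists r' => // x y ox oy xy /=.
    have := hr x y ox oy xy; rewrite le_min => /andP[h1 h2].
    have := TL (f x) (f y) (f1 x ox) (f1 y oy) h1; lra.
  (* The map T o f competes as well, so its minimum cannot reach c + d, while B o f is above c - d
     everywhere. *)
  have [x ox hx] : exists2 x, octahedron x & B (T (f x)) < c + d.
    apply: contrapT => H; have : E (c + d).
      exists (T \o f) => // x ox; rewrite leNgt; apply/negP => h; apply: H; by exists x.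
    move=> /(sup_upper_bound hE); rewrite -/c; lra.
  exists (f x); have yx := f1 x ox.
  have B1 : c - d < B (f x) by apply: lt_le_trans (hf x ox); rewrite -/c in ha.
  have [h1 h2] := Tasc (f x) yx.
  split=> // [|v]; first by rewrite ler_norml; apply/andP; split; lra.
  apply: le_trans (h2 v) _; rewrite ler_wpM2r ?ipn_ge0//.
  apply: (@le_trans _ _ (Num.sqrt (e ^+ 2))); last by rewrite sqrtr_sqr gtr0_norm.
  by rewrite ler_wsqrtr// ler_pdivrMr//; lra.
have /choice[y hy] : forall n : nat, exists y, [/\ nrm y = 1, `|B y - c| <= n.+1%:R^-1 &
    forall v, `|dB y v - p * B y * ip y v| <= n.+1%:R^-1 * nrm v].
  by move=> k; apply: step; rewrite invr_gt0.
have [||||l lc Bl] := @palais_smale y c (fun n => n.+1%:R^-1) c0.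
- by move=> d d0; have [N _ hN] := near_infty_natSinv_lt (PosNum d0); exists N => k /hN /ltW.
- by move=> k; have [] := hy k.
- by move=> k; have [] := hy k.
- by move=> k; have [] := hy k.
by exists l; rewrite Bl.
Qed.

End MinMaxEnd.

(** * Measurability on row vectors: boxes, balls, open sets, continuous maps *)

Section MeasurableRV.
Context {R : realType}.
Implicit Types n : nat.

Lemma rV_ballP n (a x : 'rV[R]_n) (r : R) : 0 < r ->
  (`|a - x| < r) <-> (forall i, `|a ord0 i - x ord0 i| < r).
Proof.
move=> r0; split=> [h i|h].
  by apply: le_lt_trans h; have := coord_le_norm (a - x) i; rewrite !mxE.
suff : mx_norm (a - x) < r by [].
rewrite mx_normrE; apply: bigmax_lt => // -[i j] _ /=.
by rewrite ord1 !mxE; exact: h.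
Qed.

Lemma measurable_rV_box n (A : 'I_n -> set (measurableTypeR R)) :
  (forall i, measurable (A i)) -> measurable [set x : 'rV[R]_n | forall i, A i (x ord0 i)].
Proof.
move=> mA; rewrite (_ : [set x | _] = \bigcap_(i in [set: 'I_n])
    (fun x : 'rV[R]_n => x ord0 i) @^-1` A i); last first.
  by apply/seteqP; split => [x H i _|x H i]; [exact: H|exact: (H i Logic.I)].
apply: fin_bigcap_measurable => // i _.
by rewrite -[X in measurable X]setTI; exact: measurable_coord.
Qed.

Lemma rV_ball_box n (a : 'rV[R]_n) (r : R) : 0 < r ->
  [set x | `|a - x| < r] = [set x | forall i, ball (a ord0 i) r (x ord0 i)].
Proof.
move=> r0; apply/seteqP; split=> x /=; first by move/(rV_ballP _ _ r0).
by move=> h; apply/(rV_ballP _ _ r0).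
Qed.

Lemma measurable_rV_ball n (a : 'rV[R]_n) (r : R) : 0 < r ->
  measurable [set x | `|a - x| < r].
Proof.
move=> r0; rewrite rV_ball_box//.
by apply: (@measurable_rV_box n (fun i => ball (a ord0 i) r)) => i; rewrite ball_itv; exact: measurable_itv.
Qed.

Lemma lebesgue_rV_ball n (a : 'rV[R]_n) (r : R) : 0 < r ->
  lebesgue_rV n [set x | `|a - x| < r] = ((2 * r) ^+ n)%:E.
Proof.
move=> r0; rewrite rV_ball_box// (lebesgue_rV_box (A := fun i => ball (a ord0 i) r)); last by move=> i; rewrite ball_itv; exact: measurable_itv.
under eq_bigr do rewrite lebesgue_measure_ball ?ltW//.
by rewrite prodEFin prodr_const card_ord mulr_natl.
Qed.

Lemma open_measurable_rV n (U : set 'rV[R]_n) : open U -> measurable U.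
Proof.
move=> oU.
(* Balls of rational centre and radius 1/(k+1), kept only when contained in U. In the max norm a
   ball is a box, hence measurable. *)
pose F (qk : 'rV[rat]_n * nat) : set 'rV[R]_n :=
  let b := [set x | `|map_mx ratr qk.1 - x| < qk.2.+1%:R^-1] in
  if `[< b `<=` U >] then b else set0.
have -> : U = \bigcup_qk F qk.
  apply/seteqP; split=> x; last first.
    move=> [qk _]; rewrite /F; case: asboolP => // bU; exact: bU.
  move=> Ux; have /nbhs_ballP[e /= e0 xU] : nbhs x U by apply: open_nbhs_nbhs; split.
  have e2 : 0 < e / 2 by rewrite divr_gt0.
  have [k _ hk] := near_infty_natSinv_lt (PosNum e2).
  have {}hk := hk k (leqnn _); rewrite /= in hk.
  have k0 : 0 < k.+1%:R^-1 :> R by rewrite invr_gt0.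
  have /choice[q hq] : forall i, exists q : rat, `|ratr q - x ord0 i| < k.+1%:R^-1.
    move=> i; have [] := @rat_in_itvoo R (x ord0 i - k.+1%:R^-1) (x ord0 i + k.+1%:R^-1).
      by rewrite ltrBlDr -addrA ltrDl addr_gt0.
    by move=> q; rewrite in_itv /= => /andP[h1 h2]; exists q; rewrite ltr_distl h1.
  exists (\row_i q i, k) => //; rewrite /F /=.
  have xin : `|map_mx ratr (\row_i q i) - x| < k.+1%:R^-1.
    by apply/rV_ballP => // i; rewrite !mxE.
  case: asboolP => //; case=> y /= hy; apply: xU.
  rewrite mx_norm_ball /ball_ /= -(subrKA (map_mx ratr (\row_i q i))).
  rewrite (le_lt_trans (ler_normD _ _))// distrC.
  by have := ltrD xin hy; move: (k.+1%:R^-1) hk => r; lra.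
apply: countable_bigcupT_measurable; first exact: countableP.
move=> qk; rewrite /F; case: asboolP => // _.
by apply: measurable_rV_ball; rewrite invr_gt0.
Qed.

Lemma continuous_measurable_rV n (f : 'rV[R]_n -> R) :
  continuous f -> measurable_fun setT f.
Proof.
move=> /continuousP cf; apply: (measurability _ (measurable_realfun.RGenOpens.measurableE R)).
move=> _ [_ [a [b ->] <-]]; rewrite setTI; apply: open_measurable_rV.
exact/cf/interval_open.
Qed.

Lemma measurable_rV_continuous n m (f : 'rV[R]_n -> 'rV[R]_m) :
  continuous f -> measurable_fun setT f.
Proof.
move=> cf; apply: measurable_fun_coordP => i; apply: continuous_measurable_rV => x.
exact: (@continuous_comp _ _ _ f (fun M : 'rV[R]_m => M ord0 i) x (cf x) (@coord_continuous R 1 m ord0 i (f x))).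
Qed.

Lemma measurable_rVD d (T : measurableType d) n (f g : T -> 'rV[R]_n) :
  measurable_fun setT f -> measurable_fun setT g -> measurable_fun setT (fun x => f x + g x).
Proof.
move=> mf mg; apply: measurable_fun_coordP => i.
rewrite (_ : (fun x => _) = (fun x => f x ord0 i) \+ (fun x => g x ord0 i)).
  by apply: measurable_funD; exact: (measurableT_comp (measurable_coord i)).
by apply/funext => x; rewrite mxE.
Qed.

Lemma measurable_rVN d (T : measurableType d) n (f : T -> 'rV[R]_n) :
  measurable_fun setT f -> measurable_fun setT (fun x => - f x).
Proof.
move=> mf; apply: measurable_fun_coordP => i.
rewrite (_ : (fun x => _) = (fun x => - f x ord0 i)).
  by apply: measurable_funN; exact: (measurableT_comp (measurable_coord i)).
by apply/funext => x; rewrite mxE.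
Qed.

Lemma measurable_rVB d (T : measurableType d) n (f g : T -> 'rV[R]_n) :
  measurable_fun setT f -> measurable_fun setT g -> measurable_fun setT (fun x => f x - g x).
Proof. by move=> mf mg; apply: measurable_rVD => //; exact: measurable_rVN. Qed.

End MeasurableRV.

(** * Lebesgue measure under translations, reflection and orthogonal maps *)

Section Invariance.
Context {R : realType}.
Local Notation mu n := (@lebesgue_rV R n).
Local Open Scope ereal_scope.

(** The shifted measure agrees with Lebesgue measure on half-open intervals, which determines it. *)
Lemma lebesgue_shift (a : R) (f : measurableTypeR R -> \bar R) :
  measurable_fun setT f -> (forall x, 0 <= f x) ->
  \int[lebesgue_measure]_x f (x + a)%R = \int[lebesgue_measure]_x f x.
Proof.
move=> mf f0; pose h : measurableTypeR R -> measurableTypeR R := fun x => (x + a)%R.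
have mh : measurable_fun setT h by apply: measurable_funD.
have -> : \int[lebesgue_measure]_x f (x + a)%R = \int[lebesgue_measure]_x (f \o h) x by [].
transitivity (\int[pushforward lebesgue_measure h]_x f x).
  by rewrite (ge0_integral_pushforward mh).
apply: eq_measure_integral => /= A mA _; apply/esym.
pose nu := measure_function_pushforward__canonical__measure_function_Measure lebesgue_measure mh.
apply: (@lebesgue_measure_unique R nu) => // _ [[x y] _ <-].
rewrite /= /pushforward.
rewrite (_ : h @^-1` _ = `](x - a)%R, (y - a)%R]%classic); last first.
  by apply/seteqP; split=> z /=; rewrite !in_itv /= /h ltrBlDr lerBrDr.
rewrite !lebesgue_measure_itv /= !lte_fin ltrD2r; case: ifP => // _.
by rewrite -!EFinB; congr EFin; ring.
Qed.

Lemma integral_rVS n (f : 'rV[R]_n.+1 -> \bar R) :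
  measurable_fun setT f -> (forall x, 0 <= f x) ->
  \int[mu n.+1]_x f x = \int[lebesgue_measure]_t \int[mu n]_x f (consrV (t, x)).
Proof.
move=> mf f0; rewrite (ge0_integral_pushforward (@measurable_consrV R n))//.
rewrite preimage_setT.
have mg : measurable_fun setT (f \o @consrV R n) by exact: (measurableT_comp mf (@measurable_consrV R n)).
exact: (@fubini_tonelli1 _ _ _ _ R lebesgue_measure (mu n) _ mg (fun x => f0 _)).
Qed.

Lemma consrV_add n (t a : R) (x v : 'rV[R]_n) :
  (consrV (t, x) + consrV (a, v) = consrV (t + a, x + v))%R.
Proof.
apply: etrans (@add_row_mx _ 1 1 n _ _ _ _) _; rewrite /consrV /=.
by congr (@row_mx _ 1 1 n _ _); apply/matrixP => i j; rewrite !mxE.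
Qed.

Lemma measurable_consrVt n (t : R) : measurable_fun setT (fun x : 'rV[R]_n => consrV (t, x)).
Proof. exact: (measurableT_comp (@measurable_consrV R n) (measurable_pair1 t)). Qed.

Lemma integral_rV_shift n (v : 'rV[R]_n) (f : 'rV[R]_n -> \bar R) :
  measurable_fun setT f -> (forall x, 0 <= f x) ->
  \int[mu n]_x f (x + v)%R = \int[mu n]_x f x.
Proof.
elim: n v f => [|n IH] v f mf f0.
  by apply: eq_integral => x _; congr f; apply/rowP => -[].
have mfv : measurable_fun setT (fun x : 'rV[R]_n.+1 => f (x + v)%R).
  by apply: (measurableT_comp mf); exact: measurable_rVD.
rewrite !integral_rVS//.
pose a := (unconsrV v).1; pose w := (unconsrV v).2.
have vE : v = consrV (a, w) by rewrite -[LHS](unconsrVK v).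
transitivity (\int[lebesgue_measure]_t \int[mu n]_x f (consrV (t + a, x)%R)).
  apply: eq_integral => t _.
  transitivity (\int[mu n]_x f (consrV (t + a, x + w)%R)).
    by apply: eq_integral => x _; rewrite -consrV_add -vE.
  apply: (IH w (fun x => f (consrV (t + a, x)%R))) => //.
  by apply: (measurableT_comp mf); exact: measurable_consrVt.
apply: (lebesgue_shift a (f := fun t => \int[mu n]_x f (consrV (t, x)))).
  have mg : measurable_fun setT (f \o @consrV R n).
    exact: (measurableT_comp mf (@measurable_consrV R n)).
  exact: (@measurable_fun_fubini_tonelli_F _ _ _ _ R (mu n) _ mg (fun x => f0 _)).
by move=> t; apply: integral_ge0.
Qed.

(** Uniqueness of Haar measure by Tonelli. Integrate 1_A(y) 1_B(x+y), shift x by y in one order and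
    y by -x in the other, using the invariance of [mu n] and of [nu] respectively. *)
Lemma translation_invariant_measure n (nu : {sigma_finite_measure set 'rV[R]_n -> \bar R}) :
  (forall (v : 'rV[R]_n) f, measurable_fun setT f -> (forall x, 0 <= f x) ->
     \int[nu]_x f (x + v)%R = \int[nu]_x f x) ->
  forall A B, measurable A -> measurable B ->
  nu A * mu n B = nu B * mu n (-%R @^-1` A).
Proof.
move=> nuT A B mA mB.
pose f (p : 'rV[R]_n * 'rV[R]_n) : \bar R := (\1_A p.2 * \1_B (p.1 + p.2)%R)%:E.
have mf : measurable_fun setT f.
  apply/measurable_EFinP; apply: measurable_funM.
    by apply: (measurableT_comp (measurable_indic mA)); exact: measurable_snd.
  apply: (measurableT_comp (measurable_indic mB)).
  by apply: measurable_rVD; [exact: measurable_fst|exact: measurable_snd].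
have f0 p : 0 <= f p by rewrite lee_fin mulr_ge0.
have FT := @fubini_tonelli _ _ _ _ R (mu n) nu f mf f0.
have E1 : \int[nu]_y \int[mu n]_x f (x, y) = nu A * mu n B.
  transitivity (\int[nu]_y ((\1_A y)%:E * mu n B)).
    apply: eq_integral => y _; rewrite /f /=.
    under eq_integral do rewrite EFinM.
    rewrite ge0_integralZl//; last first.
      by apply/measurable_EFinP; apply: (measurableT_comp (measurable_indic mB)); exact: measurable_rVD.
    congr (_ * _).
    rewrite (integral_rV_shift y (f := fun x => (\1_B x)%:E))//.
      by rewrite integral_indic// setIT.
    by apply/measurable_EFinP; exact: measurable_indic.
  rewrite ge0_integralZr//; first by rewrite integral_indic// setIT.
  by apply/measurable_EFinP; exact: measurable_indic.
pose g (p : 'rV[R]_n * 'rV[R]_n) : \bar R := (\1_A (p.2 - p.1)%R * \1_B p.2)%:E.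
have mg : measurable_fun setT g.
  apply/measurable_EFinP; apply: measurable_funM.
    apply: (measurableT_comp (measurable_indic mA)).
    by apply: measurable_rVB; [exact: measurable_snd|exact: measurable_fst].
  by apply: (measurableT_comp (measurable_indic mB)); exact: measurable_snd.
have g0 p : 0 <= g p by rewrite lee_fin mulr_ge0.
have GT := @fubini_tonelli _ _ _ _ R (mu n) nu g mg g0.
have mNA : measurable (-%R @^-1` A : set 'rV[R]_n).
  by rewrite -[X in measurable X]setTI; apply: (measurable_rVN (f := id)).
have E2 : \int[mu n]_x \int[nu]_y f (x, y) = \int[mu n]_x \int[nu]_y g (x, y).
  apply: eq_integral => x _.
  rewrite -[RHS](nuT x (fun y => g (x, y))) //; last exact: (measurableT_comp mg (measurable_pair1 x)).
  by apply: eq_integral => y _; rewrite /f /g /= addrK addrC.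
have E3 : \int[nu]_y \int[mu n]_x g (x, y) = nu B * mu n (-%R @^-1` A).
  transitivity (\int[nu]_y ((\1_B y)%:E * mu n (-%R @^-1` A))).
    apply: eq_integral => y _; rewrite /g /=.
    under eq_integral do rewrite mulrC EFinM.
    rewrite ge0_integralZl//; last first.
      by apply/measurable_EFinP; apply: (measurableT_comp (measurable_indic mA)); exact: measurable_rVB.
    congr (_ * _).
    rewrite -(integral_rV_shift y (f := fun x => (\1_A (y - x)%R)%:E))//; last first.
      by apply/measurable_EFinP; apply: (measurableT_comp (measurable_indic mA)); exact: measurable_rVB.
    rewrite -[in RHS](setIT (-%R @^-1` A)) -integral_indic//.
    by apply: eq_integral => x _; rewrite opprD addrCA subrr addr0 /= !indicE.
  rewrite ge0_integralZr//; first by rewrite integral_indic// setIT.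
  by apply/measurable_EFinP; exact: measurable_indic.
by rewrite -E1 -FT E2 GT E3.
Qed.

(** Taking nu = mu and a ball for B in [translation_invariant_measure] and cancelling the finite
    positive volume of the ball gives mu(-A) = mu(A). *)
Lemma integral_rV_opp n (f : 'rV[R]_n -> \bar R) :
  measurable_fun setT f -> (forall x, 0 <= f x) ->
  \int[mu n]_x f (- x)%R = \int[mu n]_x f x.
Proof.
move=> mf f0; have mN : measurable_fun setT (-%R : 'rV[R]_n -> 'rV[R]_n).
  exact: (measurable_rVN (f := id)).
have -> : \int[mu n]_x f (- x)%R = \int[mu n]_x (f \o -%R) x by [].
rewrite -[X in \int[mu n]_(x in X) _](preimage_setT (-%R : 'rV[R]_n -> 'rV[R]_n)).
rewrite -(ge0_integral_pushforward mN)//.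
apply: eq_measure_integral => /= A mA _; rewrite /pushforward.
pose B : set 'rV[R]_n := [set x | (`|0 - x| < 1)%R].
have mB : measurable B by exact: measurable_rV_ball.
have := @translation_invariant_measure n (mu n) (@integral_rV_shift n) A B mA mB.
rewrite [RHS]muleC => /esym; rewrite lebesgue_rV_ball//.
have b0 : (0 < (2 * 1) ^+ n :> R)%R by rewrite exprn_gt0// mulr_gt0.
by move/(congr1 (fun z => z * ((2 * 1) ^+ n)^-1%:E)); rewrite -!muleA -!EFinM divff ?gt_eqF// !mule1.
Qed.

Lemma lebesgue_rV_bounded n (A : set 'rV[R]_n) (r : R) : measurable A ->
  (forall x, A x -> (`|x| < r)%R) -> mu n A < +oo.
Proof.
move=> mA Ar; have [r0|r0] := ltrP 0 r; last first.
  rewrite (_ : A = set0) ?measure0//; apply/seteqP; split=> // x /Ar; apply/negP.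
  by rewrite -leNgt (le_trans r0).
apply: (@le_lt_trans _ _ (mu n [set x | (`|0 - x| < r)%R])).
  rewrite le_measure ?inE//; first exact: measurable_rV_ball.
  by move=> x /Ar /=; rewrite sub0r normrN.
by rewrite lebesgue_rV_ball// ltry.
Qed.

Lemma lebesgue_rV_open n (U : set 'rV[R]_n) x : open U -> U x -> 0 < mu n U.
Proof.
move=> oU Ux; have /nbhs_ballP[e /= e0 xU] : nbhs x U by apply: open_nbhs_nbhs; split.
apply: (@lt_le_trans _ _ (mu n [set y | (`|x - y| < e)%R])).
  by rewrite lebesgue_rV_ball// lte_fin exprn_gt0// mulr_gt0.
rewrite le_measure ?inE//; [exact: measurable_rV_ball|exact: open_measurable_rV|].
by move=> y /= xy; apply: xU; rewrite mx_norm_ball.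
Qed.

(** The squared Euclidean norm. The norm |x| on row vectors is the max norm, which orthogonal maps
    do not preserve. *)
Definition sqn n (x : 'rV[R]_n) : R := \sum_i x ord0 i ^+ 2.

Lemma sqn_ge0 n (x : 'rV[R]_n) : (0 <= sqn x)%R.
Proof. by apply: sumr_ge0 => i _; exact: sqr_ge0. Qed.

Lemma sqnN n (x : 'rV[R]_n) : sqn (- x)%R = sqn x.
Proof. by apply: eq_bigr => i _; rewrite mxE sqrrN. Qed.

Lemma sqn_orth n (g : 'M[R]_n) x : (g *m g^T = 1%:M)%R -> sqn (x *m g) = sqn x.
Proof.
move=> gg; have E y : sqn y = (y *m y^T)%R ord0 ord0.
  by rewrite mxE; apply: eq_bigr => i _; rewrite mxE expr2.
by rewrite !E trmx_mul mulmxA -[(x *m g *m g^T)%R]mulmxA gg mulmx1.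
Qed.

Lemma norm_sqn n (x : 'rV[R]_n) : (`|x| ^+ 2 <= sqn x)%R.
Proof.
have [->|x0] := eqVneq x 0%R; first by rewrite normr0 expr0n sqn_ge0.
have h : mx_norm x != 0%R by apply: contra_neq x0 => /mx_norm_eq0.
have [[i j] /= E] := mx_norm_neq0 h; rewrite ord1 in E.
have {E} -> : `|x|%R = `|x ord0 j|%R by exact: E.
rewrite /sqn (bigD1 j)//= real_normK ?num_real// lerDl.
by apply: sumr_ge0 => k _; exact: sqr_ge0.
Qed.

Lemma sqn_norm n (x : 'rV[R]_n) : (sqn x <= n%:R * `|x| ^+ 2)%R.
Proof.
rewrite -[n in n%:R]card_ord -sum1_card natr_sum mulr_suml; apply: ler_sum => i _.
by rewrite mul1r -real_normK ?num_real// ler_sqr ?nnegrE// coord_le_norm.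
Qed.

Lemma sqn_continuous n : continuous (@sqn n).
Proof.
apply: continuous_sum => i x.
have c := @coord_continuous R 1 n ord0 i x; exact: (cvgM c c).
Qed.

Definition eball n (a : 'rV[R]_n) (r : R) : set 'rV[R]_n := [set x | (sqn (x - a) < r ^+ 2)%R].

Lemma eball_open n (a : 'rV[R]_n) r : open (eball a r).
Proof.
have cf : continuous (fun x : 'rV[R]_n => sqn (x - a)%R).
  apply: continuous_sum => i x.
  have c : {for x, continuous (fun x : 'rV[R]_n => (x - a)%R ord0 i)}.
    rewrite (_ : (fun x : 'rV[R]_n => _) = (fun x : 'rV[R]_n => x ord0 i - a ord0 i)%R); last first.
      by apply/funext => y; rewrite !mxE.
    exact: (cvgB (@coord_continuous R 1 n ord0 i x) (cvg_cst _)).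
  exact: (cvgM c c).
by move/continuousP : cf => /(_ _ (@open_lt R (r ^+ 2)%R)).
Qed.

Lemma eball_measurable n (a : 'rV[R]_n) r : measurable (eball a r).
Proof. by apply: open_measurable_rV; exact: eball_open. Qed.

Lemma eball_norm n (a : 'rV[R]_n) r x : (0 <= r)%R -> eball a r x -> (`|x - a| < r)%R.
Proof.
move=> r0 h; rewrite -(@ltr_pXn2r _ 2)// ?nnegrE//.
exact: le_lt_trans (norm_sqn _) h.
Qed.

Lemma eball_fin n (a : 'rV[R]_n) r : (0 <= r)%R -> mu n (eball a r) < +oo.
Proof.
move=> r0; apply: (@lebesgue_rV_bounded _ _ (r + `|a|)%R); first exact: eball_measurable.
move=> x /(eball_norm r0) h; rewrite -[x](subrK a).
by rewrite (le_lt_trans (ler_normD _ _))// ltrD2r.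
Qed.

Lemma eball_pos n (a : 'rV[R]_n) r : (0 < r)%R -> 0 < mu n (eball a r).
Proof.
move=> r0; apply: (@lebesgue_rV_open _ _ a); first exact: eball_open.
by rewrite /eball /= subrr /sqn big1 ?exprn_gt0// => i _; rewrite mxE expr0n.
Qed.

Lemma eball_orth n (g : 'M[R]_n) r : (g *m g^T = 1%:M)%R ->
  (fun x : 'rV[R]_n => x *m g)%R @^-1` eball 0%R r = eball 0%R r.
Proof. by move=> gg; apply/seteqP; split=> x; rewrite /eball /= !subr0 sqn_orth. Qed.

Lemma measurable_mulmxr n (g : 'M[R]_n) : measurable_fun setT (fun x : 'rV[R]_n => x *m g)%R.
Proof.
apply: measurable_fun_coordP => i; under eq_fun do rewrite mxE.
apply: (@measurable_sum _ _ R _ _ _ (fun j (x : 'rV[R]_n) => x ord0 j * g j i)%R) => j.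
by apply: measurable_funM; [exact: measurable_coord|exact: measurable_cst].
Qed.

Section Orthogonal.
Variables (n : nat) (g : 'M[R]_n).
Hypothesis gg : (g *m g^T = 1%:M)%R.

Let h (x : 'rV[R]_n) := (x *m g)%R.
Let nu := pushforward (mu n) h.
Let mh : measurable_fun setT h := @measurable_mulmxr n g.

HB.instance Definition _ := Measure.copy nu
  (measure_function_pushforward__canonical__measure_function_Measure (mu n) mh).

Let nu_sf : sigma_finite setT nu.
Proof.
exists (fun k => eball 0%R k.+1%:R).
  apply/seteqP; split=> // x _; pose k := Num.truncn `|sqn x|.
  have hk : (sqn x < k.+1%:R)%R by rewrite (le_lt_trans (ler_norm _))// truncnS_gt.
  exists k => //; rewrite /eball /= subr0; apply: lt_le_trans hk _.
  by rewrite expr2 ler_peMl// ler1n.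
move=> k; split; first exact: eball_measurable.
by rewrite /nu /pushforward /= eball_orth//; exact: eball_fin.
Qed.

HB.instance Definition _ := Measure_isSigmaFinite.Build _ _ _ nu nu_sf.

(** The image measure [nu] is translation invariant, hence proportional to Lebesgue measure; the
    Euclidean unit ball, mapped to itself, shows that the factor is 1. *)
Lemma integral_rV_orth (f : 'rV[R]_n -> \bar R) :
  measurable_fun setT f -> (forall x, 0 <= f x) ->
  \int[mu n]_x f (x *m g)%R = \int[mu n]_x f x.
Proof.
have nuE f' : measurable_fun setT f' -> (forall x, 0 <= f' x) ->
    \int[nu]_x f' x = \int[mu n]_x f' (x *m g)%R.
  by move=> mf f0; rewrite (ge0_integral_pushforward mh).
move=> mf f0; rewrite -nuE//.
apply: eq_measure_integral => /= A mA _.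
have nuT (v : 'rV[R]_n) f' : measurable_fun setT f' -> (forall x, 0 <= f' x) ->
     \int[nu]_x f' (x + v)%R = \int[nu]_x f' x.
  move=> mf' f'0; rewrite !nuE//; last by apply: (measurableT_comp mf'); exact: measurable_rVD.
  rewrite -[RHS](integral_rV_shift (v *m g^T)%R (f := fun x => f' (x *m g)%R))//; last first.
    exact: (measurableT_comp mf' mh).
  by apply: eq_integral => x _; rewrite mulmxDl -mulmxA (mulmx1C gg) mulmx1.
have mB := @eball_measurable n 0%R 1.
have H0 := @translation_invariant_measure n nu nuT A _ mA mB.
have E1 : nu (eball 0%R 1) = mu n (eball 0%R 1) by rewrite /nu /pushforward /= eball_orth.
have E2 : mu n (-%R @^-1` A : set 'rV[R]_n) = mu n A.
  have := @integral_rV_opp n (fun x => (\1_A x)%:E).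
  have mI : measurable_fun setT (fun x => (\1_A x)%:E : \bar R).
    by apply/measurable_EFinP; exact: measurable_indic.
  have I0 x : 0 <= (\1_A x)%:E :> \bar R by rewrite lee_fin.
  move=> /(_ mI I0) E.
  have mNA : measurable (-%R @^-1` A : set 'rV[R]_n).
    by rewrite -[X in measurable X]setTI; apply: (measurable_rVN (f := id)).
  transitivity (\int[mu n]_x (\1_(-%R @^-1` A : set 'rV[R]_n) x)%:E).
    by rewrite integral_indic// setIT.
  transitivity (\int[mu n]_x (\1_A x)%:E); last by rewrite integral_indic// setIT.
  by rewrite -E; apply: eq_integral => x _; rewrite !indicE.
have b0 := @eball_pos n 0%R 1%R ltr01; have b1 := @eball_fin n 0%R 1%R ler01.
have H : nu A * mu n (eball 0%R 1) = mu n A * mu n (eball 0%R 1).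
  by rewrite [RHS]muleC; exact: etrans H0 (congr2 mule E1 E2).
have fb : mu n (eball 0%R 1) \is a fin_num by rewrite ge0_fin_numE ?measure_ge0.
have := congr1 (fun z => z * (fine (mu n (eball 0%R 1)))^-1%:E) H.
rewrite -!muleA -{1 3}(fineK fb) -!EFinM divff ?mule1; first exact.
by rewrite gt_eqF// fine_gt0// b0 b1.
Qed.

End Orthogonal.
End Invariance.

(** * Directional derivatives and smooth radial bumps *)

Section Derivatives.
Context {R : realType}.

Lemma is_derive_epsP (V : normedModType R) (f : V -> R) (x v : V) (d : R) :
  is_derive x v f d <-> forall e : R, 0 < e -> exists2 r : R, 0 < r & forall h : R, h != 0 -> `|h| < r ->
    `|(f (x + h *: v) - f x) / h - d| <= e.
Proof.
have E h : h^-1 *: ((f \o shift x) (h *: v) - f x) = (f (x + h *: v) - f x) / h.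
  by rewrite /= [h *: v + x]addrC -[LHS]/(h^-1 * _) mulrC.
split=> [[df <-] e e0|H].
  move: df; rewrite /derivable => /cvgrPdist_le /(_ e e0).
  rewrite near_withinE => /nbhs_ballP[r /= r0 hr]; exists r => // h h0 hr'.
  have := hr h; rewrite -ball_normE /= sub0r normrN => /(_ hr' h0).
  by rewrite E distrC.
have cv : (fun h => h^-1 *: ((f \o shift x) (h *: v) - f x)) @ 0^' --> d.
  apply/cvgrPdist_le => e e0; have [r r0 hr] := H e e0.
  rewrite near_withinE; apply/nbhs_ballP; exists r => //= h.
  rewrite -ball_normE /= sub0r normrN => hr' h0.
  by rewrite E distrC; exact: hr.
by apply: DeriveDef; [exact: cvgP cv|exact: cvg_lim cv].
Qed.

Lemma is_derive_line (V : normedModType R) (f : V -> R) (x v : V) (t d : R) :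
  is_derive (x + t *: v) v f d <-> is_derive t (1 : R) (fun s => f (x + s *: v)) d.
Proof.
have E h : x + t *: v + h *: v = x + (t + h *: (1 : R)) *: v.
  have -> : h *: (1 : R) = h by exact: mulr1.
  by rewrite scalerDl addrA.
split=> /is_derive_epsP H; apply/is_derive_epsP => e e0; have [r r0 hr] := H e e0;
  exists r => // h h0 hh; have := hr h h0 hh; by rewrite E.
Qed.

Lemma derivable_val (V : normedModType R) (f : V -> R) (x v : V) (d : R) :
  is_derive x v f d -> 'D_v f x = d /\ derivable f x v.
Proof. by move=> h; split; [exact: derive_val|exact: ex_derive]. Qed.

(** A coinduction principle: a class of continuous functions stable under partial derivatives
    consists of smooth functions. Smoothness is proved below by exhibiting such classes. *)
Lemma smooth_class n (P : ('rV[R]_n -> R) -> Prop) :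
  (forall f, P f -> continuous f) ->
  (forall f i, P f -> exists2 g, P g & forall x, is_derive x (delta_mx ord0 i) f (g x)) ->
  forall f, P f -> smooth f.
Proof.
move=> Pc Pd f Pf s.
have Ps : P (foldr (@partial R n) f s).
  elim: s => [//|i s IH] /=; have [g Pg dg] := Pd _ i IH.
  rewrite (_ : partial i _ = g)//; apply/funext => x.
  by have [] := derivable_val (dg x).
split=> [|i x]; first exact: Pc.
by have [g Pg dg] := Pd _ i Ps; have [] := derivable_val (dg x).
Qed.

(** The family t^(-k) exp(-1/t), extended by 0. It is stable under differentiation up to linear
    combinations, whereas exp(-1/t) alone is not. *)
Definition flat (k : nat) (t : R) : R := if 0 < t then t^-1 ^+ k * expR (- t^-1) else 0.

Lemma flat_ge0 k t : 0 <= flat k t.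
Proof.
by rewrite /flat; case: ifP => // t0; rewrite mulr_ge0 ?expR_ge0// exprn_ge0// invr_ge0 ltW.
Qed.

(** The term of order k+2 of the exponential series beats t^(-k-2). The quadratic bound yields the
    zero derivative at t = 0. *)
Lemma flat_le k : exists2 C : R, 0 < C & forall t, flat k t <= C * t ^+ 2.
Proof.
exists k.+2`!%:R => [|t]; first by rewrite ltr0n fact_gt0.
rewrite /flat; case: ltrP => [t0|t0]; last by rewrite mulr_ge0// sqr_ge0.
rewrite expRN ler_pdivrMr ?expR_gt0//.
have f0 : 0 < k.+2`!%:R :> R by rewrite ltr0n fact_gt0.
have h : t^-1 ^+ k.+2 / k.+2`!%:R <= expR t^-1.
  have := @expR_ge1Dxn R t^-1 k.+1; rewrite invr_ge0 ltW// => /(_ isT).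
  by apply: le_trans; rewrite lerDr.
move: k.+2`!%:R f0 h => C C0 h.
apply: le_trans (ler_wpM2l _ h); last by rewrite mulr_ge0 ?sqr_ge0// ltW.
have -> : t^-1 ^+ k.+2 = t^-1 ^+ k * t^-1 ^+ 2 by rewrite -exprD addn2.
move: (t^-1 ^+ k) => a.
by rewrite le_eqVlt; apply/orP; left; apply/eqP; field; rewrite (gt_eqF t0) (gt_eqF C0).
Qed.

Lemma flat_lt0 k t : t <= 0 -> flat k t = 0.
Proof. by rewrite /flat ltNge => ->. Qed.

Lemma is_derive_flat k t : is_derive t (1 : R) (flat k) (flat k.+2 t - k%:R * flat k.+1 t).
Proof.
case: (ltrgtP t 0) => t0.
- rewrite !flat_lt0 ?ltW// mulr0 subrr.
  apply: (near_eq_is_derive _ (@is_derive_cst _ _ _ (0 : R) t 1)).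
  have t1 : 0 < - t by rewrite oppr_gt0.
  have := @near_dist_lt R R^o t _ t1.
  by apply: filterS => s; rewrite ltr_distl => /andP[h _]; rewrite flat_lt0//; lra.
- have D : is_derive t 1 (fun s => s^-1 ^+ k * expR (- s^-1))
      (flat k.+2 t - k%:R * flat k.+1 t).
    rewrite /flat t0.
    have tn : t != 0 by rewrite gt_eqF.
    have dV : is_derive t (1 : R) (fun s => s^-1) (- t ^- 2).
      have := @is_deriveV _ id t 1 1 tn (is_derive_id _ _).
      by move=> h; apply: (is_derive_eq h); rewrite -[LHS]/(_ * _) mulr1.
    have dX := is_deriveX k dV.
    have dN := is_deriveN dV.
    have dE := @is_derive1_comp R expR (fun s => - s^-1) t _ _ (is_derive_expR _) dN.
    have M := is_deriveM dX dE.
    rewrite (_ : (fun s => _) = (fun s : R => s^-1) ^+ k * (expR \o (fun s => - s^-1))); last first.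
      by apply/funext => s; rewrite fctE exprfctE.
    apply: (is_derive_eq M).
    rewrite exprfctE /= -![_ *: _]/(_ * _) /=; case: k {dX M} => [|k].
      by rewrite /= !mul0r; field.
    rewrite /= !(exprS t^-1); move: (t^-1 ^+ k) (expR _) k.+1%:R => a b c.
    by field.
  apply: (near_eq_is_derive _ D).
  have := @near_dist_lt R R^o t _ t0.
  apply: filterS => s; rewrite ltr_distl => /andP[_ h]; rewrite /flat.
  by have -> : 0 < s by lra.
- rewrite t0 !flat_lt0// mulr0 subrr; apply/is_derive_epsP => e e0.
  have [C C0 hC] := flat_le k.
  exists (e / C) => [|h h0 hh]; first by rewrite divr_gt0.
  rewrite (@flat_lt0 k 0)// add0r subr0 subr0 -[h *: _]/(h * 1) mulr1 normrM normfV.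
  rewrite ler_pdivrMr ?normr_gt0// (ger0_norm (flat_ge0 _ _)).
  apply: le_trans (hC h) _; rewrite -real_normK ?num_real// expr2 mulrA ler_wpM2r//.
  by rewrite mulrC -ler_pdivlMr// ltW.
Qed.


Lemma flat_continuous k : continuous (flat k).
Proof.
move=> t; have [df _] := is_derive_flat k t.
by apply: differentiable_continuous; exact/derivable1_diffP.
Qed.

Lemma flat0_le1 t : flat 0 t <= 1.
Proof.
rewrite /flat; case: ltrP => // t0; rewrite mul1r expR_le1 oppr_le0 invr_ge0 ltW//.
Qed.

Section Bump.
Variable n : nat.
Local Notation V := 'rV[R]_n.
Implicit Types (x : V) (i : 'I_n).
Local Notation e_ i := (delta_mx ord0 i : V).

Inductive polyfun : (V -> R) -> Prop :=
| Pcst c : polyfun (fun=> c)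
| Pcoord i : polyfun (fun x => x ord0 i)
| Padd p q : polyfun p -> polyfun q -> polyfun (fun x => p x + q x)
| Pmul p q : polyfun p -> polyfun q -> polyfun (fun x => p x * q x).

Lemma polyfun_continuous p : polyfun p -> continuous p.
Proof.
elim=> [c|i|{}p q _ cp _ cq|{}p q _ cp _ cq] x.
- exact: (@cvg_cst _ c _ (nbhs x) _).
- exact: (@coord_continuous R 1 n ord0 i x).
- exact: (cvgD (cp x) (cq x)).
- exact: (cvgM (cp x) (cq x)).
Qed.

Lemma is_derive_add (f g : V -> R) x v a b : is_derive x v f a -> is_derive x v g b ->
  is_derive x v (fun x => f x + g x) (a + b).
Proof. by move=> df dg; exact: (is_deriveD df dg). Qed.

Lemma is_derive_mul (f g : V -> R) x v a b : is_derive x v f a -> is_derive x v g b ->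
  is_derive x v (fun x => f x * g x) (a * g x + f x * b).
Proof.
move=> df dg; apply: (is_derive_eq (is_deriveM df dg)).
by rewrite -![_ *: _]/(_ * _) addrC mulrC.
Qed.

Lemma is_derive_coord x v j : is_derive x v (fun x => x ord0 j) (v ord0 j).
Proof.
apply/is_derive_epsP => e e0; exists 1 => // h h0 _.
by rewrite !mxE addrAC subrr add0r mulrAC divff// mul1r subrr normr0 ltW.
Qed.

Lemma is_derive_comp1 (h : R -> R) (f : V -> R) x v a b : is_derive (f x) (1 : R) h a ->
  is_derive x v f b -> is_derive x v (fun x => h (f x)) (a * b).
Proof.
move=> dh df; have E y : y = y + 0 *: v :> V by rewrite scale0r addr0.
have {}df : is_derive (0 : R) (1 : R) (fun t => f (x + t *: v)) b.
  by apply: (proj1 (is_derive_line f x v 0 b)); rewrite -(E x).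
suff : is_derive (0 : R) (1 : R) (fun t => h (f (x + t *: v))) (a * b).
  by move=> /(proj2 (is_derive_line (fun y => h (f y)) x v 0 (a * b))); rewrite -(E x).
have dh' : is_derive (f (x + 0 *: v)) (1 : R) h a by rewrite -(E x).
have := @is_derive1_comp R h (fun t => f (x + t *: v)) 0 a b dh' df.
by rewrite mulrC.
Qed.

Lemma polyfun_derive p i : polyfun p ->
  exists2 q, polyfun q & forall x, is_derive x (e_ i) p (q x).
Proof.
elim=> [c|j|{}p q _ [p' Pp dp] _ [q' Pq dq]|{}p q Pp0 [p' Pp dp] Pq0 [q' Pq dq]].
- exists (fun=> 0); first exact: Pcst.
  by move=> x; exact: is_derive_cst.
- exists (fun=> (e_ i) ord0 j); first exact: Pcst.
  by move=> x; exact: is_derive_coord.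
- exists (fun x => p' x + q' x); first exact: Padd.
  by move=> x; exact: is_derive_add.
- exists (fun x => p' x * q x + p x * q' x); first by apply: Padd; exact: Pmul.
  by move=> x; exact: is_derive_mul.
Qed.

Lemma polyfun_sqn : polyfun (@sqn R n).
Proof.
rewrite /sqn; elim: (index_enum _) => [|i r IH].
  rewrite (_ : (fun x => _) = (fun=> 0)); first exact: Pcst.
  by apply/funext => x; rewrite big_nil.
rewrite (_ : (fun x => _) = (fun x => x ord0 i * x ord0 i + \sum_(j <- r) x ord0 j ^+ 2)).
  by apply: Padd => //; apply: Pmul; exact: Pcoord.
by apply/funext => x; rewrite big_cons expr2.
Qed.

Variable a : R.
Hypothesis a0 : 0 < a.

Let s x : R := 1 + (- a) * sqn x.

Let polyfun_s : polyfun s.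
Proof. by apply: Padd; [exact: Pcst|apply: Pmul; [exact: Pcst|exact: polyfun_sqn]]. Qed.

(** Differentiating flat k (s x) raises k and produces a polynomial factor, so polynomial
    coefficients and all orders k enter the class. *)
Inductive bumpfun : (V -> R) -> Prop :=
| Bterm p k : polyfun p -> bumpfun (fun x => p x * flat k (s x))
| Badd f g : bumpfun f -> bumpfun g -> bumpfun (fun x => f x + g x).

Lemma bumpfun_smooth f : bumpfun f -> smooth f.
Proof.
apply: smooth_class => {}f.
  elim=> [p k Pp|{}f g _ cf _ cg] x; last exact: (cvgD (cf x) (cg x)).
  have c := @continuous_comp _ _ _ s (flat k) x (@polyfun_continuous _ polyfun_s x) (@flat_continuous k (s x)).
  exact: (cvgM (@polyfun_continuous _ Pp x) c).
move=> i; elim=> [p k Pp|{}f g _ [f' Bf df] _ [g' Bg dg]].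
  have [q Pq dq] := polyfun_derive i Pp; have [r Pr dr] := polyfun_derive i polyfun_s.
  exists (fun x => q x * flat k (s x) + ((p x * r x) * flat k.+2 (s x) +
      ((- k%:R) * (p x * r x)) * flat k.+1 (s x))).
    apply: Badd; first exact: Bterm.
    apply: Badd; first by apply: Bterm; exact: Pmul.
    by apply: Bterm; apply: Pmul; [exact: Pcst|exact: Pmul].
  move=> x; have dc := is_derive_comp1 (is_derive_flat k (s x)) (dr x).
  by apply: (is_derive_eq (is_derive_mul (dq x) dc)); ring.
exists (fun x => f' x + g' x); first exact: Badd.
by move=> x; exact: is_derive_add.
Qed.

(** The function exp(-1/(1 - a|x|^2)) on the Euclidean ball of radius a^(-1/2), extended by 0. Being
    radial, it is invariant under orthogonal maps. *)
Definition bump x : R := flat 0 (1 - a * sqn x).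

Lemma bump_smooth : smooth bump.
Proof.
apply: bumpfun_smooth; rewrite (_ : bump = (fun x => 1 * flat 0 (s x))).
  exact: (Bterm 0 (Pcst 1)).
by apply/funext => x; rewrite mul1r /bump /s mulNr.
Qed.

Lemma bump_ge0 x : 0 <= bump x. Proof. exact: flat_ge0. Qed.
Lemma bump_le1 x : bump x <= 1. Proof. exact: flat0_le1. Qed.
Lemma bumpN x : bump (- x) = bump x. Proof. by rewrite /bump sqnN. Qed.
Lemma bump_orth (g : 'M[R]_n) x : g *m g^T = 1%:M -> bump (x *m g) = bump x.
Proof. by move=> gg; rewrite /bump sqn_orth. Qed.
Lemma bump_gt0 x : (0 < bump x) = (sqn x < a^-1).
Proof.
rewrite -[a^-1]mul1r ltr_pdivlMr// -(subr_gt0 _ 1) mulrC /bump.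
have [h|h] := ltrP 0 (1 - a * sqn x); last by rewrite flat_lt0// ltxx.
by rewrite /flat h mul1r; exact: expR_gt0.
Qed.
Lemma bump_eq0 x : a^-1 <= sqn x -> bump x = 0.
Proof.
by move=> h; apply/eqP; rewrite eq_le bump_ge0 andbT leNgt bump_gt0 -leNgt.
Qed.
Lemma bump_lb x : a * sqn x <= 1 / 2 -> expR (- 2) <= bump x.
Proof.
move=> h; have h2 : 1 / 2 <= 1 - a * sqn x by lra.
have h0 : 0 < 1 - a * sqn x by lra.
rewrite /bump /flat h0 mul1r ler_expR lerN2 -[2]invrK lef_pV2 ?posrE ?invr_gt0//.
by rewrite -div1r.
Qed.

End Bump.
End Derivatives.

(** * Calculus of smooth functions: chain, product and affine substitution *)

Section SmoothCalculus.
Context {R : realType}.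

Lemma mvt_line (V : normedModType R) (f g : V -> R) (v x : V) (t : R) :
  (forall y, is_derive y v f (g y)) ->
  exists2 th, `|th| <= `|t| & f (x + t *: v) - f x = t * g (x + th *: v).
Proof.
move=> df; pose F s := f (x + s *: v).
have dF s : is_derive s (1 : R) F (g (x + s *: v)).
  by apply: (proj1 (is_derive_line f x v s _)).
have cF a b : {within `[a, b], continuous F}.
  apply: continuous_subspaceT => s; have [h _] := dF s.
  by apply: differentiable_continuous; exact/derivable1_diffP.
have F0 : F 0 = f x by rewrite /F scale0r addr0.
case: (lerP 0 t) => t0.
  have [c] := MVT_segment t0 (fun s _ => dF s) (@cF 0 t).
  rewrite in_itv /= => /andP[c0 ct] E; exists c; first by rewrite !ger0_norm.
  by rewrite -/(F t) -F0 E subr0 mulrC.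
have [c] := MVT_segment (ltW t0) (fun s _ => dF s) (@cF t 0).
rewrite in_itv /= => /andP[tc c0] E; exists c; first by rewrite !ler0_norm ?lerN2// ltW.
rewrite -/(F t) -F0; apply: oppr_inj; rewrite opprB E sub0r mulrN mulrC; ring.
Qed.

Lemma continuous_eps (V : normedModType R) (f : V -> R) x : continuous f ->
  forall e, 0 < e -> exists2 d : R, 0 < d & forall y, `|x - y| < d -> `|f x - f y| < e.
Proof.
move=> cf e e0; have /cvgrPdist_lt /(_ e e0) := cf x.
move=> /nbhs_ballP[d /= d0 hd]; exists d => // y xy; apply: hd.
by rewrite -ball_normE.
Qed.

Lemma eps_continuous (V : normedModType R) (f : V -> R) :
  (forall x e, 0 < e -> exists2 d : R, 0 < d & forall y, `|x - y| < d -> `|f x - f y| < e) ->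
  continuous f.
Proof.
move=> H x; apply/cvgrPdist_lt => e e0; have [d d0 hd] := H x e e0.
by apply: filterS (@near_dist_lt R V x d d0); exact: hd.
Qed.

Definition bsupp n (f : 'rV[R]_n -> R) := exists r : R, forall x, r <= `|x| -> f x = 0.

(** Heine's theorem on a ball slightly larger than the support; farther out, nearby points both have
    value 0. *)
Lemma bsupp_ucont n (f : 'rV[R]_n -> R) : continuous f -> bsupp f ->
  forall e, 0 < e -> exists2 d : R, 0 < d & forall x y, `|x - y| < d -> `|f x - f y| <= e.
Proof.
move=> cf [r hr] e e0.
pose K := [set x : 'rV[R]_n | `|x| <= `|r| + 1].
have cK : compact K.
  apply: bounded_closed_compact.
    exists (`|r| + 1); split; first exact: num_real.
    by move=> M hM x Kx; apply: le_trans Kx (ltW hM).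
  have nc : continuous (fun x : 'rV[R]_n => `|x|) by exact: norm_continuous.
  rewrite (_ : K = (fun x : 'rV[R]_n => `|x|) @^-1` [set y | y <= `|r| + 1])//.
  by apply: closed_comp => [x _|]; [exact: nc|exact: closed_le].
have /compact_near_coveringP := cK.
move=> /(_ R (0 : R)^'+ (fun d x => forall y, `|x - y| < d -> `|f x - f y| <= e) _).
have H : forall x, K x -> \forall x' \near x & d \near (0 : R)^'+,
    (fun d x => forall y, `|x - y| < d -> `|f x - f y| <= e) d x'.
  move=> x _; have e2 : 0 < e / 2 by rewrite divr_gt0.
  have [d d0 hd] := continuous_eps x cf e2.
  have d2 : 0 < d / 2 by rewrite divr_gt0.
  exists ([set x' | `|x - x'| < d / 2], [set s | s < d / 2]).
    split; first exact: (@near_dist_lt R _ x (d / 2) d2).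
    exact: nbhs_right_lt.
  move=> [x' s] /= [h1 h2] y h3.
  have h4 : `|x - y| < d.
    rewrite -(subrKA x'); apply: le_lt_trans (ler_normD _ _) _; lra.
  have h5 := hd x' _; have h6 := hd y h4.
  rewrite -(subrKA (f x)); apply: le_trans (ler_normD _ _) _.
  have := h5 (lt_trans h1 _); rewrite ltr_pdivrMr// ltr_pMr// ltr1n => /(_ isT).
  by rewrite distrC; lra.
move=> /(_ H) h.
have : \forall d \near (0 : R)^'+, 0 < d /\ d <= 1 /\ K `<=` (fun x => forall y, `|x - y| < d -> `|f x - f y| <= e).
  near=> d; split; first by near: d; exact: nbhs_right_gt.
  by split; near: d; [exact: nbhs_right_le|exact: h].
move=> /filter_ex[d [d0 [d1 hd]]]; exists d => // x y xy.
have [xK|xK] := lerP `|x| (`|r| + 1); first exact: hd.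
have xr : r <= `|x| by have := ler_norm r; lra.
have yr : r <= `|y|.
  have := ler_norm r; have := ler_dist_dist x y; have := ler_norm (`|x| - `|y|); lra.
by rewrite !hr// subrr normr0 ltW.
Unshelve. all: by end_near.
Qed.

Section Smooth.
Variable n : nat.
Local Notation V := 'rV[R]_n.
Implicit Types (x : V) (i : 'I_n) (f g : V -> R).
Local Notation e_ i := (delta_mx ord0 i : V).

Lemma smooth_cont f : smooth f -> continuous f.
Proof. by move=> /(_ [::])[]. Qed.

Lemma smooth_derive f x i : smooth f -> is_derive x (e_ i) f (partial i f x).
Proof. by move=> /(_ [::])[_ /(_ i x)] /derivableP. Qed.

Lemma smooth_partial f i : smooth f -> smooth (partial i f).
Proof. by move=> sf s; have := sf (rcons s i); rewrite foldr_rcons. Qed.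

(** The chain rule in a direction v. The increment is telescoped along the coordinates, and each
    piece is handled by the mean value theorem and the continuity of one partial derivative. *)
Lemma smooth_total f x v : smooth f -> is_derive x v f (\sum_i v ord0 i * partial i f x).
Proof.
move=> sf; apply/is_derive_epsP => e e0.
pose K := \sum_i `|v ord0 i| + 1.
have K0 : 0 < K by rewrite ltr_wpDl// sumr_ge0.
have eK : 0 < e / K by rewrite divr_gt0.
have /choice[d hd] : forall i, exists d, 0 < d /\
    forall y, `|x - y| < d -> `|partial i f x - partial i f y| < e / K.
  move=> i; have [d d0 h] := continuous_eps x (smooth_cont (smooth_partial i sf)) eK.
  by exists d.
have [r r0 hr] : exists2 r, 0 < r & forall i, r <= d i.
  exists (\big[Num.min/1]_i d i); first by apply: lt_bigmin => // i _; case: (hd i).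
  by move=> i; exact: bigmin_le_cond.
(* [w k] keeps the first k coordinates of v: a path from 0 to v along the axes. *)
pose w k : V := \row_j (if (j < k)%N then v ord0 j else 0).
exists (r / (2 * (`|v| + 1))) => [|h h0 hh].
  by rewrite divr_gt0// mulr_gt0// ltr_wpDl.
have w0 : w 0%N = 0 by apply/rowP => j; rewrite !mxE.
have wn : w n = v by apply/rowP => j; rewrite !mxE ltn_ord.
have ws (k : 'I_n) : w k.+1 = w k + v ord0 k *: e_ k.
  apply/rowP => j; rewrite !mxE eqxx /= ltnS leq_eqVlt.
  have [->|jk] := eqVneq j k; first by rewrite eqxx ltnn add0r mulr1.
  by rewrite mulr0 addr0; case: eqP => // /val_inj; move/eqP: jk.
have wv k : `|w k| <= `|v|.
  suff : mx_norm (w k) <= `|v| by [].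
  rewrite mx_normrE; apply: bigmax_le => // -[a j] _ /=; rewrite ord1 mxE.
  by case: ifP => _; rewrite ?normr0// coord_le_norm.
have tele : f (x + h *: v) - f x = \sum_(k < n) (f (x + h *: w k.+1) - f (x + h *: w k)).
  rewrite -(big_mkord xpredT (fun k => f (x + h *: w k.+1) - f (x + h *: w k))).
  by rewrite telescope_sumr// w0 wn scaler0 addr0.
have vk k : `|v ord0 k| <= `|v| by exact: coord_le_norm.
have step (k : 'I_n) : `|(f (x + h *: w k.+1) - f (x + h *: w k)) / h - v ord0 k * partial k f x|
    <= `|v ord0 k| * (e / K).
  rewrite ws scalerDr addrA scalerA.
  have [th hth ->] := @mvt_line _ f (partial k f) (e_ k) (x + h *: w k) (h * v ord0 k)
    (fun y => smooth_derive y k sf).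
  rewrite [h * _]mulrC mulrAC mulrK ?unitfE// -mulrBr normrM ler_wpM2l//.
  rewrite distrC ltW//; apply: (hd k).2; apply: lt_le_trans (hr k).
  rewrite -addrA opprD addrA subrr sub0r normrN.
  apply: le_lt_trans (ler_normD _ _) _; rewrite !normrZ.
  have en : `|e_ k| <= 1.
    suff : mx_norm (e_ k) <= 1 by [].
    rewrite mx_normrE; apply: bigmax_le => // -[a b] _.
    by rewrite mxE; case: andP => _; rewrite ?normr1 ?normr0.
  move: hth; rewrite normrM => hth.
  have b1 : `|h| * `|w k| <= `|h| * `|v| by rewrite ler_wpM2l.
  have b2 : `|th| * `|e_ k| <= `|h| * `|v|.
    apply: le_trans (_ : `|h| * `|v ord0 k| * 1 <= _); first by rewrite ler_pM.
    by rewrite mulr1 ler_wpM2l.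
  move: hh; rewrite ltr_pdivlMr ?mulr_gt0 ?ltr_wpDl// => hh.
  have := normr_ge0 h; have : 0 < `|h| by rewrite normr_gt0.
  lra.
have -> : (f (x + h *: v) - f x) / h - \sum_i v ord0 i * partial i f x =
    \sum_(k < n) ((f (x + h *: w k.+1) - f (x + h *: w k)) / h - v ord0 k * partial k f x).
  by rewrite tele mulr_suml -sumrB.
apply: le_trans (ler_norm_sum _ _ _) _; apply: le_trans (ler_sum _ (fun k _ => step k)) _.
rewrite -mulr_suml mulrA ler_pdivrMr// [leRHS]mulrC; apply: ler_wpM2r; first exact: ltW.
by rewrite lerDl.
Qed.

Inductive smooth_products : (V -> R) -> Prop :=
| SPmul f g : smooth f -> smooth g -> smooth_products (fun x => f x * g x)
| SPadd f g : smooth_products f -> smooth_products g -> smooth_products (fun x => f x + g x).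

Lemma smooth_mul f g : smooth f -> smooth g -> smooth (fun x => f x * g x).
Proof.
move=> sf sg; apply: (@smooth_class _ _ smooth_products); last exact: SPmul.
  move=> F; elim=> [f1 g1 sf1 sg1|f1 g1 _ cf _ cg] x.
    exact: (cvgM (@smooth_cont f1 sf1 x) (@smooth_cont g1 sg1 x)).
  exact: (cvgD (cf x) (cg x)).
move=> F i; elim=> [f1 g1 sf1 sg1|f1 g1 _ [f' Pf df] _ [g' Pg dg]].
  exists (fun x => partial i f1 x * g1 x + f1 x * partial i g1 x).
    by apply: SPadd; apply: SPmul => //; exact: smooth_partial.
  by move=> x; apply: is_derive_mul; exact: smooth_derive.
exists (fun x => f' x + g' x); first exact: SPadd.
by move=> x; exact: is_derive_add.
Qed.

Lemma partialM i f g x : smooth f -> smooth g ->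
  partial i (fun x => f x * g x) x = partial i f x * g x + f x * partial i g x.
Proof.
move=> sf sg; have h := is_derive_mul (smooth_derive x i sf) (smooth_derive x i sg).
by have [] := derivable_val h.
Qed.

Section Affine.
Variables (M : 'M[R]_n) (b : V).
Let A x := x *m M + b.

Inductive smooth_affine : (V -> R) -> Prop :=
| SAcomp c f : smooth f -> smooth_affine (fun x => c * f (A x))
| SAadd f g : smooth_affine f -> smooth_affine g -> smooth_affine (fun x => f x + g x).

Let is_derive_affine f x i : smooth f ->
  is_derive x (e_ i) (fun x => f (A x)) (\sum_j M i j * partial j f (A x)).
Proof.
move=> sf; have D := smooth_total (A x) (row i M) sf.
have E h : A (x + h *: e_ i) = A x + h *: row i M.
  by rewrite /A mulmxDl -scalemxAl -rowE addrAC.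
apply/is_derive_epsP => e e0.
have [r r0 hr] := proj1 (is_derive_epsP _ _ _ _) D e e0; exists r => // h h0 hh.
have := hr h h0 hh; rewrite E; congr (`|_ - _| <= _).
by apply: eq_bigr => j _; rewrite mxE.
Qed.

Let affine_lip : exists2 K : R, 0 < K & forall x y e, 0 < e -> `|x - y| < e / K ->
  `|A x - A y| < e.
Proof.
pose K := \sum_i \sum_j `|M i j| + 1.
have K0 : 0 < K by rewrite ltr_wpDl// sumr_ge0// => i _; exact: sumr_ge0.
exists K => // x y e e0 xy; rewrite /A opprD addrACA subrr addr0 -mulmxBl.
suff : mx_norm ((x - y) *m M) < e by [].
rewrite mx_normrE; apply: bigmax_lt => // -[a j] _ /=; rewrite ord1 mxE.
apply: le_lt_trans (ler_norm_sum _ _ _) _.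
apply: (@le_lt_trans _ _ (`|x - y| * K)); last by rewrite -ltr_pdivlMr.
apply: (@le_trans _ _ (`|x - y| * \sum_i `|M i j|)).
  rewrite mulr_sumr; apply: ler_sum => i _; rewrite normrM ler_wpM2r//.
  exact: coord_le_norm.
rewrite ler_wpM2l// /K; apply: (@le_trans _ _ (\sum_i \sum_j `|M i j|)); last by rewrite lerDl.
by apply: ler_sum => i _; rewrite (bigD1 j)//= lerDl sumr_ge0.
Qed.

Lemma smooth_comp_affine f : smooth f -> smooth (fun x => f (x *m M + b)).
Proof.
move=> sf; apply: (@smooth_class _ _ smooth_affine); last first.
  rewrite (_ : (fun x => _) = (fun x => 1 * f (A x))); first exact: SAcomp.
  by apply/funext => x; rewrite mul1r.
- move=> F i; elim=> [c f1 sf1|f1 g1 _ [f' Pf df] _ [g' Pg dg]]; last first.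
    exists (fun x => f' x + g' x); first exact: SAadd.
    by move=> x; exact: is_derive_add.
  exists (fun x => \sum_j c * M i j * partial j f1 (A x)).
    elim: (index_enum _) => [|j r IH].
      rewrite (_ : (fun x => _) = (fun x => 0 * f1 (A x))); first exact: SAcomp.
      by apply/funext => x; rewrite big_nil mul0r.
    rewrite (_ : (fun x => _) = (fun x => c * M i j * partial j f1 (A x) +
        \sum_(j <- r) c * M i j * partial j f1 (A x))).
      by apply: SAadd => //; apply: SAcomp; exact: smooth_partial.
    by apply/funext => x; rewrite big_cons.
  move=> x; have h := is_derive_mul (@is_derive_cst _ _ _ c x (e_ i)) (is_derive_affine x i sf1).
  apply: (is_derive_eq h); rewrite mul0r add0r mulr_sumr.
  by apply: eq_bigr => j _; rewrite mulrA.
move=> F; elim=> [c f1 sf1|f1 g1 _ cf _ cg] x.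
  have cA : continuous (fun x => f1 (A x)).
    apply: eps_continuous => {}x e e0; have [d d0 hd] := continuous_eps (A x) (smooth_cont sf1) e0.
    have [K K0 hK] := affine_lip; exists (d / K) => [|y xy]; first by rewrite divr_gt0.
    exact/hd/hK.
  exact: (cvgM (@cvg_cst _ c _ (nbhs x) _) (cA x)).
exact: (cvgD (cf x) (cg x)).
Qed.

Lemma partial_comp_affine f i x : smooth f ->
  partial i (fun x => f (x *m M + b)) x = \sum_j M i j * partial j f (x *m M + b).
Proof. by move=> sf; have [] := derivable_val (is_derive_affine x i sf). Qed.

End Affine.

Let reflectE f x : (fun y => f (x - y)) = (fun y => f (y *m (- 1%:M) + x)).
Proof. by apply/funext => y; rewrite mulmxN mulmx1 [- y + x]addrC. Qed.

Lemma smooth_reflect f x : smooth f -> smooth (fun y => f (x - y)).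
Proof. by move=> sf; rewrite reflectE; exact: smooth_comp_affine. Qed.

Lemma partial_reflect f x i y : smooth f ->
  partial i (fun y => f (x - y)) y = - partial i f (x - y).
Proof.
move=> sf; rewrite reflectE partial_comp_affine// mulmxN mulmx1 [- y + x]addrC.
rewrite (bigD1 i)//= big1 => [|j ji]; first by rewrite !mxE eqxx mulN1r addr0.
by rewrite !mxE eq_sym (negbTE ji) oppr0 mul0r.
Qed.

Lemma bsupp_partial f i : smooth f -> bsupp f -> bsupp (partial i f).
Proof.
move=> sf [r hr]; exists (r + 1) => x rx.
apply/eqP; rewrite -normr_le0; apply/ler_addgt0Pr => e e0; rewrite add0r.
have [d d0 hd] := proj1 (is_derive_epsP _ _ _ _) (smooth_derive x i sf) e e0.
pose h := Num.min (d / 2) 1.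
have h0 : 0 < h by rewrite lt_min ltr01 andbT divr_gt0.
have h1 : h <= 1 by rewrite ge_min lexx orbT.
have hd2 : h < d.
  by apply: (@le_lt_trans _ _ (d / 2)); [rewrite ge_min lexx|rewrite ltr_pdivrMr// ltr_pMr// ltr1n].
have := hd h; rewrite gt_eqF// gtr0_norm// => /(_ isT hd2).
have en : `|e_ i| <= 1.
  suff : mx_norm (e_ i) <= 1 by [].
  rewrite mx_normrE; apply: bigmax_le => // -[a b] _.
  by rewrite mxE; case: andP => _; rewrite ?normr1 ?normr0.
have xh : r <= `|x + h *: e_ i|.
  have := ler_normB (x + h *: e_ i) (h *: e_ i); rewrite addrK normrZ gtr0_norm//.
  have : h * `|e_ i| <= 1 by rewrite -[1]mulr1 ler_pM// ltW.
  lra.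
by rewrite !hr ?subrr ?mul0r ?sub0r ?normrN//; lra.
Qed.

Lemma test_functionP f : test_function f <-> smooth f /\ bsupp f.
Proof.
split=> [[sf cs]|[sf [r hr]]]; split=> //.
  have [M [_ hM]] := compact_bounded cs.
  exists (M + 2) => x Mx; apply: contrapT => fx.
  have : `|x| <= M + 1.
    apply: (hM (M + 1)); first by rewrite ltrDl.
    by apply: subset_closure => /=; apply/eqP.
  by lra.
apply: bounded_closed_compact; last exact: closed_closure.
exists r; split; first exact: num_real.
move=> M rM x cx /=; apply: ltW; apply: le_lt_trans rM.
have nc : continuous (fun x : V => `|x|) by exact: norm_continuous.
have : closed ((fun x : V => `|x|) @^-1` [set y | y <= r]).
  by apply: closed_comp => [y _|]; [exact: nc|exact: closed_le].
move=> /closure_id E.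
suff : ((fun x : V => `|x|) @^-1` [set y | y <= r]) x by [].
rewrite E; apply: (closure_subset _ cx) => y /= /eqP fy.
by rewrite leNgt; apply/negP => ry; apply: fy; apply: hr; exact: ltW.
Qed.

End Smooth.
End SmoothCalculus.

(** * Almost everywhere convergence *)

Section IntegralTools.
Context d (T : measurableType d) (R : realType) (mu : {measure set T -> \bar R}).
Implicit Types (f g h : T -> R).
Local Notation mfun f := (measurable_fun setT f).

Lemma ae_cvg_fatou (f_ : nat -> T -> R) f (C : \bar R) :
  (forall k, mfun (f_ k)) -> mfun f -> (forall k x, 0 <= f_ k x) -> (forall x, 0 <= f x) ->
  {ae mu, forall x, f_ ^~ x @ \oo --> f x} ->
  (forall k, (\int[mu]_x (f_ k x)%:E <= C)%E) -> (\int[mu]_x (f x)%:E <= C)%E.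
Proof.
move=> mf_ mf f0_ f0 ff hC.
pose F k x := (f_ k x)%:E.
have mF k : measurable_fun setT (F k) by apply/measurable_EFinP.
have F0 k x : setT x -> (0 <= F k x)%E by move=> _; rewrite lee_fin.
have -> : (\int[mu]_x (f x)%:E = \int[mu]_x limn_einf (F^~ x))%E.
  apply: ge0_ae_eq_integral => //.
  - exact/measurable_EFinP.
  - apply: (emeasurable_fun_cvg (fun n x => einfs (F^~ x) n)) => [n|x _].
      exact: measurable_fun_einfs.
    by rewrite limn_einf_lim; exact: is_cvg_einfs.
  - by move=> x _; rewrite lee_fin.
  - move=> x _; rewrite limn_einf_lim; apply: lime_ge; first exact: is_cvg_einfs.
    by apply: nearW => n; apply: le_ereal_inf_tmp => _ [k /= _ <-]; rewrite lee_fin.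
  apply: filterS ff => x fx _.
  have E : (F^~ x @ \oo --> (f x)%:E)%E by apply: cvg_EFin => //; exact: nearW.
  by rewrite is_cvg_limn_einfE; [rewrite (cvg_lim _ E)|exact: cvgP E].
apply: le_trans (fatou mu measurableT mF F0) _.
rewrite limn_einf_lim; apply: lime_le; first exact: is_cvg_einfs.
apply: nearW => n; apply: le_trans (hC n); apply: ereal_inf_lbound.
by exists n => /=.
Qed.

(** The sum of 2^k h_k has integral at most the sum of 2^(-k), so it is finite almost everywhere and
    dominates each of its terms. *)
Lemma borel_cantelli_ae (h : nat -> T -> R) :
  (forall k, mfun (h k)) -> (forall k x, 0 <= h k x) ->
  (forall k, (\int[mu]_x (h k x)%:E <= (4 ^- k)%:E)%E) ->
  {ae mu, forall x, exists C : R, forall k, h k x <= C * 2 ^- k}.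
Proof.
move=> mh h0 hC.
pose H k x := ((2 ^+ k * h k x)%R%:E : \bar R).
have mH k : measurable_fun setT (H k).
  by apply/measurable_EFinP; apply: measurable_funM.
have H0 k x : (0 <= H k x)%E by rewrite lee_fin mulr_ge0.
have HC k : (\int[mu]_x H k x <= (2^-1 ^+ k)%:E)%E.
  rewrite /H; under eq_integral do rewrite EFinM.
  rewrite ge0_integralZl//; last 2 first.
  - exact/measurable_EFinP.
  - by move=> x _; rewrite lee_fin.
  apply: le_trans (lee_wpmul2l _ (hC k)) _; first by rewrite lee_fin exprn_ge0.
  rewrite -EFinM lee_fin -exprVn -exprMn le_eqVlt; apply/orP; left; apply/eqP; congr (_ ^+ _).
  by lra.
have S : (\int[mu]_x (\sum_(k <oo) H k x) < +oo)%E.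
  rewrite integral_nneseries//.
  apply: (@le_lt_trans _ _ (\sum_(k <oo) (2^-1 ^+ k)%:E)%E); first by apply: lee_nneseries => [k _ _|k _]; [exact: integral_ge0|exact: HC].
  have cg : (series (geometric (1 : R) 2^-1)) @ \oo --> (1 * (1 - 2^-1)^-1 : R).
    by apply: cvg_geometric_series; rewrite ger0_norm//; lra.
  have -> : (\sum_(k <oo) (2^-1 ^+ k)%:E = ((1 : R) * (1 - 2^-1)^-1)%:E)%E.
    apply/cvg_lim => //.
    rewrite (_ : (fun n => _) = EFin \o series (geometric (1 : R) 2^-1)).
      by apply: cvg_EFin; [exact: nearW|exact: cg].
    apply/funext => n /=.
    by rewrite /series /= -sumEFin; apply: eq_bigr => k _; rewrite mul1r.
  exact: ltry.
have mS : measurable_fun setT (fun x => \sum_(k <oo) H k x)%E.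
  by apply: ge0_emeasurable_sum.
have iS : mu.-integrable setT (fun x => \sum_(k <oo) H k x)%E.
  apply/integrableP; split=> //; under eq_integral do rewrite gee0_abs ?nneseries_ge0//.
  exact: S.
apply: filterS (integrable_ae measurableT iS) => x /(_ Logic.I) fin.
exists (fine (\sum_(k <oo) H k x)%E) => k.
rewrite ler_pdivlMr ?exprn_gt0// mulrC -lee_fin fineK//.
rewrite -[leLHS]/(H k x) (@nneseriesD1 _ (H^~ x) k)//=.
by rewrite leeDl// nneseries_ge0.
Qed.

Lemma ae_cvg_subseq (f_ : nat -> T -> R) f :
  (forall k, mfun (f_ k)) -> mfun f ->
  (forall k, (\int[mu]_x (`|f_ k x - f x|)%:E <= (4 ^- k)%:E)%E) ->
  {ae mu, forall x, f_ ^~ x @ \oo --> f x}.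
Proof.
move=> mf_ mf hC.
have := @borel_cantelli_ae (fun k x => `|f_ k x - f x|) _ _ hC.
move=> /(_ _ (fun _ _ => normr_ge0 _)) H.
apply: filterS (H _) => [x [C hx]|k]; last first.
  by apply: measurableT_comp => //; exact: measurable_funB.
apply/cvgrPdist_le => e e0.
have C0 : 0 <= C by have := hx 0%N; rewrite expr0 invr1 mulr1; apply: le_trans.
have c2 : (fun k => C * 2^-1 ^+ k) @ \oo --> C * (0 : R).
  by apply: cvgMr; apply: cvg_expr; rewrite ger0_norm//; lra.
rewrite mulr0 in c2; move/cvgrPdist_le : c2 => /(_ e e0).
apply: filterS => k; rewrite sub0r normrN distrC => h.
apply: le_trans (hx k) _; apply: le_trans h; rewrite -exprVn; exact: ler_norm.
Qed.

End IntegralTools.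

(** * Density in L^1 of continuous functions with bounded support *)

Section Density.
Context {R : realType}.

(** The truncation min(max(t,0),1), written with absolute values so that its continuity is
    immediate. *)
Definition clip (t : R) : R := (`|t| - `|t - 1| + 1) / 2.

Lemma clip_cont : continuous clip.
Proof.
move=> t; apply: cvgMl.
have c1 : (fun t : R => `|t|) @ t --> `|t| by apply: cvg_norm; exact: cvg_id.
have c2 : (fun t : R => `|t - 1|) @ t --> `|t - 1|.
  by apply: cvg_norm; exact: (cvgB cvg_id (cvg_cst _)).
exact: (cvgD (cvgB c1 c2) (cvg_cst _)).
Qed.

Lemma clip_ge0 t : 0 <= clip t.
Proof. by rewrite /clip divr_ge0//; case: (ger0P t) => ?; case: (ger0P (t - 1)) => ?; lra. Qed.
Lemma clip_le1 t : clip t <= 1.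
Proof. by rewrite /clip ler_pdivrMr//; case: (ger0P t) => ?; case: (ger0P (t - 1)) => ?; lra. Qed.
Lemma clip_0 t : t <= 0 -> clip t = 0.
Proof. by move=> t0; rewrite /clip ler0_norm// ler0_norm; lra. Qed.
Lemma clip_1 t : 1 <= t -> clip t = 1.
Proof. by move=> t0; rewrite /clip ger0_norm ?ger0_norm; lra. Qed.

Variable n : nat.
Local Notation V := 'rV[R]_n.
Local Notation mu := (@lebesgue_rV R n).
Implicit Types f g : V -> R.

Definition cutoff (N : nat) (x : V) : R := clip (N%:R - `|x|).

Lemma cutoff_cont N : continuous (cutoff N).
Proof.
move=> x; have c1 : (fun x : V => N%:R - `|x|) @ x --> N%:R - `|x|.
  have c2 : (fun x : V => `|x|) @ x --> `|x| by exact: norm_continuous.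
  exact: (cvgB (cvg_cst _) c2).
exact: (@continuous_comp _ _ _ (fun x : V => N%:R - `|x|) clip x c1 (@clip_cont _)).
Qed.

Lemma cutoff_bsupp N : bsupp (cutoff N).
Proof. by exists N%:R => x Nx; rewrite /cutoff clip_0// subr_le0. Qed.

Lemma cutoff_cvg x : cutoff ^~ x @ \oo --> (1 : R).
Proof.
apply: (@cvg_trans _ (cst (1 : R) @ \oo)); last exact: cvg_cst.
apply: near_eq_cvg; exists (Num.truncn `|x|).+2 => // N /= hN.
rewrite /cutoff clip_1// lerBrDr.
have := truncnS_gt `|x| ; have : (Num.truncn `|x|).+2%:R <= N%:R :> R by rewrite ler_nat.
rewrite -natr1; lra.
Qed.

Lemma contM f g : continuous f -> continuous g -> continuous (fun x => f x * g x).
Proof. by move=> cf cg x; exact: (cvgM (cf x) (cg x)). Qed.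

Lemma cont_clip f : continuous f -> continuous (fun x => clip (f x)).
Proof. by move=> cf x; exact: (@continuous_comp _ _ _ f clip x (cf x) (@clip_cont _)). Qed.

Lemma bounded_bsupp_integrable f (C : R) : measurable_fun setT f -> bsupp f ->
  (forall x, `|f x| <= C) -> mu.-integrable setT (EFin \o f).
Proof.
move=> mf [r hr] hC.
have C0 : 0 <= C by apply: le_trans (normr_ge0 _) (hC 0).
pose A := [set x : V | `|0 - x| < `|r| + 1].
have rp : 0 < `|r| + 1 by rewrite ltr_wpDl.
have mA : measurable A by exact: measurable_rV_ball.
apply: (@le_integrable _ _ _ mu _ measurableT _ (fun x => (C * \1_A x)%:E)).
- exact/measurable_EFinP.
- move=> x _ /=; rewrite lee_fin [leRHS]ger0_norm ?mulr_ge0//.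
  rewrite indicE; have [xA|xA] := boolP (x \in A); first by rewrite mulr1.
  rewrite mulr0 hr ?normr0//; move: xA; rewrite notin_setE /A /= sub0r normrN => /negP.
  by rewrite -leNgt; have := ler_norm r; lra.
apply/integrableP; split.
  by apply/measurable_EFinP; apply: measurable_funM => //; exact: measurable_indic.
under eq_integral do rewrite gee0_abs ?lee_fin ?mulr_ge0// EFinM.
rewrite ge0_integralZl//; last first.
  by apply/measurable_EFinP; exact: measurable_indic.
have -> : (\int[mu]_x (\1_A x)%:E = ((2 * (`|r| + 1)) ^+ n)%:E)%E.
  by rewrite integral_indic// setIT; exact: (lebesgue_rV_ball 0 rp).
by rewrite -EFinM ltry.
Qed.

Lemma bsupp_bounded f : continuous f -> bsupp f -> exists2 C : R, 0 < C & forall x, `|f x| <= C.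
Proof.
move=> cf [r hr].
pose K := [set x : V | `|x| <= `|r| + 1].
have cK : compact K.
  apply: bounded_closed_compact.
    exists (`|r| + 1); split; first exact: num_real.
    by move=> M hM x Kx; apply: le_trans Kx (ltW hM).
  have nc : continuous (fun x : V => `|x|) by exact: norm_continuous.
  rewrite (_ : K = (fun x : V => `|x|) @^-1` [set y | y <= `|r| + 1])//.
  by move/continuous_closedP : nc => /(_ _ (@closed_le R (`|r| + 1))).
have K0 : K !=set0 by exists 0; rewrite /K /= normr0 addr_ge0.
have cn : {within K, continuous (fun x => - `|f x|)}.
  apply: continuous_subspaceT => x; exact: (cvgN (cvg_norm (cf x))).
have [c _ hc] := EVT_min_rV K0 cK cn.
exists (`|f c| + 1) => [|x]; first by rewrite ltr_wpDl.
have [xK|xK] := lerP `|x| (`|r| + 1).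
  have := hc x; rewrite inE => /(_ xK); lra.
by rewrite hr ?normr0 ?addr_ge0//; have := ler_norm r; lra.
Qed.

Lemma bsupp_integrable f : continuous f -> bsupp f -> mu.-integrable setT (EFin \o f).
Proof.
move=> cf bf; have [C _ hC] := bsupp_bounded cf bf.
by apply: bounded_bsupp_integrable hC => //; exact: continuous_measurable_rV.
Qed.

Definition L1approx f := measurable_fun setT f /\ forall e : R, 0 < e ->
  exists2 g, continuous g /\ bsupp g & (\int[mu]_x (`|f x - g x|)%:E <= e%:E)%E.

Let mnormB f g : measurable_fun setT f -> measurable_fun setT g ->
  measurable_fun setT (fun x => (`|f x - g x|)%:E).
Proof.
by move=> mf mg; apply/measurable_EFinP; apply: measurableT_comp => //; exact: measurable_funB.
Qed.

Lemma L1dist_triangle f g (h : V -> R) : measurable_fun setT f -> measurable_fun setT g ->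
  measurable_fun setT h ->
  (\int[mu]_x (`|f x - h x|)%:E <= \int[mu]_x (`|f x - g x|)%:E + \int[mu]_x (`|g x - h x|)%:E)%E.
Proof.
move=> mf mg mh; rewrite -ge0_integralD//; [|exact: mnormB|exact: mnormB].
apply: ge0_le_integral => //; first exact: mnormB.
- by apply: emeasurable_funD; exact: mnormB.
- by move=> x _; rewrite lee_fin -(subrKA (g x)) ler_normD.
Qed.

Lemma L1approx_close f : measurable_fun setT f ->
  (forall e : R, 0 < e -> exists2 h, L1approx h & (\int[mu]_x (`|f x - h x|)%:E <= e%:E)%E) ->
  L1approx f.
Proof.
move=> mf H; split=> // e e0; have e2 : 0 < e / 2 by rewrite divr_gt0.
have [h [mh hh] fh] := H _ e2; have [g [cg bg] hg] := hh _ e2.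
exists g => //; apply: le_trans (L1dist_triangle mf mh (continuous_measurable_rV cg)) _.
by apply: le_trans (leeD fh hg) _; rewrite -EFinD lee_fin -splitr.
Qed.

Lemma L1approx_dominated (f_ : nat -> V -> R) f (G : V -> R) :
  (forall k, L1approx (f_ k)) -> measurable_fun setT f ->
  mu.-integrable setT (EFin \o G) -> (forall k x, `|f_ k x| <= G x) ->
  (forall x, f_ ^~ x @ \oo --> f x) -> L1approx f.
Proof.
move=> af mf iG fG ff; apply: L1approx_close => // e e0.
have [] := @dominated_convergence _ _ _ mu setT measurableT (fun k => EFin \o f_ k) (EFin \o f) (EFin \o G).
- by move=> k; apply/measurable_EFinP; exact: (af k).1.
- exact/measurable_EFinP.
- by apply: nearW => x _; apply: cvg_EFin; [exact: nearW|exact: ff].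
- exact: iG.
- by apply: nearW => x k _; rewrite lee_fin.
move=> _ + _ => /fine_cvgP[fin /cvgrPdist_le /(_ e e0) H].
have [k [] /= hk1 hk2] := filter_ex (filterI fin H).
exists (f_ k) => //; move: hk2; rewrite sub0r normrN => hk2.
rewrite -(fineK hk1) /= in hk2 *.
have -> : (\int[mu]_x (`|f x - f_ k x|)%:E = \int[mu]_x `|(f_ k x)%:E - (f x)%:E|)%E.
  by apply: eq_integral => x _; rewrite /= distrC.
by rewrite -(fineK hk1) lee_fin; apply: le_trans hk2; exact: ler_norm.
Qed.

Lemma L1approx_bsupp g : continuous g -> bsupp g -> L1approx g.
Proof.
move=> cg bg; split; first exact: continuous_measurable_rV.
move=> e e0; exists g => //; under eq_integral do rewrite subrr normr0.
by rewrite integral0 lee_fin ltW.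
Qed.

Lemma bsuppD f g : bsupp f -> bsupp g -> bsupp (fun x => f x + g x).
Proof.
move=> [r hr] [s hs]; exists (Num.max r s) => x; rewrite ge_max => /andP[h1 h2].
by rewrite hr// hs// addr0.
Qed.

Lemma L1approxD f g : L1approx f -> L1approx g -> L1approx (fun x => f x + g x).
Proof.
move=> [mf hf] [mg hg]; split; first exact: measurable_funD.
move=> e e0; have e2 : 0 < e / 2 by rewrite divr_gt0.
have [f' [cf bf] h1] := hf _ e2; have [g' [cg bg] h2] := hg _ e2.
have mf' := continuous_measurable_rV cf; have mg' := continuous_measurable_rV cg.
exists (fun x => f' x + g' x); first by split; [move=> x; exact: (cvgD (cf x) (cg x))|exact: bsuppD].
apply: (@le_trans _ _ (\int[mu]_x ((`|f x - f' x|)%:E + (`|g x - g' x|)%:E))%E).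
  apply: ge0_le_integral => //.
  - by apply: mnormB; exact: measurable_funD.
  - by apply: emeasurable_funD; exact: mnormB.
  - by move=> x _; rewrite lee_fin opprD addrACA ler_normD.
rewrite ge0_integralD//; [|exact: mnormB|exact: mnormB].
by apply: le_trans (leeD h1 h2) _; rewrite -EFinD lee_fin -splitr.
Qed.

Lemma L1approxZ (c : R) f : L1approx f -> L1approx (fun x => c * f x).
Proof.
move=> [mf hf]; split; first exact: measurable_funM.
move=> e e0; have c1 : 0 < `|c| + 1 by rewrite ltr_wpDl.
have [g [cg bg] h] := hf (e / (`|c| + 1)) (divr_gt0 e0 c1).
have mg := continuous_measurable_rV cg.
exists (fun x => c * g x).
  split; first by move=> x; exact: (cvgM (cvg_cst c) (cg x)).
  by have [r hr] := bg; exists r => x /hr ->; rewrite mulr0.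
under eq_integral do rewrite -mulrBr normrM EFinM.
rewrite ge0_integralZl//; last exact: mnormB.
apply: le_trans (lee_wpmul2l _ h) _; first by rewrite lee_fin.
by rewrite -EFinM lee_fin mulrA ler_pdivrMr// mulrC ler_wpM2l ?lerDl// ltW.
Qed.

(** The positivity sets of continuous functions are stable under intersection, by taking products.
    They generate the sigma-algebra, since a coordinate strip is the positivity set of a product of
    two clipped functions. *)
Let posset : set (set V) := [set A | exists2 f : V -> R,
  continuous f /\ (forall x, 0 <= f x) & A = [set x | 0 < f x]].

Let posset_gen : @measurable _ V = <<s posset >>.
Proof.
apply/seteqP; split; last first.
  apply: smallest_sub; first exact: sigma_algebra_measurable.
  move=> _ [f [cf f0] ->]; apply: open_measurable_rV.
  by move/continuousP : cf => /(_ _ (@open_gt R 0)).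
apply: smallest_sub; first exact: smallest_sigma_algebra.
move=> A; rewrite -bigcup_seq => -[i /= _ [C mC <-]]; rewrite setTI.
have : measurable_fun setT (fun x : g_sigma_algebraType posset => (x : V) ord0 i).
  apply: (measurability _ (measurable_realfun.RGenOpens.measurableE R)).
  move=> _ [_ [a [b ->] <-]]; rewrite setTI; apply: sub_sigma_algebra.
  exists (fun x : V => clip (x ord0 i - a) * clip (b - x ord0 i)).
    split=> [|x]; last by rewrite mulr_ge0// clip_ge0.
    apply: contM; apply: cont_clip => x; have ci := @coord_continuous R 1 n ord0 i x.
      exact: (cvgB ci (cvg_cst a)).
    exact: (cvgB (cvg_cst b) ci).
  have clip_gt0 t : (0 < clip t) = (0 < t).
    have [t0|t0] := lerP t 0; first by rewrite clip_0// ltxx.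
    by rewrite /clip divr_gt0// gtr0_norm//; case: (ger0P (t - 1)) => ?; lra.
  apply/seteqP; split=> x /=; rewrite in_itv /=.
    by move=> /andP[h1 h2]; rewrite mulr_gt0// clip_gt0 subr_gt0.
  have [h1|h1] := ltrP a (x ord0 i); last by rewrite clip_0 ?mul0r ?ltxx// subr_le0.
  have [h2|h2] := ltrP (x ord0 i) b; first by [].
  by rewrite (@clip_0 (b - _)) ?mulr0 ?ltxx// subr_le0.
by move=> /(_ measurableT C mC); rewrite setTI.
Qed.

(** Dynkin's pi-lambda argument on A. The cutoff keeps the complement step inside L^1, the whole
    space having infinite measure in general. *)
Lemma L1approx_cutoff_indic N (A : set V) : measurable A ->
  L1approx (fun x => cutoff N x * \1_A x).
Proof.
have mc := continuous_measurable_rV (@cutoff_cont N).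
have ic := bsupp_integrable (@cutoff_cont N) (@cutoff_bsupp N).
have c0 x : 0 <= cutoff N x by exact: clip_ge0.
have mcA B : measurable B -> measurable_fun setT (fun x => cutoff N x * \1_B x).
  by move=> mB; apply: measurable_funM => //; exact: measurable_indic.
rewrite posset_gen.
apply: (@dynkin_induction _ V posset (fun A => L1approx (fun x => cutoff N x * \1_A x)) posset_gen) => //.
- move=> _ _ [f [cf f0] ->] [g [cg g0] ->]; exists (fun x => f x * g x).
    by split=> x; [exact: (cvgM (cf x) (cg x))|rewrite mulr_ge0].
  apply/seteqP; split=> x /=; first by move=> [h1 h2]; rewrite mulr_gt0.
  rewrite lt_neqAle eq_sym mulf_eq0 negb_or => /andP[/andP[h1 h2] _].
  by rewrite !lt_neqAle !(eq_sym 0) h1 h2 f0 g0.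
- rewrite (_ : (fun x => _) = cutoff N); last by apply/funext => x; rewrite indicT mulr1.
  by apply: L1approx_bsupp; [exact: cutoff_cont|exact: cutoff_bsupp].
- move=> _ [f [cf f0] ->].
  have mf : measurable [set x | 0 < f x].
    by apply: open_measurable_rV; move/continuousP : cf => /(_ _ (@open_gt R 0)).
  (* As k grows, clip (k f) tends to the indicator of the set where f > 0. *)
  apply: (@L1approx_dominated (fun k x => cutoff N x * clip (k%:R * f x)) _ (cutoff N)) => //.
  + move=> k; apply: L1approx_bsupp; last first.
      by have [r hr] := @cutoff_bsupp N; exists r => x /hr ->; rewrite mul0r.
    apply: contM; first exact: cutoff_cont.
    by apply: cont_clip => x; exact: (cvgM (cvg_cst _) (cf x)).
  + exact: mcA.
  + by move=> k x; rewrite normrM !ger0_norm ?clip_ge0 ?c0// ler_piMr// clip_le1.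
  move=> x; apply: cvgM; first exact: cvg_cst.
  rewrite indicE; have [xA|xA] := boolP (x \in _).
    rewrite inE /= in xA.
    apply: (@cvg_trans _ (cst (1 : R) @ \oo)); last exact: cvg_cst.
    apply: near_eq_cvg; exists (Num.truncn (f x)^-1).+1 => // k /= hk.
    rewrite clip_1// -ler_pdivrMr// mul1r; apply: ltW; apply: lt_le_trans (truncnS_gt _) _.
    by rewrite ler_nat.
  rewrite notin_setE /= in xA; have -> : f x = 0.
    by apply/eqP; rewrite eq_le f0 andbT leNgt; apply/negP.
  under eq_fun do rewrite mulr0 clip_0//.
  exact: cvg_cst.
- move=> S mS hS; rewrite (_ : (fun x => _) = (fun x => cutoff N x + (-1) * (cutoff N x * \1_S x))).
    apply: L1approxD; first by apply: L1approx_bsupp; [exact: cutoff_cont|exact: cutoff_bsupp].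
    exact: L1approxZ.
  by apply/funext => x; rewrite !indicE in_setC; case: (x \in S) => /=; ring.
move=> F mF tF hF.
have mU : measurable (\bigcup_k F k) by exact: bigcupT_measurable.
have sumE1 x m k : F k x -> \sum_(j < m) \1_(F j) x = ((k < m)%N)%:R :> R.
  move=> Fk; have E j : \1_(F j) x = (j == k)%:R :> R.
    rewrite indicE; have [->|jk] := eqVneq j k; first by rewrite mem_set.
    rewrite memNset// => Fj; move/trivIsetP : tF => /(_ j k Logic.I Logic.I jk) /seteqP[+ _].
    by move=> /(_ x) /=; apply.
  under eq_bigr do rewrite E.
  elim: m => [|m IH]; first by rewrite big_ord0 ltn0.
  rewrite big_ord_recr/= IH; case: (ltngtP k m) => h.
  - by rewrite (ltn_trans h (ltnSn m)) addr0.
  - by rewrite ltnNge h/= addr0.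
  - by rewrite h ltnSn add0r.
have sumE x m : (exists2 k, F k x & \sum_(j < m) \1_(F j) x = ((k < m)%N)%:R :> R) \/
    ((~ exists k, F k x) /\ \sum_(j < m) \1_(F j) x = 0 :> R).
  have [[k Fk]|nF] := pselect (exists k, F k x); first by left; exists k => //; exact: sumE1.
  right; split=> //; apply: big1 => j _; rewrite indicE memNset// => Fj.
  by apply: nF; exists j.
apply: (@L1approx_dominated (fun m x => \sum_(k < m) cutoff N x * \1_(F k) x) _ (cutoff N)) => //.
- elim=> [|m IH].
    rewrite (_ : (fun x => _) = (fun x => 0 * cutoff N x)); last first.
      by apply/funext => x; rewrite big_ord0 mul0r.
    by apply: L1approxZ; apply: L1approx_bsupp; [exact: cutoff_cont|exact: cutoff_bsupp].
  rewrite (_ : (fun x => _) = (fun x => \sum_(k < m) cutoff N x * \1_(F k) x + cutoff N x * \1_(F m) x)).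
    exact: L1approxD.
  by apply/funext => x; rewrite big_ord_recr.
- exact: mcA.
- move=> m x; rewrite -mulr_sumr normrM ger0_norm// ler_piMr//.
  by have [[k _ ->]|[_ ->]] := sumE x m; rewrite ?normr0// ger0_norm//; case: (k < m)%N.
move=> x; under eq_fun do rewrite -mulr_sumr.
apply: cvgM; first exact: cvg_cst.
rewrite indicE; have [xU|xU] := boolP (x \in _).
  rewrite inE in xU; have [k0 _ Fx] := xU.
  apply: (@cvg_trans _ (cst (1 : R) @ \oo)); last exact: cvg_cst.
  apply: near_eq_cvg; exists k0.+1 => // m /= hm.
  by rewrite (sumE1 x m k0 Fx) hm.
apply: (@cvg_trans _ (cst (0 : R) @ \oo)); last exact: cvg_cst.
apply: near_eq_cvg; apply: nearW => m /=.
by have [[k Fx _]|[_ ->]//] := sumE x m; move: xU; rewrite notin_setE => -[]; exists k.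
Qed.

Import HBSimple.

Lemma L1approx_integrable f : mu.-integrable setT (EFin \o f) -> L1approx f.
Proof.
move=> intf; have mf : measurable_fun setT f by case/integrableP : intf => /measurable_EFinP.
have mc N := continuous_measurable_rV (@cutoff_cont N).
have c0 N x : 0 <= cutoff N x by exact: clip_ge0.
have [g_ [ig _ gf]] := approximation_sfun_integrable measurableT intf.
have mg k : measurable_fun setT (g_ k) by case/integrableP : (ig k) => /measurable_EFinP.
have ag k : L1approx (g_ k).
  apply: (@L1approx_dominated (fun N x => cutoff N x * g_ k x) _ (fun x => `|g_ k x|)) => //.
  - move=> N; have [M [a ga]] : exists M (a : seq R), forall x,
        g_ k x = \sum_(i < M) (a`_i * \1_(g_ k @^-1` [set a`_i]) x).
      by eexists; eexists; exact: (fimfunEord (g_ k)).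
    rewrite (_ : (fun x => _) = (fun x => \sum_(i < M) a`_i * (cutoff N x * \1_(g_ k @^-1` [set a`_i]) x))); last first.
      by apply/funext => x; rewrite ga mulr_sumr; apply: eq_bigr => i _; rewrite mulrCA.
    elim: M {ga} => [|M IH].
      rewrite (_ : (fun x => _) = (fun x => 0 * cutoff N x)); last first.
        by apply/funext => x; rewrite big_ord0 mul0r.
      apply: L1approxZ; apply: L1approx_bsupp; [exact: cutoff_cont|exact: cutoff_bsupp].
    under eq_fun do rewrite big_ord_recr/=.
    apply: L1approxD => //; apply: L1approxZ; apply: L1approx_cutoff_indic.
    by rewrite -[X in measurable X]setTI; exact: mg.
  - have /integrable_abse := ig k; exact.
  - by move=> N x; rewrite normrM ger0_norm// ler_piMl// clip_le1.
  - move=> x; rewrite -[X in _ --> X]mul1r; apply: cvgM; first exact: cutoff_cvg.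
    exact: cvg_cst.
apply: L1approx_close => // e e0.
move: gf => /fine_cvgP[fin /cvgrPdist_le /(_ e e0) H].
have [k [] /= hk1 hk2] := filter_ex (filterI fin H).
exists (g_ k) => //; move: hk2; rewrite sub0r normrN => hk2.
rewrite -(fineK hk1) /= in hk2 *.
rewrite (_ : (\int[mu]_x (`|f x - g_ k x|)%:E = \int[mu]_x `|(f x)%:E - (g_ k x)%:E|)%E)//.
by rewrite -(fineK hk1) lee_fin; apply: le_trans hk2; exact: ler_norm.
Qed.

End Density.

(** * Real-valued integrals, the spaces L^q and their completeness *)

Lemma powR_norm_cont (R : realType) (q : R) : 0 < q -> continuous (fun t : R => `|t| `^ q).
Proof.
move=> q0 t; change ((fun t : R => `|t| `^ q) @ t --> `|t| `^ q); have [->|t0] := eqVneq t 0.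
  rewrite normr0 powR0 ?gt_eqF//; apply/cvgrPdist_lt => e e0.
  exists (e `^ q^-1); first by rewrite /= powR_gt0.
  move=> y /=; rewrite !sub0r !normrN => hy; rewrite ger0_norm ?powR_ge0//.
  have -> : e = (e `^ q^-1) `^ q by rewrite -powRrM mulVf ?gt_eqF// powRr1// ltW.
  by apply: gt0_ltr_powR; rewrite ?nnegrE ?powR_ge0.
have nt : 0 < `|t| by rewrite normr_gt0.
have c1 : (fun t : R => `|t|) @ t --> `|t| by exact: norm_continuous.
have c2 : (fun t : R => ln `|t|) @ t --> ln `|t|.
  by apply: (continuous_cvg _ _ c1); exact: continuous_ln.
have c3 : (fun t : R => expR (q * ln `|t|)) @ t --> expR (q * ln `|t|).
  by apply: (continuous_cvg _ (@continuous_expR R _)); exact: (cvgM (cvg_cst _) c2).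
rewrite [X in _ --> X]/powR gt_eqF//.
apply: cvg_trans c3; apply: near_eq_cvg.
have H : \forall x \near t, 0 < `|x| := @cvgr_gt _ _ _ _ _ _ c1 0 nt.
near=> x; rewrite /powR gt_eqF//; near: x; exact: H.
Unshelve. all: by end_near.
Qed.

Section Int.
Context d (T : measurableType d) (R : realType) (mu : {measure set T -> \bar R}).
Implicit Types (f g h : T -> R).
Local Notation mfun f := (measurable_fun setT f).
Local Notation I f := (Rintegral mu setT f).

Definition intg f := mu.-integrable setT (EFin \o f).

Lemma intgP f : intg f <-> mfun f /\ (\int[mu]_x (`|f x|)%:E < +oo)%E.
Proof.
split=> [/integrableP[/measurable_EFinP mf i]|[mf i]].
  by split => //; rewrite (eq_integral (fun x => `|(EFin \o f) x|))%E.
by apply/integrableP; split; [exact/measurable_EFinP|rewrite (eq_integral (fun x => (`|f x|)%:E))%E].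
Qed.

Lemma intg_meas f : intg f -> mfun f.
Proof. by case/intgP. Qed.

Lemma intg_le f g : mfun f -> (forall x, `|f x| <= g x) -> intg g -> intg f.
Proof.
move=> mf fg; apply: le_integrable => //; first exact/measurable_EFinP.
by move=> x _ /=; rewrite lee_fin; apply: le_trans (fg x) (ler_norm _).
Qed.

Lemma intgD f g : intg f -> intg g -> intg (fun x => f x + g x).
Proof. by move=> fi gi; have := integrableD measurableT fi gi. Qed.
Lemma intgZ (c : R) f : intg f -> intg (fun x => c * f x).
Proof. by move=> fi; have := integrableZl measurableT c fi. Qed.
Lemma intgN f : intg f -> intg (fun x => - f x).
Proof.
by move=> /(intgZ (-1)); congr intg; apply/funext => x; rewrite mulN1r.
Qed.
Lemma intgB f g : intg f -> intg g -> intg (fun x => f x - g x).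
Proof. by move=> fi /intgN gi; exact: intgD. Qed.
Lemma intg_norm f : intg f -> intg (fun x => `|f x|).
Proof. exact: integrable_norm. Qed.
Lemma intg0 : intg (fun=> 0).
Proof. exact: integrable0. Qed.
Lemma intg_sum (J : Type) (s : seq J) (F : J -> T -> R) :
  (forall j, intg (F j)) -> intg (fun x => \sum_(j <- s) F j x).
Proof.
move=> Fi; elim: s => [|j s IH].
  by rewrite (_ : (fun x => _) = fun=> 0)//; [exact: intg0|apply/funext => x; rewrite big_nil].
rewrite (_ : (fun x => _) = fun x => F j x + \sum_(j <- s) F j x); first exact: intgD.
by apply/funext => x; rewrite big_cons.
Qed.

Lemma EFin_int f : intg f -> (I f)%:E = (\int[mu]_x (f x)%:E)%E.
Proof. by move=> fi; rewrite /Rintegral fineK//; exact: integrable_fin_num. Qed.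

Lemma eq_int f g : f =1 g -> I f = I g.
Proof. by move=> /funext ->. Qed.

Lemma intD f g : intg f -> intg g -> I (fun x => f x + g x) = I f + I g.
Proof. by move=> fi gi; exact: RintegralD. Qed.
Lemma intB f g : intg f -> intg g -> I (fun x => f x - g x) = I f - I g.
Proof. by move=> fi gi; exact: RintegralB. Qed.
Lemma intZ (c : R) f : intg f -> I (fun x => c * f x) = c * I f.
Proof. by move=> fi; exact: RintegralZl. Qed.
Lemma intN f : intg f -> I (fun x => - f x) = - I f.
Proof.
by move=> fi; rewrite -mulN1r -intZ//; apply: eq_int => x; rewrite mulN1r.
Qed.
Lemma int_ge0 f : (forall x, 0 <= f x) -> 0 <= I f.
Proof. by move=> f0; apply: Rintegral_ge0. Qed.
Lemma int_le f g : intg f -> intg g -> (forall x, f x <= g x) -> I f <= I g.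
Proof. by move=> fi gi fg; apply: le_Rintegral. Qed.
Lemma int_norm f : intg f -> `|I f| <= I (fun x => `|f x|).
Proof. by move=> fi; exact: le_normr_Rintegral. Qed.
Lemma int0 : I (fun=> 0) = 0.
Proof. by rewrite /Rintegral integral0. Qed.
Lemma int_sum (J : Type) (s : seq J) (F : J -> T -> R) :
  (forall j, intg (F j)) -> I (fun x => \sum_(j <- s) F j x) = \sum_(j <- s) I (F j).
Proof.
move=> Fi; elim: s => [|j s IH].
  by rewrite big_nil (_ : (fun x => _) = fun=> 0) ?int0//; apply/funext => x; rewrite big_nil.
rewrite big_cons -IH -intD//; last exact: intg_sum.
by apply: eq_int => x; rewrite big_cons.
Qed.

Lemma intg_ae f g : mfun g -> {ae mu, forall x, f x = g x} -> intg f -> intg g.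
Proof.
move=> mg fg /intgP[mf fi]; apply/intgP; split=> //; apply: le_lt_trans fi.
rewrite (@ge0_ae_eq_integral _ _ _ mu setT (fun x => (`|g x|)%:E) (fun x => (`|f x|)%:E))//.
- by apply/measurable_EFinP; exact: measurableT_comp.
- by apply/measurable_EFinP; exact: measurableT_comp.
- by move: fg; apply: filterS => x -> _.
Qed.

Lemma int_ae f g : mfun f -> mfun g -> {ae mu, forall x, f x = g x} -> I f = I g.
Proof.
move=> mf mg fg; congr fine; apply: ae_eq_integral => //.
- exact/measurable_EFinP.
- exact/measurable_EFinP.
- by move: fg; apply: filterS => x -> _.
Qed.

Lemma int_eq0 f : intg f -> (forall x, 0 <= f x) -> I f = 0 -> {ae mu, forall x, f x = 0}.
Proof.
move=> fi f0 If; have := EFin_int fi; rewrite If => /esym E.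
have /(ae_eq_integral_abs _ measurableT) : mfun (EFin \o f) by exact/measurable_EFinP/intg_meas.
have E2 : (\int[mu]_x `|(EFin \o f) x| = 0)%E.
  by apply: etrans E; apply: eq_integral => x _ /=; rewrite ger0_norm.
move=> h; have := (h mu).1 E2; rewrite /ae_eq; apply: filterS => x /(_ Logic.I) /=.
by case.
Qed.

Lemma int_le_ereal f (C : R) : mfun f -> (forall x, 0 <= f x) ->
  (\int[mu]_x (f x)%:E <= C%:E)%E -> intg f /\ I f <= C.
Proof.
move=> mf f0 fC; have fi : intg f.
  apply/intgP; split=> //; under eq_integral do rewrite ger0_norm//.
  by apply: le_lt_trans fC (ltry _).
by split=> //; rewrite -lee_fin EFin_int.
Qed.

Lemma int_fatou (f_ : nat -> T -> R) f (C : R) :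
  (forall k, intg (f_ k)) -> mfun f -> (forall k x, 0 <= f_ k x) -> (forall x, 0 <= f x) ->
  {ae mu, forall x, f_ ^~ x @ \oo --> f x} ->
  (forall k, I (f_ k) <= C) -> intg f /\ I f <= C.
Proof.
move=> fi mf f_0 f0 ff fC; apply: int_le_ereal => //.
by apply: (ae_cvg_fatou (fun k => intg_meas (fi k)) mf f_0 f0 ff) => k; rewrite -EFin_int// lee_fin.
Qed.

Definition LP (q : R) f := mfun f /\ intg (fun x => `|f x| `^ q).

Lemma mpow (q : R) f : mfun f -> mfun (fun x => `|f x| `^ q).
Proof.
by move=> mf; apply: (measurableT_comp (measurable_powR q)); exact: measurableT_comp.
Qed.

Lemma LfunP (q : R) f : 0 < q -> (f \in Lfun mu q%:E) <-> LP q f.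
Proof.
move=> q0.
have E : ('N[mu]_(q%:E)[EFin \o f] `^ q = \int[mu]_x (`|f x| `^ q)%:E)%E.
  by rewrite powR_Lnorm ?gt_eqF//.
split.
  rewrite inE => /andP[]; rewrite !inE /= => mf h; split => //; apply/intgP; split; first exact: mpow.
  under eq_integral do rewrite ger0_norm ?powR_ge0//.
  rewrite -E; apply: poweR_lty; exact: h.
move=> [mf /intgP[_ h]]; rewrite inE; apply/andP; split; rewrite inE//=.
move: h; under eq_integral do rewrite ger0_norm ?powR_ge0//.
by rewrite -E => h; apply: (lty_poweRy _ h); rewrite gt_eqF.
Qed.

Lemma pow2 (a : R) : `|a| `^ 2 = a ^+ 2.
Proof. by rewrite powR_mulrn// real_normK ?num_real. Qed.

Lemma LP2 f : LP 2 f <-> mfun f /\ intg (fun x => f x ^+ 2).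
Proof. by rewrite /LP; under eq_fun do rewrite pow2. Qed.

Lemma intgM f g : LP 2 f -> LP 2 g -> intg (fun x => f x * g x).
Proof.
move=> /LP2[mf fi] /LP2[mg gi]; apply: (@intg_le _ (fun x => f x ^+ 2 + g x ^+ 2)).
- exact: measurable_funM.
- move=> x; rewrite ler_norml; apply/andP; split; first by nra.
  by nra.
- exact: intgD.
Qed.

Lemma int_CS f g : LP 2 f -> LP 2 g ->
  I (fun x => f x * g x) ^+ 2 <= I (fun x => f x ^+ 2) * I (fun x => g x ^+ 2).
Proof.
move=> f2 g2; have [_ fi] := (LP2 f).1 f2; have [_ gi] := (LP2 g).1 g2.
have fg := intgM f2 g2.
set A := I (fun x => f x ^+ 2); set B := I (fun x => g x ^+ 2); set C := I _.
have H (t s : R) : 0 <= t ^+ 2 * A + 2 * t * s * C + s ^+ 2 * B.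
  have := @int_ge0 (fun x => (t * f x + s * g x) ^+ 2) (fun x => sqr_ge0 _).
  rewrite (_ : (fun x => _) = fun x => (t ^+ 2 * f x ^+ 2 + (2 * t * s) * (f x * g x)) + s ^+ 2 * g x ^+ 2); last first.
    by apply/funext => x; ring.
  rewrite intD; [|by apply: intgD; exact: intgZ|exact: intgZ].
  by rewrite intD ?intZ//; exact: intgZ.
have A0 : 0 <= A by apply: int_ge0 => x; exact: sqr_ge0.
have B0 : 0 <= B by apply: int_ge0 => x; exact: sqr_ge0.
have [A0'|A0'] := eqVneq A 0.
  suff -> : C = 0 by rewrite expr0n/= mulr_ge0.
  apply/eqP/negPn/negP => C0.
  have := H (- (B + 1) / (2 * C)) 1; rewrite A0' mulr0 add0r mulr1 expr1n mul1r.
  have -> : 2 * (- (B + 1) / (2 * C)) * C = - (B + 1) by field.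
  lra.
have Ap : 0 < A by rewrite lt_neqAle eq_sym A0'.
have := H (- C) A; nra.
Qed.

Lemma powR_addle (q a b : R) : 0 <= q -> 0 <= a -> 0 <= b ->
  (a + b) `^ q <= 2 `^ q * (a `^ q + b `^ q).
Proof.
move=> q0; wlog ab : a b / a <= b.
  move=> H a0 b0; have [|/ltW] := lerP a b => h; first exact: H.
  by rewrite addrC [_ `^ q + _]addrC; exact: H.
move=> a0 b0; apply: (@le_trans _ _ ((2 * b) `^ q)).
  by apply: ge0_ler_powR; rewrite ?nnegrE//; lra.
by rewrite powRM// ler_wpM2l ?powR_ge0// lerDr powR_ge0.
Qed.

Lemma powR_normD (q : R) (a b : R) : 0 <= q ->
  `|a + b| `^ q <= 2 `^ q * (`|a| `^ q + `|b| `^ q).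
Proof.
move=> q0; apply: le_trans (powR_addle q0 (normr_ge0 a) (normr_ge0 b)).
by apply: ge0_ler_powR; rewrite ?nnegrE ?addr_ge0// ler_normD.
Qed.

Lemma LPD (q : R) f g : 0 <= q -> LP q f -> LP q g -> LP q (fun x => f x + g x).
Proof.
move=> q0 [mf fi] [mg gi]; have m := measurable_funD mf mg; split => //.
apply: (intg_le (mpow _ m) _ (intgZ (2 `^ q) (intgD fi gi))) => x.
by rewrite ger0_norm ?powR_ge0//; exact: powR_normD.
Qed.

Lemma LPZ (q c : R) f : LP q f -> LP q (fun x => c * f x).
Proof.
move=> [mf fi]; split; first exact: measurable_funM.
by under eq_fun do rewrite normrM powRM//; exact: intgZ.
Qed.

Lemma LP_eq (q : R) f g : f =1 g -> LP q f -> LP q g.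
Proof. by move=> /funext ->. Qed.

Lemma LPN (q : R) f : LP q f -> LP q (fun x => - f x).
Proof. by move=> [mf fi]; split; [exact: measurableT_comp|under eq_fun do rewrite normrN]. Qed.

Lemma LPB (q : R) f g : 0 <= q -> LP q f -> LP q g -> LP q (fun x => f x - g x).
Proof. by move=> q0 lf /LPN lg; exact: LPD. Qed.

Lemma LP_le (q : R) f g : 0 <= q -> mfun f -> (forall x, `|f x| <= `|g x|) -> LP q g -> LP q f.
Proof.
move=> q0 mf fg [mg gi]; split=> //; apply: (intg_le (mpow _ mf) _ gi) => x.
by rewrite ger0_norm ?powR_ge0//; apply: ge0_ler_powR; rewrite ?nnegrE.
Qed.

Lemma LP_ae (q : R) f g : mfun g -> {ae mu, forall x, f x = g x} -> LP q f -> LP q g.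
Proof.
move=> mg fg [mf fi]; split => //; apply: intg_ae fi; first exact: mpow.
by move: fg; apply: filterS => x ->.
Qed.

Lemma intNP_eq0 (q : R) f : 0 < q -> LP q f -> I (fun x => `|f x| `^ q) = 0 ->
  {ae mu, forall x, f x = 0}.
Proof.
move=> q0 [mf fi] E; have := int_eq0 fi (fun x => powR_ge0 _ _) E.
by apply: filterS => x /powR_eq0_eq0 /eqP; rewrite normr_eq0 => /eqP.
Qed.

(** A limit selected point by point, as a lower limit. It is measurable without knowledge of
    convergence, and it coincides at two points where all terms of the sequence coincide, so it
    preserves invariance under a group. *)
Definition limsel (v : nat -> T -> R) (x : T) : R :=
  fine (limn_einf (fun k => (v k x)%:E)).

Lemma measurable_limsel v : (forall k, mfun (v k)) -> mfun (limsel v).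
Proof.
move=> mv; apply: (@measurableT_comp _ _ _ _ _ _ (@fine R)); first exact: fine_measurable.
apply: (emeasurable_fun_cvg (fun n x => einfs (fun k => (v k x)%:E) n)) => [n|x _].
  by apply: measurable_fun_einfs => k; exact/measurable_EFinP.
by rewrite limn_einf_lim; exact: is_cvg_einfs.
Qed.

Lemma limsel_cvg v x l : v ^~ x @ \oo --> l -> limsel v x = l.
Proof.
move=> h; rewrite /limsel.
have E : ((fun k => (v k x)%:E) @ \oo --> l%:E)%E by apply: cvg_EFin => //; exact: nearW.
by rewrite is_cvg_limn_einfE; [rewrite (cvg_lim _ E)|exact: cvgP E].
Qed.

(* Extract a subsequence along which consecutive differences are summable. *)
Lemma LP_complete (q : R) (u : nat -> T -> R) : 0 < q -> (forall m, LP q (u m)) ->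
  (forall e, 0 < e -> exists M, forall m n, (M <= m)%N -> (M <= n)%N ->
     I (fun x => `|u m x - u n x| `^ q) <= e) ->
  exists s : nat -> nat, let v := limsel (fun k => u (s k)) in LP q v /\
  forall e, 0 < e -> exists M, forall m, (M <= m)%N -> I (fun x => `|u m x - v x| `^ q) <= e.
Proof.
move=> q0 uq uC.
(* Even after multiplication by (2^q)^k the integrals of the differences are at most 4^(-k).
   Borel-Cantelli then bounds |D_k| by a constant times 2^(-k) at almost every point. *)
pose rr : R := (4 * 2 `^ q)^-1.
have rr0 k : 0 < rr ^+ k by rewrite exprn_gt0// invr_gt0 mulr_gt0// powR_gt0.
have /choice[t tP] (k : nat) := uC _ (rr0 k.+1).
pose s := fix s k := if k is k'.+1 then maxn (s k').+1 (t k) else t 0%N.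
have st k : (t k <= s k)%N by case: k => [|k] //=; exact: leq_maxr.
have ss' k : (s k < s k.+1)%N by exact: leq_maxl.
have ss k : (s k <= s k.+1)%N by exact: ltnW.
have sm k m : (k <= m)%N -> (s k <= s m)%N.
  by move=> /subnK <-; elim: (m - k)%N => // j /leq_trans; apply; rewrite addSn.
exists s => v.
have mv : mfun v by apply: measurable_limsel => k; case: (uq (s k)).
pose D k x := u (s k.+1) x - u (s k) x.
have Dq k : LP q (D k) by apply: LPB => //; exact: ltW.
have DI k : I (fun x => `|D k x| `^ q) <= rr ^+ k.+1.
  by apply: tP; [apply: leq_trans (st k) (ss k)|exact: st].
have cv : {ae mu, forall x, (fun k => u (s k) x) @ \oo --> v x}.
  have : {ae mu, forall x, exists C : R, forall k, (2 `^ q) ^+ k * `|D k x| `^ q <= C * 2 ^- k}.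
    apply: borel_cantelli_ae.
    - by move=> k; apply: measurable_funM => //; apply: mpow; case: (Dq k).
    - by move=> k x; rewrite mulr_ge0 ?exprn_ge0 ?powR_ge0.
    move=> k; have [_ Di] := Dq k; rewrite -EFin_int; last exact: intgZ.
    have q2 : 0 < (2 : R) `^ q by rewrite powR_gt0.
    have e2 : (1 : R) <= 2 `^ q.
      by rewrite -[leLHS](powRr0 2); apply: ler_powR; [lra|exact: ltW].
    rewrite intZ// lee_fin; apply: le_trans (ler_wpM2l _ (DI k)) _; first by rewrite exprn_ge0// ltW.
    rewrite /rr invfM exprMn [_ ^+ k.+1 * _]mulrC mulrA -exprVn exprS.
    have -> : (2 `^ q) ^+ k * ((2 `^ q)^-1 * (2 `^ q)^-1 ^+ k) = (2 `^ q)^-1 :> R.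
      by rewrite mulrCA -exprMn divff ?gt_eqF// expr1n mulr1.
    rewrite exprS mulrA ler_piMl ?exprn_ge0//; apply: le_trans (_ : 1 * 1 <= _); last by rewrite mul1r.
    apply: ler_pM; [by rewrite invr_ge0 ltW|by rewrite invr_ge0|by rewrite invf_le1|by rewrite invf_le1// ler1n].
  apply: filterS => x [C hC].
  have C0 : 0 <= C.
    by have := hC 0%N; rewrite !expr0 invr1 mul1r mulr1; apply: le_trans; exact: powR_ge0.
  pose c := (C + 1) `^ q^-1.
  have Dx k : `|D k x| <= c * 2^-1 ^+ k.
    have p2 : 0 < (2 : R) `^ q by rewrite powR_gt0.
    have h : `|D k x| `^ q <= C * ((2 `^ q) ^+ k)^-1.
      rewrite ler_pdivlMr ?exprn_gt0// mulrC; apply: le_trans (hC k) _.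
      by rewrite ler_piMr// invf_le1 ?exprn_gt0// exprn_ege1// ler1n.
    have -> : `|D k x| = (`|D k x| `^ q) `^ q^-1.
      by rewrite -powRrM divff ?gt_eqF// powRr1.
    have -> : c * 2^-1 ^+ k = ((C + 1) * ((2 `^ q) ^+ k)^-1) `^ q^-1.
      rewrite powRM ?invr_ge0 ?exprn_ge0 ?addr_ge0 ?(ltW p2)//; congr (_ * _).
      rewrite -exprVn -powRN -!powR_mulrn ?powR_ge0 ?invr_ge0// -powRrM.
      rewrite -[2^-1]powR_inv1// -!powRrM; congr powR; field; exact: lt0r_neq0.
    apply: ge0_ler_powR; rewrite ?nnegrE ?invr_ge0 ?powR_ge0 ?(ltW q0)//.
      by rewrite mulr_ge0 ?addr_ge0// invr_ge0 exprn_ge0// ltW.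
    apply: le_trans h _; rewrite ler_wpM2r ?invr_ge0 ?exprn_ge0 ?(ltW p2)//; lra.
  suff cc : cvgn (fun k => u (s k) x) by have -> : v x = limn (fun k => u (s k) x) by exact: limsel_cvg.
  have -> : (fun k => u (s k) x) = (fun k => u (s 0%N) x + series (fun k => D k x) k).
    apply/funext => k; have := eq_sum_telescope (fun k => u (s k) x) k; exact.
  apply: is_cvgD; first exact: is_cvg_cst.
  apply: normed_cvg; apply: (@series_le_cvg _ _ (geometric c 2^-1)).
  - by move=> k; exact: normr_ge0.
  - by move=> k; rewrite /= mulr_ge0// ?powR_ge0// exprn_ge0.
  - by move=> k; exact: Dx.
  - by apply: is_cvg_geometric_series; rewrite ger0_norm; lra.
(* Fatou's lemma lets the second index of the Cauchy condition tend to infinity along the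
   subsequence. *)
have fat e M : (forall m n, (M <= m)%N -> (M <= n)%N -> I (fun x => `|u m x - u n x| `^ q) <= e) ->
  forall m, (M <= m)%N -> intg (fun x => `|u m x - v x| `^ q) /\ I (fun x => `|u m x - v x| `^ q) <= e.
  move=> hM m Mm.
  apply: (@int_fatou (fun k x => `|u m x - u (s (k + M)%N) x| `^ q)).
  - by move=> k; have [] := LPB (ltW q0) (uq m) (uq (s (k + M)%N)).
  - by apply: mpow; apply: measurable_funB => //; case: (uq m).
  - by move=> k x; exact: powR_ge0.
  - by move=> x; exact: powR_ge0.
  - move: cv; apply: filterS => x cvx.
    have cM : (fun k => u (s (k + M)%N) x) @ \oo --> v x by move: cvx; rewrite -(cvg_shiftn M).
    have c1 : (fun k => u m x - u (s (k + M)%N) x) @ \oo --> u m x - v x by exact: (cvgB (cvg_cst _) cM).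
    exact: (continuous_cvg _ (@powR_norm_cont R q q0 _) c1).
  move=> k; apply: hM => //.
  have sk k' : (k' <= s k')%N by elim: k' => // k' IH; apply: leq_ltn_trans IH (ss' _).
  by apply: leq_trans (sk _); exact: leq_addl.
have [M0 hM0] := uC 1 ltr01.
split.
  have [] := fat _ _ hM0 M0 (leqnn _) => h _.
  have : LP q (fun x => u M0 x - (u M0 x - v x)).
    apply: LPB => //; first exact: ltW.
    by split=> //; apply: measurable_funB => //; case: (uq M0).
  by apply: LP_eq => x; rewrite opprB addrCA subrr addr0.
move=> e /uC[M hM]; exists M => m Mm; exact: (fat _ _ hM m Mm).2.
Qed.

End Int.

(** * Pointwise inequalities for powers *)

Section PowerEstimates.
Context {R : realType}.
Implicit Types (p q a b x y : R).

(** Convexity of the power function, as a rearrangement of Young's inequality for a^(q-1) and b with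
    exponents q/(q-1) and q. *)
Lemma powR_tangent q a b : 1 <= q -> 0 <= a -> 0 <= b ->
  a `^ q + q * a `^ (q - 1) * (b - a) <= b `^ q.
Proof.
move=> q1 a0 b0; have q0 : 0 < q by apply: lt_le_trans q1.
have aa : a * a `^ (q - 1) = a `^ q by rewrite mulr_powRB1.
have [<-|q1'] := eqVneq 1 q.
  by rewrite subrr powRr0 !powRr1//; lra.
have q1'' : 0 < q - 1 by rewrite subr_gt0 lt_neqAle q1'.
have := @conjugate_powR R (a `^ (q - 1)) b (q / (q - 1)) q (powR_ge0 _ _) b0 (divr_gt0 q0 q1'') q0.
have -> : (q / (q - 1))^-1 + q^-1 = 1 by field; rewrite ?gt_eqF.
rewrite -powRrM (_ : (q - 1) * (q / (q - 1)) = q); last by field; rewrite gt_eqF.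
move=> /(_ erefl) h.
have h2 : q * (a `^ (q - 1) * b) <= (q - 1) * a `^ q + b `^ q.
  apply: le_trans (ler_wpM2l (ltW q0) h) _; rewrite le_eqVlt; apply/orP; left; apply/eqP.
  by field; rewrite ?gt_eqF.
rewrite mulrBr -mulrA [q * a `^ _ * a]mulrAC -mulrA aa; lra.
Qed.

(** The derivative of |x|^p divided by p. *)
Definition phi p x := `|x| `^ (p - 2) * x.

Lemma phiN p x : phi p (- x) = - phi p x.
Proof. by rewrite /phi normrN mulrN. Qed.

Lemma phi_abs p x : 1 < p -> `|phi p x| = `|x| `^ (p - 1).
Proof.
move=> p1; rewrite /phi normrM ger0_norm ?powR_ge0// mulrC.
by rewrite (_ : p - 2 = p - 1 - 1) ?mulr_powRB1// ?subr_gt0//; lra.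
Qed.

Lemma phi_mul p x : 1 < p -> phi p x * x = `|x| `^ p.
Proof.
move=> p1; rewrite /phi -mulrA -expr2 -[x ^+ 2]real_normK ?num_real// expr2 mulrA [_ `^ _ * _]mulrC.
rewrite (_ : p - 2 = p - 1 - 1) ?mulr_powRB1// ?subr_gt0//; last by lra.
by rewrite mulrC mulr_powRB1//; lra.
Qed.

Lemma phi_ge0 p x : 1 < p -> 0 <= x -> phi p x = x `^ (p - 1).
Proof.
by move=> p1 x0; have := phi_abs x p1; rewrite (ger0_norm x0) ger0_norm// /phi mulr_ge0 ?powR_ge0.
Qed.

Lemma pow_convex p x y : 1 < p -> `|x| `^ p + p * phi p x * (y - x) <= `|y| `^ p.
Proof.
move=> p1; apply: le_trans (powR_tangent (ltW p1) (normr_ge0 x) (normr_ge0 y)).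
have p0 : 0 < p by lra.
have aa : `|x| * `|x| `^ (p - 1) = `|x| `^ p by rewrite mulr_powRB1.
rewrite lerD2l.
have -> : p * phi p x * (y - x) = p * (phi p x * y - `|x| `^ p) by rewrite -mulrA mulrBr phi_mul.
have -> : p * `|x| `^ (p - 1) * (`|y| - `|x|) = p * (`|x| `^ (p - 1) * `|y| - `|x| `^ p).
  by rewrite -mulrA mulrBr [_ `^ _ * `|x|]mulrC aa.
apply: ler_wpM2l; first exact: ltW.
by rewrite lerD2r; apply: le_trans (ler_norm _) _; rewrite normrM phi_abs.
Qed.

(** For equal signs this is the tangent inequality of exponent p-1. For opposite signs the two
    moduli add up and each base is at most |a - b|. *)
Lemma phi_lip p a b : 2 <= p ->
  `|phi p a - phi p b| <= (p - 1) * (`|a| + `|b|) `^ (p - 2) * `|a - b|.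
Proof.
move=> p2; have p1 : 1 < p by lra.
have mono s t : 0 <= s -> s <= t -> s `^ (p - 2) <= t `^ (p - 2).
  by move=> s0 st; apply: ge0_ler_powR; rewrite ?nnegrE; lra.
wlog ab : a b / `|b| <= `|a|.
  move=> H; have [|/ltW] := lerP `|b| `|a| => h; first exact: H.
  by rewrite distrC [`|a| + _]addrC [`|a - b|]distrC; exact: H.
wlog a0 : a b ab / 0 <= a.
  move=> H; have [|/ltW] := lerP 0 a => h; first exact: H.
  have := H (- a) (- b); rewrite !normrN !phiN oppr_ge0 => /(_ ab h).
  by rewrite -!opprD !normrN.
rewrite (ger0_norm a0) in ab *.
have [b0|b0] := lerP 0 b.
  rewrite (ger0_norm b0) in ab *; rewrite !phi_ge0//.
  have h1 : b `^ (p - 1) <= a `^ (p - 1) by apply: ge0_ler_powR; rewrite ?nnegrE; lra.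
  rewrite !ger0_norm ?subr_ge0//.
  have := @powR_tangent (p - 1) a b _ a0 b0; rewrite (_ : p - 1 - 1 = p - 2); last by lra.
  move=> /(_ ltac:(lra)) h2.
  have h3 : (p - 1) * a `^ (p - 2) * (a - b) <= (p - 1) * (a + b) `^ (p - 2) * (a - b).
    by apply: ler_wpM2r; [lra|apply: ler_wpM2l; [lra|apply: mono; lra]].
  lra.
rewrite (ltr0_norm b0) in ab *.
have -> : phi p b = - (- b) `^ (p - 1) by rewrite -[b in LHS]opprK phiN phi_ge0//; lra.
rewrite phi_ge0// opprK ger0_norm ?addr_ge0 ?powR_ge0// (ger0_norm (_ : 0 <= a - b)); last by lra.
rewrite -!(@mulr_powRB1 _ _ (p - 1)) ?oppr_ge0//; try lra.
rewrite (_ : p - 1 - 1 = p - 2); last by lra.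
have h1 := mono _ _ a0 (ltac:(lra) : a <= a - b).
have h2 := @mono (- b) (a - b) ltac:(lra) ltac:(lra).
have h3 : (a - b) * (a - b) `^ (p - 2) <= (p - 1) * (a - b) `^ (p - 2) * (a - b).
  rewrite -mulrA [(a - b) `^ _ * _]mulrC ler_peMl//; last by lra.
  by rewrite mulr_ge0 ?powR_ge0//; lra.
apply: le_trans h3; rewrite [leRHS]mulrBl -[- (b * _)]mulNr.
by apply: lerD; apply: ler_wpM2l => //; lra.
Qed.

(** Convexity at x makes the remainder nonnegative, convexity at y bounds it by p (phi y - phi x)(y
    - x), and [phi_lip] concludes. *)
Lemma pow_taylor p x y : 2 <= p ->
  `| `|y| `^ p - `|x| `^ p - p * phi p x * (y - x) |
    <= p * (p - 1) * (`|x| + `|y|) `^ (p - 2) * `|y - x| ^+ 2.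
Proof.
move=> p2; have p1 : 1 < p by lra.
have h1 := pow_convex x y p1; have h2 := pow_convex y x p1.
rewrite ger0_norm; last by lra.
have h3 : (phi p y - phi p x) * (y - x) <= (p - 1) * (`|x| + `|y|) `^ (p - 2) * `|y - x| ^+ 2.
  apply: le_trans (ler_norm _) _; rewrite normrM expr2 mulrA ler_wpM2r//.
  by rewrite [`|x| + _]addrC; exact: phi_lip.
have : p * ((phi p y - phi p x) * (y - x)) <= p * ((p - 1) * (`|x| + `|y|) `^ (p - 2) * `|y - x| ^+ 2).
  by apply: ler_wpM2l => //; lra.
have -> : p * (p - 1) * (`|x| + `|y|) `^ (p - 2) * `|y - x| ^+ 2 = p * ((p - 1) * (`|x| + `|y|) `^ (p - 2) * `|y - x| ^+ 2) by ring.
apply: le_trans; lra.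
Qed.

Lemma is_derive_norm_powR p x : 2 < p -> is_derive x (1 : R) (fun t => `|t| `^ p) (p * phi p x).
Proof.
move=> p2; apply/is_derive_epsP => e e0.
pose K := p * (p - 1) * (2 * `|x| + 1) `^ (p - 2) + 1.
have K0 : 0 < K.
  rewrite ltr_wpDl// mulr_ge0 ?powR_ge0//; apply: mulr_ge0; lra.
exists (Num.min 1 (e / K)); first by rewrite lt_min ltr01 divr_gt0.
move=> h h0; rewrite lt_min => /andP[h1 he]; rewrite -[h *: 1]/(h * 1) mulr1.
have hn : 0 < `|h| by rewrite normr_gt0.
have -> : (`|x + h| `^ p - `|x| `^ p) / h - p * phi p x =
   (`|x + h| `^ p - `|x| `^ p - p * phi p x * (x + h - x)) / h by field.
rewrite normrM normfV ler_pdivrMr//; apply: le_trans (pow_taylor x (x + h) (ltW p2)) _.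
rewrite (_ : x + h - x = h); last by ring.
rewrite expr2 mulrA ler_wpM2r//; apply: (@le_trans _ _ (K * `|h|)); last first.
  by rewrite -ler_pdivlMl// mulrC ltW.
apply: ler_wpM2r => //; rewrite /K ler_wpDr//; apply: ler_wpM2l; first by apply: mulr_ge0; lra.
have := ler_normD x h; have := normr_ge0 x; have := normr_ge0 (x + h) => n1 n2 n3.
by apply: ge0_ler_powR; rewrite ?nnegrE; lra.
Qed.

(** Replace each factor by the largest of the three numbers, whose p-th power is one of the
    summands. *)
Lemma young3 p (s t r : R) : 2 <= p -> 0 <= s -> 0 <= t -> 0 <= r ->
  s `^ (p - 2) * t * r <= s `^ p + t `^ p + r `^ p.
Proof.
move=> p2 s0 t0 r0; pose m := Num.max s (Num.max t r).
have m0 : 0 <= m by rewrite /m !le_max s0.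
have [sm tm rm] : [/\ s <= m, t <= m & r <= m] by rewrite /m !le_max !lexx !orbT.
apply: (@le_trans _ _ (m `^ p)).
  rewrite -(@mulr_powRB1 _ m p)//; last by lra.
  rewrite -(@mulr_powRB1 _ m (p - 1))//; last by lra.
  rewrite (_ : p - 1 - 1 = p - 2); last by lra.
  rewrite [leRHS]mulrC; apply: ler_pM => //; first by rewrite mulr_ge0 ?powR_ge0.
  rewrite mulrC; apply: ler_pM => //; rewrite ?powR_ge0//.
  by apply: ge0_ler_powR; rewrite ?nnegrE//; lra.
have := powR_ge0 s p; have := powR_ge0 t p; have := powR_ge0 r p => n1 n2 n3.
by rewrite /m !maxEle; case: (t <= r); case: ifP => _; lra.
Qed.

End PowerEstimates.

(** * Convolution with smooth kernels of bounded support *)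

Section Convolution.
Context {R : realType}.
Variable n : nat.
Local Notation V := 'rV[R]_n.
Local Notation mu := (@lebesgue_rV R n).
Local Notation I f := (Rintegral mu setT f).
Local Notation intg := (@intg _ _ R mu).
Local Notation e_ i := (delta_mx ord0 i : V).
Implicit Types (f g k u v : V -> R) (x y : V).

Definition B0 (r : R) : set V := [set x | `|x| < r].

Lemma B0_open r : open (B0 r).
Proof.
have nc : continuous (fun x : V => `|x|) by exact: norm_continuous.
by move/continuousP : nc => /(_ _ (@open_lt R r)).
Qed.

Lemma B0_meas r : measurable (B0 r).
Proof. by apply: open_measurable_rV; exact: B0_open. Qed.

Lemma mu_intg (A : set V) : measurable A -> (mu A < +oo)%E -> intg (\1_A).
Proof.
move=> mA fA; apply/intgP; split; first exact: measurable_indic.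
under eq_integral do rewrite ger0_norm//.
by rewrite integral_indic// setIT.
Qed.

Lemma B0_intg r : intg (\1_(B0 r)).
Proof. by apply: mu_intg (B0_meas r) _; apply: (lebesgue_rV_bounded (B0_meas r) (r := r)). Qed.

Definition loc u := measurable_fun setT u /\ forall r, intg (fun x => u x * \1_(B0 r) x).

Lemma loc_mul u f : loc u -> measurable_fun setT f -> (exists C, forall x, `|f x| <= C) ->
  bsupp f -> intg (fun x => f x * u x).
Proof.
move=> [mu_ lu] mf [C hC] [r hr].
have C0 : 0 <= C by apply: le_trans (hC 0); exact: normr_ge0.
apply: (intg_le _ _ (intgZ C (intg_norm (lu r)))); first exact: measurable_funM.
move=> x; rewrite normrM; have [xr|xr] := lerP r `|x|.
  by rewrite hr// normr0 mul0r mulr_ge0.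
by rewrite indicE mem_set ?mulr1 ?ler_wpM2r.
Qed.

Lemma cont_mul u f : loc u -> continuous f -> bsupp f -> intg (fun x => f x * u x).
Proof.
move=> lu cf bf; apply: loc_mul => //; first exact: continuous_measurable_rV.
by have [C _ hC] := bsupp_bounded cf bf; exists C.
Qed.

Lemma LP_loc q u : 1 <= q -> LP mu q u -> loc u.
Proof.
move=> q1 [mu_ iu]; split=> // r.
have q0 : 0 < q by lra.
apply: (intg_le _ _ (intgD (B0_intg r) iu)).
  by apply: measurable_funM => //; apply: measurable_indic; exact: B0_meas.
move=> x; rewrite normrM [`|\1__ _|]ger0_norm// indicE; case: (x \in _); last first.
  by rewrite mulr0 add0r powR_ge0.
rewrite mulr1; have [x1|x1] := lerP `|u x| 1; first by rewrite ler_wpDr ?powR_ge0.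
by rewrite ler_wpDl// -[leLHS]powRr1//; apply: ler_powR => //; exact: ltW.
Qed.

Lemma loc_add u v : loc u -> loc v -> loc (fun x => u x + v x).
Proof.
move=> [mu_ iu] [mv iv]; split; first exact: measurable_funD.
by move=> r; under eq_fun do rewrite mulrDl; exact: intgD.
Qed.

Lemma loc_scale (c : R) u : loc u -> loc (fun x => c * u x).
Proof.
move=> [mu_ iu]; split; first exact: measurable_funM.
by move=> r; under eq_fun do rewrite -mulrA; exact: intgZ.
Qed.

Definition conv k u (x : V) : R := I (fun y => k (x - y) * u y).

Lemma reflect_cont k x : continuous k -> continuous (fun y => k (x - y)).
Proof.
move=> ck; apply: eps_continuous => y e e0; have [d d0 hd] := continuous_eps (x - y) ck e0.
exists d => // z hz; apply: hd.
have -> : x - y - (x - z) = z - y by rewrite opprB [z - x]addrC addrACA subrr add0r addrC.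
by rewrite distrC.
Qed.

Lemma reflect_bsupp k x : bsupp k -> bsupp (fun y => k (x - y)).
Proof.
move=> [r hr]; exists (r + `|x|) => y hy; apply: hr.
by rewrite distrC; apply: le_trans (lerB_dist _ _); rewrite lerBrDr.
Qed.

Lemma conv_intg k u x : continuous k -> bsupp k -> loc u -> intg (fun y => k (x - y) * u y).
Proof. by move=> ck bk lu; apply: cont_mul => //; [exact: reflect_cont|exact: reflect_bsupp]. Qed.

(* Uniform bound on a kernel difference supported near [x] controls the convolutions. *)
Lemma conv_bound u x (k : V -> R) (e r : R) : loc u -> measurable_fun setT k ->
  (forall y, `|k y| <= e) -> (forall y, r <= `|y| -> k y = 0) ->
  intg (fun y => k y * u y) /\ `|I (fun y => k y * u y)| <= e * I (fun y => `|u y * \1_(B0 r) y|).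
Proof.
move=> lu mk ke kr.
have i1 : intg (fun y => k y * u y) by apply: loc_mul => //; [exists e|exists r].
have i2 := intg_norm (lu.2 r); split=> //.
apply: le_trans (int_norm i1) _; rewrite -intZ//.
apply: int_le => [| |y]; [exact: intg_norm|exact: intgZ|].
have e0 : 0 <= e by apply: le_trans (ke 0); exact: normr_ge0.
rewrite normrM; have [xr|xr] := lerP r `|y|.
  by rewrite kr// normr0 mul0r mulr_ge0.
by rewrite indicE mem_set ?mulr1 ?ler_wpM2r.
Qed.

Lemma bsupp_pos f : bsupp f -> exists2 r, 0 < r & forall x, r <= `|x| -> f x = 0.
Proof.
move=> [r hr]; exists (`|r| + 1); first by rewrite ltr_wpDl.
by move=> x hx; apply: hr; have := ler_norm r; lra.
Qed.

Lemma small_rel (C e : R) : 0 <= C -> 0 < e -> exists2 e', 0 < e' & e' * C < e.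
Proof.
move=> C0 e0; exists (e / (C + 1)); first by rewrite divr_gt0// ltr_wpDl.
by rewrite -mulrA -[ltRHS]mulr1 ltr_pM2l// mulrC ltr_pdivrMr ?ltr_wpDl//; lra.
Qed.

Lemma conv_cont k u : continuous k -> bsupp k -> loc u -> continuous (conv k u).
Proof.
move=> ck bk lu; apply: eps_continuous => x e e0.
have [r r0 hr] := bsupp_pos bk.
set M := r + `|x| + 1.
have [e' e'0 he'] := small_rel (int_ge0 mu (fun y => normr_ge0 (u y * \1_(B0 M) y))) e0.
have [d d0 hd] := bsupp_ucont ck bk e'0.
exists (Num.min d 1); first by rewrite lt_min d0 ltr01.
move=> x'; rewrite lt_min => /andP[xd x1].
rewrite /conv -intB; [|exact: conv_intg|exact: conv_intg].
rewrite (_ : (fun y => _) = fun y => (k (x - y) - k (x' - y)) * u y); last first.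
  by apply/funext => y; rewrite mulrBl.
apply: le_lt_trans he'.
have [] := @conv_bound u x (fun y => k (x - y) - k (x' - y)) e' M lu => //.
- by apply: measurable_funB; apply: continuous_measurable_rV; exact: reflect_cont.
- by move=> y; apply: hd; rewrite opprB addrA subrK.
- move=> y hy.
  have h1 : r <= `|x - y| by have := lerB_dist y x; rewrite distrC /M in hy *; lra.
  have h2 : r <= `|x' - y|.
    by have := lerB_dist y x; have := ler_distD x' x y; rewrite [`|y - x|]distrC /M in hy *; lra.
  by rewrite !hr// subrr.
Qed.

(** By the mean value theorem and uniform continuity of the partial derivative, the difference
    quotients of the kernel converge uniformly on a fixed ball; [conv_bound] carries this over to
    the integrals. *)
Lemma is_derive_conv k u i x : smooth k -> bsupp k -> loc u ->
  is_derive x (e_ i) (conv k u) (conv (partial i k) u x).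
Proof.
move=> sk bk lu; have ck := smooth_cont sk.
have sp := smooth_partial i sk; have cp := smooth_cont sp; have bp := bsupp_partial i sk bk.
apply/is_derive_epsP => e e0.
have [r r0 hr] := bsupp_pos bk; have [r' r'0 hr'] := bsupp_pos bp.
set M := r + r' + `|x| + 1.
have [e' e'0 he'] := small_rel (int_ge0 mu (fun y => normr_ge0 (u y * \1_(B0 M) y))) e0.
have [d d0 hd] := bsupp_ucont cp bp e'0.
have ne : `|e_ i| <= 1 :> R.
  rewrite -(@ler_pXn2r _ 2) ?nnegrE// expr1n.
  apply: le_trans (norm_sqn _) _; rewrite /sqn (bigD1 i)//= mxE !eqxx expr1n big1 ?addr0// => j ji.
  by rewrite mxE eqxx (negbTE ji)/= expr0n.
exists (Num.min d 1); first by rewrite lt_min d0 ltr01.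
move=> h h0; rewrite lt_min => /andP[hd1 h1].
have hh t : `|t| <= `|h| -> `|t *: e_ i| < d /\ `|t *: e_ i| < 1.
  move=> ht; rewrite normrZ.
  have : `|t| * `|e_ i| <= `|h| * 1 by apply: ler_pM.
  by rewrite mulr1; lra.
have i1 : intg (fun y => k (x + h *: e_ i - y) * u y) by exact: conv_intg.
have i2 : intg (fun y => k (x - y) * u y) by exact: conv_intg.
have i3 : intg (fun y => partial i k (x - y) * u y) by exact: conv_intg.
have -> : (conv k u (x + h *: e_ i) - conv k u x) / h - conv (partial i k) u x =
   I (fun y => ((k (x + h *: e_ i - y) - k (x - y)) / h - partial i k (x - y)) * u y).
  rewrite /conv -intB// [_ / h]mulrC -intZ; last exact: intgB.
  rewrite -intB//; last by apply: intgZ; exact: intgB.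
  by apply: eq_int => y; ring.
apply: le_trans (ltW he').
have [] := @conv_bound u x (fun y => (k (x + h *: e_ i - y) - k (x - y)) / h - partial i k (x - y)) e' M lu => //.
- apply: measurable_funB; last by apply: continuous_measurable_rV; exact: reflect_cont.
  apply: measurable_funM => //.
  by apply: measurable_funB; apply: continuous_measurable_rV; exact: reflect_cont.
- move=> y; have [th hth E] := @mvt_line R V k (partial i k) (e_ i) (x - y) h (fun y => smooth_derive y i sk).
  rewrite (_ : x + h *: e_ i - y = x - y + h *: e_ i); last by rewrite addrAC.
  rewrite E mulrAC divff// mul1r; apply: hd.
  by rewrite addrAC subrr add0r; exact: (hh _ hth).1.
- move=> y hy.
  have h2 : r + r' + 1 <= `|x - y| by have := lerB_dist y x; rewrite distrC /M in hy *; lra.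
  have h3 : r <= `|x + h *: e_ i - y|.
    rewrite (_ : x + h *: e_ i - y = x - y + h *: e_ i); last by rewrite addrAC.
    have := lerB_normD (x - y) (h *: e_ i); have := (hh h (lexx _)).2; lra.
  by rewrite !hr ?hr' ?subrr ?mul0r//; lra.
Qed.

Lemma conv_smooth k u : smooth k -> bsupp k -> loc u -> smooth (conv k u).
Proof.
move=> sk bk lu.
apply: (@smooth_class R n (fun f => exists k, [/\ smooth k, bsupp k & f = conv k u])).
- by move=> _ [k' [sk' bk' ->]]; apply: conv_cont => //; exact: smooth_cont.
- move=> _ i [k' [sk' bk' ->]]; exists (conv (partial i k') u); last first.
    by move=> x; exact: is_derive_conv.
  by exists (partial i k'); split=> //; [exact: smooth_partial|exact: bsupp_partial].
- by exists k.
Qed.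

Lemma partial_conv k u i x : smooth k -> bsupp k -> loc u ->
  partial i (conv k u) x = conv (partial i k) u x.
Proof. by move=> sk bk lu; rewrite /partial; have [] := derivable_val (is_derive_conv i x sk bk lu). Qed.

Lemma conv_bsupp k u : bsupp k -> bsupp u -> bsupp (conv k u).
Proof.
move=> [r hr] [s hs]; exists (r + s) => x hx; rewrite /conv.
rewrite (_ : (fun y => _) = fun=> 0) ?int0//; apply/funext => y.
have [ys|ys] := lerP s `|y|; first by rewrite hs// mulr0.
by rewrite hr ?mul0r//; have := lerB_dist x y; lra.
Qed.

Lemma convD k u v x : continuous k -> bsupp k -> loc u -> loc v ->
  conv k (fun y => u y + v y) x = conv k u x + conv k v x.
Proof.
move=> ck bk lu lv; rewrite /conv -intD; [|exact: conv_intg|exact: conv_intg].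
by apply: eq_int => y; rewrite mulrDr.
Qed.

Lemma convZ k u (c : R) x : continuous k -> bsupp k -> loc u ->
  conv k (fun y => c * u y) x = c * conv k u x.
Proof.
move=> ck bk lu; rewrite /conv -intZ; last exact: conv_intg.
by apply: eq_int => y; rewrite mulrCA.
Qed.

Lemma int_reflect k x : measurable_fun setT k -> (forall y, 0 <= k y) ->
  (\int[mu]_y (k (x - y))%:E = \int[mu]_y (k y)%:E)%E.
Proof.
move=> mk k0.
have mN : measurable_fun setT (fun y => (k (- y))%:E).
  apply/measurable_EFinP; apply: (measurableT_comp mk).
  exact: (measurable_rVN (@measurable_id _ V setT)).
rewrite -(integral_rV_opp (f := fun y => (k y)%:E)); [|exact/measurable_EFinP|by move=> y; rewrite lee_fin].
rewrite -(integral_rV_shift (- x) mN); last by move=> y; rewrite lee_fin.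
by apply: eq_integral => y _; rewrite opprB.
Qed.

Lemma measurable_conv_kernel k u : measurable_fun setT k -> measurable_fun setT u ->
  measurable_fun setT (fun z : V * V => k (z.1 - z.2) * u z.2).
Proof.
move=> mk mu_; apply: measurable_funM.
  apply: (measurableT_comp mk); apply: measurable_rVB; [exact: measurable_fst|exact: measurable_snd].
exact: (measurableT_comp mu_ measurable_snd).
Qed.

Definition kernel k := [/\ smooth k, bsupp k, forall x, 0 <= k x & I k = 1].

Lemma kernel_mass k x : kernel k -> (\int[mu]_y (k (x - y))%:E = 1)%E.
Proof.
move=> [sk bk k0 k1]; have ck := smooth_cont sk.
rewrite int_reflect//; last exact: continuous_measurable_rV.
by rewrite -EFin_int ?k1//; exact: bsupp_integrable.
Qed.

Lemma kernel_tonelli k f : kernel k -> measurable_fun setT f -> (forall x, 0 <= f x) ->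
  (\int[mu]_x \int[mu]_y (k (x - y) * f y)%:E = \int[mu]_y (f y)%:E)%E.
Proof.
move=> kk mf f0; have [sk bk k0 k1] := kk; have ck := smooth_cont sk; have mk := continuous_measurable_rV ck.
rewrite (@fubini_tonelli _ _ _ _ R mu mu (fun z : V * V => (k (z.1 - z.2) * f z.2)%:E)); last 2 first.
- by apply/measurable_EFinP; exact: measurable_conv_kernel.
- by move=> z; rewrite lee_fin mulr_ge0.
apply: eq_integral => y _ /=.
under eq_integral do rewrite mulrC EFinM.
rewrite ge0_integralZl//.
- rewrite (integral_rV_shift (- y) (f := fun x => (k x)%:E)).
  + by rewrite -EFin_int ?k1 ?mule1//; exact: bsupp_integrable.
  + exact/measurable_EFinP.
  + by move=> x; rewrite lee_fin.
- apply/measurable_EFinP; apply: (measurableT_comp mk).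
  by apply: measurable_rVB; [exact: measurable_id|exact: measurable_cst].
- by move=> x _; rewrite lee_fin.
- by rewrite lee_fin.
Qed.

Lemma conv_le k u v x : kernel k -> loc u -> loc v -> (forall y, u y <= v y) -> conv k u x <= conv k v x.
Proof.
move=> [sk bk k0 _] lu lv uv; have ck := smooth_cont sk.
by apply: int_le => [| |y]; [exact: conv_intg|exact: conv_intg|rewrite ler_wpM2l].
Qed.

Lemma loc_cst c : loc (fun=> c).
Proof. by split=> // r; apply: intgZ; exact: B0_intg. Qed.

Lemma conv_cst k c x : kernel k -> conv k (fun=> c) x = c.
Proof.
move=> kk; have [sk bk k0 k1] := kk; have ck := smooth_cont sk.
rewrite /conv; under eq_Rintegral do rewrite mulrC.
have ci : intg (fun y => k (x - y)).
  by have := conv_intg x ck bk (loc_cst 1); under eq_fun do rewrite mulr1.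
rewrite intZ//; suff -> : I (fun y => k (x - y)) = 1 by rewrite mulr1.
by apply: EFin_inj; rewrite EFin_int// kernel_mass.
Qed.

Lemma loc_norm u : loc u -> loc (fun x => `|u x|).
Proof.
move=> [mu_ iu]; split; first exact: measurableT_comp.
move=> r; have := intg_norm (iu r); congr intg; apply/funext => x.
by rewrite normrM [`|\1__ _|]ger0_norm.
Qed.

Lemma conv_norm k u x : kernel k -> loc u -> `|conv k u x| <= conv k (fun y => `|u y|) x.
Proof.
move=> [sk bk k0 _] lu; have ck := smooth_cont sk.
apply: le_trans (int_norm (conv_intg x ck bk lu)) _; rewrite le_eqVlt; apply/orP; left; apply/eqP.
by apply: eq_int => y; rewrite normrM ger0_norm.
Qed.

(** Jensen's inequality: integrate the tangent line of t^q at t = |conv k u x| against the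
    probability density k(x - .). *)
Lemma conv_jensen k u q x : kernel k -> 1 <= q -> LP mu q u ->
  `|conv k u x| `^ q <= conv k (fun y => `|u y| `^ q) x.
Proof.
move=> kk q1 uq; have [sk bk k0 k1] := kk; have ck := smooth_cont sk.
have lu := LP_loc q1 uq; have q0 : 0 < q by lra.
have lq : loc (fun y => `|u y| `^ q).
  split; first by case: uq => m _; exact: mpow.
  move=> r; apply: (intg_le _ _ uq.2).
    by apply: measurable_funM; [case: uq => m _; exact: mpow|apply: measurable_indic; exact: B0_meas].
  by move=> y; rewrite ger0_norm ?mulr_ge0 ?powR_ge0// indicE; case: (y \in _); rewrite ?mulr1// mulr0 powR_ge0.
set a := `|conv k u x|; pose t := q * a `^ (q - 1).
have t0 : 0 <= t by rewrite mulr_ge0 ?powR_ge0// ltW.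
have ha : a <= conv k (fun y => `|u y|) x by exact: conv_norm.
have : conv k (fun y => (a `^ q - t * a) + t * `|u y|) x <= conv k (fun y => `|u y| `^ q) x.
  apply: conv_le => //.
    by apply: loc_add; [exact: loc_cst|apply: loc_scale; exact: loc_norm].
  by move=> y; have := powR_tangent q1 (normr_ge0 (conv k u x)) (normr_ge0 (u y)); rewrite -/a -/t; lra.
rewrite convD//; [|exact: loc_cst|by apply: loc_scale; exact: loc_norm].
rewrite conv_cst// convZ//; last exact: loc_norm.
by have := ler_wpM2l t0 ha; lra.
Qed.

Lemma conv_LP k u q : kernel k -> 1 <= q -> LP mu q u ->
  LP mu q (conv k u) /\ I (fun x => `|conv k u x| `^ q) <= I (fun x => `|u x| `^ q).
Proof.
move=> kk q1 uq; have [sk bk k0 k1] := kk; have ck := smooth_cont sk; have q0 : 0 < q by lra.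
have mc : measurable_fun setT (conv k u).
  by apply: continuous_measurable_rV; apply: conv_cont => //; exact: LP_loc uq.
have [] : intg (fun x => `|conv k u x| `^ q) /\ I (fun x => `|conv k u x| `^ q) <= I (fun x => `|u x| `^ q).
  apply: int_le_ereal; [exact: mpow|by move=> x; exact: powR_ge0|].
  rewrite EFin_int; last by case: uq.
  rewrite -(kernel_tonelli kk (f := fun y => `|u y| `^ q)); last 2 first.
  - by case: uq => m _; exact: mpow.
  - by move=> x; exact: powR_ge0.
  have mF : measurable_fun setT (fun z : V * V => (k (z.1 - z.2) * `|u z.2| `^ q)%:E).
    apply/measurable_EFinP.
    apply: (@measurable_conv_kernel k (fun y => `|u y| `^ q)); first exact: continuous_measurable_rV.
    by case: uq => m _; exact: mpow.
  have F0 z : (0 <= (k (z.1 - z.2) * `|u z.2| `^ q)%:E)%E by rewrite lee_fin mulr_ge0 ?powR_ge0.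
  apply: ge0_le_integral => //.
  - by apply/measurable_EFinP; exact: mpow.
  - exact: (@measurable_fun_fubini_tonelli_F _ _ _ _ R mu _ mF F0).
  move=> x _; apply: le_trans (_ : ((conv k (fun y => `|u y| `^ q) x)%:E <= _)%E).
    by rewrite lee_fin; exact: conv_jensen.
  rewrite /conv /Rintegral; case: (ltP (\int[mu]_y (k (x - y) * `|u y| `^ q)%:E)%E +oo%E) => h.
    by rewrite fineK// ge0_fin_numE//; apply: integral_ge0 => y _; exact: (F0 (x, y)).
  by apply: le_trans h; rewrite leey.
by split.
Qed.

End Convolution.

(** * Radial mollifiers and their convergence *)

Section Mollifiers.
Context {R : realType}.
Variable n : nat.
Local Notation V := 'rV[R]_n.
Local Notation mu := (@lebesgue_rV R n).
Local Notation I f := (Rintegral mu setT f).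
Local Notation intg := (@intg _ _ R mu).
Implicit Types (f g k u v : V -> R) (x y : V).

Lemma bump_bsupp (a : R) : 0 < a -> bsupp (@bump R n a).
Proof.
move=> a0; exists (Num.sqrt a^-1) => x hx; apply: bump_eq0 => //.
apply: le_trans (norm_sqn x); rewrite -[leLHS]sqr_sqrtr ?invr_ge0 ?(ltW a0)//.
by rewrite ler_pXn2r ?nnegrE ?sqrtr_ge0.
Qed.

Lemma bump_intg (a : R) : 0 < a -> intg (@bump R n a).
Proof.
move=> a0; apply: bsupp_integrable; [exact/smooth_cont/bump_smooth|exact: bump_bsupp].
Qed.

Lemma bump_int_gt0 (a : R) : 0 < a -> 0 < I (@bump R n a).
Proof.
move=> a0; pose r := Num.sqrt (2 * a)^-1.
have r0 : 0 < r by rewrite sqrtr_gt0 invr_gt0 mulr_gt0.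
have mE : measurable (eball (0 : V) r) by exact: eball_measurable.
have fE : (mu (eball (0 : V) r) < +oo)%E by apply: eball_fin; exact: ltW.
apply: (@lt_le_trans _ _ (I (fun x => expR (- 2) * \1_(eball (0 : V) r) x))).
  rewrite intZ; last exact: mu_intg.
  rewrite mulr_gt0 ?expR_gt0// -lte_fin EFin_int; last exact: mu_intg.
  by rewrite integral_indic// setIT; exact: eball_pos.
apply: int_le; [by apply: intgZ; exact: mu_intg|exact: bump_intg|move=> x].
rewrite indicE; have [xE|xE] := boolP (x \in _); last by rewrite mulr0 bump_ge0.
rewrite mulr1; apply: bump_lb.
move: xE; rewrite inE /eball /= subr0 /r sqr_sqrtr ?invr_ge0 ?mulr_ge0 ?(ltW a0)// => h.
have := ltW h; rewrite -(ler_pM2l a0) => /le_trans; apply.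
by rewrite le_eqVlt; apply/orP; left; apply/eqP; field; rewrite gt_eqF.
Qed.

(** Normalised bumps supported in the ball of radius 1/(j+1). They are radial so that mollification
    commutes with orthogonal maps. *)
Definition rho (j : nat) x : R := (I (@bump R n (j.+1%:R ^+ 2)))^-1 * bump (j.+1%:R ^+ 2) x.

Let jp (j : nat) : 0 < j.+1%:R ^+ 2 :> R.
Proof. by rewrite exprn_gt0. Qed.

Lemma rho_kernel j : kernel (rho j).
Proof.
have I0 := bump_int_gt0 (jp j).
have sc : smooth (fun _ : V => (I (@bump R n (j.+1%:R ^+ 2)))^-1).
  apply: (@smooth_class R n (fun f => exists c, f = fun=> c)).
  - by move=> _ [c ->]; exact: cst_continuous.
  - by move=> _ i [c ->]; exists (fun=> 0); [by exists 0|move=> x; exact: is_derive_cst].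
  - by eexists.
split.
- by apply: smooth_mul => //; exact: bump_smooth.
- by have [r hr] := bump_bsupp (jp j); exists r => x /hr; rewrite /rho => ->; rewrite mulr0.
- by move=> x; rewrite mulr_ge0 ?bump_ge0// invr_ge0 ltW.
- by rewrite intZ ?mulVf ?gt_eqF//; exact: bump_intg.
Qed.

Lemma rho_supp j x : j.+1%:R^-1 <= `|x| -> rho j x = 0.
Proof.
move=> hx; rewrite /rho bump_eq0 ?mulr0//.
apply: le_trans (norm_sqn x); rewrite -exprVn ler_pXn2r ?nnegrE//.
Qed.

Lemma rho_orth j (g : 'M[R]_n) x : g *m g^T = 1%:M -> rho j (x *m g) = rho j x.
Proof. by move=> gg; rewrite /rho bump_orth. Qed.

Lemma intg_loc f : intg f -> loc f.
Proof.
move=> fi; have mf := intg_meas fi; split=> // r.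
apply: (intg_le _ _ (intg_norm fi)).
  by apply: measurable_funM => //; apply: measurable_indic; exact: B0_meas.
by move=> x; rewrite normrM indicE; case: (x \in _); rewrite ?normr1 ?mulr1// normr0 mulr0.
Qed.

Lemma conv_L1 k f : kernel k -> intg f ->
  intg (conv k f) /\ I (fun x => `|conv k f x|) <= I (fun x => `|f x|).
Proof.
move=> kk fi; have f1 : LP mu 1 f.
  by split; [exact: (intg_meas fi)|under eq_fun do rewrite powRr1//; exact: intg_norm].
have [[mc h1] h2] := conv_LP kk (lexx 1) f1; split.
  by apply: (intg_le mc _ h1) => x; rewrite powRr1.
have E (h : V -> R) : (fun x => `|h x| `^ 1) = (fun x => `|h x|) by apply/funext => x; rewrite powRr1.
by move: h2; rewrite !E.
Qed.

Lemma rho_ucvg g e j x : continuous g -> bsupp g ->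
  (forall y, `|x - y| < j.+1%:R^-1 -> `|g x - g y| <= e) -> `|conv (rho j) g x - g x| <= e.
Proof.
move=> cg bg h; have kk := rho_kernel j; have [sk bk k0 k1] := kk.
have lg : loc g by exact/intg_loc/bsupp_integrable.
have ck := smooth_cont sk.
have lg' : loc (fun y => g y - g x) by apply: loc_add => //; exact: loc_cst.
have -> : conv (rho j) g x - g x = conv (rho j) (fun y => g y - g x) x.
  by rewrite convD// ?conv_cst//; exact: loc_cst.
apply: le_trans (conv_norm x kk lg') _; rewrite -[leRHS](conv_cst e x kk).
apply: int_le => [| |y].
- by apply: conv_intg => //; exact: loc_norm.
- by apply: conv_intg => //; exact: loc_cst.
have [xy|xy] := ltrP `|x - y| j.+1%:R^-1; first by rewrite ler_wpM2l// distrC h.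
by rewrite rho_supp ?mul0r.
Qed.

Lemma natinv_lt (d : R) : 0 < d -> exists J : nat, forall j, (J <= j)%N -> j.+1%:R^-1 < d.
Proof.
move=> d0; exists (Num.truncn d^-1) => j hj.
rewrite invf_plt ?posrE//; apply: lt_le_trans (truncnS_gt _) _; by rewrite ler_nat.
Qed.

Lemma rho_L1 f : intg f -> forall e, 0 < e -> exists J : nat, forall j, (J <= j)%N ->
  I (fun x => `|conv (rho j) f x - f x|) <= e.
Proof.
move=> fi e e0; have e3 : 0 < e / 3 by rewrite divr_gt0.
have [_ /(_ _ e3)[g [cg bg] hg]] := L1approx_integrable fi.
have gi : intg g by exact: bsupp_integrable.
have fgi := intgB fi gi.
have hfg : I (fun x => `|f x - g x|) <= e / 3 by rewrite -lee_fin EFin_int//; exact: intg_norm.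
have [r r0 hr] := bsupp_pos bg.
have B00 : 0 <= I (\1_(B0 (r + 1)) : V -> R) by apply: int_ge0.
have [e' e'0 he'] := small_rel B00 e3.
have [d d0 hd] := bsupp_ucont cg bg e'0.
have [J hJ] := natinv_lt d0.
exists J => j Jj; have kk := rho_kernel j; have [sk bk k0 k1] := kk; have ck := smooth_cont sk.
have [cfi _] := conv_L1 kk fi; have [cgi _] := conv_L1 kk gi; have [cdi hcd] := conv_L1 kk fgi.
have B1 : I (fun x => `|conv (rho j) g x - g x|) <= e / 3.
  apply: le_trans (ltW he'); rewrite -intZ; last exact: B0_intg.
  apply: int_le => [| |x].
  - by apply: intg_norm; exact: intgB.
  - by apply: intgZ; exact: B0_intg.
  rewrite indicE; have [xB|xB] := boolP (x \in _).
    by rewrite mulr1; apply: rho_ucvg => // y hy; apply: hd; apply: lt_trans hy (hJ _ Jj).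
  move: xB; rewrite notin_setE /B0 /= => /negP; rewrite -leNgt => xB.
  rewrite mulr0; apply: rho_ucvg => // y hy.
  have j1 : j.+1%:R^-1 <= 1 :> R by rewrite invf_le1// ler1n.
  have hy' := lt_le_trans hy j1; have h3 := lerB_dist x y; have h4 : r <= `|y| by lra.
  have h5 : r <= `|x| by lra.
  by rewrite !hr// subrr normr0.
apply: (@le_trans _ _ (I (fun x => `|conv (rho j) (fun y => f y - g y) x| + (`|conv (rho j) g x - g x| + `|f x - g x|)))).
  apply: int_le => [| |x].
  - by apply: intg_norm; exact: intgB.
  - by apply: intgD; [exact: intg_norm|apply: intgD; apply: intg_norm; exact: intgB].
  rewrite (_ : conv (rho j) (fun y => f y - g y) x = conv (rho j) f x - conv (rho j) g x); last first.
    rewrite /conv -intB; [|by apply: conv_intg => //; exact: intg_loc..].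
    by apply: eq_int => y; rewrite mulrBr.
  rewrite (_ : conv (rho j) f x - f x = (conv (rho j) f x - conv (rho j) g x) + ((conv (rho j) g x - g x) - (f x - g x))); last by ring.
  by apply: le_trans (ler_normD _ _) _; rewrite lerD2l; exact: ler_normB.
rewrite intD; [|exact: intg_norm|by apply: intgD; apply: intg_norm; exact: intgB].
rewrite intD; [|by apply: intg_norm; exact: intgB|by apply: intg_norm; exact: intgB].
lra.
Qed.

(** Mollify the truncations of u to larger and larger balls, with scales fast enough for
    Borel-Cantelli. Near a fixed point the truncation is eventually invisible. *)
Lemma rho_ae u : loc u -> exists s : nat -> nat, (forall j, (j <= s j)%N) /\
  {ae mu, forall x, (fun j => conv (rho (s j)) u x) @ \oo --> u x}.
Proof.
move=> lu; pose f j x := u x * \1_(B0 j%:R) x.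
have fi j : intg (f j) by exact: lu.2.
have /choice[s sP] (j : nat) : exists t, (j <= t)%N /\ I (fun x => `|conv (rho t) (f j) x - f j x|) <= 4 ^- j.
  have p4 : 0 < (4 : R) ^- j by rewrite invr_gt0 exprn_gt0.
  have [J hJ] := rho_L1 (fi j) p4; exists (maxn j J); split; first exact: leq_maxl.
  by apply: hJ; exact: leq_maxr.
exists s; split; first by move=> j; have [] := sP j.
have hi j : intg (fun x => `|conv (rho (s j)) (f j) x - f j x|).
  by apply: intg_norm; apply: intgB => //; have [] := conv_L1 (rho_kernel (s j)) (fi j).
have H2 j : (\int[mu]_x (`|conv (rho (s j)) (f j) x - f j x|)%:E <= (4 ^- j)%:E)%E.
  by rewrite -EFin_int// lee_fin; case: (sP j).
have := borel_cantelli_ae (fun j => intg_meas (hi j)) (fun j x => normr_ge0 _) H2.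
apply: filterS => x [C hC].
(* The kernel has radius at most 1, so for j >= |x| + 1 only values of u inside the j-th ball enter
   at x. *)
have ev (j : nat) : `|x| + 1 <= j%:R -> `|conv (rho (s j)) u x - u x| <= C * 2 ^- j.
  move=> hj; have := hC j; rewrite /f.
  rewrite [\1__ x]indicE mem_set ?mulr1; last by rewrite /B0 /=; lra.
  suff -> : conv (rho (s j)) (fun x => u x * \1_(B0 j%:R) x) x = conv (rho (s j)) u x by [].
  apply: eq_int => y; have [xy|xy] := ltrP `|x - y| (s j).+1%:R^-1; last by rewrite rho_supp ?mul0r.
  rewrite indicE mem_set ?mulr1// /B0 /=.
  have j1 : (s j).+1%:R^-1 <= 1 :> R by rewrite invf_le1// ler1n.
  by have xy' := lt_le_trans xy j1; have := lerB_dist y x; rewrite distrC; lra.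
apply/cvgrPdist_le => e e0.
have C0' : 0 <= C by have := hC 0%N; rewrite expr0 invr1 mulr1; apply: le_trans.
have C0 : 0 <= `|C| by [].
have [e' e'0 he'] := small_rel C0 e0.
have g0 : (fun j => 2^-1 ^+ j : R) @ \oo --> (0 : R).
  by apply: cvg_expr; rewrite ger0_norm; lra.
move/cvgrPdist_le : g0 => /(_ _ e'0) [J _ hJ].
exists (maxn J (Num.truncn (`|x| + 1)).+1) => // j /=; rewrite geq_max => /andP[Jj xj].
rewrite distrC; apply: le_trans (ev j _) _.
  by apply: ltW; apply: lt_le_trans (truncnS_gt _) _; rewrite ler_nat.
apply: le_trans (ltW he'); rewrite mulrC; apply: ler_pM => //.
- by have := hJ j Jj; rewrite sub0r normrN exprVn ger0_norm// invr_ge0 exprn_ge0.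
- exact: ler_norm.
Qed.

End Mollifiers.

(** * Integration along lines and translation estimates *)

Section Lines.
Context {R : realType}.
Local Notation leb := (@lebesgue_measure R).
Local Open Scope ereal_scope.

Lemma ftc_abs (h h' : R -> R) (a b : R) : (a <= b)%R ->
  (forall t, is_derive t (1 : R)%R h (h' t)) -> continuous h' ->
  `|h b - h a|%:E <= \int[leb]_(t in `[a, b]) `|h' t|%:E.
Proof.
move=> ab dh ch; have [<-|anb] := eqVneq a b.
  by rewrite subrr normr0; apply: integral_ge0 => t _; rewrite lee_fin.
have ab' : (a < b)%R by rewrite lt_neqAle anb.
have dv t : derivable h t 1 by have [_] := derivable_val (dh t).
have ch0 t : {for t, continuous h} by apply: differentiable_continuous; exact/derivable1_diffP.
have := @continuous_FTC2 R h' h a b ab' (continuous_subspaceT ch).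
have H : derivable_oo_LRcontinuous h a b.
  split; first by move=> t _; exact: dv.
  - by apply: cvg_at_right_filter; exact: ch0.
  - by apply: cvg_at_left_filter; exact: ch0.
move=> /(_ H) H2; rewrite -[(h b - h a)%R]/(fine ((h b)%:E - (h a)%:E)).
rewrite -H2; last by move=> t _; rewrite derive1E; have [] := derivable_val (dh t).
have mh : measurable_fun `[a, b] (fun t => (h' t)%:E).
  apply/measurable_EFinP; apply: measurable_funTS; exact: continuous_measurable_fun.
apply: le_trans (le_abse_integral leb _ mh) => //.
by rewrite H2 //= => t _; rewrite derive1E; have [] := derivable_val (dh t).
Qed.

Variable n : nat.
Local Notation V := 'rV[R]_n.
Local Notation mu := (@lebesgue_rV R n).
Implicit Types (x z : V).

Lemma line_cont (g : V -> R) x z : continuous g -> continuous (fun t : R => g (x + t *: z)%R).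
Proof.
move=> cg; apply: eps_continuous => t e e0.
have [d d0 hd] := continuous_eps (x + t *: z)%R cg e0.
exists (d / (`|z| + 1))%R; first by rewrite divr_gt0// ltr_wpDl.
move=> s hs; apply: hd; rewrite opprD addrACA subrr add0r -scalerBl normrZ.
have z1 : (0 < `|z| + 1)%R by rewrite ltr_wpDl.
move: hs; rewrite ltr_pdivlMr// => hs; apply: le_lt_trans hs.
by rewrite ler_wpM2l// lerDl.
Qed.

Lemma ftc_line (f g : V -> R) x z (a b : R) : (a <= b)%R ->
  (forall y, is_derive y z f (g y)) -> continuous g ->
  `|f (x + b *: z) - f (x + a *: z)|%:E <= \int[leb]_(t in `[a, b]) `|g (x + t *: z)|%:E.
Proof.
move=> ab dg cg; apply: (@ftc_abs (fun t => f (x + t *: z)%R) (fun t => g (x + t *: z)%R)) => //.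
  by move=> t; apply: (proj1 (is_derive_line f x z t _)).
exact: line_cont.
Qed.

Lemma measurable_line z : measurable_fun setT (fun p : V * measurableTypeR R => (p.1 + p.2 *: z)%R : V).
Proof.
apply: measurable_rVD; first exact: measurable_fst.
apply: measurable_fun_coordP => i; under eq_fun do rewrite mxE.
by apply: measurable_funM => //; exact: measurable_snd.
Qed.

(** The increment is at most the integral of |g| over a unit segment; square it, exchange the
    integrals, and remove the shift t z by translation invariance. *)
Lemma translation_smooth (f g : V -> R) z : (forall y, is_derive y z f (g y)) -> continuous f ->
  continuous g ->
  \int[mu]_x ((f (x + z) - f x) ^+ 2)%:E <= \int[mu]_x (g x ^+ 2)%:E.
Proof.
move=> dg cf cg.
pose U : set R := `[0%R, 1%R]%classic.
have mU : measurable U by exact: measurable_itv.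
have mg := continuous_measurable_rV cg; have mf := continuous_measurable_rV cf.
pose F (p : V * measurableTypeR R) := ((g (p.1 + p.2 *: z)) ^+ 2 * \1_U p.2)%:E.
have mF : measurable_fun setT F.
  apply/measurable_EFinP; apply: measurable_funM.
    by apply: measurable_funX; apply: (measurableT_comp mg); exact: measurable_line.
  have mi : measurable_fun setT (fun t : measurableTypeR R => \1_U t : R).
    exact: measurable_indic.
  exact: (measurableT_comp mi measurable_snd).
have F0 p : 0 <= F p by rewrite lee_fin mulr_ge0 ?sqr_ge0.
have i1 (c : R) : (0 <= c)%R -> \int[leb]_t (c * \1_U t)%:E = c%:E.
  move=> c0; under eq_integral do rewrite EFinM.
  rewrite ge0_integralZl//; last by apply/measurable_EFinP; exact: measurable_indic.
  have U1 : leb U = 1%:E by rewrite /U lebesgue_measure_itv /= lte_fin ltr01 -EFinB subr0.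
  have -> : \int[leb]_t (\1_U t)%:E = 1%:E by rewrite integral_indic// setIT.
  by rewrite mule1.
apply: (@le_trans _ _ (\int[mu]_x \int[leb]_t F (x, t))).
  apply: ge0_le_integral => //.
  - by move=> x _; rewrite lee_fin sqr_ge0.
  - apply/measurable_EFinP; apply: measurable_funX; apply: measurable_funB => //.
    apply: (measurableT_comp mf); apply: measurable_rVD; [exact: measurable_id|exact: measurable_cst].
  - exact: (@measurable_fun_fubini_tonelli_F _ _ _ _ R leb _ mF F0).
  move=> x _; pose c := `|f (x + z) - f x|%R.
  have c0 : (0 <= c)%R by exact: normr_ge0.
  have gm : measurable_fun setT (fun t : R => g (x + t *: z)%R).
    by apply: continuous_measurable_fun; exact: line_cont.
  have im : measurable_fun setT (\1_U : R -> R) by exact: measurable_indic.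
  have Fm : measurable_fun setT (fun t : R => F (x, t)).
    by apply/measurable_EFinP; apply: measurable_funM => //; exact: measurable_funX.
  have h1 : c%:E <= \int[leb]_t (`|g (x + t *: z)| * \1_U t)%:E.
    have := @ftc_line f g x z 0%R 1%R ler01 dg cg; rewrite scale1r scale0r addr0 -/c => /le_trans; apply.
    rewrite integral_mkcond le_eqVlt; apply/orP; left; apply/eqP; apply: eq_integral => t _.
    by rewrite patchE indicE /U; case: ifP => _; rewrite ?mulr1 ?mulr0.
  have -> : ((f (x + z) - f x) ^+ 2 = c ^+ 2)%R by rewrite /c real_normK ?num_real.
  (* Cauchy-Schwarz on the unit segment in linear form: 2 c |g| <= |g|^2 + c^2 is integrated in t,
     with c the absolute increment. *)
  suff : (2 * c)%:E * c%:E <= \int[leb]_t F (x, t) + (c ^+ 2)%:E.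
    rewrite -EFinM -leeBlDr// -EFinB; apply: le_trans; rewrite lee_fin; lra.
  apply: (@le_trans _ _ ((2 * c)%:E * \int[leb]_t (`|g (x + t *: z)| * \1_U t)%:E)).
    by apply: lee_wpmul2l => //; rewrite lee_fin mulr_ge0.
  have gm2 : measurable_fun setT (fun t : R => (`|g (x + t *: z)| * \1_U t)%:E).
    by apply/measurable_EFinP; apply: measurable_funM => //; exact: measurableT_comp.
  have c20 : 0 <= (2 * c)%:E by rewrite lee_fin mulr_ge0.
  have p0 t : setT t -> 0 <= (`|g (x + t *: z)| * \1_U t)%:E by move=> _; rewrite lee_fin mulr_ge0.
  rewrite -ge0_integralZl//.
  rewrite -(i1 (c ^+ 2)%R (sqr_ge0 _)) -ge0_integralD//; last 2 first.
  - by move=> t _; rewrite lee_fin mulr_ge0 ?sqr_ge0.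
  - by apply/measurable_EFinP; exact: measurable_funM.
  apply: ge0_le_integral => //.
  - by move=> t _; rewrite -EFinM lee_fin !mulr_ge0.
  - exact: measurable_funeM.
  - by apply: emeasurable_funD => //; apply/measurable_EFinP; exact: measurable_funM.
  move=> t _; rewrite -EFinM -EFinD lee_fin /= indicE; case: (t \in _); rewrite ?mulr0 ?addr0// !mulr1.
  have : (g (x + t *: z) ^+ 2 = `|g (x + t *: z)| ^+ 2)%R by rewrite real_normK ?num_real.
  move=> ->; have := sqr_ge0 (`|g (x + t *: z)| - c)%R; nra.
rewrite (@fubini_tonelli _ _ _ _ R mu leb F mF F0).
rewrite [leRHS](_ : _ = \int[leb]_t (\int[mu]_x (g x ^+ 2)%:E * (\1_U t)%:E)).
  rewrite le_eqVlt; apply/orP; left; apply/eqP; apply: eq_integral => t _.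
  rewrite /F /=; under eq_integral do rewrite EFinM muleC.
  have mg2 : measurable_fun setT (fun x => (g x ^+ 2)%:E) by apply/measurable_EFinP; exact: measurable_funX.
  rewrite ge0_integralZl//.
  - by rewrite muleC (integral_rV_shift (t *: z) mg2)// => x; rewrite lee_fin sqr_ge0.
  - apply: (measurableT_comp mg2); apply: measurable_rVD; [exact: measurable_id|exact: measurable_cst].
  - by move=> x _; rewrite lee_fin sqr_ge0.
rewrite ge0_integralZl//.
- have -> : \int[leb]_t (\1_U t)%:E = 1%:E by rewrite -[RHS](i1 1%R ler01); apply: eq_integral => t _; rewrite mul1r.
  by rewrite mule1.
- by apply/measurable_EFinP.
- by apply: integral_ge0 => x _; rewrite lee_fin sqr_ge0.
Qed.

End Lines.

(** * The Gagliardo-Nirenberg inequality by induction on the dimension *)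

Section Gagliardo.
Context {R : realType}.
Local Notation leb := (@lebesgue_measure R).
Local Notation mu n := (@lebesgue_rV R n).
Local Open Scope ereal_scope.

(** The only information kept about derivatives: through each point and in each coordinate
    direction, the integral of g_i along the line dominates F. *)
Definition line_dominated n (F : 'rV[R]_n -> R) (g : 'I_n -> 'rV[R]_n -> \bar R) :=
  [/\ measurable_fun setT F, forall x, (0 <= F x)%R,
      forall i, measurable_fun setT (g i), forall i x, 0 <= g i x &
      forall i x, (F x)%:E <= \int[leb]_s g i (x + s *: delta_mx ord0 i)%R].

(** The form that a slice needs: beside the n directions inside the slice there is a bound [a]
    coming from the direction transverse to it. Its exponent 1 + 1/n is that of [gagliardo n], which
    lives in one dimension more. *)
Definition slice_bound n := forall F g (a : 'rV[R]_n -> \bar R), line_dominated F g ->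
  measurable_fun setT a -> (forall x, (F x)%:E <= a x) ->
  \int[mu n]_x (F x `^ (1 + n%:R^-1))%:E <= (\sum_i \int[mu n]_x g i x) * (\int[mu n]_x a x) `^ n%:R^-1.

Definition gagliardo n := forall F g, line_dominated F g ->
  \int[mu n.+1]_x (F x `^ (1 + n%:R^-1))%:E <= (\sum_i \int[mu n.+1]_x g i x) `^ (1 + n%:R^-1).

Lemma integral_rV0 (f : 'rV[R]_0 -> \bar R) : measurable_fun setT f -> (forall x, 0 <= f x) ->
  \int[mu 0]_x f x = f 0%R.
Proof. by move=> mf f0; rewrite integral_dirac// diracT mul1e. Qed.

Lemma consrV_e0 n (t s : R) (y : 'rV[R]_n) :
  (consrV (t, y) + s *: delta_mx ord0 ord0 = consrV (t + s, y))%R.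
Proof.
rewrite -[y in RHS]addr0 -consrV_add; congr (_ + _)%R.
apply/rowP => i; rewrite [LHS]mxE [in LHS]mxE eqxx /= /consrV; case: (split_ordP (m := 1) (n := n) i) => j ->.
  have -> : (lshift n j == ord0 :> 'I_n.+1) = true by apply/eqP/val_inj; rewrite /= ord1.
  by rewrite (@row_mxEl _ 1 1 n) mxE mulr1.
have -> : (rshift 1 j == ord0 :> 'I_n.+1) = false by [].
by rewrite (@row_mxEr _ 1 1 n) mxE mulr0.
Qed.

Lemma consrV_eS n (t s : R) (y : 'rV[R]_n) (i : 'I_n) :
  (consrV (t, y) + s *: delta_mx ord0 (lift ord0 i) = consrV (t, y + s *: delta_mx ord0 i))%R.
Proof.
rewrite -[t in RHS]addr0 -consrV_add; congr (_ + _)%R.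
apply/rowP => k; rewrite [LHS]mxE [in LHS]mxE eqxx /= /consrV; case: (split_ordP (m := 1) (n := n) k) => j ->.
  have -> : (lshift n j == lift ord0 i :> 'I_n.+1) = false.
    by apply/negbTE/eqP => /(congr1 val); rewrite /= ord1.
  by rewrite (@row_mxEl _ 1 1 n) mxE mulr0.
have -> : (rshift 1 j == lift ord0 i :> 'I_n.+1) = (j == i) by [].
by rewrite (@row_mxEr _ 1 1 n) !mxE eqxx.
Qed.

(** Apply the slice bound at fixed first coordinate t, with [a] the integral of g_0 along the first
    axis. Since [a] does not depend on t its power factors out, and the remaining terms integrate to
    the other integrals of the g_i. *)
Lemma slice_gagliardo n : slice_bound n.+1 -> gagliardo n.+1.
Proof.
move=> H F g [mF F0 mg g0 Fg].
pose e : R := (1 + n.+1%:R^-1)%R.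
have mFe : measurable_fun setT (fun x => (F x `^ e)%:E).
  by apply/measurable_EFinP; exact: (measurableT_comp (measurable_powR e)).
rewrite integral_rVS//; last by move=> x; rewrite lee_fin powR_ge0.
pose a (y : 'rV[R]_n.+1) := \int[leb]_r g ord0 (consrV (r, y)).
have mga : measurable_fun setT (fun p : measurableTypeR R * 'rV[R]_n.+1 => g ord0 (consrV p)).
  by apply: (measurableT_comp (mg _)); exact: measurable_consrV.
have ma : measurable_fun setT a.
  exact: (@measurable_fun_fubini_tonelli_G _ _ _ _ R leb _ mga (fun p => g0 _ _)).
have Ia : \int[mu n.+1]_y a y = \int[mu n.+2]_x g ord0 x.
  rewrite [RHS]integral_rVS//; apply/esym.
  exact: (@fubini_tonelli _ _ _ _ R leb (mu n.+1) _ mga (fun p => g0 _ _)).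
pose B t := \sum_i \int[mu n.+1]_y g (lift ord0 i) (consrV (t, y)).
have mgi i : measurable_fun setT (fun p : measurableTypeR R * 'rV[R]_n.+1 => g (lift ord0 i) (consrV p)).
  by apply: (measurableT_comp (mg _)); exact: measurable_consrV.
have mgit i : measurable_fun setT (fun t => \int[mu n.+1]_y g (lift ord0 i) (consrV (t, y))).
  exact: (@measurable_fun_fubini_tonelli_F _ _ _ _ R (mu n.+1) _ (mgi i) (fun p => g0 _ _)).
have B0 t : 0 <= B t by apply: sume_ge0 => i _; apply: integral_ge0.
have mB : measurable_fun setT B by exact: emeasurable_sum.
set A := \int[mu n.+2]_x g ord0 x.
have A0 : 0 <= A by apply: integral_ge0.
set T := (\sum_i _).
have T0 : 0 <= T by apply: sume_ge0 => i _; apply: integral_ge0.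
have ET : T = A + \int[leb]_t B t.
  rewrite /T big_ord_recl; congr (_ + _).
  rewrite /B ge0_integral_sum//; last by move=> i t _; apply: integral_ge0.
  by apply: eq_bigr => i _; rewrite integral_rVS.
have AT : A <= T by rewrite ET leeDl// integral_ge0.
have BT : \int[leb]_t B t <= T by rewrite ET leeDr.
apply: (@le_trans _ _ (\int[leb]_t (B t * A `^ n.+1%:R^-1))).
  apply: ge0_le_integral => //.
  - by move=> t _; apply: integral_ge0 => y _; rewrite lee_fin powR_ge0.
  - apply: (@measurable_fun_fubini_tonelli_F _ _ _ _ R (mu n.+1) (fun p => (F (consrV p) `^ e)%:E)).
      by apply: (measurableT_comp mFe); exact: measurable_consrV.
    by move=> p; rewrite lee_fin powR_ge0.
  - by apply: emeasurable_funM => //.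
  move=> t _; rewrite /A -Ia.
  apply: (H (fun y => F (consrV (t, y))) (fun i y => g (lift ord0 i) (consrV (t, y))) a) => //.
    split => //.
    - by apply: (measurableT_comp mF); exact: measurable_consrVt.
    - by move=> i; apply: (measurableT_comp (mg _)); exact: measurable_consrVt.
    - by move=> i y; under eq_integral do rewrite -consrV_eS.
  move=> y; apply: le_trans (Fg ord0 (consrV (t, y))) _.
  under eq_integral do rewrite consrV_e0 addrC.
  rewrite (lebesgue_shift t (f := fun s => g ord0 (consrV (s, y))))//.
  by apply: (measurableT_comp mga); exact: measurable_pair2.
under eq_integral do rewrite muleC.
rewrite ge0_integralZl ?poweR_ge0// muleC.
have e0 : (0 <= n.+1%:R^-1 :> R)%R by rewrite invr_ge0.
apply: (@le_trans _ _ (T * T `^ n.+1%:R^-1)).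
  apply: lee_pmul => //; [exact: integral_ge0|exact: poweR_ge0|].
  by apply: gt0_ler_poweR => //; rewrite in_itv /= ?leey ?A0 ?T0.
rewrite poweRD//; last by rewrite /poweRD_def gt_eqF//= ltr_wpDr.
by rewrite poweRe1.
Qed.

Lemma slice_bound1 : slice_bound 1.
Proof.
move=> F g a [mF F0 mg g0 Fg] ma Fa.
rewrite invr1 poweRe1; last by apply: integral_ge0 => x _; apply: le_trans (Fa x); rewrite lee_fin.
rewrite big_ord1.
have a0 x : 0 <= a x by apply: le_trans (Fa x); rewrite lee_fin.
set B := \int[mu 1]_x g ord0 x.
have FB x : (F x)%:E <= B.
  apply: le_trans (Fg ord0 x) _; rewrite /B integral_rVS//.
  have -> : x = consrV (x ord0 ord0, 0%R : 'rV[R]_0).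
    by rewrite -[LHS]unconsrVK /unconsrV; congr (consrV (_, _)); apply/rowP; case.
  under eq_integral do rewrite consrV_e0 addrC.
  rewrite (lebesgue_shift _ (f := fun s => g ord0 (consrV (s, 0%R : 'rV[R]_0))))//; last first.
    apply: (measurableT_comp (mg _)); apply: (measurableT_comp (@measurable_consrV R 0)).
    exact: measurable_pair2.
  rewrite le_eqVlt; apply/orP; left; apply/eqP; apply: eq_integral => s _; rewrite integral_rV0//.
  by apply: (measurableT_comp (mg _)); exact: measurable_consrVt.
rewrite -ge0_integralZl//; last by apply: integral_ge0.
apply: ge0_le_integral => //.
- by move=> x _; rewrite lee_fin powR_ge0.
- by apply/measurable_EFinP; exact: (measurableT_comp (measurable_powR _)).
- by apply: measurable_funeM.
move=> x _; rewrite -[(1 + 1)%R]/(2%:R) powR_mulrn// expr2 EFinM.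
by apply: lee_pmul => //; rewrite lee_fin.
Qed.

(** Hoelder applied to F times F^(1/Q) with Q = n+2 and P = 1 + 1/(n+1): the inequality without
    transverse bound controls the first norm, and F <= a controls the second. *)
Lemma gagliardo_slice n : gagliardo n.+1 -> slice_bound n.+2.
Proof.
move=> H F g a D ma Fa; have [mF F0 mg g0 Fg] := D.
have a0 x : 0 <= a x by apply: le_trans (Fa x); rewrite lee_fin.
pose P : R := (1 + n.+1%:R^-1)%R; pose Q : R := n.+2%:R.
have P0 : (0 < P)%R by rewrite ltr_wpDr.
have Q0 : (0 < Q)%R by rewrite ltr0n.
have PQ : (P^-1 + Q^-1 = 1)%R.
  by rewrite /P /Q -[n.+2%:R]natr1 -natr1; field; rewrite natr1 ?gt_eqF// natr1 ?gt_eqF.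
have mG : measurable_fun setT (fun x => (F x `^ Q^-1)%R).
  exact: (measurableT_comp (measurable_powR _)).
have := @hoelder _ _ R (mu n.+2) F (fun x => (F x `^ Q^-1)%R) P Q mF mG P0 Q0 PQ.
have EN (r : R) (h : 'rV[R]_n.+2 -> \bar R) : (0 < r)%R ->
    'N[mu n.+2]_(r%:E)[h] = (\int[mu n.+2]_x (`|h x| `^ r)) `^ r^-1.
  move=> r0; rewrite -poweR_Lnorm ?gt_eqF// -poweRrM divff ?gt_eqF// poweRe1//.
  exact: Lnorm_ge0.
rewrite Lnorm1 !EN//.
have -> : \int[mu n.+2]_x `|(F x * F x `^ Q^-1)%:E| = \int[mu n.+2]_x (F x `^ (1 + Q^-1))%:E.
  apply: eq_integral => x _; rewrite /= ger0_norm ?mulr_ge0 ?powR_ge0//.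
  rewrite powRD; last by rewrite gt_eqF// ltr_wpDr ?invr_ge0// ltW.
  by rewrite powRr1.
move=> /le_trans; apply; apply: lee_pmul; rewrite ?poweR_ge0//.
  have -> : \sum_i \int[mu n.+2]_x g i x = ((\sum_i \int[mu n.+2]_x g i x) `^ P) `^ P^-1.
    rewrite -poweRrM divff ?gt_eqF// poweRe1//.
    by apply: sume_ge0 => i _; apply: integral_ge0.
  apply: gt0_ler_poweR; rewrite ?invr_ge0 ?(ltW P0)//.
  - by rewrite in_itv /= leey andbT; apply: integral_ge0 => x _; first [exact: poweR_ge0|exact: a0|by rewrite lee_fin powR_ge0].
  - by rewrite in_itv /= leey andbT poweR_ge0.
  apply: le_trans (H F g D); rewrite le_eqVlt; apply/orP; left; apply/eqP; apply: eq_integral => x _.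
  by rewrite /= ?gee0_abs ?ger0_norm ?lee_fin// ?poweR_EFin.
apply: gt0_ler_poweR; rewrite ?invr_ge0 ?(ltW Q0)//.
- by rewrite in_itv /= leey andbT; apply: integral_ge0 => x _; first [exact: poweR_ge0|exact: a0|by rewrite lee_fin powR_ge0].
- by rewrite in_itv /= leey andbT; apply: integral_ge0.
rewrite [leLHS](_ : _ = \int[mu n.+2]_x (F x)%:E).
  apply: ge0_le_integral => //; last exact/measurable_EFinP.
  by move=> x _; rewrite lee_fin.
apply: eq_integral => x _.
by rewrite /= ?gee0_abs ?ger0_norm ?lee_fin ?powR_ge0// ?poweR_EFin -powRrM mulVf ?gt_eqF// powRr1.
Qed.

Lemma gagliardo_all n : gagliardo n.+1.
Proof.
elim: n => [|n IH]; first exact/slice_gagliardo/slice_bound1.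
by apply: slice_gagliardo; exact: gagliardo_slice.
Qed.

End Gagliardo.

(** * Measure-preserving substitutions *)

Section Preserving.
Context {R : realType}.
Variable n : nat.
Local Notation V := 'rV[R]_n.
Local Notation mu := (@lebesgue_rV R n).
Local Notation I f := (Rintegral mu setT f).
Local Notation intg := (@intg _ _ R mu).

Definition preserving (T : V -> V) := measurable_fun setT T /\
  forall f : V -> \bar R, measurable_fun setT f -> (forall x, (0 <= f x)%E) ->
    (\int[mu]_x f (T x) = \int[mu]_x f x)%E.

Lemma preserving_shift v : preserving (fun x => x + v).
Proof.
split; last by move=> f mf f0; exact: integral_rV_shift.
by apply: measurable_rVD; [exact: measurable_id|exact: measurable_cst].
Qed.

Lemma preserving_reflect v : preserving (fun x => v - x).
Proof.
have m : measurable_fun setT (fun x : V => v - x).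
  by apply: measurable_rVB; [exact: measurable_cst|exact: measurable_id].
split=> // f mf f0.
have mN : measurable_fun setT (fun y : V => f (- y)).
  exact: (measurableT_comp mf (measurable_rVN (@measurable_id _ V setT))).
rewrite -[RHS](integral_rV_opp mf f0) -[RHS](integral_rV_shift (- v) mN)//.
by apply: eq_integral => y _; rewrite opprB.
Qed.

Lemma preserving_orth (g : 'M[R]_n) : g *m g^T = 1%:M -> preserving (fun x => x *m g).
Proof.
move=> gg; split; first exact: measurable_mulmxr.
by move=> f mf f0; exact: integral_rV_orth.
Qed.

Variable T : V -> V.
Hypothesis pT : preserving T.

Lemma meas_preserving d (W : measurableType d) (f : V -> W) :
  measurable_fun setT f -> measurable_fun setT (fun x => f (T x)).
Proof. by move=> mf; exact: (measurableT_comp mf pT.1). Qed.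

Lemma intg_preserving (f : V -> R) : intg f -> intg (fun x => f (T x)).
Proof.
move=> /intgP[mf fi]; apply/intgP; split; first exact: meas_preserving.
rewrite (pT.2 (fun x => (`|f x|)%:E))//.
by apply/measurable_EFinP; exact: measurableT_comp.
Qed.

Lemma int_preserving (f : V -> R) : measurable_fun setT f -> I (fun x => f (T x)) = I f.
Proof.
move=> mf; congr fine; rewrite [LHS]integralE [RHS]integralE; congr (_ - _)%E.
  have mp : measurable_fun setT ((EFin \o f)^\+)%E by apply: measurable_funepos; exact/measurable_EFinP.
  by rewrite -(pT.2 _ mp (fun x => funepos_ge0 _ _)); apply: eq_integral => x _; rewrite !funeposE.
have mp : measurable_fun setT ((EFin \o f)^\-)%E by apply: measurable_funeneg; exact/measurable_EFinP.
by rewrite -(pT.2 _ mp (fun x => funeneg_ge0 _ _)); apply: eq_integral => x _; rewrite !funenegE.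
Qed.

Lemma ae_preserving (P : V -> Prop) : {ae mu, forall x, P x} -> {ae mu, forall x, P (T x)}.
Proof.
move=> [A [mA A0 PA]].
have mTA : measurable (T @^-1` A) by rewrite -[X in measurable X]setTI; exact: pT.1.
exists (T @^-1` A); split => //; last by move=> x /= nP; apply: PA.
have : (\int[mu]_x (\1_(T @^-1` A) x)%:E = \int[mu]_x (\1_A x)%:E)%E.
  have m1 : measurable_fun setT (fun x => (\1_A x : R)%:E) by apply/measurable_EFinP; exact: measurable_indic.
  have p1 x : (0 <= (\1_A x : R)%:E)%E by rewrite lee_fin.
  by rewrite -[RHS](pT.2 _ m1 p1).
by rewrite !integral_indic// !setIT => ->.
Qed.

Lemma LP_preserving q (f : V -> R) : LP mu q f -> LP mu q (fun x => f (T x)).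
Proof.
by move=> [mf fi]; split; [exact: meas_preserving|exact: (intg_preserving fi)].
Qed.

End Preserving.

(** * Weak derivatives: uniqueness, mollification, orthogonal substitution *)

Section WeakDerivative.
Context {R : realType}.
Variable n : nat.
Local Notation V := 'rV[R]_n.
Local Notation mu := (@lebesgue_rV R n).
Local Notation I f := (Rintegral mu setT f).
Local Notation intg := (@intg _ _ R mu).
Implicit Types (f g u v w phi : V -> R) (x y : V) (i : 'I_n).

Definition wk i u w := LP mu 2 w /\ forall phi, smooth phi -> bsupp phi ->
  I (fun x => u x * partial i phi x) = - I (fun x => w x * phi x).

Lemma weak_partialP i u w : weak_partial i u w <-> wk i u w.
Proof.
split=> [[/LfunP h H]|[h H]]; split.
- exact: h.
- by move=> phi sp bp; apply: H; exact/test_functionP.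
- exact/LfunP.
- by move=> phi /test_functionP[sp bp]; exact: H.
Qed.

(** The convolution of g with the constant 1 is the constant function with value the integral of g.
    Its partial derivative, which is the integral of the partial derivative of g, therefore
    vanishes. *)
Lemma int_partial0 i g : smooth g -> bsupp g -> I (partial i g) = 0.
Proof.
move=> sg bg; have l1 : loc (fun _ : V => 1 : R) by exact: loc_cst.
have cg := smooth_cont sg; have sp := smooth_partial i sg; have cp := smooth_cont sp.
have C k x : continuous k -> conv k (fun=> 1) x = I k.
  move=> ck; rewrite /conv -(int_preserving (preserving_reflect x) (continuous_measurable_rV ck)).
  by apply: eq_int => y; rewrite mulr1.
rewrite -(C _ 0 cp) -partial_conv//.
rewrite (_ : conv g (fun=> 1) = fun=> I g); last by apply/funext => x; exact: C.
by rewrite /partial derive_cst.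
Qed.

Lemma loc_intg u phi : loc u -> smooth phi -> bsupp phi -> intg (fun x => u x * phi x).
Proof.
move=> lu sp bp; under eq_fun do rewrite mulrC.
by apply: cont_mul => //; exact: smooth_cont.
Qed.

Lemma bsupp_mul f g : bsupp f -> bsupp (fun x => f x * g x).
Proof. by move=> [r hr]; exists r => x /hr ->; rewrite mul0r. Qed.

Lemma cont_loc f : continuous f -> loc f.
Proof.
move=> cf; have mf := continuous_measurable_rV cf; split=> // r.
set N := (Num.truncn r).+2.
have bs : bsupp (fun x => f x * cutoff N x).
  by have [r' hr] := @cutoff_bsupp R n N; exists r' => x /hr ->; rewrite mulr0.
have [C C0 hC] := bsupp_bounded (contM cf (@cutoff_cont R n N)) bs.
apply: (intg_le _ _ (intgZ C (@B0_intg R n r))).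
  by apply: measurable_funM => //; apply: measurable_indic; exact: B0_meas.
move=> x; rewrite indicE; have [xB|xB] := boolP (x \in _); last by rewrite !mulr0 normr0.
rewrite !mulr1; have := hC x; rewrite /cutoff clip_1 ?mulr1// lerBrDr.
move: xB; rewrite inE /B0 /= => xB.
by have := truncnS_gt r; rewrite -[(Num.truncn r).+2%:R]natr1; lra.
Qed.

Lemma LP_bsupp q f : 0 < q -> continuous f -> bsupp f -> LP mu q f.
Proof.
move=> q0 cf bf; split; first exact: continuous_measurable_rV.
apply: bsupp_integrable.
  by move=> x; apply: (continuous_cvg _ (@powR_norm_cont R q q0 _) (cf x)).
by have [r hr] := bf; exists r => x /hr ->; rewrite normr0 powR0 ?gt_eqF.
Qed.

Lemma wk_smooth i f : smooth f -> bsupp f -> wk i f (partial i f).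
Proof.
move=> sf bf; have sp := smooth_partial i sf; have bp := bsupp_partial i sf bf.
split; first by apply: LP_bsupp => //; exact: smooth_cont.
move=> phi sphi bphi; apply/eqP; rewrite -addr_eq0; apply/eqP.
rewrite -intD; last 2 first.
- apply: loc_intg; [exact/cont_loc/smooth_cont|exact: smooth_partial|exact: bsupp_partial].
- by apply: loc_intg => //; exact/cont_loc/smooth_cont.
rewrite -(int_partial0 i (smooth_mul sf sphi) (bsupp_mul _ bf)).
by apply: eq_int => x; rewrite partialM// addrC.
Qed.

Lemma wkD i u v w w' : loc u -> loc v -> wk i u w -> wk i v w' ->
  wk i (fun x => u x + v x) (fun x => w x + w' x).
Proof.
move=> lu lv [w2 H] [w2' H']; split; first exact: LPD.
move=> phi sp bp.
have lw := LP_loc (ler1n _ 2) w2; have lw' := LP_loc (ler1n _ 2) w2'.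
have sp' := smooth_partial i sp; have bp' := bsupp_partial i sp bp.
transitivity (I (fun x => u x * partial i phi x) + I (fun x => v x * partial i phi x)).
  by rewrite -intD; [apply: eq_int => x; rewrite mulrDl|exact: loc_intg|exact: loc_intg].
rewrite H// H'// -opprD -intD; [|exact: loc_intg|exact: loc_intg].
by congr (- _); apply: eq_int => x; rewrite mulrDl.
Qed.

Lemma wkZ i c u w : loc u -> wk i u w -> wk i (fun x => c * u x) (fun x => c * w x).
Proof.
move=> lu [w2 H]; split; first exact: LPZ.
move=> phi sp bp; have lw := LP_loc (ler1n _ 2) w2.
have sp' := smooth_partial i sp; have bp' := bsupp_partial i sp bp.
transitivity (c * I (fun x => u x * partial i phi x)).
  by rewrite -intZ; [apply: eq_int => x; rewrite mulrA|exact: loc_intg].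
rewrite H// mulrN -intZ; last exact: loc_intg.
by congr (- _); apply: eq_int => x; rewrite mulrA.
Qed.

Lemma wk_ae i u v w w' : measurable_fun setT u -> measurable_fun setT v -> measurable_fun setT w' ->
  {ae mu, forall x, u x = v x} -> {ae mu, forall x, w x = w' x} -> wk i u w -> wk i v w'.
Proof.
move=> mu_ mv mw' uv ww [w2 H]; split; first exact: LP_ae w2.
move=> phi sp bp; have cp := smooth_cont sp; have cp' := smooth_cont (smooth_partial i sp).
rewrite (int_ae (g := fun x => u x * partial i phi x)); last 3 first.
- by apply: measurable_funM => //; exact: continuous_measurable_rV.
- by apply: measurable_funM => //; exact: continuous_measurable_rV.
- by move: uv; apply: filterS => x ->.
rewrite H//; congr (- _); apply: int_ae.
- by apply: measurable_funM; [case: w2|exact: continuous_measurable_rV].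
- by apply: measurable_funM => //; exact: continuous_measurable_rV.
- by move: ww; apply: filterS => x ->.
Qed.

(** The reflected kernel y -> k(x - y) is a test function, and its derivative in y is minus that of
    k at x - y. *)
Lemma partial_conv_wk k i u w x : smooth k -> bsupp k -> loc u -> wk i u w ->
  partial i (conv k u) x = conv k w x.
Proof.
move=> sk bk lu [w2 H]; rewrite partial_conv// /conv.
have := H (fun y => k (x - y)) (smooth_reflect x sk) (reflect_bsupp x bk).
under eq_Rintegral do rewrite partial_reflect// mulrN mulrC.
under [in RHS]eq_Rintegral do rewrite mulrC.
rewrite intN; last by apply: conv_intg => //; [exact/smooth_cont/smooth_partial|exact: bsupp_partial].
by move/oppr_inj.
Qed.

(** Two weak derivatives have the same mollifications, namely the derivatives of the mollified u,
    and mollification recovers a function almost everywhere. *)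
Lemma wk_uniq i u w w' : loc u -> wk i u w -> wk i u w' -> {ae mu, forall x, w x = w' x}.
Proof.
move=> lu W W'; have lw := LP_loc (ler1n _ 2) W.1; have lw' := LP_loc (ler1n _ 2) W'.1.
have lN : loc (fun x => (-1) * w' x) by exact: loc_scale.
have ld := loc_add lw lN.
have [s [_ ae]] := rho_ae ld.
move: ae; apply: filterS => x; have -> : (fun j => conv (rho (s j)) (fun x => w x + (-1) * w' x) x) = fun=> 0.
  apply/funext => j; have [sk bk _ _] := @rho_kernel R n (s j); have ck := smooth_cont sk.
  rewrite convD// convZ// -(partial_conv_wk x sk bk lu W) -(partial_conv_wk x sk bk lu W'); ring.
move=> /(cvg_lim (@Rhausdorff R)); rewrite lim_cst// => h.
by move: h; lra.
Qed.

Lemma wk_orth (g : 'M[R]_n) u (w : 'I_n -> V -> R) i : g *m g^T = 1%:M -> loc u ->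
  (forall j, wk j u (w j)) ->
  wk i (fun x => u (x *m g)) (fun x => \sum_j g i j * w j (x *m g)).
Proof.
move=> gg lu W; have pg := preserving_orth gg.
have lw j := LP_loc (ler1n _ 2) (W j).1.
have gg' : g^T *m g = 1%:M by rewrite (mulmx1C gg).
have pg' : preserving (fun x : V => x *m g^T) by apply: preserving_orth; rewrite trmxK.
have gK x : x *m g *m g^T = x by rewrite -mulmxA gg mulmx1.
split.
  elim: (index_enum _) => [|j s IH].
    apply: (LP_eq (f := fun=> 0)); first by move=> x; rewrite big_nil.
    by apply: LP_bsupp => //; [move=> x; exact: cst_continuous|exists 0].
  apply: (LP_eq (f := fun x => g i j * w j (x *m g) + \sum_(j <- s) g i j * w j (x *m g))).
    by move=> x; rewrite big_cons.
  by apply: LPD => //; apply: LPZ; apply: (LP_preserving pg (W j).1).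
move=> phi sp bp.
(* The test function transported by the inverse of g; the identity for u is tested with it after
   changing variables. *)
pose psi y := phi (y *m g^T + 0).
have spsi : smooth psi by exact: smooth_comp_affine.
have bpsi : bsupp psi.
  have [r r0 hr] := bsupp_pos bp; exists (Num.sqrt (n%:R * r ^+ 2) + 1) => y hy.
  rewrite /psi addr0; apply: hr; rewrite leNgt; apply/negP => h.
  have := norm_sqn y; rewrite -(@sqn_orth _ _ g^T) ?trmxK// => h1.
  have h2 := le_trans h1 (sqn_norm (y *m g^T)).
  have h3 : n%:R * `|y *m g^T| ^+ 2 <= n%:R * r ^+ 2 :> R.
    by apply: ler_wpM2l => //; rewrite ler_pXn2r ?nnegrE// ltW.
  have h4 := le_trans h2 h3.
  have s0 : 0 <= n%:R * r ^+ 2 :> R by rewrite mulr_ge0 ?sqr_ge0.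
  rewrite -(sqr_sqrtr s0) ler_pXn2r ?nnegrE ?sqrtr_ge0// in h4.
  by move: (le_trans hy h4); rewrite gerDl ler10.
have sj j := smooth_partial j spsi; have bj j := bsupp_partial j spsi bpsi.
have E y : partial i phi (y *m g^T) = \sum_j g i j * partial j psi y.
  have -> : \sum_j g i j * partial j psi y = \sum_k (g *m g^T) i k * partial k phi (y *m g^T).
    under eq_bigr do rewrite /psi partial_comp_affine// addr0 mulr_sumr.
    rewrite exchange_big /=; apply: eq_bigr => k _; rewrite mxE mulr_suml.
    by apply: eq_bigr => j _; rewrite mulrA.
  rewrite gg (bigD1 i)//= mxE eqxx mul1r big1 ?addr0// => k ki.
  by rewrite mxE eq_sym (negbTE ki) mul0r.
have mp := continuous_measurable_rV (smooth_cont (smooth_partial i sp)).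
have mphi := continuous_measurable_rV (smooth_cont sp).
transitivity (I (fun y => u y * partial i phi (y *m g^T))).
  rewrite -(int_preserving pg (f := fun y => u y * partial i phi (y *m g^T))).
    by apply: eq_int => x; rewrite gK.
  by apply: measurable_funM; [exact: lu.1|exact: (meas_preserving pg')].
transitivity (\sum_j g i j * I (fun y => u y * partial j psi y)).
  rewrite (eq_int mu (g := fun y => \sum_j g i j * (u y * partial j psi y))); last first.
    by move=> y; rewrite E mulr_sumr; apply: eq_bigr => j _; rewrite mulrCA.
  rewrite int_sum; last by move=> j; apply: intgZ; exact: loc_intg.
  by apply: eq_bigr => j _; rewrite intZ//; exact: loc_intg.
rewrite (eq_bigr (fun j => - I (fun y => g i j * (w j y * psi y)))); last first.
  by move=> j _; rewrite (W j).2// mulrN -intZ//; exact: loc_intg.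
rewrite sumrN -int_sum; last by move=> j; apply: intgZ; exact: loc_intg.
congr (- _).
rewrite -(int_preserving pg (f := fun y => \sum_j g i j * (w j y * psi y))).
  by apply: eq_int => x; rewrite mulr_suml; apply: eq_bigr => j _; rewrite /psi gK addr0 mulrA.
apply: measurable_sum => j; apply: measurable_funM => //; apply: measurable_funM; first exact: (lw j).1.
exact: continuous_measurable_rV (smooth_cont spsi).
Qed.

End WeakDerivative.

(** * Absorption, and decay at infinity of mollified functions *)

Lemma gagliardoN (R : realType) (N : nat) : (3 <= N)%N ->
  forall (F : 'rV[R]_N -> R) g, line_dominated F g ->
  (\int[lebesgue_rV N]_x (F x `^ (1 + N.-1%:R^-1))%:E <=
    (\sum_i \int[lebesgue_rV N]_x g i x) `^ (1 + N.-1%:R^-1))%E.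
Proof. by case: N => [|[|[|m]]]// _; exact: gagliardo_all. Qed.

(** Divide by the power of A on the right, legitimate because A is positive, and raise what is left,
    A^(1 - ex/2), to the power g. *)
Lemma self_bound (R : realType) (A D c ex g : R) : 0 < A -> 0 <= D -> 0 <= c -> 0 <= g ->
  g * (1 - ex / 2) = 1 -> A <= (c * (A * D) `^ 2^-1) `^ ex ->
  A <= c `^ (g * ex) * D `^ (g * ex / 2).
Proof.
move=> Ap D0 c0 g0 hg main; have A0 := ltW Ap.
rewrite (powRM _ c0 (powR_ge0 _ _)) -powRrM (powRM _ A0 D0) in main.
have A1 : A = A `^ (2^-1 * ex) * A `^ (1 - ex / 2).
  rewrite -powRD; last by apply/implyP => _; rewrite gt_eqF.
  by rewrite (_ : 2^-1 * ex + (1 - ex / 2) = 1) ?powRr1//; field.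
have m2 : A `^ (1 - ex / 2) <= c `^ ex * D `^ (2^-1 * ex).
  rewrite -(ler_pM2l (powR_gt0 (2^-1 * ex) Ap)) -A1; apply: le_trans main _.
  by rewrite le_eqVlt; apply/orP; left; apply/eqP; ring.
have -> : c `^ (g * ex) * D `^ (g * ex / 2) = (c `^ ex * D `^ (2^-1 * ex)) `^ g.
  by rewrite powRM ?powR_ge0// -!powRrM; congr (_ `^ _ * _ `^ _); field.
have -> : A = (A `^ (1 - ex / 2)) `^ g by rewrite -powRrM mulrC hg powRr1.
by apply: (ge0_ler_powR g0); rewrite ?nnegrE ?mulr_ge0 ?powR_ge0.
Qed.

Lemma cvg_sqB (R : realType) (a b : nat -> R) (la lb : R) : a @ \oo --> la -> b @ \oo --> lb ->
  (fun j => (a j - b j) ^+ 2) @ \oo --> (la - lb) ^+ 2.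
Proof.
move=> ha hb; rewrite expr2; apply: (cvg_trans _ (cvgM (cvgB ha hb) (cvgB ha hb))).
by apply: near_eq_cvg; apply: nearW => j; rewrite /= expr2.
Qed.

Section Vanishing.
Context {R : realType}.
Variable n : nat.
Local Notation V := 'rV[R]_n.
Local Notation mu := (@lebesgue_rV R n).
Local Notation I f := (Rintegral mu setT f).
Local Notation intg := (@intg _ _ R mu).

Lemma int_tail (f : V -> R) (e : R) : intg f -> (forall x, 0 <= f x) -> 0 < e ->
  exists j : nat, I (fun x => f x * \1_(~` B0 j%:R) x) <= e.
Proof.
move=> fi f0 e0; have mf := intg_meas fi.
pose F j x := (f x * \1_(~` B0 j%:R) x)%:E.
have mB j : measurable (~` B0 j%:R : set V) by apply: measurableC; exact: B0_meas.
have fj j : intg (fun x => f x * \1_(~` B0 j%:R) x).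
  apply: (intg_le _ _ fi); first by apply: measurable_funM => //; exact: measurable_indic.
  by move=> x; rewrite ger0_norm ?mulr_ge0// indicE; case: (x \in _); rewrite ?mulr1// mulr0.
have [] := @dominated_convergence _ _ _ mu setT measurableT F (cst 0%E) (EFin \o f).
- by move=> j; apply/measurable_EFinP; exact: (intg_meas (fj j)).
- exact: measurable_cst.
- apply: nearW => x _; apply: (@cvg_trans _ (cst (0%E : \bar R) @ \oo)); last exact: cvg_cst.
  apply: near_eq_cvg; exists (Num.truncn `|x|).+1 => // j /= hj.
  rewrite /F indicE memNset ?mulr0//= => h; apply: h; rewrite /B0 /=.
  by apply: lt_le_trans (truncnS_gt _) _; rewrite ler_nat.
- exact: fi.
- apply: nearW => x j _; rewrite /F lee_fin ger0_norm ?mulr_ge0// indicE.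
  by case: (x \in _); rewrite ?mulr1// mulr0.
move=> _ _; rewrite integral0 => /fine_cvgP[fin /cvgrPdist_le /(_ e e0) H].
have [j [] /= _ h] := filter_ex (filterI fin H).
exists j; apply: le_trans h; rewrite sub0r normrN; exact: ler_norm.
Qed.

(** By Jensen the q-th power at x is bounded by the integral of |u|^q near x, which is a small tail
    when x is far away. Vanishing at infinity lets integrals along half-lines dominate the
    function. *)
Lemma conv_vanish k (u : V -> R) q (e : R) : kernel k -> 1 <= q -> LP mu q u -> 0 < e ->
  exists T, forall x, T <= `|x| -> `|conv k u x| <= e.
Proof.
move=> kk q1 uq e0; have [sk bk k0 k1] := kk; have ck := smooth_cont sk; have q0 : 0 < q by lra.
have [r r0 hr] := bsupp_pos bk; have [C C0 hC] := bsupp_bounded ck bk.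
have [j hj] := int_tail uq.2 (fun x => powR_ge0 _ _) (divr_gt0 (powR_gt0 q e0) C0).
exists (r + j%:R) => x hx.
have lq : loc (fun y => `|u y| `^ q) by apply: intg_loc; case: uq.
have h : `|conv k u x| `^ q <= e `^ q.
  apply: le_trans (conv_jensen x kk q1 uq) _.
  have hj' : C * I (fun x => `|u x| `^ q * \1_(~` B0 j%:R) x) <= e `^ q by rewrite -ler_pdivlMl// mulrC.
  apply: le_trans hj'; rewrite -intZ; last first.
    apply: (intg_le _ _ uq.2).
      apply: measurable_funM; first by apply: mpow; case: uq.
      by apply: measurable_indic; apply: measurableC; exact: B0_meas.
    by move=> y; rewrite ger0_norm ?mulr_ge0 ?powR_ge0// indicE; case: (y \in _); rewrite ?mulr1// mulr0 powR_ge0.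
  apply: int_le; first exact: conv_intg.
    apply: intgZ; apply: (intg_le _ _ uq.2).
      apply: measurable_funM; first by apply: mpow; case: uq.
      by apply: measurable_indic; apply: measurableC; exact: B0_meas.
    by move=> y; rewrite ger0_norm ?mulr_ge0 ?powR_ge0// indicE; case: (y \in _); rewrite ?mulr1// mulr0 powR_ge0.
  move=> y; have [yj|yj] := ltrP `|y| j%:R.
    rewrite hr ?mul0r ?mulr_ge0 ?powR_ge0 ?(ltW C0)//.
    by have := lerB_dist x y; lra.
  rewrite indicE mem_set ?mulr1; last by rewrite /B0 /=; apply/negP; rewrite -leNgt.
  by rewrite ler_wpM2r ?powR_ge0//; apply: le_trans (hC _); exact: ler_norm.
rewrite leNgt; apply/negP => h2; move: h; rewrite leNgt => /negP; apply.
by apply: gt0_ltr_powR; rewrite ?nnegrE// ltW.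
Qed.

Lemma sq_sum_le (J : finType) (b : J -> R) : (\sum_j b j) ^+ 2 <= #|J|%:R * \sum_j b j ^+ 2.
Proof.
rewrite expr2 mulr_suml; under eq_bigr do rewrite mulr_sumr.
apply: (@le_trans _ _ (\sum_i \sum_j (b i ^+ 2 / 2 + b j ^+ 2 / 2))).
  apply: ler_sum => i _; apply: ler_sum => j _.
  by have := sqr_ge0 (b i - b j); rewrite !expr2; nra.
under eq_bigr do rewrite big_split /= sumr_const -[_ *+ _]mulr_natl -mulr_suml.
rewrite big_split /= sumr_const -[_ *+ #|J|]mulr_natl -mulr_sumr -mulr_suml le_eqVlt.
by apply/orP; left; apply/eqP; field.
Qed.

End Vanishing.

(** * The Sobolev inequality and the translation estimate in D^{1,2} *)

Section Sobolev.
Context {R : realType}.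
Variable N : nat.
Hypothesis N3 : (3 <= N)%N.
Local Notation V := 'rV[R]_N.
Local Notation mu := (@lebesgue_rV R N).
Local Notation I f := (Rintegral mu setT f).
Local Notation intg := (@intg _ _ R mu).
Local Notation p := (@crit_exp R N).

Let N3R : 3 <= N%:R :> R. Proof. by rewrite ler_nat. Qed.

Lemma crit_gt2 : 2 < p.
Proof. by rewrite /crit_exp ltr_pdivlMr; have := N3R; lra. Qed.

(** The exponent for which Gagliardo's inequality applied to |v|^gam returns the L^p norm: gam
    N/(N-1) = p, and gam - 1 = p/2 leaves the factor |v|^(p/2) beside the gradient. *)
Definition gam : R := 2 * (N%:R - 1) / (N%:R - 2).

Lemma gam_gt2 : 2 < gam.
Proof. by rewrite /gam ltr_pdivlMr; have := N3R; lra. Qed.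

Definition Sob : R := (gam * N%:R) `^ p.

Lemma phi_cont (q : R) : 2 < q -> continuous (@phi R q).
Proof.
move=> q2 t; have q20 : 0 < q - 2 by lra.
exact: (cvgM (@powR_norm_cont R _ q20 t) cvg_id).
Qed.

Lemma gam_half : gam - 1 = p / 2.
Proof. by have := N3R; rewrite /gam /crit_exp => h; field; lra. Qed.

Lemma gam_exp : gam * (1 + N.-1%:R^-1) = p.
Proof.
have -> : N.-1%:R = N%:R - 1 :> R by rewrite -subn1 natrB// (leq_trans _ N3).
by have := N3R; rewrite /gam /crit_exp => h; field; apply/andP; split; lra.
Qed.

(** Apply [gagliardoN] to F = |v|^gam, whose derivative is gam |v|^(p/2) times that of v in modulus.
    Cauchy-Schwarz bounds the right side through A and D, and [self_bound] absorbs A, which is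
    finite since v is in L^p. *)
Lemma sobolev_smooth (v : V -> R) : smooth v -> LP mu p v -> (forall i, LP mu 2 (partial i v)) ->
  (forall e, 0 < e -> exists T, forall x, T <= `|x| -> `|v x| <= e) ->
  I (fun x => `|v x| `^ p) <= Sob * (I (fun x => \sum_i partial i v x ^+ 2)) `^ (p / 2).
Proof.
move=> sv vp dv van; have cv := smooth_cont sv; have mv := continuous_measurable_rV cv.
have g2 := gam_gt2; have p2 := crit_gt2; have g1 : 1 < gam by lra.
have di i : intg (fun x => partial i v x ^+ 2) by have [] := (LP2 mu _).1 (dv i).
set A := I (fun x => `|v x| `^ p); set D := I _.
have A0 : 0 <= A by apply: int_ge0 => x; exact: powR_ge0.
have D0 : 0 <= D by apply: int_ge0 => x; apply: sumr_ge0 => i _; exact: sqr_ge0.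
pose F x := `|v x| `^ gam.
pose G i x := gam * phi gam (v x) * partial i v x.
have cG i : continuous (G i).
  move=> x; have cp := smooth_cont (smooth_partial i sv).
  have c1 : (fun x => phi gam (v x)) @ x --> phi gam (v x) by apply: (continuous_cvg _ (@phi_cont gam g2 _) (cv x)).
  exact: (cvgM (cvgM (cvg_cst gam) c1) (cp x)).
have dF i x : is_derive x (delta_mx ord0 i : V) F (G i x).
  exact: (is_derive_comp1 (is_derive_norm_powR (v x) g2) (smooth_derive x i sv)).
pose g i x : \bar R := (`|G i x|)%:E.
have half : LP mu 2 (fun x => `|v x| `^ (p / 2)).
  apply/LP2; split; first exact: mpow.
  move: vp.2; congr intg; apply/funext => x.
  by rewrite -[RHS]powR_mulrn ?powR_ge0// -powRrM; congr (_ `^ _); field.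
have GE i x : `|G i x| = gam * (`|v x| `^ (p / 2) * `|partial i v x|).
  rewrite /G normrM normrM phi_abs// gam_half (ger0_norm (_ : 0 <= gam)) ?mulrA//; lra.
have hp i : LP mu 2 (fun x => `|partial i v x|).
  have [m h] := dv i; split; first exact: measurableT_comp.
  by move: h; congr intg; apply/funext => x; rewrite normr_id.
have XI i := intgM half (hp i).
have XB i : I (fun x => `|v x| `^ (p / 2) * `|partial i v x|) <= (A * D) `^ 2^-1.
  have X0 : 0 <= I (fun x => `|v x| `^ (p / 2) * `|partial i v x|).
    by apply: int_ge0 => x; rewrite mulr_ge0 ?powR_ge0.
  rewrite powR12_sqrt ?mulr_ge0// -(@ler_pXn2r _ 2) ?nnegrE ?sqrtr_ge0// sqr_sqrtr ?mulr_ge0//.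
  apply: le_trans (int_CS half (hp i)) _.
  have -> : I (fun x => (`|v x| `^ (p / 2)) ^+ 2) = A.
    by apply: eq_int => x; rewrite -powR_mulrn ?powR_ge0// -powRrM; congr (_ `^ _); field.
  apply: ler_wpM2l => //; apply: int_le.
  - by have [] := (LP2 mu _).1 (hp i).
  - exact: intg_sum.
  - move=> x; rewrite real_normK ?num_real// (bigD1 i)//= lerDl.
    by apply: sumr_ge0 => j _; exact: sqr_ge0.
have LD : line_dominated F g.
  split.
  - exact: mpow.
  - by move=> x; exact: powR_ge0.
  - move=> i; apply/measurable_EFinP; apply: measurableT_comp => //; exact: continuous_measurable_rV.
  - by move=> i x; rewrite lee_fin.
  move=> i x; apply/lee_addgt0Pr => e e0.
  have [T hT] := van (e `^ gam^-1) (powR_gt0 _ e0).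
  pose a := `|T| + `|x|.
  have a0 : - a <= 0 by rewrite oppr_le0 addr_ge0.
  (* At distance |T| + |x| backwards along the axis the i-th coordinate has modulus at least |T|, so
     F is below e there and only the integral along the line remains. *)
  have far : F (x + (- a) *: delta_mx ord0 i) <= e.
    rewrite /F; have -> : e = (e `^ gam^-1) `^ gam by rewrite -powRrM mulVf ?powRr1 ?gt_eqF//; lra.
    apply: ge0_ler_powR; rewrite ?nnegrE ?powR_ge0//; first by lra.
    apply: hT; apply: le_trans (ler_norm T) _; apply: le_trans (coord_le_norm _ i).
    rewrite mxE mxE mxE !eqxx mulr1; have := coord_le_norm x i; have := lerB_dist a (x ord0 i).
    by rewrite (ger0_norm (_ : 0 <= a)) ?addr_ge0// distrC /a; lra.
  have := @ftc_line R N F (G i) x (delta_mx ord0 i) (- a) 0 a0 (dF i) (cG i).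
  rewrite scale0r addr0 => h.
  apply: (@le_trans _ _ ((F (x + (- a) *: delta_mx ord0 i))%:E + (`|F x - F (x + (- a) *: delta_mx ord0 i)|)%:E)%E).
    by rewrite -EFinD lee_fin -lerBlDl ler_norm.
  rewrite addeC; apply: leeD; last by rewrite lee_fin.
  apply: le_trans h _; apply: ge0_subset_integral => //.
  apply/measurable_EFinP; apply: measurableT_comp => //.
  by apply: continuous_measurable_fun; exact: line_cont.
pose ex : R := 1 + N.-1%:R^-1; pose c := gam * N%:R.
have c0 : 0 <= c by rewrite mulr_ge0//; lra.
have gex : gam * ex = p by exact: gam_exp.
have ex0 : 0 < ex by rewrite ltr_wpDr.
have main : A <= (c * (A * D) `^ 2^-1) `^ ex.
  rewrite -lee_fin -poweR_EFin /A EFin_int; last exact: vp.2.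
  have := gagliardoN N3 LD; rewrite -/ex.
  have -> : (\int[mu]_x (F x `^ ex)%:E = \int[mu]_x (`|v x| `^ p)%:E)%E.
    by apply: eq_integral => x _; rewrite /F -powRrM gex.
  move=> /le_trans; apply; apply: gt0_ler_poweR; rewrite ?(ltW ex0)//.
  - by rewrite in_itv /= leey andbT; apply: sume_ge0 => i _; apply: integral_ge0 => x _; rewrite lee_fin.
  - by rewrite in_itv /= leey andbT lee_fin mulr_ge0 ?powR_ge0.
  apply: (@le_trans _ _ (\sum_(i < N) (gam * (A * D) `^ 2^-1)%:E)%E).
    apply: lee_sum => i _; rewrite /g.
    rewrite (eq_integral (fun x => (gam * (`|v x| `^ (p / 2) * `|partial i v x|))%:E)); last first.
      by move=> x _; rewrite GE.
    rewrite -EFin_int; last exact: intgZ.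
    by rewrite lee_fin intZ//; apply: ler_wpM2l => //; lra.
  rewrite sumEFin sumr_const card_ord lee_fin le_eqVlt; apply/orP; left; apply/eqP.
  by rewrite -[_ *+ N]mulr_natr /c; ring.
have [A00|A00] := eqVneq A 0; first by rewrite A00 mulr_ge0 ?powR_ge0.
have Ap : 0 < A by rewrite lt_neqAle eq_sym A00.
have hg : gam * (1 - ex / 2) = 1.
  by rewrite mulrBr mulr1 mulrA gex -gam_half opprB addrCA subrr addr0.
rewrite /Sob -/c -gex; by apply: (self_bound Ap D0 c0 _ hg main); apply: ltW; apply: lt_trans g2.
Qed.

Lemma int_sq_conv k (w : V -> R) : kernel k -> LP mu 2 w ->
  LP mu 2 (conv k w) /\ I (fun x => conv k w x ^+ 2) <= I (fun x => w x ^+ 2).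
Proof.
move=> kk w2; have [h1 h2] := conv_LP kk (ler1n _ 2) w2; split=> //.
by move: h2; rewrite (eq_int mu (fun x => pow2 (conv k w x))) (eq_int mu (fun x => pow2 (w x))).
Qed.

Section Fixed.
Variables (u : V -> R) (w : 'I_N -> V -> R).
Hypotheses (up : LP mu p u) (uw : forall i, wk i u (w i)).

Let lu : loc u.
Proof. by apply: LP_loc up; have := crit_gt2; lra. Qed.

Let w2 i : intg (fun x => w i x ^+ 2).
Proof. by have [] := (LP2 mu _).1 (uw i).1. Qed.

Let conv_grad k : kernel k -> (forall i, partial i (conv k u) = conv k (w i)).
Proof. by move=> [sk bk _ _] i; apply/funext => x; exact: partial_conv_wk. Qed.

Let conv_grad_le k : kernel k ->
  intg (fun x => \sum_i partial i (conv k u) x ^+ 2) /\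
  I (fun x => \sum_i partial i (conv k u) x ^+ 2) <= I (fun x => \sum_i w i x ^+ 2).
Proof.
move=> kk; have h i := int_sq_conv kk (uw i).1.
have hi i : intg (fun x => partial i (conv k u) x ^+ 2).
  by rewrite conv_grad//; have [] := (LP2 mu _).1 (h i).1.
split; first exact: intg_sum.
by rewrite !int_sum//; apply: ler_sum => i _; rewrite conv_grad//; exact: (h i).2.
Qed.

(** Mollify: the gradients do not grow in L^2, the smooth case applies, and Fatou's lemma passes to
    the limit. *)
Lemma sobolev : I (fun x => `|u x| `^ p) <= Sob * (I (fun x => \sum_i w i x ^+ 2)) `^ (p / 2).
Proof.
have p2 := crit_gt2; have p1 : 1 <= p by lra.
have [s [_ ae]] := rho_ae lu.
have kk j := @rho_kernel R N (s j).
apply: (int_fatou (f_ := fun j x => `|conv (rho (s j)) u x| `^ p) _ _ _ _ _ _).2.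
- by move=> j; have [[]] := conv_LP (kk j) p1 up.
- by apply: mpow; case: up.
- by move=> j x; exact: powR_ge0.
- by move=> x; exact: powR_ge0.
- move: ae; apply: filterS => x h.
  by apply: (continuous_cvg _ (@powR_norm_cont R p _ _) h); lra.
move=> j; have [sk bk _ _] := kk j.
apply: le_trans (sobolev_smooth _ _ _ _) _.
- exact: conv_smooth.
- by have [] := conv_LP (kk j) p1 up.
- by move=> i; rewrite conv_grad//; have [] := int_sq_conv (kk j) (uw i).1.
- by move=> e e0; exact: (conv_vanish (kk j) p1 up e0).
apply: ler_wpM2l; first exact: powR_ge0.
apply: ge0_ler_powR; rewrite ?nnegrE; last exact: (conv_grad_le (kk j)).2.
- lra.
- by apply: int_ge0 => x; apply: sumr_ge0 => i _; exact: sqr_ge0.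
- by apply: int_ge0 => x; apply: sumr_ge0 => i _; exact: sqr_ge0.
Qed.

(** The difference is square integrable although u need not be. The factor N comes from the Cauchy
    inequality over the N coordinates, |z| being the max norm. *)
Lemma translation z : intg (fun x => (u (x + z) - u x) ^+ 2) /\
  I (fun x => (u (x + z) - u x) ^+ 2) <= N%:R * `|z| ^+ 2 * I (fun x => \sum_i w i x ^+ 2).
Proof.
have [s [_ ae]] := rho_ae lu.
have kk j := @rho_kernel R N (s j).
have pz := preserving_shift z.
have mu_ := lu.1.
set C := N%:R * _ * _.
have H j : (\int[mu]_x ((conv (rho (s j)) u (x + z) - conv (rho (s j)) u x) ^+ 2)%:E <= C%:E)%E.
  have [sk bk _ _] := kk j; have sc := conv_smooth sk bk lu.
  have sp i := smooth_cont (smooth_partial i sc).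
  have cG : continuous (fun y => \sum_i z ord0 i * partial i (conv (rho (s j)) u) y).
    by apply: continuous_sum => i x; exact: (cvgM (cvg_cst _) (sp i x)).
  apply: le_trans (translation_smooth (fun y => smooth_total y z sc) (smooth_cont sc) cG) _.
  apply: (@le_trans _ _ (\int[mu]_x ((N%:R * `|z| ^+ 2) * \sum_i partial i (conv (rho (s j)) u) x ^+ 2)%:E)%E).
    apply: ge0_le_integral => //.
    - by move=> x _; rewrite lee_fin sqr_ge0.
    - by apply/measurable_EFinP; apply: measurable_funX; exact: continuous_measurable_rV.
    - by apply/measurable_EFinP; apply: measurable_funM => //; apply: intg_meas; exact: (conv_grad_le (kk j)).1.
    move=> x _; rewrite lee_fin; apply: le_trans (sq_sum_le _) _.
    rewrite card_ord -mulrA; apply: ler_wpM2l => //; rewrite mulr_sumr; apply: ler_sum => i _.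
    rewrite exprMn; apply: ler_wpM2r; first exact: sqr_ge0.
    by rewrite -[leLHS]real_normK ?num_real// ler_pXn2r ?nnegrE// coord_le_norm.
  have [gi gl] := conv_grad_le (kk j).
  rewrite -EFin_int; last exact: intgZ.
  by rewrite lee_fin intZ//; apply: ler_wpM2l => //; rewrite mulr_ge0 ?sqr_ge0.
have mc j : measurable_fun setT (conv (rho (s j)) u).
  by have [sk bk _ _] := kk j; apply: continuous_measurable_rV; apply: conv_cont => //; exact: smooth_cont.
have m2 (f : V -> R) : measurable_fun setT f -> measurable_fun setT (fun x : V => (f (x + z) - f x) ^+ 2).
  move=> mf; apply: measurable_funX; apply: measurable_funB => //; exact: (meas_preserving pz).
apply: int_le_ereal; [exact: m2|by move=> x; exact: sqr_ge0|].
apply: (@ae_cvg_fatou _ _ R mu (fun j x => (conv (rho (s j)) u (x + z) - conv (rho (s j)) u x) ^+ 2)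
  (fun x => (u (x + z) - u x) ^+ 2) C%:E) => //.
- by move=> j; exact: m2.
- exact: m2.
- by move=> j x; exact: sqr_ge0.
- by move=> x; exact: sqr_ge0.
have ae' := ae_preserving pz ae.
apply: filterS2 ae ae' => x h1 h2.
exact: (cvg_sqB h2 h1).
Qed.

End Fixed.

End Sobolev.

(** * The space D^{1,2}: the form [ipD], coercivity and completeness *)

Lemma powR_divl (R : realType) (q a b : R) : 0 <= a -> 0 <= b -> (a / b) `^ q = a `^ q / b `^ q.
Proof.
by move=> a0 b0; rewrite powRM ?invr_ge0// -[b^-1]powR_inv1// -powRrM mulN1r powRN.
Qed.

Lemma eqP_le (R : realType) (a b : R) : a = b -> a <= b.
Proof. by move=> ->. Qed.

Section D12calculus.
Context {R : realType}.
Variable N : nat.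
Hypothesis N3 : (3 <= N)%N.
Local Notation V := 'rV[R]_N.
Local Notation mu := (@lebesgue_rV R N).
Local Notation I f := (Rintegral mu setT f).
Local Notation intg := (@intg _ _ R mu).
Local Notation p := (@crit_exp R N).
Implicit Types (u v w : V -> R).

Let p2 : 2 < p. Proof. exact: crit_gt2. Qed.
Let p0 : 0 < p. Proof. by apply: lt_trans p2. Qed.
Let p1 : 1 <= p. Proof. by apply: ltW; apply: lt_trans p2; rewrite ltr1n. Qed.

Lemma D12_LP u : D12 u -> LP mu p u.
Proof. by move=> [/LfunP h _]; exact: h. Qed.

Lemma D12_loc u : D12 u -> loc u.
Proof. by move=> /D12_LP; exact: LP_loc. Qed.

Lemma D12_wk i u : D12 u -> wk i u (wpartial i u).
Proof.
move=> [_ /(_ i)[w hw]]; apply/weak_partialP.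
by have := @xgetPex _ (cst 0) [set w | weak_partial i u w] (ex_intro _ w hw).
Qed.

(** The chosen derivatives [wpartial] are accessible only through the uniqueness of weak
    derivatives, hence up to null sets; all later identities about them are of this kind. *)
Lemma D12_intro u (w : 'I_N -> V -> R) : LP mu p u -> (forall i, wk i u (w i)) ->
  D12 u /\ forall i, {ae mu, forall x, wpartial i u x = w i x}.
Proof.
move=> up uw; have Du : D12 u.
  by split; [exact/LfunP|move=> i; exists (w i); exact/weak_partialP].
split=> // i; apply: (wk_uniq (D12_loc Du)) (uw i); exact: D12_wk.
Qed.

Lemma D12D u v : D12 u -> D12 v -> D12 (fun x => u x + v x) /\
  forall i, {ae mu, forall x, wpartial i (fun x => u x + v x) x = wpartial i u x + wpartial i v x}.
Proof.
move=> Du Dv; apply: D12_intro.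
  by apply: LPD (D12_LP Du) (D12_LP Dv); exact: ltW.
by move=> i; apply: wkD (D12_loc Du) (D12_loc Dv) (D12_wk i Du) (D12_wk i Dv).
Qed.

Lemma D12Z (c : R) u : D12 u -> D12 (fun x => c * u x) /\
  forall i, {ae mu, forall x, wpartial i (fun x => c * u x) x = c * wpartial i u x}.
Proof.
move=> Du; apply: D12_intro; first exact: LPZ (D12_LP Du).
by move=> i; apply: wkZ (D12_loc Du) (D12_wk i Du).
Qed.

Lemma D12_ae u v : measurable_fun setT v -> {ae mu, forall x, u x = v x} -> D12 u ->
  D12 v /\ forall i, {ae mu, forall x, wpartial i v x = wpartial i u x}.
Proof.
move=> mv uv Du; have up := D12_LP Du; apply: D12_intro; first exact: LP_ae up.
move=> i; have h := D12_wk i Du; apply: (wk_ae up.1 mv h.1.1 uv _ h).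
exact: nearW.
Qed.

Lemma D12_smooth u : smooth u -> bsupp u -> D12 u.
Proof.
move=> su bu; have [] // := @D12_intro u (fun i => partial i u).
  by apply: LP_bsupp => //; exact: smooth_cont.
by move=> i; exact: wk_smooth.
Qed.

Lemma D12_0 : D12 (fun _ : V => 0 : R).
Proof.
apply: D12_smooth; last by exists 0.
apply: (@smooth_class R N (fun f => f = fun=> 0)) => //.
- by move=> _ ->; exact: cst_continuous.
- by move=> _ i ->; exists (fun=> 0) => // x; exact: is_derive_cst.
Qed.

Definition dir u v : R := I (fun x => \sum_i wpartial i u x * wpartial i v x).

Lemma wp2 i u : D12 u -> LP mu 2 (wpartial i u).
Proof. by move=> /(D12_wk i) []. Qed.

Lemma dir_intg u v : D12 u -> D12 v -> intg (fun x => \sum_i wpartial i u x * wpartial i v x).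
Proof. by move=> Du Dv; apply: intg_sum => i; apply: intgM; exact: wp2. Qed.

Lemma dirC u v : dir u v = dir v u.
Proof. by apply: eq_int => x; apply: eq_bigr => i _; rewrite mulrC. Qed.

Lemma dirE u : dir u u = I (grad_sq u).
Proof. by apply: eq_int => x; apply: eq_bigr => i _; rewrite expr2. Qed.

Lemma grad_intg u : D12 u -> intg (grad_sq u).
Proof. by move=> Du; apply: intg_sum => i; have [] := (LP2 mu _).1 (wp2 i Du). Qed.

Lemma ae_forall (P : 'I_N -> V -> Prop) : (forall i, {ae mu, forall x, P i x}) ->
  {ae mu, forall x, forall i, P i x}.
Proof.
move=> H; have : \forall x \ae mu, forall i, setT i -> P i x.
  by apply: (@filter_forall _ _ _ _ _) => i; move: (H i); apply: filterS.
by apply: filterS => x h i; exact: h.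
Qed.

Lemma dirD u v w : D12 u -> D12 v -> D12 w ->
  dir (fun x => u x + v x) w = dir u w + dir v w.
Proof.
move=> Du Dv Dw; have [Duv h] := D12D Du Dv.
rewrite /dir -intD; [|exact: dir_intg|exact: dir_intg].
apply: int_ae; [exact: (intg_meas (dir_intg Duv Dw))| |].
  by apply: intg_meas; apply: intgD; exact: dir_intg.
move: (ae_forall h); apply: filterS => x hx.
by rewrite -big_split; apply: eq_bigr => i _; rewrite hx mulrDl.
Qed.

Lemma dirZ c u w : D12 u -> D12 w -> dir (fun x => c * u x) w = c * dir u w.
Proof.
move=> Du Dw; have [Duv h] := D12Z c Du.
rewrite /dir -intZ; last exact: dir_intg.
apply: int_ae; [exact: (intg_meas (dir_intg Duv Dw))| |].
  by apply: intg_meas; apply: intgZ; exact: dir_intg.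
move: (ae_forall h); apply: filterS => x hx.
by rewrite mulr_sumr; apply: eq_bigr => i _; rewrite hx mulrA.
Qed.

Lemma dir_ge0 u : 0 <= dir u u.
Proof. by rewrite dirE; apply: int_ge0 => x; apply: sumr_ge0 => i _; exact: sqr_ge0. Qed.

Lemma dir_ae u v w : measurable_fun setT v -> {ae mu, forall x, u x = v x} -> D12 u -> D12 w ->
  dir v w = dir u w.
Proof.
move=> mv uv Du Dw; have [Dv h] := D12_ae mv uv Du.
apply: int_ae; [exact: (intg_meas (dir_intg Dv Dw))|exact: (intg_meas (dir_intg Du Dw))|].
by move: (ae_forall h); apply: filterS => x hx; apply: eq_bigr => i _; rewrite hx.
Qed.

Definition nrm u : R := (I (fun x => `|u x| `^ p)) `^ p^-1.

Lemma nrm_ge0 u : 0 <= nrm u. Proof. exact: powR_ge0. Qed.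

Lemma nrm_pow u : nrm u `^ p = I (fun x => `|u x| `^ p).
Proof.
rewrite -powRrM mulVf ?gt_eqF// powRr1//; apply: int_ge0 => x; exact: powR_ge0.
Qed.

Lemma nrm_eq0 u : LP mu p u -> nrm u = 0 -> {ae mu, forall x, u x = 0}.
Proof.
move=> up h; apply: (intNP_eq0 p0 up); rewrite -nrm_pow h powR0// gt_eqF//.
Qed.

Lemma nrm_le u (c : R) : 0 <= c -> I (fun x => `|u x| `^ p) <= c `^ p -> nrm u <= c.
Proof.
move=> c0 h; rewrite leNgt; apply/negP => h2; move: h; rewrite -nrm_pow leNgt => /negP; apply.
by apply: gt0_ltr_powR; rewrite ?nnegrE// nrm_ge0.
Qed.

Definition Ksob : R := (@Sob R N) `^ p^-1.

Lemma nrm_sobolev u : D12 u -> nrm u <= Ksob * Num.sqrt (dir u u).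
Proof.
move=> Du; have S0 : 0 <= @Sob R N by exact: powR_ge0.
apply: nrm_le; first by rewrite mulr_ge0 ?powR_ge0 ?sqrtr_ge0.
rewrite powRM ?powR_ge0 ?sqrtr_ge0// /Ksob -powRrM mulVf ?gt_eqF// powRr1//.
rewrite -powR12_sqrt ?dir_ge0// -powRrM mulrC [2^-1 * p]mulrC dirE [leRHS]mulrC.
exact: (sobolev N3 (D12_LP Du) (fun i => D12_wk i Du)).
Qed.

#[local] Opaque nrm dir crit_exp.

(** Hoelder with exponents p/(p-2), p and p. After normalising the three norms to 1 it is [young3]
    integrated, whence the constant 3; if one norm vanishes the integrand is zero almost
    everywhere. *)
Lemma holder3 (s t r : V -> R) : LP mu p s -> LP mu p t -> LP mu p r ->
  intg (fun x => `|s x| `^ (p - 2) * `|t x| * `|r x|) /\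
  I (fun x => `|s x| `^ (p - 2) * `|t x| * `|r x|) <= 3 * (nrm s `^ (p - 2) * nrm t * nrm r).
Proof.
move=> sp tp rp; have pm2 : 0 < p - 2 by rewrite subr_gt0.
have mF : measurable_fun setT (fun x => `|s x| `^ (p - 2) * `|t x| * `|r x|).
  apply: measurable_funM; last by apply: measurableT_comp => //; case: rp.
  by apply: measurable_funM; [apply: mpow; case: sp|apply: measurableT_comp => //; case: tp].
have iF : intg (fun x => `|s x| `^ (p - 2) * `|t x| * `|r x|).
  apply: (intg_le mF _ (intgD (intgD sp.2 tp.2) rp.2)) => x.
  rewrite ger0_norm ?mulr_ge0 ?powR_ge0//; apply: young3 => //; exact: ltW.
split=> //.
have zero : {ae mu, forall x, `|s x| `^ (p - 2) * `|t x| * `|r x| = 0} ->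
    I (fun x => `|s x| `^ (p - 2) * `|t x| * `|r x|) <= 3 * (nrm s `^ (p - 2) * nrm t * nrm r).
  move=> z; rewrite (int_ae (g := fun=> 0) mF) ?int0//.
  by rewrite !mulr_ge0 ?nrm_ge0 ?powR_ge0.
have [s0|s0] := eqVneq (nrm s) 0.
  apply: zero; move: (nrm_eq0 sp s0); apply: filterS => x ->.
  by rewrite normr0 powR0 ?mul0r// gt_eqF.
have [t0|t0] := eqVneq (nrm t) 0.
  by apply: zero; move: (nrm_eq0 tp t0); apply: filterS => x ->; rewrite normr0 mulr0 mul0r.
have [r0|r0] := eqVneq (nrm r) 0.
  by apply: zero; move: (nrm_eq0 rp r0); apply: filterS => x ->; rewrite normr0 mulr0.
have pos u : nrm u != 0 -> 0 < nrm u by move=> h; rewrite lt_neqAle eq_sym h nrm_ge0.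
have {}s0 := pos _ s0; have {}t0 := pos _ t0; have {}r0 := pos _ r0.
pose K := nrm s `^ (p - 2) * nrm t * nrm r.
have K0 : 0 < K by exact: mulr_gt0 (mulr_gt0 (powR_gt0 _ s0) t0) r0.
have one u : LP mu p u -> 0 < nrm u ->
    intg (fun x => (`|u x| / nrm u) `^ p) /\ I (fun x => (`|u x| / nrm u) `^ p) = 1.
  move=> up u0; have E x : (`|u x| / nrm u) `^ p = (nrm u `^ p)^-1 * `|u x| `^ p.
    by rewrite (powR_divl _ (normr_ge0 _) (nrm_ge0 _)) mulrC.
  have EE : (fun x => (`|u x| / nrm u) `^ p) = (fun x => (nrm u `^ p)^-1 * `|u x| `^ p) by exact/funext.
  rewrite EE.
  split; first exact: intgZ up.2.
  rewrite intZ; last exact: up.2.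
  by rewrite -nrm_pow mulVf// gt_eqF// powR_gt0.
have [is_ s1] := one _ sp s0; have [it t1] := one _ tp t0; have [ir r1] := one _ rp r0.
have le x : `|s x| `^ (p - 2) * `|t x| * `|r x| <=
   K * ((`|s x| / nrm s) `^ p + (`|t x| / nrm t) `^ p + (`|r x| / nrm r) `^ p).
  have h := young3 (ltW p2) (divr_ge0 (normr_ge0 (s x)) (nrm_ge0 s))
    (divr_ge0 (normr_ge0 (t x)) (nrm_ge0 t)) (divr_ge0 (normr_ge0 (r x)) (nrm_ge0 r)).
  apply: le_trans (ler_wpM2l (ltW K0) h).
  rewrite (powR_divl _ (normr_ge0 (s x)) (nrm_ge0 s)) /K.
  have : nrm s `^ (p - 2) != 0 by rewrite gt_eqF// powR_gt0.
  move: (nrm s `^ (p - 2)) (`|s x| `^ (p - 2)) (nrm t) (nrm r) t0 r0 => a b c d t0' r0' a0'.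
  apply: eqP_le; field.
  by rewrite a0' !gt_eqF.
have ig := intgD (intgD is_ it) ir.
have S : I (fun x => (`|s x| / nrm s) `^ p + (`|t x| / nrm t) `^ p + (`|r x| / nrm r) `^ p) = 1 + 1 + 1.
  apply: etrans (intD (intgD is_ it) ir) _; apply: etrans (congr2 +%R (intD is_ it) r1) _.
  exact: (congr1 (fun z => z + 1) (congr2 +%R s1 t1)).
have := int_le iF (intgZ K ig) le; rewrite (intZ K ig) S (_ : 1 + 1 + 1 = 3); last by ring.
by move=> H; apply: (le_trans H); exact: (eqP_le (mulrC K 3)).
Qed.

Variable O : set V.
Hypotheses (mO : measurable O) (fO : (mu O < +oo)%E).

Lemma O_sq u : LP mu p u -> intg (fun x => \1_O x * u x ^+ 2).
Proof.
move=> up; have m1 : measurable_fun setT (\1_O : V -> R) by exact: measurable_indic.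
apply: (intg_le _ _ (intgD (mu_intg mO fO) up.2)).
  by apply: measurable_funM => //; apply: measurable_funX; case: up.
move=> x; rewrite !indicE; case: (x \in O); last by rewrite mul0r normr0 add0r powR_ge0.
rewrite mul1r ger0_norm ?sqr_ge0// -pow2; have [h|h] := lerP `|u x| 1.
  have : `|u x| `^ 2 <= 1 `^ 2 by apply: ge0_ler_powR; rewrite ?nnegrE.
  by rewrite powR1 => /le_trans; apply; rewrite lerDl powR_ge0.
by rewrite ler_wpDl//; apply: ler_powR; exact: ltW.
Qed.

Lemma O_LP2 u : LP mu p u -> LP mu 2 (fun x => \1_O x * u x).
Proof.
move=> up; apply/LP2; split.
  by apply: measurable_funM; [exact: measurable_indic|case: up].
move: (O_sq up); congr intg; apply/funext => x; rewrite exprMn; congr (_ * _).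
by rewrite indicE; case: (x \in O); rewrite ?expr1n ?expr0n.
Qed.

Lemma O_mul u v : LP mu p u -> LP mu p v -> intg (fun x => \1_O x * u x * v x).
Proof.
move=> up vp; have := intgM (O_LP2 up) (O_LP2 vp); congr intg; apply/funext => x.
by rewrite indicE; case: (x \in O); rewrite ?mul1r ?mul0r.
Qed.

Variable lam : R.
Hypotheses (lam0 : lam <= 0) (hlam : (- Lambda O < lam%:E)%E).

Definition ipD u v : R := dir u v + lam * I (fun x => \1_O x * u x * v x).

Lemma ipDC u v : ipD u v = ipD v u.
Proof. by rewrite /ipD dirC; congr (_ + _ * _); apply: eq_int => x; rewrite mulrAC. Qed.

Lemma ipDD u v w : D12 u -> D12 v -> D12 w -> ipD (fun x => u x + v x) w = ipD u w + ipD v w.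
Proof.
move=> Du Dv Dw; rewrite /ipD dirD// (eq_int mu (g := fun x => \1_O x * u x * w x + \1_O x * v x * w x)); last first.
  by move=> x; ring.
by rewrite intD; [rewrite mulrDr addrACA|exact: O_mul (D12_LP Du) (D12_LP Dw)|exact: O_mul (D12_LP Dv) (D12_LP Dw)].
Qed.

Lemma ipDZ c u w : D12 u -> D12 w -> ipD (fun x => c * u x) w = c * ipD u w.
Proof.
move=> Du Dw; rewrite /ipD dirZ// (eq_int mu (g := fun x => c * (\1_O x * u x * w x))); last first.
  by move=> x; ring.
by rewrite intZ; [rewrite mulrDr [lam * (c * _)]mulrCA|exact: O_mul (D12_LP Du) (D12_LP Dw)].
Qed.

Lemma ipD_ae u v w : measurable_fun setT v -> {ae mu, forall x, u x = v x} -> D12 u -> D12 w ->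
  ipD v w = ipD u w.
Proof.
move=> mv uv Du Dw; rewrite /ipD (dir_ae mv uv Du Dw); congr (_ + _ * _).
have m1 : measurable_fun setT (\1_O : V -> R) by exact: measurable_indic.
have mw := (D12_LP Dw).1; have mu_ := (D12_LP Du).1.
apply: int_ae; [by do 2 apply: measurable_funM => //..|].
by move: uv; apply: filterS => x ->.
Qed.

(** Any real L <= Lambda that exceeds -lam satisfies L |u|^2 <= |grad u|^2 in integrated form, the
    left side over O only. As lam <= 0 the form keeps the positive fraction 1 + lam/L of the
    Dirichlet energy. *)
Lemma coercive : exists2 kap, 0 < kap & forall u, D12 u -> kap * dir u u <= ipD u u.
Proof.
(* A finite L is needed because Lambda may be infinite. *)
have [L [L0 lL hL]] : exists L, [/\ 0 < L, - lam < L & (L%:E <= Lambda O)%E].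
  case E : (Lambda O) hlam => [l| |].
  - rewrite -EFinN lte_fin ltrNl => h; exists l; split=> //; apply: le_lt_trans h; rewrite oppr_ge0//.
  - by move=> _; exists (1 - lam); split; rewrite ?leey// ?subr_gt0 ?(le_lt_trans lam0)// -subr_gt0 opprK subrK.
  - by rewrite /= ltNge leey.
exists (1 + lam / L); first by rewrite -ltrBlDl sub0r ltrNl -mulNr ltr_pdivrMr// mul1r.
move=> u Du; have up := D12_LP Du.
set X := I (fun x => \1_O x * u x * u x).
have EX : X = I (fun x => \1_O x * u x ^+ 2) by apply: eq_int => x; rewrite expr2 mulrA.
have X0 : 0 <= X by rewrite EX; apply: int_ge0 => x; rewrite mulr_ge0 ?sqr_ge0.
have main : L * X <= dir u u.
  have [->|Xn0] := eqVneq X 0; first by rewrite mulr0 dir_ge0.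
  have Xp : 0 < X by rewrite lt_neqAle eq_sym Xn0.
  have EXe : (\int[mu]_(x in O) ((u x) ^+ 2)%:E = X%:E)%E.
    rewrite EX EFin_int; last exact: O_sq.
    rewrite [LHS]integral_mkcond; apply: eq_integral => x _; rewrite patchE indicE.
    by case: (x \in O); rewrite ?mul1r ?mul0r.
  have : (L%:E <= rayleigh O u)%E.
    apply: le_trans hL _; apply: ereal_inf_lbound; exists u => //; split=> // u0.
    move/eqP : Xn0; apply; rewrite EX -(int0 mu); apply: int_ae.
    - exact: intg_meas (O_sq up).
    - exact: measurable_cst.
    - by move: u0; apply: filterS => x /(_ Logic.I) ->; rewrite /= expr0n mulr0.
  rewrite /rayleigh EXe eqe (negbTE Xn0) -EFin_int; last exact: grad_intg.
  by rewrite inver (negbTE Xn0) lee_pdivlMr// -EFinM lee_fin dirE.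
rewrite /ipD -/X mulrDl mul1r lerD2l mulrAC ler_pdivrMr//.
by rewrite [lam * X * L]mulrAC -mulrA; apply: ler_wnM2l => //; rewrite mulrC.
Qed.

Lemma ipD_le u : ipD u u <= dir u u.
Proof.
rewrite /ipD gerDl mulr_le0_ge0// int_ge0// => x.
by rewrite -mulrA -expr2 mulr_ge0 ?sqr_ge0.
Qed.

Lemma D12B a b : D12 a -> D12 b -> D12 (fun x => a x - b x) /\
  forall i, {ae mu, forall x, wpartial i (fun x => a x - b x) x = wpartial i a x - wpartial i b x}.
Proof.
move=> Da Db; have [Db' h'] := D12Z (-1) Db; have [D h] := D12D Da Db'.
have E : (fun x => a x - b x) = (fun x => a x + -1 * b x) by apply/funext => x; rewrite mulN1r.
by rewrite E; split=> // i; move: (h i) (h' i); apply: filterS2 => x -> ->; rewrite mulN1r.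
Qed.

(** Use [holder3] with the indicator of a ball containing the support as first factor, since it
    equals its own (p-2)-th power. *)
Lemma dual_p (psi : V -> R) : continuous psi -> bsupp psi -> exists2 C, 0 <= C &
  forall f, LP mu p f -> `|I (fun x => f x * psi x)| <= C * nrm f.
Proof.
move=> cp bp; have [r hr] := bp; have psip : LP mu p psi by exact: LP_bsupp.
have chip : LP mu p (\1_(B0 r) : V -> R).
  split; first by apply: measurable_indic; exact: B0_meas.
  have := @B0_intg R N r; congr intg; apply/funext => x; rewrite indicE.
  by case: (x \in _); rewrite ?normr1 ?powR1// normr0 powR0// gt_eqF.
exists (3 * (nrm (\1_(B0 r)) `^ (p - 2) * nrm psi)).
  by rewrite !mulr_ge0 ?powR_ge0.
move=> f fp; have [iF hF] := holder3 chip fp psip.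
have E x : `|f x * psi x| = `|\1_(B0 r) x| `^ (p - 2) * `|f x| * `|psi x|.
  rewrite normrM indicE; have [h|h] := boolP (x \in _); first by rewrite normr1 powR1 mul1r.
  rewrite hr ?normr0 ?mulr0//; move: h; rewrite notin_setE /B0 /= => /negP; by rewrite -leNgt.
have iF' : intg (fun x => f x * psi x).
  apply: (intg_le _ _ iF); last by move=> x; rewrite E.
  by apply: measurable_funM; [case: fp|exact: continuous_measurable_rV].
apply: (le_trans (int_norm iF')); apply: (le_trans (eqP_le (eq_int mu E))); apply: (le_trans hF).
by move: (nrm _ `^ _) (nrm f) (nrm psi) => a b c; apply: eqP_le; ring.
Qed.

Lemma dual_2 (psi : V -> R) : continuous psi -> bsupp psi -> exists2 C, 0 <= C &
  forall f, LP mu 2 f -> `|I (fun x => f x * psi x)| <= C * Num.sqrt (I (fun x => f x ^+ 2)).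
Proof.
move=> cp bp; have psip : LP mu 2 psi by exact: LP_bsupp.
exists (Num.sqrt (I (fun x => psi x ^+ 2))) => [|f f2]; first exact: sqrtr_ge0.
rewrite -sqrtr_sqr mulrC -sqrtrM; last by apply: int_ge0 => x; exact: sqr_ge0.
by apply: ler_wsqrtr; exact: int_CS.
Qed.

Lemma small0 (a : R) : (forall e, 0 < e -> `|a| <= e) -> a = 0.
Proof.
move=> H; apply/eqP; rewrite -normr_le0; apply/ler_addgt0Pr => e e0.
by rewrite add0r; exact: H.
Qed.

(* The limit is selected pointwise, so that it inherits symmetries of the sequence. *)
Lemma D12_complete (u : nat -> V -> R) : (forall m, D12 (u m)) ->
  (forall e, 0 < e -> exists M, forall m n, (M <= m)%N -> (M <= n)%N ->
     dir (fun x => u m x - u n x) (fun x => u m x - u n x) <= e) ->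
  exists s : nat -> nat, let v := limsel (fun k => u (s k)) in D12 v /\
  forall e, 0 < e -> exists M, forall m, (M <= m)%N ->
    dir (fun x => u m x - v x) (fun x => u m x - v x) <= e.
Proof.
move=> Du uC.
have Dm m n := D12B (Du m) (Du n).
have uCp e : 0 < e -> exists M, forall m n, (M <= m)%N -> (M <= n)%N ->
     I (fun x => `|u m x - u n x| `^ p) <= e.
  move=> e0; have K1 : 0 < Ksob + 1 by rewrite ltr_wpDl ?powR_ge0.
  pose X := e `^ p^-1 / (Ksob + 1).
  have X0 : 0 < X by rewrite divr_gt0 ?powR_gt0.
  have [M hM] := uC (X ^+ 2) (exprn_gt0 _ X0); exists M => m n Mm Mn.
  have -> : e = (e `^ p^-1) `^ p by rewrite -powRrM mulVf ?gt_eqF// powRr1// ltW.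
  rewrite -nrm_pow; apply: ge0_ler_powR; rewrite ?nnegrE ?nrm_ge0 ?powR_ge0 ?(ltW p0)//.
  apply: le_trans (nrm_sobolev (Dm m n).1) _.
  have h := ler_wsqrtr (hM m n Mm Mn); rewrite sqrtr_sqr ger0_norm ?(ltW X0)// in h.
  apply: le_trans (ler_wpM2l (powR_ge0 _ _) h) _.
  rewrite /X mulrA ler_pdivrMr// mulrC ler_wpM2l ?powR_ge0// lerDl//.
have [s [vp hv]] := LP_complete p0 (fun m => D12_LP (Du m)) uCp.
exists s => v.
have wC i : exists w, LP mu 2 w /\ forall e, 0 < e -> exists M, forall m, (M <= m)%N ->
    I (fun x => `|wpartial i (u m) x - w x| `^ 2) <= e.
  have [|s' [wp hw]] := LP_complete (ltr0n _ 2) (fun m => wp2 i (Du m)).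
    move=> e e0; have [M hM] := uC e e0; exists M => m n Mm Mn.
    apply: le_trans (hM m n Mm Mn); rewrite dirE.
    have [Dmn hmn] := Dm m n.
    rewrite (int_ae (g := fun x => wpartial i (fun x => u m x - u n x) x ^+ 2)); last 3 first.
    - by apply: mpow; apply: measurable_funB; [case: (wp2 i (Du m))|case: (wp2 i (Du n))].
    - by apply: measurable_funX; case: (wp2 i Dmn).
    - by move: (hmn i); apply: filterS => x ->; rewrite pow2.
    apply: int_le; [by have [] := (LP2 mu _).1 (wp2 i Dmn)|exact: grad_intg|move=> x].
    by rewrite /grad_sq (bigD1 i)//= lerDl; apply: sumr_ge0 => j _; exact: sqr_ge0.
  by exists (limsel (fun k => wpartial i (u (s' k)))).
have /choice[w hw] := wC.
have lv : loc v by exact: LP_loc vp.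
(* The weak derivative identity is closed under these limits: the two pairings with test functions
   are continuous in L^p and L^2 by [dual_p] and [dual_2]. *)
have Hv : forall i, wk i v (w i).
  move=> i; split; first exact: (hw i).1.
  move=> phi sphi bphi; have sp := smooth_partial i sphi; have bp := bsupp_partial i sphi bphi.
  have [C C0 hC] := dual_p (smooth_cont sp) bp.
  have [C' C'0 hC'] := dual_2 (smooth_cont sphi) bphi.
  have lw := LP_loc (ler1n _ 2) (hw i).1.
  apply/eqP; rewrite -subr_eq0 opprK; apply/eqP; apply: small0 => e e0.
  have e2 : 0 < e / 2 by rewrite divr_gt0.
  have [d d0 hd] := small_rel C0 e2; have [d' d'0 hd'] := small_rel C'0 e2.
  have [M hM] := hv (d `^ p) (powR_gt0 _ d0).
  have [M' hM'] := (hw i).2 (d' ^+ 2) (exprn_gt0 _ d'0).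
  pose m := maxn M M'.
  have um := hM m (leq_maxl _ _); have wm := hM' m (leq_maxr _ _).
  have nu : nrm (fun x => u m x - v x) <= d by apply: nrm_le => //; exact: ltW.
  have lu := D12_loc (Du m); have W := D12_wk i (Du m); have lwm := LP_loc (ler1n _ 2) W.1.
  have -> : I (fun x => v x * partial i phi x) + I (fun x => w i x * phi x) =
      - I (fun x => (u m x - v x) * partial i phi x) - I (fun x => (wpartial i (u m) x - w i x) * phi x).
    rewrite (eq_int mu (f := fun x => (u m x - v x) * partial i phi x) (g := fun x => u m x * partial i phi x - v x * partial i phi x)); last first.
      by move=> x; rewrite mulrBl.
    rewrite intB; [|exact: loc_intg|exact: loc_intg].
    rewrite (eq_int mu (f := fun x => (wpartial i (u m) x - w i x) * phi x) (g := fun x => wpartial i (u m) x * phi x - w i x * phi x)); last first.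
      by move=> x; rewrite mulrBl.
    rewrite intB; [|exact: loc_intg|exact: loc_intg].
    rewrite W.2//; move: (I (fun x => v x * _)) (I (fun x => w i x * _)) (I (fun x => wpartial i (u m) x * _)) => a b c.
    ring.
  apply: le_trans (ler_normB _ _) _; rewrite normrN.
  have h1 : `|I (fun x => (u m x - v x) * partial i phi x)| <= e / 2.
    apply: le_trans (hC _ _) _; first by apply: LPB (D12_LP (Du m)) vp; exact: ltW.
    by apply: le_trans (ler_wpM2l C0 nu) _; rewrite mulrC ltW.
  have h2 : `|I (fun x => (wpartial i (u m) x - w i x) * phi x)| <= e / 2.
    apply: le_trans (hC' _ _) _; first by apply: LPB W.1 (hw i).1.
    have h3 : Num.sqrt (I (fun x => (wpartial i (u m) x - w i x) ^+ 2)) <= d'.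
      rewrite -(ger0_norm (ltW d'0)) -sqrtr_sqr; apply: ler_wsqrtr; apply: le_trans wm.
      by apply: eqP_le; apply: eq_int => x; rewrite pow2.
    by apply: le_trans (ler_wpM2l C'0 h3) _; rewrite mulrC ltW.
  by have := lerD h1 h2; rewrite -splitr.
have [Dv hae] := D12_intro vp Hv.
split=> // e e0.
have eN : 0 < e / N%:R by rewrite divr_gt0// ltr0n (leq_trans _ N3).
have /choice[M hM] i := (hw i).2 (e / N%:R) eN.
exists (\max_i M i) => m hm.
have [Dmv hmv] := D12B (Du m) Dv.
have sq i : intg (fun x => (wpartial i (u m) x - w i x) ^+ 2).
  by have [] := (LP2 mu _).1 (LPB (ler0n _ 2) (wp2 i (Du m)) (hw i).1).
rewrite dirE (int_ae (g := fun x => \sum_i (wpartial i (u m) x - w i x) ^+ 2)); last 3 first.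
- exact: (intg_meas (grad_intg Dmv)).
- by apply: intg_meas; apply: intg_sum => i; exact: sq.
- move: (ae_forall hmv) (ae_forall hae); apply: filterS2 => x h1 h2.
  by apply: eq_bigr => i _; rewrite h1 h2.
rewrite int_sum; last by move=> i; exact: sq.
apply: (@le_trans _ _ (\sum_(i < N) (e / N%:R))).
  apply: ler_sum => i _; apply: le_trans (hM i m _).
    by apply: eqP_le; apply: eq_int => x; rewrite pow2.
  by apply: leq_trans hm; exact: leq_bigmax.
by rewrite sumr_const card_ord -[_ *+ N]mulr_natr divfK// pnatr_eq0 -lt0n (leq_trans _ N3).
Qed.

End D12calculus.

(** * A Rellich estimate by mollification, and the product rule *)

Section Rellich.
#[local] Opaque crit_exp nrm dir rho.
Context {R : realType}.
Variable N : nat.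
Hypothesis N3 : (3 <= N)%N.
Local Notation V := 'rV[R]_N.
Local Notation mu := (@lebesgue_rV R N).
Local Notation I f := (Rintegral mu setT f).
Local Notation intg := (@intg _ _ R mu).
Local Notation p := (@crit_exp R N).
Implicit Types (u v w : V -> R).

Let p2 : 2 < p. Proof. exact: crit_gt2. Qed.

Lemma closed_ball_compact (r : R) : compact [set x : V | `|x| <= r].
Proof.
apply: bounded_closed_compact.
  exists r; split; first exact: num_real.
  by move=> M hM x Kx; apply: le_trans Kx (ltW hM).
have nc : continuous (fun x : V => `|x|) by exact: norm_continuous.
by move/continuous_closedP : nc => /(_ _ (@closed_le R r)).
Qed.

Lemma open_dist (a : V) (d : R) : open [set y | `|a - y| < d].
Proof.
have c : continuous (fun y : V => `|a - y|).
  apply: eps_continuous => y e e0; exists e => // z hz.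
  apply: le_lt_trans (ler_dist_dist _ _) _.
  by have -> : a - y - (a - z) = z - y; [rewrite opprB [z - a]addrC addrACA subrr add0r addrC|rewrite distrC].
by move/continuousP : c => /(_ _ (@open_lt R d)).
Qed.

Lemma finite_net (K : set V) (d : R) : compact K -> 0 < d ->
  exists s : seq V, forall x, K x -> exists2 y, y \in s & `|y - x| < d.
Proof.
rewrite compact_cover => cK d0.
pose f (a : V) : set V := [set y | `|a - y| < d].
have H a : setT a -> open (f a) by move=> _; exact: open_dist.
have [] := cK _ setT f H.
  by move=> x _; exists x => //; rewrite /f /= subrr normr0.
move=> D' _ hD; exists (finmap.enum_fset D') => x /hD [a /= aD ax]; by exists a.
Qed.

Lemma conv_quad k u (c d : R) x : kernel k -> loc u -> loc (fun y => u y ^+ 2) ->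
  conv k (fun y => u y ^+ 2 + (c * u y + d)) x = conv k (fun y => u y ^+ 2) x + (c * conv k u x + d).
Proof.
move=> kk lu lu2; have [sk bk k0 k1] := kk; have ck := smooth_cont sk.
have lc := loc_scale c lu; have ld := @loc_cst R N d.
by rewrite (convD x ck bk lu2 (loc_add lc ld)) (convD x ck bk lc ld) (convZ c x ck bk lu) (conv_cst d x kk).
Qed.

(** By Jensen the squared difference at x is at most the k-average of (u(x-z) - u(x))^2. Integrating
    in x first, the translation estimate applies with |z| < h. *)
Lemma conv_sq_dist k u (h : R) : kernel k -> (forall x, h <= `|x| -> k x = 0) -> 0 <= h -> D12 u ->
  I (fun x => (u x - conv k u x) ^+ 2) <= N%:R * h ^+ 2 * dir u u /\
  intg (fun x => (u x - conv k u x) ^+ 2).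
Proof.
move=> kk kh h0 Du; have [sk bk k0 k1] := kk; have ck := smooth_cont sk.
have mk := continuous_measurable_rV ck.
have up := D12_LP N3 Du; have lu := D12_loc N3 Du; have mu_ := up.1.
have lu2 : loc (fun x => u x ^+ 2).
  split; first exact: measurable_funX.
  move=> r; have := O_sq N3 (B0_meas r) (lebesgue_rV_bounded (B0_meas r) (r := r) (fun x h => h)) up.
  by congr intg; apply/funext => x; rewrite mulrC.
have mc : measurable_fun setT (conv k u) by apply: continuous_measurable_rV; exact: conv_cont.
have pt x : (((u x - conv k u x) ^+ 2)%:E <= \int[mu]_z (k z * (u (x - z) - u x) ^+ 2)%:E)%E.
  pose q y := (u y - u x) ^+ 2.
  have lq : loc q.
    rewrite (_ : q = fun y => u y ^+ 2 + ((- 2 * u x) * u y + u x ^+ 2)); last by apply/funext => y; rewrite /q; ring.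
    by apply: loc_add => //; apply: loc_add; [exact: loc_scale|exact: loc_cst].
  have le1 : (u x - conv k u x) ^+ 2 <= conv k q x.
    have -> : conv k q x = conv k (fun y => u y ^+ 2 + ((- 2 * u x) * u y + u x ^+ 2)) x.
      by apply: eq_int => y; rewrite /q; congr (_ * _); ring.
    set a := conv k u x.
    (* With a the k-average of u near x, the variance about a is nonnegative, so the average of u^2
       is at least a^2. *)
    have : 0 <= conv k (fun y => u y ^+ 2 + ((- 2 * a) * u y + a ^+ 2)) x.
      apply: int_ge0 => y; rewrite mulr_ge0//.
      have E : (u y - a) ^+ 2 = u y ^+ 2 + (- 2 * a * u y + a ^+ 2) by ring.
      by rewrite -E sqr_ge0.
    rewrite !conv_quad// -/a; nra.
  apply: (@le_trans _ _ (conv k q x)%:E); first by rewrite lee_fin.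
  rewrite /conv EFin_int; last exact: conv_intg.
  have mq : measurable_fun setT (fun y : V => (k (x - y) * q y)%:E).
    apply/measurable_EFinP; apply: measurable_funM; last exact: lq.1.
    exact: (meas_preserving (preserving_reflect x)).
  have pq (y : V) : (0 <= (k (x - y) * q y)%:E)%E by rewrite lee_fin mulr_ge0 ?sqr_ge0.
  rewrite -((preserving_reflect x).2 _ mq pq) le_eqVlt; apply/orP; left; apply/eqP.
  by apply: eq_integral => z _; rewrite /q subKr.
have mF : measurable_fun setT (fun z : V * V => (k z.2 * (u (z.1 - z.2) - u z.1) ^+ 2)%:E).
  apply/measurable_EFinP; apply: measurable_funM; first exact: (measurableT_comp mk measurable_snd).
  apply: measurable_funX; apply: measurable_funB; last exact: (measurableT_comp mu_ measurable_fst).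
  by apply: (measurableT_comp mu_); apply: measurable_rVB; [exact: measurable_fst|exact: measurable_snd].
have F0 (z : V * V) : (0 <= (k z.2 * (u (z.1 - z.2) - u z.1) ^+ 2)%:E)%E by rewrite lee_fin mulr_ge0 ?sqr_ge0.
have [i1 i2] : intg (fun x => (u x - conv k u x) ^+ 2) /\
    I (fun x => (u x - conv k u x) ^+ 2) <= N%:R * h ^+ 2 * dir u u; last by [].
apply: int_le_ereal.
- by apply: measurable_funX; exact: measurable_funB.
- by move=> x; exact: sqr_ge0.
apply: (@le_trans _ _ (\int[mu]_x \int[mu]_z (k z * (u (x - z) - u x) ^+ 2)%:E)%E).
  apply: ge0_le_integral => //.
  - by move=> x _; rewrite lee_fin sqr_ge0.
  - by apply/measurable_EFinP; apply: measurable_funX; exact: measurable_funB.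
  - exact: (@measurable_fun_fubini_tonelli_F _ _ _ _ R mu _ mF F0).
rewrite (@fubini_tonelli _ _ _ _ R mu mu _ mF F0) /=.
have C0 : 0 <= N%:R * h ^+ 2 * dir u u by rewrite !mulr_ge0 ?sqr_ge0 ?dir_ge0.
apply: (@le_trans _ _ (\int[mu]_z ((N%:R * h ^+ 2 * dir u u) * k z)%:E)%E).
  apply: ge0_le_integral => //.
  - by move=> z _; apply: integral_ge0 => x _; exact: (F0 (x, z)).
  - exact: (@measurable_fun_fubini_tonelli_G _ _ _ _ R mu _ mF F0).
  - by apply/measurable_EFinP; exact: measurable_funM.
  move=> z _; under eq_integral do rewrite EFinM.
  have [ti tl] := translation N3 up (fun i => D12_wk i Du) (- z).
  have mt : measurable_fun setT (fun x : V => ((u (x - z) - u x) ^+ 2)%:E).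
    by apply/measurable_EFinP; exact: (intg_meas ti).
  have pz (x : V) : setT x -> (0 <= ((u (x - z) - u x) ^+ 2)%:E)%E by move=> _; rewrite lee_fin sqr_ge0.
  have kz : (0 <= (k z)%:E)%E by rewrite lee_fin.
  rewrite ge0_integralZl//.
  rewrite -EFin_int// -EFinM lee_fin [leRHS]mulrC.
  have [hz|hz] := lerP h `|z|; first by rewrite kh// !mul0r.
  apply: ler_wpM2l => //; apply: le_trans tl _; rewrite normrN dirE.
  apply: ler_wpM2r; first by apply: int_ge0 => x; apply: sumr_ge0 => i _; exact: sqr_ge0.
  by apply: ler_wpM2l => //; rewrite ler_pXn2r ?nnegrE// ltW.
under eq_integral do rewrite EFinM.
have ki : intg k by exact: bsupp_integrable.
have mke : measurable_fun setT (fun z : V => (k z)%:E) by exact/measurable_EFinP.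
have k0e (z : V) : setT z -> (0 <= (k z)%:E)%E by rewrite lee_fin.
by rewrite ge0_integralZl// -EFin_int// k1 mule1.
Qed.

(* A bounded family of linear functionals controls the L2 norm on balls. *)
Lemma rellich (r0 E0 eps : R) : 0 < r0 -> 0 < E0 -> 0 < eps ->
  exists M (L : 'I_M -> (V -> R) -> R),
   [/\ forall i u v, D12 u -> D12 v -> L i (fun x => u x - v x) = L i u - L i v,
       forall i, exists K, forall u, D12 u -> `|L i u| <= K * nrm u &
       forall u, D12 u -> dir u u <= E0 -> (forall i, `|L i u| <= 1) ->
         I (fun x => \1_(B0 r0) x * u x ^+ 2) <= eps].
Proof.
move=> r00 E00 e0.
have NE : 0 <= 2 * N%:R * E0 by rewrite !mulr_ge0// ltW.
(* The mollification scale h is chosen with 2 N h^2 E0 <= eps/2, so that replacing u by k * u costs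
   at most half of eps. *)
have [h2 h20 hh2] := small_rel NE (divr_gt0 e0 (ltr0n _ 2)).
have sh20 : 0 < Num.sqrt h2 by rewrite sqrtr_gt0.
have [J hJ] := natinv_lt sh20.
pose k := @rho R N J; have kk : kernel k by exact: rho_kernel.
have [sk bk k0 k1] := kk; have ck := smooth_cont sk.
pose h : R := J.+1%:R^-1; have h0 : 0 < h by rewrite invr_gt0.
have hs : h ^+ 2 < h2.
  have := hJ J (leqnn J); rewrite -/h => hl.
  by rewrite -(sqr_sqrtr (ltW h20)) ltr_pXn2r ?nnegrE ?sqrtr_ge0// ltW.
have kh x : h <= `|x| -> k x = 0 by exact: rho_supp.
pose m0 := I (\1_(B0 r0) : V -> R).
have m00 : 0 <= m0 by apply: int_ge0.
have NE' : 0 <= 8 * m0 by rewrite mulr_ge0.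
have [e2 e20 he2] := small_rel NE' (divr_gt0 e0 (ltr0n _ 2)).
pose eta := Num.sqrt e2; have eta0 : 0 < eta by rewrite sqrtr_gt0.
have [r r0' hr] := bsupp_pos bk.
pose M0 := r + r0 + 1.
pose U := I (\1_(B0 M0) : V -> R) + ((@Ksob R N) * Num.sqrt E0) `^ p.
have U0 : 0 <= U by rewrite addr_ge0 ?powR_ge0// int_ge0.
have [e' e'0 he'] := small_rel U0 eta0.
have [d d0 hd] := bsupp_ucont ck bk e'0.
have dm : 0 < Num.min d 1 by rewrite lt_min d0 ltr01.
have [s hs'] := finite_net (@closed_ball_compact r0) dm.
(* The functionals are the values of the mollified function at the points of a finite net of the
   ball, scaled by 1/eta. If all are at most 1, equicontinuity bounds the mollified function by 2
   eta on the whole ball. *)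
exists (size s), (fun i u => eta^-1 * conv k u (tnth (in_tuple s) i)); split.
- move=> i u v Du Dv; have Dv' := (D12Z N3 (-1) Dv).1.
  rewrite -mulrBr; congr (_ * _); rewrite /conv -intB; last 2 first.
  + by apply: conv_intg => //; exact: D12_loc.
  + by apply: conv_intg => //; exact: D12_loc.
  by apply: eq_int => y; rewrite mulrBr.
- move=> i; set x := tnth _ _.
  have [C C0 hC] := dual_p N3 (@reflect_cont R N k x ck) (@reflect_bsupp R N k x bk).
  exists (eta^-1 * C) => u Du; rewrite normrM ger0_norm ?invr_ge0 ?(ltW eta0)// -mulrA.
  apply: ler_wpM2l; first by rewrite invr_ge0 ltW.
  rewrite /conv (eq_int mu (g := fun y => u y * k (x - y))); first exact: hC (D12_LP N3 Du).
  by move=> y; rewrite mulrC.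
move=> u Du uE uL; have up := D12_LP N3 Du; have lu := D12_loc N3 Du.
have cc := conv_cont ck bk lu.
have uU : I (fun y => `|u y * \1_(B0 M0) y|) <= U.
  apply: (@le_trans _ _ (I (fun y => \1_(B0 M0) y + `|u y| `^ p))).
    apply: int_le => [| |y].
    - by apply: intg_norm; exact: lu.2.
    - by apply: intgD; [exact: B0_intg|exact: up.2].
    rewrite indicE; case: (y \in _); last by rewrite mulr0 normr0 add0r powR_ge0.
    rewrite mulr1; have [y1|y1] := lerP `|u y| 1; first by rewrite ler_wpDr ?powR_ge0.
    rewrite ler_wpDl// -[leLHS]powRr1//; apply: ler_powR; first exact: ltW.
    by apply: ltW; apply: lt_trans p2; rewrite ltr1n.
  rewrite intD; [|exact: B0_intg|exact: up.2].
  rewrite lerD2l -(nrm_pow N3); apply: ge0_ler_powR; rewrite ?nnegrE ?nrm_ge0//.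
  - by apply: ltW; apply: lt_trans p2.
  - by rewrite mulr_ge0 ?powR_ge0 ?sqrtr_ge0.
  apply: le_trans (nrm_sobolev N3 Du) _; apply: ler_wpM2l; first exact: powR_ge0.
  exact: ler_wsqrtr.
have vs x : `|x| <= r0 -> `|conv k u x| <= 2 * eta.
  move=> xr; have [y ys yx] := hs' x xr.
  have [i hi] : exists i : 'I_(size s), y = tnth (in_tuple s) i.
    by have /tnthP[i hi] : y \in in_tuple s by []; exists i.
  have := uL i; rewrite -hi normrM ger0_norm ?invr_ge0 ?(ltW eta0)// mulrC ler_pdivrMr// mul1r => h1.
  move: yx; rewrite lt_min => /andP[yd y1].
  have yr : `|y| <= r0 + 1 by have := lerB_dist y x; lra.
  have h2' : `|conv k u x - conv k u y| <= eta.
    rewrite /conv -intB; [|exact: conv_intg|exact: conv_intg].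
    rewrite (eq_int mu (g := fun z => (k (x - z) - k (y - z)) * u z)); last by move=> z; rewrite mulrBl.
    have [] := @conv_bound R N u x (fun z => k (x - z) - k (y - z)) e' M0 lu.
    - by apply: measurable_funB; apply: continuous_measurable_rV; exact: reflect_cont.
    - by move=> z; apply: hd; rewrite opprB addrA subrK distrC.
    - move=> z hz; have a1 := lerB_dist z x; have a2 := lerB_dist z y.
      rewrite distrC in a1; rewrite distrC in a2; rewrite /M0 in hz.
      by rewrite !hr ?subrr//; lra.
    move=> _ /le_trans; apply; apply: le_trans (ltW he'); apply: ler_wpM2l; [exact: ltW|exact: uU].
  rewrite -(subrK (conv k u y) (conv k u x)) mulr_natl mulr2n; apply: le_trans (ler_normD _ _) _.
  exact: (lerD h2' h1).
have [dl di] := conv_sq_dist kk kh (ltW h0) Du.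
have Bi := @B0_intg R N r0.
(* On the ball u^2 <= 2 (u - k * u)^2 + 2 (k * u)^2, and (k * u)^2 <= 4 e2 since eta^2 = e2. *)
apply: (@le_trans _ _ (I (fun x => 2 * (u x - conv k u x) ^+ 2 + (8 * e2) * \1_(B0 r0) x))).
  apply: int_le => [| |x].
  - apply: (O_sq N3 (B0_meas r0) _ up).
    exact: (lebesgue_rV_bounded (B0_meas r0) (r := r0) (fun x h => h)).
  - by apply: intgD; exact: intgZ.
  rewrite indicE; have [xB|xB] := boolP (x \in _); last by rewrite mul0r mulr0 addr0 mulr_ge0 ?sqr_ge0.
  rewrite mul1r mulr1; move: xB; rewrite inE => /ltW /vs hv.
  have : conv k u x ^+ 2 <= 4 * e2.
    rewrite -[leLHS]real_normK ?num_real//.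
    have : `|conv k u x| ^+ 2 <= (2 * eta) ^+ 2 by rewrite ler_pXn2r ?nnegrE ?mulr_ge0// ltW.
    by rewrite exprMn /eta sqr_sqrtr ?(ltW e20)//; lra.
  have := sqr_ge0 (u x - 2 * conv k u x); nra.
rewrite intD; [|exact: intgZ|exact: intgZ].
rewrite !intZ//.
have a1 : 2 * I (fun x => (u x - conv k u x) ^+ 2) <= eps / 2.
  apply: le_trans (ler_wpM2l _ dl) _ => //; apply: le_trans (ltW hh2).
  apply: (@le_trans _ _ (2 * (N%:R * h ^+ 2 * E0))).
    by apply: ler_wpM2l => //; apply: ler_wpM2l => //; rewrite mulr_ge0 ?sqr_ge0.
  rewrite (_ : 2 * (N%:R * h ^+ 2 * E0) = h ^+ 2 * (2 * N%:R * E0)); last by ring.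
  by apply: ler_wpM2r => //; exact: ltW.
have a2 : 8 * e2 * m0 <= eps / 2 by apply: le_trans (ltW he2); apply: eqP_le; ring.
by have := lerD a1 a2; rewrite -splitr.
Qed.

(** Leibniz rule: the identity for u is tested with chi phi. *)
Lemma wk_mul i (chi u w : V -> R) : smooth chi -> bsupp chi -> LP mu p u -> wk i u w ->
  wk i (fun x => chi x * u x) (fun x => chi x * w x + partial i chi x * u x).
Proof.
move=> sc bc up [w2 H].
have p1 : 1 <= p by apply: ltW; apply: lt_trans p2; rewrite ltr1n.
have lu : loc u by exact: LP_loc up.
have lw := LP_loc (ler1n _ 2) w2.
have sp := smooth_partial i sc; have bp := bsupp_partial i sc bc.
have cc := smooth_cont sc; have cp := smooth_cont sp.
have mul2 (f : V -> R) (g : V -> R) : continuous f -> bsupp f -> loc (fun x => g x ^+ 2) ->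
    measurable_fun setT g -> LP mu 2 (fun x => f x * g x).
  move=> cf bf lg mg; have mf := continuous_measurable_rV cf; apply/LP2; split; first exact: measurable_funM.
  have := cont_mul (f := fun x => f x * f x) lg (contM cf cf) (bsupp_mul f bf).
  by congr intg; apply/funext => x; ring.
have lu2 : loc (fun x => u x ^+ 2).
  split; first by apply: measurable_funX; exact: up.1.
  move=> r; have := O_sq N3 (B0_meas r) (lebesgue_rV_bounded (B0_meas r) (r := r) (fun x h => h)) up.
  by congr intg; apply/funext => x; rewrite mulrC.
have lw2 : loc (fun x => w x ^+ 2) by apply: intg_loc; have [] := (LP2 mu _).1 w2.
split.
  by apply: LPD => //; [exact: mul2 cc bc lw2 w2.1|exact: mul2 cp bp lu2 up.1].
move=> phi sphi bphi; have cphi := smooth_cont sphi.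
have sm := smooth_mul sc sphi; have bm := bsupp_mul phi bc.
have := H (fun x => chi x * phi x) sm bm.
have i1 : intg (fun x => u x * (partial i chi x * phi x)).
  exact: (loc_intg lu (smooth_mul sp sphi) (bsupp_mul phi bp)).
have i2 : intg (fun x => u x * (chi x * partial i phi x)).
  exact: (loc_intg lu (smooth_mul sc (smooth_partial i sphi)) (bsupp_mul _ bc)).
have i3 : intg (fun x => w x * (chi x * phi x)) by exact: (loc_intg lw sm bm).
rewrite (eq_int mu (f := fun x => u x * _) (g := fun x => u x * (partial i chi x * phi x) + u x * (chi x * partial i phi x))); last first.
  by move=> x; rewrite partialM// mulrDr.
rewrite intD// => E.
rewrite (eq_int mu (f := fun x => chi x * u x * _) (g := fun x => u x * (chi x * partial i phi x))); last by move=> x; ring.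
rewrite (eq_int mu (f := fun x => (_ + _) * _) (g := fun x => w x * (chi x * phi x) + u x * (partial i chi x * phi x))); last by move=> x; ring.
by rewrite intD// opprD -E addrAC subrr add0r.
Qed.

End Rellich.

(** * Infinite orbits and the compact embedding into L^p of Omega *)

Section CompactEmbedding.
Context {R : realType}.
Variable N : nat.
Hypothesis N3 : (3 <= N)%N.
Local Notation V := 'rV[R]_N.
Local Notation mu := (@lebesgue_rV R N).
Local Notation I f := (Rintegral mu setT f).
Local Notation intg := (@intg _ _ R mu).
Local Notation p := (@crit_exp R N).
Implicit Types (u v w : V -> R).
#[local] Opaque crit_exp nrm dir.

Let p2 : 2 < p. Proof. exact: crit_gt2. Qed.
Let N0 : (0 < N)%N. Proof. exact: leq_trans N3. Qed.

Lemma infinite_ord (A : set V) m : infinite_set A ->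
  exists f : 'I_m -> V, injective f /\ forall i, A (f i).
Proof.
move=> /infiniteP/pcard_leP[f]; exists (fun i => f (i : nat)); split.
  by move=> i j /(@inj _ _ _ f) h; apply/val_inj/h; rewrite inE.
by move=> i; apply: (@funS _ _ _ _ f).
Qed.

Lemma mulmx_lip (g : 'M[R]_N) (y : V) : g *m g^T = 1%:M -> `|y *m g| <= N%:R * `|y|.
Proof.
move=> gg; have N1 : 1 <= N%:R :> R by rewrite ler1n.
rewrite -(@ler_pXn2r _ 2) ?nnegrE ?mulr_ge0//.
apply: le_trans (norm_sqn _) _; rewrite sqn_orth//; apply: le_trans (sqn_norm _) _.
by rewrite exprMn ler_wpM2r ?sqr_ge0// expr2 ler_peMl.
Qed.

(** The gap 2r makes the balls of radius r around these m orbit points disjoint; Euclidean balls lie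
    inside balls of the max norm. *)
Definition separated (G : set 'M[R]_N) m (r : R) (y : V) := exists g : 'I_m -> 'M[R]_N,
  (forall i, G (g i)) /\ forall i j, i != j -> 2 * r <= `|y *m (g i)^T - y *m (g j)^T|.

(** Choose m distinct orbit points at x. The group elements producing them still separate the images
    of all nearby y, and compactness makes the gap uniform. *)
Lemma orbit_separation (G : set 'M[R]_N) (K : set V) m : (forall g, G g -> g *m g^T = 1%:M) ->
  compact K ->
  (forall x, K x -> infinite_set (Gorbit G x)) ->
  exists2 r, 0 < r & forall x y, K x -> `|y - x| < r -> separated G m r y.
Proof.
move=> GO /compact_near_coveringP cK infG; have NR : 0 < N%:R :> R by rewrite ltr0n.
have [|e /= e0 he] := cK R (0^'+) (fun r x => forall y, `|y - x| < r -> separated G m r y) _.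
  move=> x Kx; have [f [finj fG]] := infinite_ord m (infG x Kx).
  have /choice[g hg] i : exists g, G g /\ x *m g^T = f i by have [g Gg <-] := fG i; exists g.
  have H (ij : 'I_m * 'I_m) : (filter_prod (nbhs x) (0^'+)) (fun yr : V * R => ij.1 != ij.2 ->
      forall y', `|y' - yr.1| < yr.2 -> 2 * yr.2 <= `|y' *m (g ij.1)^T - y' *m (g ij.2)^T|).
    case: ij => i j /=; have [_|ij] := eqVneq i j; first by apply: filterE => -[y r].
    pose q (y : V) := `|y *m ((g i)^T - (g j)^T)|.
    have q0 : 0 < q x.
      rewrite /q mulmxBr (hg i).2 (hg j).2 normr_gt0 subr_eq0.
      by apply: contra ij => /eqP/finj ->.
    pose d := q x / (4 * N%:R); have d0 : 0 < d by rewrite divr_gt0// mulr_gt0.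
    have hd y : `|x - y| < d -> `|q x - q y| <= q x / 2.
      move=> xy; apply: le_trans (ler_dist_dist _ _) _; rewrite -mulmxBl mulmxBr.
      apply: le_trans (ler_normB _ _) _.
      have gT k : (g k)^T *m (g k)^T^T = 1%:M by rewrite trmxK (mulmx1C (GO _ (hg k).1)).
      have h1 := mulmx_lip (x - y) (gT i); have h2 := mulmx_lip (x - y) (gT j).
      apply: le_trans (lerD h1 h2) _; rewrite -mulr2n -[_ *+ 2]mulr_natl mulrA.
      move: xy; rewrite /d ltr_pdivlMr ?mulr_gt0// => /ltW xy.
      by rewrite ler_pdivlMr//; apply: le_trans xy; apply: eqP_le; ring.
    have m0 : 0 < Num.min (d / 2) (q x / 4) by rewrite lt_min; apply/andP; split; exact: divr_gt0.
    exists ([set y | `|x - y| < d / 2], [set r | 0 < r < Num.min (d / 2) (q x / 4)]); first split => /=.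
    - have d2 : 0 < d / 2 by exact: divr_gt0.
      exact: (@near_dist_lt R V x (d / 2) d2).
    - exists (Num.min (d / 2) (q x / 4)) => //= t /=; rewrite sub0r normrN => ht t0.
      by rewrite t0; apply: le_lt_trans ht; exact: ler_norm.
    move=> [y r] /= [hy /andP[r0]]; rewrite lt_min => /andP[rd rq] _ y' hy'.
    have xy' : `|x - y'| < d.
      have := ler_distD y x y'; rewrite [`|y - y'|]distrC; lra.
    have := hd _ xy'; rewrite -mulmxBr -/(q y') ler_norml => /andP[_ h].
    lra.
  have FP : Filter (filter_prod (nbhs x) (0^'+ : set_system R)) by exact: filter_prod_filter.
  apply: (@filterS _ _ FP _ _ _ (filter_forall FP H)) => -[y r] /= h y' hy'.
  exists g; split=> [i|i j ij]; first exact: (hg i).1.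
  exact: (h (i, j) ij y' hy').
have := he (e / 2); rewrite /= sub0r normrN gtr0_norm ?divr_gt0//.
move=> h; exists (e / 2); first exact: divr_gt0.
move=> x y Kx xy; have e2 : e / 2 < e by rewrite ltr_pdivrMr// ltr_pMr// ltr1n.
exact: (h e2 isT x Kx y xy).
Qed.

(** The gradient of u o g is the gradient of u at the image point, rotated; if u o g = u, the
    Euclidean lengths agree. *)
Lemma grad_sq_invariant (g : 'M[R]_N) u : g *m g^T = 1%:M -> D12 u ->
  (forall x, u (x *m g) = u x) -> {ae mu, forall x, grad_sq u (x *m g) = grad_sq u x}.
Proof.
move=> gg Du ug.
have W i := wk_orth i gg (D12_loc N3 Du) (fun j => D12_wk j Du).
have ae i : {ae mu, forall x, wpartial i u x = \sum_j g i j * wpartial j u (x *m g)}.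
  have := W i; rewrite (_ : (fun x => u (x *m g)) = u); last exact/funext.
  by apply: wk_uniq; [exact: D12_loc|exact: D12_wk].
move: (ae_forall ae); apply: filterS => x h.
pose w := \row_j wpartial j u (x *m g) : V.
have g' : g^T *m g^T^T = 1%:M by rewrite trmxK (mulmx1C gg).
have := sqn_orth w g'; rewrite /sqn /grad_sq.
under eq_bigr do rewrite mxE; under [in X in _ = X -> _]eq_bigr do rewrite mxE.
move=> <-; apply: eq_bigr => i _; congr (_ ^+ 2).
by rewrite h; apply: eq_bigr => j _; rewrite !mxE mulrC.
Qed.

Lemma eball_mulmx (g : 'M[R]_N) (y : V) r x : g *m g^T = 1%:M ->
  eball (y *m g) r (x *m g) = eball y r x.
Proof. by move=> gg; rewrite /eball /= -mulmxBl sqn_orth. Qed.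

Lemma sum_indic_le1 (T : Type) m (A : 'I_m -> set T) (x : T) :
  (forall i j, i != j -> A i x -> A j x -> False) -> \sum_i \1_(A i) x <= 1 :> R.
Proof.
move=> dA; have [[i Ai]|nA] := pselect (exists i, A i x).
  rewrite (bigD1 i)//= big1 ?addr0 ?indicE; first by rewrite mem_set.
  by move=> j ji; rewrite indicE memNset// => Aj; apply: (dA j i).
by rewrite big1// => i _; rewrite indicE memNset// => Ai; apply: nA; exists i.
Qed.

(** The m disjoint images of the ball all carry the same energy, so the ball holds at most 1/m of
    the total. *)
Lemma local_energy (G : set 'M[R]_N) m r y u : (forall g, G g -> g *m g^T = 1%:M) ->
  0 <= r -> D12 u -> invariant_fun G u -> separated G m r y ->
  m%:R * I (fun x => \1_(eball y r) x * grad_sq u x) <= dir u u.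
Proof.
move=> GO r0 Du iu [g [Gg sep]].
have gi := grad_intg Du; have mg := intg_meas gi.
have g0 x : 0 <= grad_sq u x by apply: sumr_ge0 => i _; exact: sqr_ge0.
have gT i : (g i)^T *m (g i)^T^T = 1%:M by rewrite trmxK (mulmx1C (GO _ (Gg i))).
have me a : measurable_fun setT (\1_(eball a r) : V -> R).
  by apply: measurable_indic; exact: eball_measurable.
have ei a : intg (fun x => \1_(eball a r) x * grad_sq u x).
  apply: (intg_le _ _ gi); first exact: measurable_funM.
  by move=> x; rewrite ger0_norm ?mulr_ge0// indicE; case: (x \in _); rewrite ?mul1r// mul0r.
have eqi i : I (fun x => \1_(eball y r) x * grad_sq u x) =
    I (fun x => \1_(eball (y *m (g i)^T) r) x * grad_sq u x).
  have pg := preserving_orth (gT i).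
  rewrite -(int_preserving pg (intg_meas (ei (y *m (g i)^T)))).
  apply: int_ae.
  - exact: intg_meas (ei y).
  - exact: (meas_preserving pg (intg_meas (ei (y *m (g i)^T)))).
  have inv x : u (x *m (g i)^T) = u x by apply: iu; exists (g i).
  have := grad_sq_invariant (gT i) Du inv; apply: filterS => x ->.
  by rewrite !indicE; congr (_%:R * _); congr nat_of_bool; apply/idP/idP; rewrite !inE eball_mulmx.
have -> : m%:R * I (fun x => \1_(eball y r) x * grad_sq u x) =
    I (fun x => \sum_(i < m) \1_(eball (y *m (g i)^T) r) x * grad_sq u x).
  rewrite int_sum//; under [RHS]eq_bigr do rewrite -eqi.
  by rewrite sumr_const card_ord -[RHS]mulr_natl.
rewrite dirE; apply: int_le => //; first exact: intg_sum.
move=> x; rewrite -mulr_suml ler_piMl//; apply: sum_indic_le1 => i j ij Ei Ej.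
have h1 := eball_norm r0 Ei; have h2 := eball_norm r0 Ej.
have := sep i j ij; have := ler_distD x (y *m (g i)^T) (y *m (g j)^T).
by rewrite [`|y *m (g i)^T - x|]distrC; lra.
Qed.

(** Difference quotients at a zero of a nonnegative function have opposite signs on the two sides.
    This gives the vanishing of the derivatives of a bump off its open support. *)
Lemma derive_min0 (W : normedModType R) (f : W -> R) (x v : W) (d : R) :
  (forall y, 0 <= f y) -> f x = 0 -> is_derive x v f d -> d = 0.
Proof.
move=> f0 fx /is_derive_epsP H; apply: small0 => e e0.
have [r r0 hr] := H e e0; have r2 : 0 < r / 2 by rewrite divr_gt0.
have rr : `|r / 2| < r by rewrite gtr0_norm//; lra.
have h1 := hr (r / 2) (lt0r_neq0 r2) rr.
have h2 := hr (- (r / 2)); rewrite oppr_eq0 normrN in h2; have {}h2 := h2 (lt0r_neq0 r2) rr.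
rewrite fx !subr0 in h1 h2; rewrite invrN mulrN in h2.
have p1 : 0 <= f (x + (r / 2) *: v) / (r / 2) by rewrite divr_ge0// ltW.
have p2' : 0 <= f (x + - (r / 2) *: v) / (r / 2) by rewrite divr_ge0// ltW.
move: h1 h2; rewrite !ler_norml => /andP[a1 a2] /andP[a3 a4].
by apply/andP; split; lra.
Qed.

Lemma conv_tonelli (k F : V -> R) : measurable_fun setT k -> measurable_fun setT F ->
  (forall x, 0 <= k x) -> (forall x, 0 <= F x) ->
  (\int[mu]_y \int[mu]_x (k (y - x) * F x)%:E = (\int[mu]_x (k x)%:E) * \int[mu]_x (F x)%:E)%E.
Proof.
move=> mk mF k0 F0.
have mke : measurable_fun setT (fun x : V => (k x)%:E) by exact/measurable_EFinP.
have mFe : measurable_fun setT (fun x : V => (F x)%:E) by exact/measurable_EFinP.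
have k0e (x : V) : (0 <= (k x)%:E)%E by rewrite lee_fin.
have F0e (x : V) : setT x -> (0 <= (F x)%:E)%E by rewrite lee_fin.
have mG : measurable_fun setT (fun z : V * V => (k (z.1 - z.2) * F z.2)%:E).
  by apply/measurable_EFinP; exact: measurable_conv_kernel.
have G0 (z : V * V) : (0 <= (k (z.1 - z.2) * F z.2)%:E)%E by rewrite lee_fin mulr_ge0.
rewrite (@fubini_tonelli _ _ _ _ R mu mu _ mG G0) /=.
rewrite -ge0_integralZl//; last by apply: integral_ge0.
apply: eq_integral => x _; under eq_integral do rewrite mulrC EFinM.
have ms : measurable_fun setT (fun y : V => (k (y - x))%:E).
  exact: (meas_preserving (preserving_shift (- x)) mke).
have s0 (y : V) : setT y -> (0 <= (k (y - x))%:E)%E by rewrite lee_fin.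
have Fx : (0 <= (F x)%:E)%E by rewrite lee_fin.
by rewrite ge0_integralZl// ((preserving_shift (- x)).2 _ mke k0e) muleC.
Qed.

(** It compares the volume of a Euclidean ball of radius r with the integral of the p-th power of
    its bump. The bump is at least exp(-2) on the cube of half side r/(2N), and the cube of half
    side r contains the ball. *)
Definition kappa : R := expR 2 `^ p * (2 * N%:R) ^+ N.

Lemma bump_ratio r : 0 < r ->
  intg (fun x : V => bump (r ^+ 2)^-1 x `^ p) /\
  I (\1_(eball (0 : V) r)) <= kappa * I (fun x : V => bump (r ^+ 2)^-1 x `^ p).
Proof.
move=> r0; pose a := (r ^+ 2)^-1; have a0 : 0 < a by rewrite invr_gt0 exprn_gt0.
have p0 : 0 < p by apply: lt_trans p2.
have sb : smooth (bump a : V -> R) by exact: bump_smooth.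
have cb := smooth_cont sb; have bb : bsupp (bump a : V -> R) by exact: bump_bsupp.
have bi : intg (fun x : V => bump a x `^ p).
  have [_] := LP_bsupp p0 cb bb; congr intg; apply/funext => x.
  by rewrite ger0_norm// bump_ge0.
split=> //.
have NR : 0 < N%:R :> R by rewrite ltr0n.
have rN : 0 < r / (2 * N%:R) by rewrite divr_gt0// mulr_gt0.
pose B1 := [set x : V | `|0 - x| < r]; pose B2 := [set x : V | `|0 - x| < r / (2 * N%:R)].
have mB1 : measurable B1 by exact: measurable_rV_ball.
have mB2 : measurable B2 by exact: measurable_rV_ball.
have E1 : mu B1 = ((2 * r) ^+ N)%:E by exact: lebesgue_rV_ball.
have E2 : mu B2 = ((2 * (r / (2 * N%:R))) ^+ N)%:E by exact: lebesgue_rV_ball.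
have i1 : intg (\1_B1) by apply: mu_intg => //; rewrite E1 ltry.
have i2 : intg (\1_B2) by apply: mu_intg => //; rewrite E2 ltry.
have I1 : I (\1_B1) = (2 * r) ^+ N.
  by apply: EFin_inj; rewrite EFin_int// integral_indic// setIT.
have I2 : I (\1_B2) = (2 * (r / (2 * N%:R))) ^+ N.
  by apply: EFin_inj; rewrite EFin_int// integral_indic// setIT.
have ie : intg (\1_(eball (0 : V) r)).
  by apply: mu_intg; [exact: eball_measurable|apply: eball_fin; exact: ltW].
apply: (@le_trans _ _ (I (\1_B1))).
  apply: int_le => // x; rewrite !indicE; have [h|h] := boolP (x \in _); last by [].
  rewrite mem_set//; move: h; rewrite inE => /(eball_norm (ltW r0)); rewrite subr0 /B1 /= sub0r normrN //.
apply: (@le_trans _ _ (kappa * (expR (- 2) `^ p * I (\1_B2)))); last first.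
  apply: ler_wpM2l; first by rewrite mulr_ge0 ?powR_ge0// exprn_ge0// mulr_ge0.
  rewrite -intZ//; apply: int_le => //; first exact: intgZ.
  move=> x; rewrite indicE; have [h|h] := boolP (x \in _); last by rewrite mulr0 powR_ge0.
  rewrite mulr1; apply: ge0_ler_powR; rewrite ?nnegrE ?expR_ge0 ?bump_ge0 ?(ltW p0)//.
  apply: bump_lb; move: h; rewrite inE /B2 /= sub0r normrN => h.
  rewrite /a mulrC ler_pdivrMr ?exprn_gt0//; apply: le_trans (sqn_norm x) _.
  have h2 : `|x| ^+ 2 <= (r / (2 * N%:R)) ^+ 2 by rewrite ler_pXn2r ?nnegrE// ltW.
  apply: le_trans (ler_wpM2l (ltW NR) h2) _.
  have N1 : 1 <= N%:R :> R by rewrite ler1n.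
  rewrite exprMn exprVn exprMn mulrA ler_pdivrMr; last by rewrite mulr_gt0// exprn_gt0.
  have r2 : 0 <= r ^+ 2 by exact: sqr_ge0.
  by nra.
rewrite I1 I2 /kappa; have e1 : expR 2 `^ p * expR (- 2) `^ p = 1 :> R.
  by rewrite -powRM ?expR_ge0// -expRD subrr expR0 powR1.
have gen (a1 a2 a3 a4 : R) : a1 * a2 * (a3 * a4) = a1 * a3 * (a2 * a4) by ring.
rewrite gen.
rewrite e1 mul1r -exprMn (_ : 2 * N%:R * (2 * (r / (2 * N%:R))) = 2 * r)//.
by field; rewrite gt_eqF.
Qed.


Definition cutb (r : R) (y : V) : V -> R := fun x => bump (r ^+ 2)^-1 (y - x).

Lemma kappa_ge0 : 0 <= kappa.
Proof. by rewrite mulr_ge0 ?powR_ge0// exprn_ge0// mulr_ge0. Qed.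

Lemma bump_partial_bound r : 0 < r -> exists2 C, 0 <= C & forall i (y x : V),
  `|partial i (cutb r y) x| <= C * \1_(eball (0 : V) r) (y - x).
Proof.
move=> r0; have a0 : 0 < (r ^+ 2)^-1 by rewrite invr_gt0 exprn_gt0.
have sb : smooth (bump (r ^+ 2)^-1 : V -> R) by exact: bump_smooth.
have bb : bsupp (bump (r ^+ 2)^-1 : V -> R) by exact: bump_bsupp.
have /choice[C hC] : forall i, exists C, forall x, `|partial i (bump (r ^+ 2)^-1 : V -> R) x| <= C.
  move=> i; have [C _ hC] := bsupp_bounded (smooth_cont (smooth_partial i sb)) (bsupp_partial i sb bb).
  by exists C.
exists (\sum_i `|C i|); first by apply: sumr_ge0.
move=> i y x; rewrite /cutb partial_reflect// normrN indicE; have [h|h] := boolP (_ \in _).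
  rewrite mulr1; apply: le_trans (hC i (y - x)) _; rewrite (bigD1 i)//=.
  by apply: le_trans (ler_norm _) _; rewrite lerDl sumr_ge0.
rewrite mulr0; have b0 : bump (r ^+ 2)^-1 (y - x) = 0.
  apply: bump_eq0 => //; move: h; rewrite notin_setE /eball /= subr0 invrK => /negP.
  by rewrite -leNgt.
by rewrite (derive_min0 (@bump_ge0 R N _) b0 (smooth_derive (y - x) i sb)) normr0.
Qed.

(** Sobolev's inequality for the product of u with a cutoff. The constants 2 and 2N come from
    (s+t)^2 <= 2 s^2 + 2 t^2 summed over the coordinates, everything being supported in the ball
    around y. *)
Lemma local_sobolev r C y u : 0 < r -> D12 u -> 0 <= C ->
  (forall i x, `|partial i (cutb r y) x| <= C * \1_(eball (0 : V) r) (y - x)) ->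
  intg (fun x => \1_(eball (0 : V) r) (y - x) * (2 * grad_sq u x + 2 * N%:R * C ^+ 2 * u x ^+ 2)) /\
  I (fun x => `|cutb r y x * u x| `^ p) <= (@Sob R N) *
    I (fun x => \1_(eball (0 : V) r) (y - x) * (2 * grad_sq u x + 2 * N%:R * C ^+ 2 * u x ^+ 2)) `^ (p / 2).
Proof.
move=> r0 Du C0 hC; have a0 : 0 < (r ^+ 2)^-1 by rewrite invr_gt0 exprn_gt0.
have up := D12_LP N3 Du; have p0 : 0 < p by apply: lt_trans p2.
have sb : smooth (bump (r ^+ 2)^-1 : V -> R) by exact: bump_smooth.
have bb : bsupp (bump (r ^+ 2)^-1 : V -> R) by exact: bump_bsupp.
have sc : smooth (cutb r y) := smooth_reflect y sb.
have bc : bsupp (cutb r y) := @reflect_bsupp R N _ y bb.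
have W i := wk_mul N3 sc bc up (D12_wk i Du).
have cp : LP mu p (fun x => cutb r y x * u x).
  apply: (LP_le (ltW p0) _ _ up).
    by apply: measurable_funM; [exact: continuous_measurable_rV (smooth_cont sc)|exact: up.1].
  move=> x; rewrite normrM ger0_norm ?bump_ge0// ler_piMl// bump_le1 //.
have mE : measurable_fun setT (fun x : V => \1_(eball (0 : V) r) (y - x) : R).
  apply: (meas_preserving (preserving_reflect y)); apply: measurable_indic; exact: eball_measurable.
have E0 (x : V) : 0 <= \1_(eball (0 : V) r) (y - x) :> R by [].
pose E1 : set V := fun x => eball (0 : V) r (y - x).
have fO : (mu E1 < +oo)%E.
  apply: (lebesgue_rV_bounded (r := r + `|y|)).
    rewrite -[X in measurable X]setTI; apply: (preserving_reflect y).1 => //; exact: eball_measurable.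
  move=> x /(eball_norm (ltW r0)); rewrite subr0 => h.
  by have := lerB_dist x y; rewrite distrC; lra.
have mO : measurable E1.
  rewrite -[X in measurable X]setTI; apply: (preserving_reflect y).1 => //; exact: eball_measurable.
have gi : intg (fun x => \1_(eball (0 : V) r) (y - x) * grad_sq u x).
  apply: (intg_le _ _ (grad_intg Du)).
    by apply: measurable_funM => //; exact: intg_meas (grad_intg Du).
  have g0 x : 0 <= grad_sq u x by apply: sumr_ge0 => i _; exact: sqr_ge0.
  by move=> x; rewrite ger0_norm ?mulr_ge0// indicE; case: (_ \in _); rewrite ?mul1r// mul0r.
have ui : intg (fun x => \1_(eball (0 : V) r) (y - x) * u x ^+ 2) by have := O_sq N3 mO fO up.
have bi : intg (fun x => \1_(eball (0 : V) r) (y - x) * (2 * grad_sq u x + 2 * N%:R * C ^+ 2 * u x ^+ 2)).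
  have := intgD (intgZ 2 gi) (intgZ (2 * N%:R * C ^+ 2) ui); congr intg; apply/funext => x; ring.
split=> //.
apply: le_trans (sobolev N3 cp W) _; apply: ler_wpM2l; first exact: powR_ge0.
have w2 i : intg (fun x => (cutb r y x * wpartial i u x + partial i (cutb r y) x * u x) ^+ 2).
  by have [] := (LP2 mu _).1 (W i).1.
apply: ge0_ler_powR; rewrite ?nnegrE.
- by rewrite divr_ge0// ltW.
- by apply: int_ge0 => x; apply: sumr_ge0 => i _; exact: sqr_ge0.
- apply: int_ge0 => x; apply: mulr_ge0 => //; apply: addr_ge0.
    by apply: mulr_ge0 => //; apply: sumr_ge0 => i _; exact: sqr_ge0.
  by apply: mulr_ge0; [apply: mulr_ge0 => //; exact: sqr_ge0|exact: sqr_ge0].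
apply: int_le; [by apply: intg_sum => i; exact: w2|exact: bi|].
move=> x; set e : R := \1_(eball (0 : V) r) (y - x).
have ee : e = 0 \/ e = 1 by rewrite /e indicE; case: (_ \in _); [right|left].
have ce : `|cutb r y x| <= e.
  rewrite ger0_norm ?bump_ge0// /e indicE; have [h|h] := boolP (_ \in _); first exact: bump_le1.
  rewrite /cutb bump_eq0//; move: h; rewrite notin_setE /eball /= subr0 invrK => /negP.
  by rewrite -leNgt.
have step i : (cutb r y x * wpartial i u x + partial i (cutb r y) x * u x) ^+ 2 <=
    e * (2 * wpartial i u x ^+ 2) + e * (2 * C ^+ 2 * u x ^+ 2).
  have h1 : (cutb r y x * wpartial i u x) ^+ 2 <= e * wpartial i u x ^+ 2.
    rewrite exprMn; apply: ler_wpM2r; first exact: sqr_ge0.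
    rewrite -[leLHS]real_normK ?num_real//; have n0 := normr_ge0 (cutb r y x).
    by case: ee ce => -> ce; nra.
  have h2 : (partial i (cutb r y) x * u x) ^+ 2 <= e * (C ^+ 2 * u x ^+ 2).
    rewrite exprMn [leRHS]mulrA; apply: ler_wpM2r; first exact: sqr_ge0.
    rewrite -[leLHS]real_normK ?num_real//; have := hC i x; rewrite -/e => hh.
    have n0 := normr_ge0 (partial i (cutb r y) x).
    apply: (@le_trans _ _ ((C * e) ^+ 2)); first by rewrite ler_pXn2r ?nnegrE// mulr_ge0.
    by rewrite exprMn; case: ee => ->; rewrite ?expr0n ?expr1n /= ?mulr0 ?mul0r ?mulr1 ?mul1r.
  have h3 := sqr_ge0 (cutb r y x * wpartial i u x - partial i (cutb r y) x * u x).
  move: (cutb r y x * wpartial i u x) (partial i (cutb r y) x * u x) h1 h2 h3 => s t h1 h2 h3.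
  have h4 : (s + t) ^+ 2 <= 2 * s ^+ 2 + 2 * t ^+ 2.
    by rewrite -subr_ge0 (_ : _ - _ = (s - t) ^+ 2)//; ring.
  apply: le_trans h4 _.
  have := lerD (ler_wpM2l (ler0n _ 2) h1) (ler_wpM2l (ler0n _ 2) h2); move=> /le_trans; apply.
  by apply: eqP_le; ring.
apply: le_trans (ler_sum _ (fun i _ => step i)) _.
rewrite big_split /= -mulr_sumr -mulr_sumr sumr_const card_ord -[_ *+ N]mulr_natl /grad_sq.
by apply: eqP_le; ring.
Qed.

(** The local inequality is integrated over all centres y, which replaces a covering with bounded
    overlap. On each ball a^(p/2) <= (4 E0/m)^(p/2-1) a, a being the local energy, and by Tonelli
    the average of the local energies is a global one. *)
Lemma averaged_sobolev (O : set V) r C m r0 eps E0 u : measurable O -> 0 < r -> 0 <= C ->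
  (forall i y x, `|partial i (cutb r y) x| <= C * \1_(eball (0 : V) r) (y - x)) ->
  (forall x y, O x -> `|y - x| < r -> eball y r `<=` B0 r0) -> open O -> D12 u -> 0 <= eps ->
  dir u u <= E0 -> (0 < m)%N ->
  (forall x y, O x -> `|y - x| < r -> m%:R * I (fun x => \1_(eball y r) x * grad_sq u x) <= dir u u) ->
  I (fun x => \1_(B0 r0) x * u x ^+ 2) <= eps -> N%:R * C ^+ 2 * eps <= E0 / m%:R ->
  I (fun x => \1_O x * `|u x| `^ p) <= (@Sob R N) * kappa * (4 * E0 / m%:R) `^ (p / 2 - 1) * (4 * E0).
Proof.
move=> mO r0' C0 hC sub oO Du e0 uE m0 loc_ ueps hm.
have up := D12_LP N3 Du; have p0 : 0 < p by apply: lt_trans p2.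
have mR : 0 < m%:R :> R by rewrite ltr0n.
have m1 : 1 <= m%:R :> R by rewrite ler1n.
have E00 : 0 <= E0 by apply: le_trans (dir_ge0 u) uE.
pose E : set V := eball 0 r; pose e (z : V) : R := \1_E z.
have mE : measurable E by exact: eball_measurable.
have me : measurable_fun setT e by exact: measurable_indic.
have gi := grad_intg Du; have gm := intg_meas gi.
have g0 x : 0 <= grad_sq u x by apply: sumr_ge0 => i _; exact: sqr_ge0.
have mB := @B0_meas R N r0.
have Bu : intg (fun x => \1_(B0 r0) x * u x ^+ 2).
  apply: (O_sq N3 mB _ up); exact: (lebesgue_rV_bounded mB (r := r0) (fun x h => h)).
pose c := 2 * N%:R * C ^+ 2; have c0 : 0 <= c by rewrite !mulr_ge0 ?sqr_ge0.
pose F x := 2 * grad_sq u x + c * (\1_(B0 r0) x * u x ^+ 2).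
have Fi : intg F by apply: intgD; exact: intgZ.
have F0 x : 0 <= F x.
  by apply: addr_ge0; apply: mulr_ge0 => //; rewrite mulr_ge0 ?sqr_ge0.
have c_eps : c * eps <= 2 * (E0 / m%:R).
  by apply: le_trans (ler_wpM2l (ler0n _ 2) hm); apply: eqP_le; rewrite /c; ring.
have Em : E0 / m%:R <= E0 by rewrite ler_pdivrMr// ler_peMr.
have IF : I F <= 4 * E0.
  rewrite intD; [|exact: intgZ|exact: intgZ].
  rewrite !intZ// -dirE.
  have a1 := ler_wpM2l (ler0n _ 2) uE; have a2 := ler_wpM2l c0 ueps.
  apply: le_trans (lerD a1 (le_trans a2 c_eps)) _; lra.
pose q := p / 2 - 1; pose K0 := (@Sob R N) * (4 * E0 / m%:R) `^ q.
have q0 : 0 < q by rewrite subr_gt0 ltr_pdivlMr// mul1r.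
have K00 : 0 <= K0 by rewrite mulr_ge0 ?powR_ge0.
have eE y x : e (y - x) = \1_(eball y r) x.
  by rewrite /e !indicE; congr (_%:R); congr nat_of_bool; apply/idP/idP; rewrite !inE /E /eball /= subr0 -sqnN opprB.
have OU : intg (fun x => \1_O x * `|u x| `^ p).
  apply: (intg_le _ _ up.2).
    by apply: measurable_funM; [exact: measurable_indic|exact: intg_meas up.2].
  by move=> x; rewrite ger0_norm ?mulr_ge0 ?powR_ge0// indicE; case: (x \in _); rewrite ?mul1r// mul0r powR_ge0.
pose b (z : V) : R := bump (r ^+ 2)^-1 z `^ p.
have b0 z : 0 <= b z by exact: powR_ge0.
have [bi bk] := bump_ratio r0'.
have mb : measurable_fun setT b by exact: intg_meas bi.
(* The inequality for one centre. If y is at distance at least r from O, the bump around y misses O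
   and the left side is zero. *)
have pt y : (\int[mu]_x (b (y - x) * (\1_O x * `|u x| `^ p))%:E <=
    K0%:E * \int[mu]_x (e (y - x) * F x)%:E)%E.
  have [[x Ox yx]|far] := pselect (exists2 x, O x & `|y - x| < r); last first.
    rewrite (_ : (fun x => _) = cst 0%E) ?integral0.
      by rewrite mule_ge0 ?lee_fin//; apply: integral_ge0 => z _; rewrite lee_fin mulr_ge0.
    apply/funext => x /=; congr EFin; rewrite indicE; have [xO|xO] := boolP (x \in O); last by rewrite mul0r mulr0.
    rewrite inE in xO; rewrite /b bump_eq0 ?powR0 ?mul0r ?gt_eqF ?invr_gt0 ?exprn_gt0// invrK leNgt.
    apply/negP => h; apply: far; exists x => //.
    have : eball (0 : V) r (y - x) by rewrite /eball /= subr0.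
    by move=> /(eball_norm (ltW r0')); rewrite subr0.
  have [ai al] := local_sobolev r0' Du C0 (fun i x => hC i y x).
  set a := I (fun x => \1_(eball (0 : V) r) (y - x) * _) in al.
  have sEB z : eball y r z -> B0 r0 z := sub x y Ox yx z.
  have aF : a = I (fun x => e (y - x) * F x).
    apply: eq_int => z; rewrite -/(e (y - z)) eE indicE; have [h|h] := boolP (z \in _); last by rewrite !mul0r.
    by rewrite /F indicE (mem_set (sEB z _)) ?mul1r//; move: h; rewrite inE.
  have Fyi : intg (fun x => e (y - x) * F x).
    move: ai; congr intg; apply/funext => z; rewrite -/(e (y - z)) eE indicE.
    have [h|h] := boolP (z \in _); last by rewrite !mul0r.
    by rewrite /F indicE (mem_set (sEB z _)) ?mul1r//; move: h; rewrite inE.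
  have a0 : 0 <= a by rewrite aF; apply: int_ge0 => z; rewrite mulr_ge0.
  (* Half of the bound is the symmetric energy estimate E0/m, the other half the smallness of u in
     L^2, which pays for the derivatives of the cutoff. *)
  have ab : a <= 4 * E0 / m%:R.
    have gy : intg (fun z => \1_(eball y r) z * grad_sq u z).
      apply: (intg_le _ _ gi).
        by apply: measurable_funM => //; apply: measurable_indic; exact: eball_measurable.
      by move=> z; rewrite ger0_norm ?mulr_ge0// indicE; case: (_ \in _); rewrite ?mul1r// mul0r.
    apply: (@le_trans _ _ (I (fun z => 2 * (\1_(eball y r) z * grad_sq u z) + c * (\1_(B0 r0) z * u z ^+ 2)))).
      rewrite aF; apply: int_le => //; first by apply: intgD; exact: intgZ.
      move=> z; rewrite eE /F mulrDr; apply: lerD; first by apply: eqP_le; ring.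
      rewrite indicE; case: (_ \in _); rewrite ?mul1r// mul0r mulr_ge0// mulr_ge0 ?sqr_ge0//.
    rewrite intD; [|exact: intgZ|exact: intgZ].
    rewrite !intZ//.
    have l1 : I (fun z => \1_(eball y r) z * grad_sq u z) <= E0 / m%:R.
      by rewrite ler_pdivlMr// mulrC; apply: le_trans (loc_ x y Ox yx) uE.
    have a2 := ler_wpM2l c0 ueps.
    apply: le_trans (lerD (ler_wpM2l (ler0n _ 2) l1) (le_trans a2 c_eps)) _.
    by apply: eqP_le; ring.
  have cp : intg (fun x => `|cutb r y x * u x| `^ p).
    have cb : continuous (cutb r y).
      by apply: smooth_cont; apply: smooth_reflect; apply: bump_smooth; rewrite invr_gt0 exprn_gt0.
    have mc : measurable_fun setT (fun x => cutb r y x * u x).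
      by apply: measurable_funM; [exact: continuous_measurable_rV|exact: up.1].
    apply: (intg_le (mpow p mc) _ up.2) => z; rewrite ger0_norm ?powR_ge0//.
    apply: ge0_ler_powR; rewrite ?nnegrE ?(ltW p0)// normrM ger0_norm ?bump_ge0// ler_piMl// bump_le1 //.
  rewrite -(EFin_int Fyi) -EFinM -aF.
  apply: (@le_trans _ _ (I (fun x => `|cutb r y x * u x| `^ p))%:E).
    rewrite (EFin_int cp); apply: ge0_le_integral => //.
    - by move=> z _; rewrite lee_fin mulr_ge0// mulr_ge0 ?powR_ge0.
    - apply/measurable_EFinP; apply: measurable_funM; last exact: intg_meas OU.
      exact: (meas_preserving (preserving_reflect y)).
    - by apply/measurable_EFinP; exact: intg_meas cp.
    move=> z _; rewrite lee_fin normrM powRM// (ger0_norm (bump_ge0 _ _)) -/(b (y - z)).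
    apply: ler_wpM2l => //; rewrite indicE; case: (_ \in _); rewrite ?mul1r// mul0r powR_ge0 //.
  rewrite lee_fin; apply: (le_trans al); rewrite /K0 -[leRHS]mulrA; apply: ler_wpM2l; first exact: powR_ge0.
  have [->|an0] := eqVneq a 0; first by rewrite mulr0 powR0// gt_eqF// divr_gt0.
  rewrite (_ : p / 2 = q + 1); last by rewrite /q subrK.
  rewrite powRD; last by apply/implyP => _.
  rewrite powRr1//; apply: ler_wpM2r => //.
  by apply: ge0_ler_powR; rewrite ?nnegrE ?(ltW q0)// divr_ge0// mulr_ge0.
have mOU := intg_meas OU; have mF := intg_meas Fi.
have O0 x : 0 <= \1_O x * `|u x| `^ p by rewrite mulr_ge0 ?powR_ge0.
have e0' z : 0 <= e z by [].
have mG : measurable_fun setT (fun z : V * V => (e (z.1 - z.2) * F z.2)%:E).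
  by apply/measurable_EFinP; exact: measurable_conv_kernel.
have G0 (z : V * V) : (0 <= (e (z.1 - z.2) * F z.2)%:E)%E by rewrite lee_fin mulr_ge0.
have mH : measurable_fun setT (fun z : V * V => (b (z.1 - z.2) * (\1_O z.2 * `|u z.2| `^ p))%:E).
  by apply/measurable_EFinP; exact: (measurable_conv_kernel mb mOU).
have H0 (z : V * V) : (0 <= (b (z.1 - z.2) * (\1_O z.2 * `|u z.2| `^ p))%:E)%E.
  by rewrite lee_fin mulr_ge0.
have mGy := @measurable_fun_fubini_tonelli_F _ _ _ _ R mu _ mG G0.
have mHy := @measurable_fun_fubini_tonelli_F _ _ _ _ R mu _ mH H0.
have total : (\int[mu]_y \int[mu]_x (b (y - x) * (\1_O x * `|u x| `^ p))%:E <=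
   \int[mu]_y (K0%:E * \int[mu]_x (e (y - x) * F x)%:E))%E.
  apply: ge0_le_integral => //.
  - by move=> y _; apply: integral_ge0 => x _; exact: (H0 (y, x)).
  - exact: measurable_funeM.
rewrite ge0_integralZl// in total; last by move=> y _; apply: integral_ge0 => x _; exact: (G0 (y, x)).
rewrite !conv_tonelli// in total.
have ei : intg e by apply: mu_intg => //; apply: eball_fin; exact: ltW.
rewrite -!EFin_int// -!EFinM lee_fin in total.
have P0 : 0 < I b.
  have e1 : 0 < I e.
    by rewrite -lte_fin EFin_int// integral_indic// setIT; exact: eball_pos.
  have := lt_le_trans e1 bk; rewrite -/b => h.
  rewrite lt_neqAle int_ge0 // andbT eq_sym; apply/negP => /eqP h2.
  by move: h; rewrite h2 mulr0 ltxx.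
rewrite -(ler_pM2l P0); apply: (le_trans total).
have h : I e * I F <= kappa * I b * (4 * E0).
  by apply: ler_pM => //; exact: int_ge0.
apply: (le_trans (ler_wpM2l K00 h)); apply: eqP_le; rewrite /K0 -/q; ring.
Qed.

(** The number m of copies is fixed first, so that the factor (4 E0/m)^(p/2-1) in [averaged_sobolev]
    makes its right side at most delta. The radius r then follows from orbit separation, and
    [rellich] provides functionals that make the L^2 norm small enough for the cutoffs at that
    scale. *)
Theorem compact_embedding (G : set 'M[R]_N) (O : set V) (E0 delta : R) :
  (forall g, G g -> g *m g^T = 1%:M) -> bounded_set O -> open O ->
  (forall x, closure O x -> infinite_set (Gorbit G x)) -> 0 < E0 -> 0 < delta ->
  exists M (L : 'I_M -> (V -> R) -> R),
   [/\ forall i u v, D12 u -> D12 v -> L i (fun x => u x - v x) = L i u - L i v,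
       forall i, exists K, forall u, D12 u -> `|L i u| <= K * nrm u &
       forall u, D12 u -> invariant_fun G u -> dir u u <= E0 -> (forall i, `|L i u| <= 1) ->
         I (fun x => \1_O x * `|u x| `^ p) <= delta].
Proof.
move=> GO [M0 [_ bO]] oO infO E00 d0.
have mO : measurable O by exact: open_measurable_rV.
pose r1 := `|M0| + 1; have r10 : 0 < r1 by rewrite ltr_wpDl.
have bO1 x : O x -> `|x| <= r1.
  by move=> Ox; apply: (bO r1) => //; rewrite /r1; have := ler_norm M0; lra.
have cO : compact (closure O).
  apply: (subclosed_compact _ (@closed_ball_compact R N r1)); first exact: closed_closure.
  have cl : closed [set x : V | `|x| <= r1].
    have nc : continuous (fun x : V => `|x|) by exact: norm_continuous.
    by move/continuous_closedP : nc => /(_ _ (@closed_le R r1)).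
  by rewrite [X in _ `<=` X](closure_id _).1//; apply: closure_subset.
pose q := p / 2 - 1; have q0 : 0 < q by rewrite subr_gt0 ltr_pdivlMr// mul1r.
pose K1 := (@Sob R N) * kappa * (4 * E0).
have K10 : 0 <= K1 by rewrite !mulr_ge0 ?powR_ge0 ?kappa_ge0// ltW.
(* The threshold for 4 E0/m: raised to the power q = p/2 - 1 and multiplied by K1 it stays below
   delta. *)
pose tau := (delta / (K1 + 1)) `^ q^-1.
have K11 : 0 < K1 + 1 by rewrite ltr_wpDl.
have tau0 : 0 < tau by rewrite powR_gt0// divr_gt0.
pose m := (Num.truncn (4 * E0 / tau)).+1; have mR : 0 < m%:R :> R by rewrite ltr0n.
have E04 : 0 <= 4 * E0 by rewrite mulr_ge0// ltW.
have mt : 4 * E0 / m%:R <= tau.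
  rewrite ler_pdivrMr// [tau * _]mulrC -ler_pdivrMr//; apply: ltW; exact: truncnS_gt.
have [r r0 sep] := orbit_separation m GO cO infO.
have [C C0 hC] := bump_partial_bound r0.
pose r2 := r1 + 2 * r; have r20 : 0 < r2 by rewrite addr_gt0// mulr_gt0.
have NC : 0 <= N%:R * C ^+ 2 by rewrite mulr_ge0 ?sqr_ge0.
have Em : 0 < E0 / m%:R by rewrite divr_gt0.
have [eps e0 he] := small_rel NC Em.
have [M [L [L1 L2 L3]]] := rellich N3 r20 E00 e0.
exists M, L; split=> // u Du iu uE uL.
have ueps := L3 u Du uE uL.
have close x y : O x -> `|y - x| < r -> separated G m r y.
  by move=> Ox; apply: sep; exact: subset_closure.
apply: le_trans (averaged_sobolev mO r0 C0 hC _ oO Du (ltW e0) uE (ltn0Sn _) _ ueps _) _.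
- move=> x y Ox yx z /(eball_norm (ltW r0)) zy; rewrite /B0 /=.
  have := bO1 x Ox; have := ler_normD (z - y) y; have := ler_normD (y - x) x.
  by rewrite !subrK /r2; lra.
- by move=> x y Ox yx; apply: (local_energy GO (ltW r0) Du iu); exact: close Ox yx.
- by apply: ltW; apply: le_lt_trans he; apply: eqP_le; ring.
have h : (4 * E0 / m%:R) `^ q <= delta / (K1 + 1).
  have -> : delta / (K1 + 1) = tau `^ q.
    by rewrite /tau -powRrM mulVf ?gt_eqF// powRr1// divr_ge0// ltW.
  by apply: ge0_ler_powR; rewrite ?nnegrE ?(ltW q0) ?(ltW tau0)// divr_ge0.
apply: (@le_trans _ _ (K1 * (delta / (K1 + 1)))).
  apply: le_trans (ler_wpM2l K10 h); apply: eqP_le; rewrite /K1 -/q; ring.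
by rewrite mulrA ler_pdivrMr// mulrC ler_wpM2l ?(ltW d0)// lerDl.
Qed.

End CompactEmbedding.

(** * The functional B and its derivative on L^p *)

Lemma tangent_mono (R : realDomainType) (a b c d s t q : R) : 0 < q ->
  c + q * a * (t - s) <= d -> d + q * b * (s - t) <= c -> 0 <= (a - b) * (s - t).
Proof.
move=> q0 h1 h2; rewrite -(pmulr_rge0 _ q0).
by rewrite (_ : q * _ = - (q * a * (t - s)) - q * b * (s - t)); [lra|ring].
Qed.

Section Functional.
Context {R : realType}.
Variable N : nat.
Hypothesis N3 : (3 <= N)%N.
Local Notation V := 'rV[R]_N.
Local Notation mu := (@lebesgue_rV R N).
Local Notation I f := (Rintegral mu setT f).
Local Notation intg := (@intg _ _ R mu).
Local Notation p := (@crit_exp R N).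
Implicit Types (u v w : V -> R).
#[local] Opaque crit_exp nrm dir.

Let p2 : 2 < p. Proof. exact: crit_gt2. Qed.
Let p1 : 1 < p. Proof. by apply: lt_trans p2; rewrite ltr1n. Qed.
Let p0 : 0 < p. Proof. by apply: lt_trans p2. Qed.

Variable O : set V.
Hypothesis mO : measurable O.

Definition Bf u : R := I (fun x => Q O x * `|u x| `^ p).
Definition dBf u v : R := p * I (fun x => Q O x * phi p (u x) * v x).

Lemma Q_abs x : `|Q O x| = 1.
Proof. by rewrite /Q; case: ifP => _; rewrite ?normrN normr1. Qed.

Lemma measurable_Q : measurable_fun setT (Q O).
Proof.
have -> : Q O = (fun x => 2 * \1_O x - 1).
  by apply/funext => x; rewrite /Q indicE; case: ifP => _ /=; ring.
by apply: measurable_funB => //; apply: measurable_funM => //; exact: measurable_indic.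
Qed.

Lemma Q_intg (f : V -> R) : intg f -> intg (fun x => Q O x * f x).
Proof.
move=> fi; apply: (intg_le _ _ (intg_norm fi)).
  by apply: measurable_funM; [exact: measurable_Q|exact: intg_meas fi].
by move=> x; rewrite normrM Q_abs mul1r.
Qed.

Lemma phi_meas u : measurable_fun setT u -> measurable_fun setT (fun x => phi p (u x)).
Proof. by move=> m; apply: measurable_funM => //; exact: mpow. Qed.

Lemma phi_intg u v : LP mu p u -> LP mu p v -> intg (fun x => phi p (u x) * v x).
Proof.
move=> up vp; have [h _] := holder3 N3 up up vp; apply: (intg_le _ _ h).
  by apply: measurable_funM; [apply: phi_meas; case: up|case: vp].
by move=> x; rewrite normrM /phi normrM ger0_norm ?powR_ge0.
Qed.

Lemma dB_intg u v : LP mu p u -> LP mu p v -> intg (fun x => Q O x * phi p (u x) * v x).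
Proof.
by move=> up vp; have := Q_intg (phi_intg up vp); congr intg; apply/funext => x; rewrite mulrA.
Qed.

(** A bound for the L^p norm of |u| + |w| when both norms are at most A. *)
Definition Tc (A : R) : R := (2 `^ p * (A `^ p + A `^ p)) `^ p^-1.

Lemma nrm_mono u (A : R) : nrm u <= A -> I (fun x => `|u x| `^ p) <= A `^ p.
Proof.
move=> h; rewrite -(nrm_pow N3); apply: ge0_ler_powR; rewrite ?nnegrE ?nrm_ge0 ?(ltW p0)//.
by apply: le_trans h; exact: nrm_ge0.
Qed.

Lemma holder_sum u w s t (A : R) : LP mu p u -> LP mu p w -> LP mu p s -> LP mu p t ->
  nrm u <= A -> nrm w <= A ->
  intg (fun x => (`|u x| + `|w x|) `^ (p - 2) * `|s x| * `|t x|) /\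
  I (fun x => (`|u x| + `|w x|) `^ (p - 2) * `|s x| * `|t x|) <=
    3 * (Tc A `^ (p - 2) * nrm s * nrm t).
Proof.
move=> up wp sp tp uA wA; pose a x := `|u x| + `|w x|.
have A0 : 0 <= A by apply: le_trans uA; exact: nrm_ge0.
have E x : `|a x| = `|u x| + `|w x| by rewrite ger0_norm// addr_ge0.
have nn f : LP mu p f -> LP mu p (fun x => `|f x|).
  move=> fp; apply: (LP_le (ltW p0) _ _ fp) => [|x]; last by rewrite normr_id.
  by apply: measurableT_comp => //; case: fp.
have ap : LP mu p a by apply: LPD (nn _ up) (nn _ wp); exact: ltW.
have [h1 h2] := holder3 N3 ap sp tp.
have EE : (fun x => `|a x| `^ (p - 2) * `|s x| * `|t x|) =
   (fun x => (`|u x| + `|w x|) `^ (p - 2) * `|s x| * `|t x|) by apply/funext => x; rewrite E.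
rewrite EE in h1 h2; split; first exact: h1.
apply: (le_trans h2).
have aT : nrm a <= Tc A.
  apply: (nrm_le N3); first exact: powR_ge0.
  rewrite /Tc -powRrM mulVf ?gt_eqF// powRr1; last by rewrite mulr_ge0 ?addr_ge0 ?powR_ge0.
  apply: (@le_trans _ _ (I (fun x => 2 `^ p * (`|u x| `^ p + `|w x| `^ p)))).
    apply: int_le; [exact: ap.2|by apply: intgZ; apply: intgD; [exact: up.2|exact: wp.2]|].
    by move=> x; rewrite E; apply: powR_addle => //; exact: ltW.
  rewrite intZ; last by apply: intgD; [exact: up.2|exact: wp.2].
  rewrite intD; [|exact: up.2|exact: wp.2].
  by apply: ler_wpM2l; [exact: powR_ge0|apply: lerD; exact: nrm_mono].
apply: ler_wpM2l; first exact: ler0n.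
apply: ler_wpM2r; first exact: nrm_ge0.
apply: ler_wpM2r; first exact: nrm_ge0.
by apply: ge0_ler_powR; rewrite ?nnegrE ?nrm_ge0 ?powR_ge0 ?subr_ge0 ?(ltW p2).
Qed.

Lemma dB_lip u w v (A : R) : LP mu p u -> LP mu p w -> LP mu p v -> nrm u <= A -> nrm w <= A ->
  `|dBf u v - dBf w v| <= p * (p - 1) * (3 * (Tc A `^ (p - 2) * nrm (fun x => u x - w x) * nrm v)).
Proof.
move=> up wp vp uA wA; have dp := LPB (ltW p0) up wp.
have [h1 h2] := holder_sum up wp dp vp uA wA.
rewrite /dBf -mulrBr normrM (ger0_norm (ltW p0)) -mulrA; apply: ler_wpM2l; first exact: ltW.
have du := dB_intg up vp; have dw := dB_intg wp vp.
rewrite -(intB du dw); apply: le_trans (int_norm (intgB du dw)) _.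
have pm : 0 <= p - 1 by rewrite subr_ge0 ltW.
apply: le_trans (ler_wpM2l pm h2); rewrite -(intZ _ h1).
apply: int_le => [| |x]; [by apply: intg_norm; exact: intgB|exact: intgZ|].
rewrite -mulrBl -mulrBr normrM normrM Q_abs mul1r.
rewrite [leRHS]mulrA; apply: ler_wpM2r => //; rewrite mulrA; apply: phi_lip; exact: ltW.
Qed.

Lemma B_intg u : LP mu p u -> intg (fun x => Q O x * `|u x| `^ p).
Proof. by move=> [_ h]; exact: Q_intg. Qed.

Lemma B_taylor u v (A : R) : LP mu p u -> LP mu p v -> nrm u <= A ->
  nrm (fun x => u x + v x) <= A ->
  `|Bf (fun x => u x + v x) - Bf u - dBf u v| <= p * (p - 1) * (3 * (Tc A `^ (p - 2) * nrm v * nrm v)).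
Proof.
move=> up vp uA wA; have wp := LPD (ltW p0) up vp.
have [h1 h2] := holder_sum up wp vp vp uA wA.
have pm : 0 <= p * (p - 1) by rewrite mulr_ge0 ?(ltW p0)// subr_ge0 ltW.
apply: le_trans (ler_wpM2l pm h2); rewrite -(intZ _ h1).
have bi := B_intg up; have bj := B_intg wp; have di := dB_intg up vp.
rewrite /Bf /dBf -(intZ p di) -(intB bj bi) -(intB (intgB bj bi) (intgZ p di)).
have ii := intgB (intgB bj bi) (intgZ p di).
apply: le_trans (int_norm ii) _; apply: int_le => [| |x]; [exact: intg_norm|exact: intgZ|].
have := pow_taylor (u x) (u x + v x) (ltW p2); rewrite [u x + v x - u x]addrAC subrr add0r => h.
have -> : Q O x * `|u x + v x| `^ p - Q O x * `|u x| `^ p - p * (Q O x * phi p (u x) * v x) =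
    Q O x * (`|u x + v x| `^ p - `|u x| `^ p - p * phi p (u x) * v x) by ring.
rewrite normrM Q_abs mul1r; apply: (le_trans h); apply: eqP_le; rewrite expr2; ring.
Qed.

(** Where Q = -1 the integrand is minus a monotone difference, hence at most 0. Only O contributes,
    and there the Lipschitz bound of [phi] leaves the L^p norm of u - v on O. *)
Lemma dB_compact u v (A : R) : LP mu p u -> LP mu p v -> nrm u <= A -> nrm v <= A ->
  dBf u (fun x => u x - v x) - dBf v (fun x => u x - v x) <=
  p * (p - 1) * (3 * (Tc A `^ (p - 2) * nrm (fun x => \1_O x * (u x - v x)) ^+ 2)).
Proof.
move=> up vp uA vA; have dp := LPB (ltW p0) up vp.
have m1 : measurable_fun setT (\1_O : V -> R) by exact: measurable_indic.
have op : LP mu p (fun x => \1_O x * (u x - v x)).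
  apply: (LP_le (ltW p0) _ _ dp); first by apply: measurable_funM => //; case: dp.
  by move=> x; rewrite normrM indicE; case: (x \in O); rewrite ?normr1 ?mul1r// normr0 mul0r.
have [h1 h2] := holder_sum up vp op op uA vA.
rewrite /dBf -mulrBr -mulrA; apply: ler_wpM2l; first exact: ltW.
have pm : 0 <= p - 1 by rewrite subr_ge0 ltW.
rewrite expr2 [Tc A `^ _ * _]mulrA; apply: le_trans (ler_wpM2l pm h2).
have du := dB_intg up dp; have dv := dB_intg vp dp.
rewrite -(intB du dv) -(intZ _ h1); apply: int_le => [| |x]; [exact: intgB|exact: intgZ|].
rewrite -mulrBl -mulrBr /Q indicE; case: (x \in O).
  rewrite !mul1r; apply: le_trans (ler_norm _) _; rewrite normrM [leRHS]mulrA; apply: ler_wpM2r => //.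
  by rewrite mulrA; apply: phi_lip; exact: ltW.
rewrite !mul0r normr0 !mulr0 mulN1r mulNr oppr_le0.
have c1 := pow_convex (u x) (v x) p1; have c2 := pow_convex (v x) (u x) p1.
exact: (tangent_mono p0 c1 c2).
Qed.

End Functional.

(** * Invariant test functions supported in Omega *)

(** A nonzero polynomial has too few roots to vanish at all the points b/2, b/3, ..., as many as its
    number of coefficients. *)
Lemma power_sum_neq0 (R : realFieldType) k (c : 'rV[R]_k) (b : R) : c != 0 -> 0 < b ->
  exists2 t, 0 < t < b & \sum_i c ord0 i * t ^+ i.+1 != 0.
Proof.
move=> c0 b0; pose P : {poly R} := \sum_(i < k) (c ord0 i)%:P * 'X ^+ i.+1.
have Pg x : \sum_i c ord0 i * x ^+ i.+1 = P.[x].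
  by rewrite /P horner_sum; apply: eq_bigr => i _; rewrite hornerM hornerC hornerXn.
have P0 : P != 0.
  apply: contra c0 => /eqP h; apply/eqP/rowP => i; rewrite mxE.
  have := congr1 (fun q : {poly R} => q`_i.+1) h; rewrite /P coef_sum coef0 => <-.
  rewrite (bigD1 i)//= coefCM coefXn eqxx mulr1 big1 ?addr0// => j ji.
  by rewrite coefCM coefXn eqSS (negbTE (_ : (i != j :> nat))) ?mulr0// eq_sym.
apply: contrapT => h.
pose rs := [seq b / j.+2%:R | j <- iota 0 (size P)].
have Hr : all (root P) rs.
  apply/allP => _ /mapP[j _ ->]; apply/rootP; apply: contrapT => /eqP nz; apply: h.
  exists (b / j.+2%:R); last by rewrite Pg.
  by rewrite divr_gt0//= ltr_pdivrMr// ltr_pMr// ltr1n.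
have Hu : uniq rs.
  rewrite map_inj_uniq ?iota_uniq// => i j /(mulfI (lt0r_neq0 b0))/invr_inj /eqP.
  by rewrite eqr_nat => /eqP[].
by have := max_poly_roots P0 Hr Hu; rewrite size_map size_iota ltnn.
Qed.

Section TestSpace.
Context {R : realType}.
Variable N : nat.
Hypothesis N3 : (3 <= N)%N.
Local Notation V := 'rV[R]_N.
Local Notation mu := (@lebesgue_rV R N).
Local Notation I f := (Rintegral mu setT f).
Local Notation intg := (@intg _ _ R mu).
Local Notation p := (@crit_exp R N).
#[local] Opaque crit_exp nrm dir.

Variables (G : set 'M[R]_N) (O : set V).
Hypotheses (GO : forall g, G g -> g *m g^T = 1%:M) (GV : forall g, G g -> G g^T)
  (O0 : O !=set0) (bO : bounded_set O) (oO : open O) (iO : invariant_set G O).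

Lemma O_bound : exists2 r : R, 0 < r & forall x, O x -> `|x| <= r.
Proof.
have [M0 [_ h]] := bO; exists (`|M0| + 1); first by rewrite ltr_wpDl.
by move=> x Ox; apply: (h (`|M0| + 1)) => //; have := ler_norm M0; lra.
Qed.

(** Convolve the indicator of an invariant subset of O with a radial bump: invariance of both
    factors makes the result invariant. *)
Lemma invariant_profile : exists phi0 : V -> R, [/\ smooth phi0, bsupp phi0,
  invariant_fun G phi0, forall x, phi0 x != 0 -> O x & exists x, 0 < phi0 x].
Proof.
have [x0 Ox0] := O0.
have [d d0 hd] : exists2 d : R, 0 < d & forall y, `|x0 - y| < d -> O y.
  have /nbhs_ballP[d /= d0 h] : nbhs x0 O by exact: open_nbhs_nbhs.
  by exists d => // y hy; apply: h; rewrite -ball_normE.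
pose s := d / 2; have s0 : 0 < s by rewrite divr_gt0.
pose a := (s ^+ 2)^-1; have a0 : 0 < a by rewrite invr_gt0 exprn_gt0.
(* The points whose Euclidean s-ball lies in O. Removing this margin keeps the support of the
   convolution inside O, and O' contains the s-ball around x0 because 2 s = d. *)
pose O' : set V := [set x | forall z, sqn (z - x) < s ^+ 2 -> O z].
have O'O : O' `<=` O by move=> x; apply; rewrite subrr /sqn big1 ?exprn_gt0// => i _; rewrite mxE expr0n.
have mO' : measurable O'.
  rewrite -(setCK O'); apply: measurableC; apply: open_measurable_rV.
  rewrite (_ : ~` O' = \bigcup_(z in ~` O) eball z s).
    by apply: bigcup_open => z _; exact: eball_open.
  apply/seteqP; split=> x /=.
    move=> nx; apply: contrapT => h; apply: nx => z zx; apply: contrapT => nz; apply: h.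
    by exists z => //; rewrite /eball /= -sqnN opprB.
  by move=> [z nz zx] h; apply: nz; apply: h; rewrite -sqnN opprB.
have sb : smooth (bump a : V -> R) by exact: bump_smooth.
have bb : bsupp (bump a : V -> R) by exact: bump_bsupp.
have [r r0 hr] := O_bound.
have fO' : (mu O' < +oo)%E.
  by apply: (lebesgue_rV_bounded mO' (r := r + 1)) => x /O'O/hr; lra.
have l1 : loc (\1_O' : V -> R) by apply: intg_loc; exact: mu_intg.
have b1 : bsupp (\1_O' : V -> R).
  by exists (r + 1) => x hx; rewrite indicE memNset// => /O'O/hr; lra.
exists (conv (bump a) (\1_O')); split.
- exact: conv_smooth.
- exact: conv_bsupp.
- move=> x _ [g Gg <-]; rewrite /conv.
  have gT : g^T *m g^T^T = 1%:M by rewrite trmxK (mulmx1C (GO Gg)).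
  have pg := preserving_orth gT.
  have inv y : \1_O' (y *m g^T) = \1_O' y :> R.
    have stab h z : G h -> O' z -> O' (z *m h^T).
      move=> Gh O'z t ht; have hT : h *m h^T = 1%:M by exact: GO.
      have -> : t = t *m h *m h^T by rewrite -mulmxA hT mulmx1.
      apply: (iO (x := t *m h)); last by exists h.
      apply: O'z; rewrite -(@sqn_orth _ _ h^T) ?trmxK ?(mulmx1C hT)//.
      by rewrite mulmxBl -mulmxA hT mulmx1.
    rewrite !indicE; congr (_%:R); congr nat_of_bool; apply/idP/idP; rewrite !inE.
      move=> h; have := stab g^T _ (GV Gg) h; rewrite trmxK -mulmxA (mulmx1C (GO Gg)) mulmx1 //.
    exact: stab.
  rewrite -(int_preserving pg (f := fun y => bump a (x *m g^T - y) * \1_O' y)); last first.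
    apply: measurable_funM; last exact: measurable_indic.
    apply: continuous_measurable_rV; apply: reflect_cont; exact: smooth_cont.
  by apply: eq_int => y; rewrite inv -mulmxBl bump_orth.
- move=> x hx; apply: contrapT => nx; move/eqP : hx; apply.
  rewrite /conv (_ : (fun y => _) = fun=> 0) ?int0//; apply/funext => y.
  rewrite indicE; have [h|h] := boolP (y \in O'); last by rewrite mulr0.
  rewrite bump_eq0 ?mul0r// /a invrK leNgt; apply/negP => h2.
  by move: h; rewrite inE => /(_ x h2).
exists x0; rewrite /conv.
have -> : I (fun y => bump a (x0 - y) * \1_O' y) = I (bump a).
  rewrite -(int_preserving (preserving_reflect x0) (continuous_measurable_rV (smooth_cont sb))).
  apply: eq_int => y; have [h|h] := ltrP (sqn (x0 - y)) (s ^+ 2).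
    rewrite indicE mem_set ?mulr1// => z hz; apply: hd.
    have e1 : eball x0 s y by rewrite /eball /= -sqnN opprB.
    have n1 := eball_norm (ltW s0) e1; have n2 := eball_norm (ltW s0) (hz : eball y s z).
    have := ler_distD y x0 z; rewrite [`|x0 - y|]distrC [`|y - z|]distrC /s in n1 n2 *; lra.
  by rewrite bump_eq0 ?mul0r// /a invrK.
exact: bump_int_gt0.
Qed.

(** Powers f, f^2, ..., f^k of one profile. A combination is a polynomial in f, and f takes every
    value between 0 and its value at x0, so the combination is not identically zero; it lives in O,
    where Q = 1. *)
Lemma test_family k : exists psi : 'I_k -> V -> R,
  (forall i, D12 (psi i) /\ invariant_fun G (psi i)) /\
  forall c : 'rV[R]_k, c != 0 -> 0 < Bf O (fun x => \sum_i c ord0 i * psi i x).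
Proof.
have [f [sf bf inf_ fO [x0 fx0]]] := invariant_profile.
pose pw (j : nat) x := f x ^+ j.+1.
have spw j : smooth (pw j).
  elim: j => [|j IH].
    by rewrite (_ : pw 0%N = f)//; apply/funext => x; rewrite /pw expr1.
  rewrite (_ : pw j.+1 = fun x => f x * pw j x); first exact: smooth_mul.
  by apply/funext => x; rewrite /pw exprS.
have bpw j : bsupp (pw j) by have [r hr] := bf; exists r => x /hr h; rewrite /pw h expr0n.
exists (fun i => pw i); split.
  move=> i; split; first exact: D12_smooth.
  by move=> x y xy; rewrite /pw (inf_ x y xy).
move=> c c0; pose g x := \sum_i c ord0 i * pw i x.
have sg : continuous g.
  apply: continuous_sum => i x; apply: continuousM; [exact: cst_continuous|exact: smooth_cont].
have bg : bsupp g.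
  by have [r hr] := bf; exists r => x /hr h; apply: big1 => i _; rewrite /pw h expr0n mulr0.
have p2 : 2 < p by exact: crit_gt2.
have p0 : 0 < p by apply: lt_trans p2.
have gp : LP mu p g by exact: LP_bsupp.
have [t /andP[t0 tf] Pt] := power_sum_neq0 c0 fx0.
(* Intermediate value theorem on a ray from x0 to a point outside the support. *)
have [z fz] : exists z, f z = t.
  have [r r0 hr] := bsupp_pos bf.
  have i0 : (0 < N)%N by exact: leq_trans N3.
  pose e : V := delta_mx ord0 (Ordinal i0).
  pose h (s : R) := f (x0 + s *: e).
  have ch : continuous h by apply: line_cont; exact: smooth_cont.
  pose T := r + `|x0|; have T0 : 0 <= T by rewrite addr_ge0// ltW.
  have h0 : h 0 = f x0 by rewrite /h scale0r addr0.
  have hT : h T = 0.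
    apply: hr; apply: le_trans (coord_le_norm _ (Ordinal i0)).
    rewrite !mxE !eqxx mulr1; have := coord_le_norm x0 (Ordinal i0).
    have := lerB_normD T (x0 ord0 (Ordinal i0)); rewrite addrC (ger0_norm T0) /T; lra.
  have [] := @IVT R h 0 T t T0 (continuous_subspaceT ch).
    rewrite h0 hT; rewrite ge_min le_max (ltW tf) (ltW t0) orbT //.
  by move=> s _ <-; exists (x0 + s *: e).
have gz : g z != 0 by rewrite /g /pw fz.
have E : Bf O g = I (fun x => `|g x| `^ p).
  apply: eq_int => x; rewrite /Q; case: ifPn => xO; first by rewrite mul1r.
  suff -> : g x = 0 by rewrite normr0 powR0 ?mulr0// gt_eqF.
  have fx : f x = 0.
    by apply: contrapT => /eqP /fO; move: xO; rewrite notin_setE.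
  by apply: big1 => i _; rewrite /pw fx expr0n mulr0.
rewrite E lt_neqAle int_ge0 ?andbT; last by move=> x; exact: powR_ge0.
rewrite eq_sym; apply/negP => /eqP h0.
have ae := intNP_eq0 p0 gp h0.
have oU : open [set x | g x != 0].
  have -> : [set x | g x != 0] = g @^-1` [set y | y != 0] by [].
  by apply: open_comp; [move=> x _; exact: sg|exact: open_neq].
have := lebesgue_rV_open (x := z) oU gz.
suff -> : mu [set x | g x != 0] = 0%E by rewrite ltxx.
have mU := open_measurable_rV oU.
have [A [mA A0 hA]] := ae; apply/eqP; rewrite eq_le measure_ge0 andbT -A0.
by apply: le_measure; rewrite ?inE// => x /= gx; apply: hA; exact/eqP.
Qed.

End TestSpace.

(** * The vector space of invariant functions in D^{1,2} *)

Section DGspace.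
Context {R : realType}.
Variable m : nat.
Local Notation N := m.+3.
Local Notation V := 'rV[R]_N.
#[local] Opaque crit_exp nrm dir.

Let N3 : (3 <= N)%N. Proof. by []. Qed.

Section Space.
Variable G : set 'M[R]_N.

(** Functions are taken with values in [R^o] so that they form a module over R, of which this set is
    a submodule. *)
Definition DGset : {pred (V -> R^o)} := mem [set u : V -> R^o | D12 (u : V -> R) /\ invariant_fun G (u : V -> R)].

Lemma DGset_submod_closed : submod_closed DGset.
Proof.
split=> [|a u v]; rewrite !inE; first by split; [exact: (@D12_0 R N)|].
move=> [Du iu] [Dv iv]; split; last by move=> x y xy; rewrite /GRing.add/= /GRing.scale/= (iu x y xy) (iv x y xy).
have [h1 _] := D12Z N3 a Du; have [h2 _] := D12D N3 h1 Dv; exact: h2.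
Qed.

HB.instance Definition _ := GRing.isSubmodClosed.Build R (V -> R^o) DGset DGset_submod_closed.

Record DG := MkDG { dgv : V -> R^o; dgvP : dgv \in DGset }.
HB.instance Definition _ := [isSub for dgv].
HB.instance Definition _ := [Choice of DG by <:].
HB.instance Definition _ := [SubChoice_isSubLmodule of DG by <:].

Definition dgfun (u : DG) : V -> R := dgv u.

Lemma dgD u v : dgfun (u + v) = (fun x => dgfun u x + dgfun v x).
Proof. by []. Qed.
Lemma dgN u : dgfun (- u) = (fun x => - dgfun u x).
Proof. by []. Qed.
Lemma dgB u v : dgfun (u - v) = (fun x => dgfun u x - dgfun v x).
Proof. by []. Qed.
Lemma dgZ a u : dgfun (a *: u) = (fun x => a * dgfun u x).
Proof. by []. Qed.
Lemma dg_sum k (c : 'rV[R]_k) (psi : 'I_k -> DG) :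
  dgfun (\sum_i c ord0 i *: psi i) = (fun x => \sum_i c ord0 i * dgfun (psi i) x).
Proof.
apply/funext => x; have D (a b : DG) : dgfun (a + b) x = dgfun a x + dgfun b x by [].
by rewrite (big_morph (fun u : DG => dgfun u x) D (erefl : dgfun 0 x = 0)).
Qed.
Lemma dgP (u : DG) : D12 (dgfun u). Proof. by have := dgvP u; rewrite inE => -[]. Qed.
Lemma dgi (u : DG) : invariant_fun G (dgfun u). Proof. by have := dgvP u; rewrite inE => -[]. Qed.
Lemma dg_intro (u : V -> R) : D12 u -> invariant_fun G u -> exists w : DG, dgfun w = u.
Proof.
move=> Du iu; have h : (u : V -> R^o) \in DGset by rewrite inE.
by exists (MkDG h).
Qed.

End Space.
End DGspace.

Lemma bilinear_bound (R : realDomainType) (P T A a b x y : R) : 0 <= P -> 0 <= T -> 0 <= a -> 0 <= b ->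
  a <= A * x -> b <= A * y -> P * (3 * (T * a * b)) <= P * (3 * (T * A * A)) * x * y.
Proof.
move=> P0 T0 a0 b0 ax yb; have := ler_pM a0 b0 ax yb.
have -> : P * (3 * (T * a * b)) = (P * (3 * T)) * (a * b) by ring.
have -> : P * (3 * (T * A * A)) * x * y = (P * (3 * T)) * (A * x * (A * y)) by ring.
by apply: ler_wpM2l; rewrite !mulr_ge0.
Qed.

(** * The invariant space as an instance of the abstract minmax setting *)

Section Records.
Context {R : realType}.
Variable m : nat.
Local Notation N := m.+3.
Local Notation V := 'rV[R]_N.
Local Notation mu := (@lebesgue_rV R N).
Local Notation I f := (Rintegral mu setT f).
Local Notation intg := (@intg _ _ R mu).
Local Notation p := (@crit_exp R N).
#[local] Opaque crit_exp nrm dir.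

Let N3 : (3 <= N)%N. Proof. by []. Qed.
Let p2 : 2 < p. Proof. exact: crit_gt2. Qed.
Let p1 : 1 < p. Proof. by apply: lt_trans p2; rewrite ltr1n. Qed.
Let p0 : 0 < p. Proof. by apply: lt_trans p2. Qed.

Variables (G : set 'M[R]_N) (O : set V) (lam : R).
Hypotheses (mO : measurable O) (fO : (mu O < +oo)%E) (lam0 : lam <= 0)
  (hlam : (- Lambda O < lam%:E)%E).
Local Notation DG := (DG G).
Implicit Types u v w : DG.

Definition dg_ip u v : R := ipD O lam (dgfun u) (dgfun v).
Definition dg_B u : R := Bf O (dgfun u).
Definition dg_dB u v : R := dBf O (dgfun u) (dgfun v).

(** Completeness stays within invariant functions because the limit is chosen by [limsel],
    pointwise, and so is exactly invariant. *)
Lemma dg_hilbert : semi_hilbert dg_ip.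
Proof.
have [kap k0 hk] := coercive N3 mO fO lam0 hlam.
split=> [u v|u v w|a u w|u|u uC].
- exact: ipDC.
- by rewrite /dg_ip dgD ipDD//; exact: dgP.
- by rewrite /dg_ip dgZ ipDZ//; exact: dgP.
- by apply: le_trans (hk _ (dgP u)); apply: mulr_ge0; [exact: ltW|exact: dir_ge0].
have [s [Dl cl]] : exists s : nat -> nat, let v := limsel (fun k => dgfun (u (s k))) in D12 v /\
  forall e, 0 < e -> exists M, forall n, (M <= n)%N ->
    dir (fun x => dgfun (u n) x - v x) (fun x => dgfun (u n) x - v x) <= e.
  apply: (D12_complete N3 (u := fun n => dgfun (u n))) => [n|e e0]; first exact: dgP.
  have [M hM] := uC _ (mulr_gt0 k0 e0); exists M => i j iM jM.
  have := hM i j iM jM; rewrite /dg_ip => h.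
  have := le_trans (hk _ (dgP (u i - u j))) h; by rewrite ler_pM2l.
have il : invariant_fun G (limsel (fun k => dgfun (u (s k)))).
  move=> x y xy; rewrite /limsel; congr (fine (limn_einf _)); apply/funext => k.
  by rewrite (dgi (u (s k)) xy).
have [l hl] := dg_intro Dl il; exists l => e e0; have [M hM] := cl e e0.
by exists M => n nM; apply: le_trans (ipD_le O lam0 _) _; rewrite dgB hl; exact: hM.
Qed.

Local Notation ipn := (ipn dg_ip).

Lemma dg_nrm : exists2 A, 0 <= A & forall u, nrm (dgfun u) <= A * ipn u.
Proof.
have [kap k0 hk] := coercive N3 mO fO lam0 hlam.
exists (Ksob N / Num.sqrt kap) => [|u]; first by rewrite divr_ge0 ?powR_ge0 ?sqrtr_ge0.
apply: le_trans (nrm_sobolev N3 (dgP u)) _; rewrite -mulrA; apply: ler_wpM2l; first exact: powR_ge0.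
rewrite mulrC ler_pdivlMr ?sqrtr_gt0// -sqrtrM ?dir_ge0// ler_sqrt; last exact: (ip_ge0 dg_hilbert).
by rewrite mulrC; exact: hk (dgP u).
Qed.

Lemma dg_dB_D w u v : dg_dB w (u + v) = dg_dB w u + dg_dB w v.
Proof.
have wp := D12_LP N3 (dgP w); have up := D12_LP N3 (dgP u); have vp := D12_LP N3 (dgP v).
rewrite /dg_dB /dBf dgD -mulrDr; congr (_ * _).
rewrite -(intD (dB_intg N3 mO wp up) (dB_intg N3 mO wp vp)); apply: eq_int => x; exact: mulrDr.
Qed.

Lemma dg_dB_Z w a u : dg_dB w (a *: u) = a * dg_dB w u.
Proof.
have wp := D12_LP N3 (dgP w); have up := D12_LP N3 (dgP u).
rewrite /dg_dB /dBf dgZ mulrCA; congr (_ * _).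
by rewrite -(intZ a (dB_intg N3 mO wp up)); apply: eq_int => x; exact: mulrCA.
Qed.

Lemma dg_dB_lip (A : R) u w v : 0 <= A -> (forall u, nrm (dgfun u) <= A * ipn u) ->
  ipn u <= 1 -> ipn w <= 1 -> 
  `|dg_dB u v - dg_dB w v| <= p * (p - 1) * (3 * (Tc N (2 * A) `^ (p - 2) * A * A)) * ipn (u - w) * ipn v.
Proof.
move=> A0 hA u1 w1.
have b z : ipn z <= 1 -> nrm (dgfun z) <= 2 * A.
  by move=> z1; apply: (le_trans (hA z)); have := ler_wpM2l A0 z1; move: (ipn z) => t; lra.
apply: le_trans (dB_lip N3 mO (D12_LP N3 (dgP u)) (D12_LP N3 (dgP w)) (D12_LP N3 (dgP v)) (b u u1) (b w w1)) _.
apply: bilinear_bound; [|exact: powR_ge0|exact: nrm_ge0|exact: nrm_ge0|exact: (hA (u - w))|exact: hA].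
by rewrite mulr_ge0 ?(ltW p0)// subr_ge0 ltW.
Qed.

Lemma dg_taylor (A : R) u v : 0 <= A -> (forall u, nrm (dgfun u) <= A * ipn u) ->
  ipn u <= 1 -> ipn v <= 1 -> 
  `|dg_B (u + v) - dg_B u - dg_dB u v| <= p * (p - 1) * (3 * (Tc N (2 * A) `^ (p - 2) * A * A)) * ipn v ^+ 2.
Proof.
move=> A0 hA u1 v1; rewrite expr2 [leRHS]mulrA.
have uA : nrm (dgfun u) <= 2 * A.
  by apply: (le_trans (hA u)); have := ler_wpM2l A0 u1; move: (ipn u) => t; lra.
have uvA : nrm (dgfun (u + v)) <= 2 * A.
  apply: (le_trans (hA (u + v))); rewrite mulrC; apply: ler_wpM2r => //.
  by apply: le_trans (ipn_triangle dg_hilbert u v) _; have := lerD u1 v1; move: (ipn u) (ipn v) => s t; lra.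
apply: le_trans (B_taylor N3 mO (D12_LP N3 (dgP u)) (D12_LP N3 (dgP v)) uA uvA) _.
apply: bilinear_bound; [|exact: powR_ge0|exact: nrm_ge0|exact: nrm_ge0|exact: hA|exact: hA].
by rewrite mulr_ge0 ?(ltW p0)// subr_ge0 ltW.
Qed.

Hypotheses (GO : forall g, G g -> g *m g^T = 1%:M) (GV : forall g, G g -> G g^T)
  (O0 : O !=set0) (bO : bounded_set O) (oO : open O) (iO : invariant_set G O)
  (infO : forall x, closure O x -> infinite_set (Gorbit G x)).

(** Combine [dB_compact] with [compact_embedding]. Two vectors of the unit ball differ by at most 2,
    hence the energy bound 4/kap for their difference. *)
Lemma dg_compact (A d : R) : 0 <= A -> (forall u, nrm (dgfun u) <= A * ipn u) -> 0 < d ->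
  exists M (L : 'I_M -> DG -> R),
    [/\ forall i u v, L i (u - v) = L i u - L i v,
        forall i, exists K, forall u, `|L i u| <= K * ipn u &
        forall u v, ipn u <= 1 -> ipn v <= 1 -> (forall i, `|L i (u - v)| <= 1) ->
          dg_dB u (u - v) - dg_dB v (u - v) <= d].
Proof.
move=> A0 hA d0; have [kap k0 hk] := coercive N3 mO fO lam0 hlam.
pose P := p * (p - 1); have P0 : 0 <= P by rewrite mulr_ge0 ?(ltW p0)// subr_ge0 ltW.
pose T := Tc N (2 * A) `^ (p - 2); have T0 : 0 <= T by exact: powR_ge0.
pose q := P * (3 * T) + 1; have q0 : 0 < q.
  by apply: ltr_wpDl => //; apply: mulr_ge0 => //; apply: mulr_ge0.
(* If the L^p norm of the difference on O is at most t, the bound of [dB_compact] is at most (q - 1)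
   d/q, hence at most d. *)
pose t := Num.sqrt (d / q); have t0 : 0 < t by rewrite sqrtr_gt0 divr_gt0.
have [M [L [LB LK Lc]]] := compact_embedding N3 GO bO oO infO
  (divr_gt0 (ltr0n R 4) k0) (powR_gt0 p t0).
exists M, (fun i u => L i (dgfun u)); split.
- by move=> i u v; rewrite dgB; apply: LB; exact: dgP.
- move=> i; have [K hK] := LK i; exists (`|K| * A) => u.
  apply: le_trans (hK _ (dgP u)) _; apply: le_trans (ler_wpM2r (nrm_ge0 _) (ler_norm K)) _.
  by rewrite -mulrA; apply: ler_wpM2l.
move=> u v u1 v1 Lu.
have b z : ipn z <= 1 -> nrm (dgfun z) <= 2 * A.
  by move=> z1; apply: (le_trans (hA z)); have := ler_wpM2l A0 z1; move: (ipn z) => s; lra.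
have up := D12_LP N3 (dgP u); have vp := D12_LP N3 (dgP v).
apply: le_trans (dB_compact N3 mO up vp (b u u1) (b v v1)) _.
have n2 : ipn (u - v) ^+ 2 <= 4.
  have h : ipn (u - v) <= 2.
    apply: le_trans (ipn_triangle dg_hilbert u (- v)) _; rewrite (ipnN dg_hilbert).
    by have := lerD u1 v1; move: (ipn u) (ipn v) => s t'; lra.
  have := lerXn2r 2 (_ : ipn (u - v) \in Num.nneg) (_ : (2 : R) \in Num.nneg) h.
  rewrite !nnegrE => h2; apply: le_trans (h2 (ipn_ge0 _ _) (ler0n _ _)) _.
  by rewrite -natrX.
have dE : dir (dgfun (u - v)) (dgfun (u - v)) <= 4 / kap.
  rewrite ler_pdivlMr// mulrC; apply: le_trans (hk _ (dgP (u - v))) _.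
  by move: n2; rewrite (ipn_sqr dg_hilbert).
have := Lc _ (dgP (u - v)) (dgi (u - v)) dE Lu => hI.
have ht : nrm (fun x => \1_O x * (dgfun u x - dgfun v x)) <= t.
  apply: (nrm_le N3); first exact: ltW.
  apply: le_trans hI; apply: eqP_le; apply: eq_int => x; rewrite dgB indicE.
  by case: (x \in O); rewrite ?mul1r// !mul0r normr0 powR0// gt_eqF.
have h2 : nrm (fun x => \1_O x * (dgfun u x - dgfun v x)) ^+ 2 <= d / q.
  rewrite -(@sqr_sqrtr _ (d / q)); last by rewrite divr_ge0 ?ltW.
  by apply: lerXn2r; rewrite ?nnegrE ?nrm_ge0 ?sqrtr_ge0.
rewrite -/P -/T; apply: (@le_trans _ _ (q * (d / q))); last by rewrite mulrCA divff ?mulr1// gt_eqF.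
move: h2; set z := nrm _ ^+ 2 => h2; have z0 : 0 <= z by exact: sqr_ge0.
have -> : P * (3 * (T * z)) = P * (3 * T) * z by clear; ring.
apply: ler_pM => //; first by apply: mulr_ge0 => //; exact: mulr_ge0.
by rewrite /q lerDl.
Qed.

Lemma dg_functional : exists C, even_functional dg_ip p C dg_B dg_dB.
Proof.
have [A A0 hA] := dg_nrm.
exists (p * (p - 1) * (3 * (Tc N (2 * A) `^ (p - 2) * A * A))); split.
- exact: p0.
- by rewrite !mulr_ge0 ?powR_ge0// ?(ltW p0)// subr_ge0 ltW.
- by move=> u; apply: eq_int => x; rewrite dgN normrN.
- move=> u v; rewrite /dg_dB /dBf dgN -mulrN; congr (_ * _).
  have h := dB_intg N3 mO (D12_LP N3 (dgP u)) (D12_LP N3 (dgP v)).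
  by rewrite -(intN h); apply: eq_int => x; rewrite phiN mulrN mulNr.
- exact: dg_dB_D.
- exact: dg_dB_Z.
- by move=> u; congr (_ * _); apply: eq_int => x; rewrite -mulrA phi_mul.
- by move=> u w v; exact: dg_dB_lip.
- by move=> u v; exact: dg_taylor.
- by move=> d; exact: (dg_compact A0 hA).
move=> k; have [psi [hp hpos]] := test_family N3 GO GV O0 bO oO iO k.
have /choice[psi' hpsi] i : exists w : DG, dgfun w = psi i.
  by have [h1 h2] := hp i; exact: dg_intro h1 h2.
exists psi' => x x0; rewrite /dg_B dg_sum.
by have := hpos x x0; congr (_ < Bf _ _); apply/funext => y; apply: eq_bigr => i _; rewrite hpsi.
Qed.

Lemma dg_critical (eps : R) : 0 < eps ->
  exists y, [/\ critical_on_sphere dg_ip p dg_B dg_dB y, 0 < dg_B y & dg_B y < eps].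
Proof. by move=> e0; have [C EF] := dg_functional; exact: (minmax_small_critical_value dg_hilbert EF e0). Qed.

End Records.

(** * Orthogonal maps act by isometries on D^{1,2} and preserve B *)

Section Symmetry.
Context {R : realType}.
Variable N : nat.
Hypothesis N3 : (3 <= N)%N.
Local Notation V := 'rV[R]_N.
Local Notation mu := (@lebesgue_rV R N).
Local Notation I f := (Rintegral mu setT f).
Local Notation intg := (@intg _ _ R mu).
Local Notation p := (@crit_exp R N).
#[local] Opaque crit_exp nrm dir.
Implicit Types (u v w : V -> R).

Variables (g : 'M[R]_N).
Hypothesis gg : g *m g^T = 1%:M.
Let pg := preserving_orth gg.

Lemma D12_orth u : D12 u -> D12 (fun x => u (x *m g)) /\
  forall i, {ae mu, forall x, wpartial i (fun x => u (x *m g)) x = \sum_j g i j * wpartial j u (x *m g)}.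
Proof.
move=> Du; apply: D12_intro => //; first exact: (LP_preserving pg (D12_LP N3 Du)).
by move=> i; exact: (wk_orth i gg (D12_loc N3 Du) (fun j => D12_wk j Du)).
Qed.

(** Both sides are the Euclidean product of two vectors, before and after the orthogonal matrix
    g. *)
Lemma sum_orth (a b : 'I_N -> R) :
  \sum_i (\sum_j g i j * a j) * (\sum_j g i j * b j) = \sum_j a j * b j.
Proof.
pose A : V := \row_j a j; pose B : V := \row_j b j.
have E : (A *m g^T) *m (B *m g^T)^T = A *m B^T.
  by rewrite trmx_mul trmxK !mulmxA -(mulmxA A) (mulmx1C gg) mulmx1.
transitivity ((A *m B^T) ord0 ord0); last by rewrite mxE; apply: eq_bigr => i _; rewrite !mxE.
rewrite -E mxE; apply: eq_bigr => i _; rewrite !mxE.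
by congr (_ * _); apply: eq_bigr => j _; rewrite !mxE mulrC.
Qed.

Lemma dir_orth u v : D12 u -> D12 v -> dir (fun x => u (x *m g)) (fun x => v (x *m g)) = dir u v.
Proof.
move=> Du Dv; have [Du' hu] := D12_orth Du; have [Dv' hv] := D12_orth Dv.
have du := intg_meas (dir_intg Du Dv).
transitivity (I (fun x => \sum_i wpartial i u (x *m g) * wpartial i v (x *m g))); last exact: (int_preserving pg du).
apply: int_ae; [exact: (intg_meas (dir_intg Du' Dv'))|exact: (meas_preserving pg du)|].
apply: filterS2 (ae_forall hu) (ae_forall hv) => x hx hy.
by rewrite -[RHS]sum_orth; apply: eq_bigr => i _; rewrite hx hy.
Qed.

Variable O : set V.
Hypotheses (mO : measurable O) (fO : (mu O < +oo)%E) (iO : forall x, (x *m g \in O) = (x \in O)).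

Lemma ipD_orth lam u v : D12 u -> D12 v ->
  ipD O lam (fun x => u (x *m g)) (fun x => v (x *m g)) = ipD O lam u v.
Proof.
move=> Du Dv; rewrite /ipD dir_orth//; congr (_ + _ * _).
have h := intg_meas (O_mul N3 mO fO (D12_LP N3 Du) (D12_LP N3 Dv)).
by rewrite -(int_preserving pg h); apply: eq_int => x; rewrite !indicE iO.
Qed.

Lemma dBf_orth u v : D12 u -> D12 v ->
  dBf O (fun x => u (x *m g)) (fun x => v (x *m g)) = dBf O u v.
Proof.
move=> Du Dv; congr (_ * _).
have h := intg_meas (dB_intg N3 mO (D12_LP N3 Du) (D12_LP N3 Dv)).
by rewrite -(int_preserving pg h); apply: eq_int => x; rewrite /Q iO.
Qed.

Lemma conv_orth k u x : (forall y, k (y *m g) = k y) -> continuous k -> loc u ->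
  {ae mu, forall y, u (y *m g) = u y} -> conv k u (x *m g) = conv k u x.
Proof.
move=> kg ck lu ug.
have mk y : measurable_fun setT (fun t : V => k (y - t) * u t).
  by apply: measurable_funM; [apply: continuous_measurable_rV; exact: reflect_cont|case: lu].
rewrite /conv -(int_preserving pg (mk (x *m g))); apply: int_ae; [exact: (meas_preserving pg (mk _))|exact: mk|].
by apply: filterS ug => y ->; rewrite -mulmxBl kg.
Qed.

End Symmetry.

(** * From invariance almost everywhere to invariance everywhere *)

Section Invariant.
Context {R : realType}.
Variable N : nat.
Hypothesis N3 : (3 <= N)%N.
Local Notation V := 'rV[R]_N.
Local Notation mu := (@lebesgue_rV R N).
#[local] Opaque crit_exp nrm dir.

(* Mollification by radial kernels turns invariance almost everywhere into invariance everywhere. *)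
Lemma invariant_representative (G : set 'M[R]_N) (w : V -> R) :
  (forall g, G g -> g *m g^T = 1%:M) -> (forall g, G g -> G g^T) -> D12 w ->
  (forall g, G g -> {ae mu, forall x, w (x *m g) = w x}) ->
  exists w' : V -> R, [/\ measurable_fun setT w', {ae mu, forall x, w x = w' x},
    D12 w' & invariant_fun G w'].
Proof.
move=> GO GV Dw wG; have lw := D12_loc N3 Dw; have [s [_ hs]] := rho_ae lw.
pose w' := limsel (fun j => conv (rho (s j)) w).
have ck j : continuous (rho j : V -> R) by have [h _ _ _] := @rho_kernel R N j; exact: smooth_cont.
have bk j : bsupp (rho j : V -> R) by have [_ h _ _] := @rho_kernel R N j.
have mw' : measurable_fun setT w'.
  by apply: measurable_limsel => j; apply: continuous_measurable_rV; exact: conv_cont.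
have ww' : {ae mu, forall x, w x = w' x}.
  by apply: filterS hs => x hx; apply/esym; exact: limsel_cvg.
have [Dw' _] := D12_ae N3 mw' ww' Dw.
exists w'; split; [exact: mw'|exact: ww'|exact: Dw'|].
move=> x _ [g Gg <-]; rewrite /w' /limsel; congr (fine (limn_einf _)); apply/funext => j.
have gT : g^T *m g^T^T = 1%:M by rewrite trmxK (mulmx1C (GO _ Gg)).
congr (_%:E); apply: conv_orth => //; last exact: wG (GV _ Gg).
by move=> y; exact: rho_orth.
Qed.

End Invariant.

(** * The principle of symmetric criticality *)

Section Criticality.
Context {R : realType}.
Variable m : nat.
Local Notation N := m.+3.
Local Notation V := 'rV[R]_N.
Local Notation mu := (@lebesgue_rV R N).
Local Notation I f := (Rintegral mu setT f).
Local Notation intg := (@intg _ _ R mu).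
Local Notation p := (@crit_exp R N).
#[local] Opaque crit_exp nrm dir.

Let N3 : (3 <= N)%N. Proof. by []. Qed.
Let p2 : 2 < p. Proof. exact: crit_gt2. Qed.
Let p1 : 1 < p. Proof. by apply: lt_trans p2; rewrite ltr1n. Qed.
Let p0 : 0 < p. Proof. by apply: lt_trans p2. Qed.

Variables (O : set V) (lam : R).
Hypotheses (mO : measurable O) (fO : (mu O < +oo)%E) (lam0 : lam <= 0)
  (hlam : (- Lambda O < lam%:E)%E).
Local Notation D1 := (DG [set (1%:M : 'M[R]_N)]).
Local Notation ip1 := (@dg_ip R m [set 1%:M] O lam).
Let H1 : semi_hilbert ip1. Proof. exact: dg_hilbert. Qed.

(** The trivial group imposes no symmetry, so the results on invariant functions specialise to the
    whole of D^{1,2}. *)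
Lemma D12_dg (u : V -> R) : D12 u -> exists w : D1, dgfun w = u.
Proof. by move=> Du; apply: dg_intro => // x y [g ->]; rewrite trmx1 mulmx1 => <-. Qed.

Lemma dBf_bound (y : D1) : exists K, forall v : D1, `|dg_dB O y v| <= K * ipn ip1 v.
Proof.
have [A A0 hA] := dg_nrm [set 1%:M] mO fO lam0 hlam.
have yp := D12_LP N3 (dgP y); have zp : LP mu p (fun=> 0) := D12_LP N3 (D12_0 N3).
have z0 v : dBf O (fun=> 0) (dgfun (v : D1)) = 0.
  rewrite /dBf (eq_int mu (g := fun=> 0)) ?int0 ?mulr0// => x.
  by rewrite /phi mulr0 mulr0 mul0r.
have nz : nrm (fun _ : V => 0 : R) <= nrm (dgfun y).
  apply: (nrm_le N3); first exact: nrm_ge0.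
  rewrite (eq_int mu (g := fun=> 0)) ?int0 ?powR_ge0// => x; rewrite normr0 powR0// gt_eqF//.
have pm : 0 <= p * (p - 1) by rewrite mulr_ge0 ?(ltW p0)// subr_ge0 ltW.
set T := Tc N (nrm (dgfun y)) `^ (p - 2).
exists (p * (p - 1) * (3 * (T * A * A)) * ipn ip1 (y - 0)) => v.
have := dB_lip N3 mO yp zp (D12_LP N3 (dgP v)) (lexx _) nz.
rewrite z0 subr0 -/T => h; apply: (le_trans h).
apply: bilinear_bound; [exact: pm|exact: powR_ge0|exact: nrm_ge0|exact: nrm_ge0|exact: (hA (y - 0))|exact: hA].
Qed.

(** Null vectors of a semidefinite form are orthogonal to everything, by Cauchy-Schwarz. *)
Lemma ipD_null (w v : V -> R) : D12 w -> D12 v -> ipD O lam w w = 0 -> ipD O lam w v = 0.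
Proof.
move=> /D12_dg[a <-] /D12_dg[b <-] h; apply/eqP; rewrite -normr_le0.
have a0 : ipn ip1 a = 0 by rewrite /ipn /dg_ip h sqrtr0.
by have := cauchy_schwarz H1 a b; rewrite a0 mul0r.
Qed.

Lemma ipD_eq0_ae (w : V -> R) : D12 w -> ipD O lam w w = 0 -> {ae mu, forall x, w x = 0}.
Proof.
move=> Dw h; have [kap k0 hk] := coercive N3 mO fO lam0 hlam.
have d0 : dir w w = 0.
  by apply/eqP; rewrite eq_le dir_ge0 andbT -(pmulr_rle0 _ k0) -h; exact: hk.
apply: (nrm_eq0 N3 (D12_LP N3 Dw)); apply/eqP; rewrite eq_le nrm_ge0 andbT.
by have := nrm_sobolev N3 Dw; rewrite d0 sqrtr0 mulr0.
Qed.

Variable G : set 'M[R]_N.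
Hypotheses (GO : forall g, G g -> g *m g^T = 1%:M) (GV : forall g, G g -> G g^T)
  (iO : forall g x, G g -> (x *m g \in O) = (x \in O)).

(* Principle of symmetric criticality: the Riesz representative of the derivative is itself
   invariant, and orthogonal to the invariant functions. *)
Lemma symmetric_criticality (y : DG G) (c : R) :
  (forall v : DG G, dg_dB O y v = c * dg_ip O lam y v) ->
  forall v : V -> R, D12 v -> dBf O (dgfun y) v = c * ipD O lam (dgfun y) v.
Proof.
move=> crit v Dv; have Dy := dgP y; have [y1 hy1] := D12_dg Dy.
have [K hK] := dBf_bound y1.
pose l (v : D1) := dg_dB O y1 v - c * ip1 y1 v.
have [w hw] : exists w, forall v, l v = ip1 w v.
  apply: (riesz H1 (K := K + `|c| * ipn ip1 y1)) => [a b|a b|a].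
  - by rewrite /l dg_dB_D// (ipDr H1); ring.
  - by rewrite /l dg_dB_Z// (ipZr H1); ring.
  - rewrite /l; apply: le_trans (ler_normB _ _) _; rewrite mulrDl; apply: lerD; first exact: hK.
    by rewrite normrM -mulrA; apply: ler_wpM2l => //; exact: cauchy_schwarz.
have Dw := dgP w.
have L b : D12 b -> dBf O (dgfun y) b - c * ipD O lam (dgfun y) b = ipD O lam (dgfun w) b.
  by move=> /D12_dg[b' <-]; have := hw b'; rewrite /l /dg_dB /dg_ip hy1.
have wG g : G g -> {ae mu, forall x, dgfun w (x *m g) = dgfun w x}.
  move=> Gg; have gg := GO Gg; have iOg x := iO x Gg.
  have gT : g^T *m g^T^T = 1%:M by rewrite trmxK (mulmx1C gg).
  have [Dwg _] := D12_orth N3 gg Dw.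
  (* Since y, the form and dB are invariant under g, the function w o g represents the same
     functional as w. *)
  have key b : D12 b -> ipD O lam (fun x => dgfun w (x *m g)) b = ipD O lam (dgfun w) b.
    move=> Db; have [DbT _] := D12_orth N3 gT Db.
    have Eb : b = (fun x => b (x *m g *m g^T)) by apply/funext => x; rewrite -mulmxA gg mulmx1.
    have Ey : dgfun y = (fun x => dgfun y (x *m g)).
      by apply/funext => x; apply/esym/(dgi y); exists g^T; [exact: GV|rewrite trmxK].
    rewrite -L// {1}Eb (ipD_orth N3 gg mO fO iOg lam Dw DbT) -L//; congr (_ - _ * _).
      by rewrite -(dBf_orth N3 gg mO iOg Dy DbT) -Ey -Eb.
    by rewrite -(ipD_orth N3 gg mO fO iOg lam Dy DbT) -Ey -Eb.
  have [Dz _] := D12B N3 Dwg Dw.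
  have : ipD O lam (fun x => dgfun w (x *m g) - dgfun w x) (fun x => dgfun w (x *m g) - dgfun w x) = 0.
    have [a ha] := D12_dg Dwg; have key2 b := key _ (dgP (b : D1)).
    have -> : (fun x => dgfun w (x *m g) - dgfun w x) = dgfun (a - w) by rewrite dgB ha.
    have := key2 (a - w); rewrite -ha => e.
    by change (ip1 (a - w) (a - w) = 0); rewrite (ipBl H1) [ip1 a _]e subrr.
  move=> /(ipD_eq0_ae Dz); apply: filterS => x /eqP; by rewrite subr_eq0 => /eqP.
have [w' [mw' ww' Dw' iw']] := invariant_representative N3 GO GV Dw wG.
have [a ha] := dg_intro Dw' iw'.
(* The invariant version w' of w is an admissible direction, in which the functional vanishes; as w
   = w' almost everywhere, w has norm zero and the functional is zero. *)
have : ipD O lam (dgfun w) w' = 0.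
  by rewrite -L// -ha; have := crit a; rewrite /dg_dB /dg_ip => ->; rewrite subrr.
rewrite ipDC (ipD_ae N3 mO lam mw' ww' Dw Dw) => h0.
by have := ipD_null Dw Dv h0; rewrite -L// => /eqP; rewrite subr_eq0 => /eqP.
Qed.

End Criticality.

(** * From critical points on the sphere to solutions of high energy *)

Section Solutions.
Context {R : realType}.
Variable m : nat.
Local Notation N := m.+3.
Local Notation V := 'rV[R]_N.
Local Notation mu := (@lebesgue_rV R N).
Local Notation I f := (Rintegral mu setT f).
Local Notation intg := (@intg _ _ R mu).
Local Notation p := (@crit_exp R N).
#[local] Opaque crit_exp nrm dir.

Let N3 : (3 <= N)%N. Proof. by []. Qed.
Let p2 : 2 < p. Proof. exact: crit_gt2. Qed.
Let p1 : 1 < p. Proof. by apply: lt_trans p2; rewrite ltr1n. Qed.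
Let p0 : 0 < p. Proof. by apply: lt_trans p2. Qed.

Variables (O : set V) (lam : R).
Hypotheses (mO : measurable O) (fO : (mu O < +oo)%E) (lam0 : lam <= 0)
  (hlam : (- Lambda O < lam%:E)%E).
Local Notation D1 := (DG [set (1%:M : 'M[R]_N)]).
Local Notation ip1 := (@dg_ip R m [set 1%:M] O lam).
Let H1 : semi_hilbert ip1. Proof. exact: dg_hilbert. Qed.

Lemma J_E u : D12 u -> J O lam u = 2^-1 * ipD O lam u u - p^-1 * Bf O u.
Proof.
move=> Du; have up := D12_LP N3 Du; have h := O_mul N3 mO fO up up.
rewrite /J; congr (_ * _ - _).
rewrite /ipD dirE -(intZ lam h) -(intD (grad_intg Du) (intgZ lam h)); apply: eq_int => x.
by congr (_ + _); rewrite expr2 -!mulrA.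
Qed.

(** The linear terms in v cancel, so J(u+v) - J(u) is half the square of v in the form minus 1/p
    times the Taylor remainder of B, hence of order |v|^2. *)
Lemma solution_of_critical (u : V -> R) : D12 u ->
  (forall v, D12 v -> dBf O u v = p * ipD O lam u v) -> solution O lam u.
Proof.
move=> Du crit; split; first exact: Du.
move=> eps e0; have [a ha] := D12_dg Du.
have [A A0 hA] := dg_nrm [set 1%:M] mO fO lam0 hlam.
(* A common bound for the L^p norms of u and of u + v with |v| <= 1, as required by [B_taylor]. *)
pose A' := A * (ipn ip1 a + 1).
pose P := p * (p - 1); have P0 : 0 <= P by rewrite mulr_ge0 ?(ltW p0)// subr_ge0 ltW.
pose T := Tc N A' `^ (p - 2); have T0 : 0 <= T by exact: powR_ge0.
pose C := 2^-1 + p^-1 * (P * (3 * (T * A * A))).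
have C0 : 0 <= C.
  apply: addr_ge0; first by rewrite invr_ge0.
  apply: mulr_ge0; first by rewrite invr_ge0 (ltW p0).
  by apply: mulr_ge0 => //; apply: mulr_ge0 => //; apply: mulr_ge0 => //; exact: mulr_ge0.
exists (Num.min 1 (eps / (C + 1))); first by rewrite lt_min ltr01 divr_gt0// ltr_wpDl.
move=> v Dv; rewrite le_min => /andP[d1 d2]; have [b hb] := D12_dg Dv.
set d := D12_norm v in d1 d2 *; have d0 : 0 <= d by exact: sqrtr_ge0.
have bd : ipn ip1 b <= d.
  rewrite /d /D12_norm -dirE /ipn /dg_ip hb ler_sqrt ?dir_ge0//; exact: ipD_le.
have hJ : J O lam (u \+ v) - J O lam u =
    2^-1 * ip1 b b - p^-1 * (Bf O (fun x => dgfun a x + dgfun b x) - Bf O (dgfun a) - dBf O (dgfun a) (dgfun b)).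
  have -> : u \+ v = dgfun (a + b) by rewrite dgD ha hb.
  rewrite (J_E Du) (J_E (dgP (a + b))) -{1 2 3}ha (_ : dBf O _ _ = p * ip1 a b); last first.
    by rewrite ha hb (crit v Dv) /dg_ip ha hb.
  have -> : ipD O lam (dgfun (a + b)) (dgfun (a + b)) = ip1 a a + 2 * ip1 a b + ip1 b b.
    have E : ip1 (a + b) (a + b) = ip1 a a + 2 * ip1 a b + ip1 b b.
      rewrite (ipDl H1) !(ipDr H1) (ipC H1 b a).
      by move: (ip1 a a) (ip1 a b) (ip1 b b) => r s t; clear; ring.
    exact: E.
  rewrite dgD; have : ip1 a a = ipD O lam (dgfun a) (dgfun a) by [].
  have pn : p != 0 by rewrite gt_eqF.
  move=> <-; move: (ip1 a a) (ip1 a b) (ip1 b b) (Bf O _) (Bf O _) (p) pn => r s t x y q qn.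
  by field.
have tb : `|Bf O (fun x => dgfun a x + dgfun b x) - Bf O (dgfun a) - dBf O (dgfun a) (dgfun b)| <=
    P * (3 * (T * A * A)) * d * d.
  apply: le_trans (B_taylor N3 mO (A := A') (D12_LP N3 (dgP a)) (D12_LP N3 (dgP b)) _ _) _.
  - by apply: le_trans (hA a) _; apply: ler_wpM2l => //; rewrite lerDl.
  - apply: le_trans (hA (a + b)) _; apply: ler_wpM2l => //.
    apply: le_trans (ipn_triangle H1 a b) _; apply: lerD => //; exact: le_trans bd d1.
  have nb : nrm (dgfun b) <= A * d by apply: le_trans (hA b) _; exact: ler_wpM2l.
  by apply: bilinear_bound; rewrite ?nrm_ge0.
have b2 : `|ip1 b b| <= d * d.
  by rewrite ger0_norm ?(ip_ge0 H1)// -(ipn_sqr H1) expr2; apply: ler_pM; rewrite ?ipn_ge0.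
rewrite hJ; apply: (@le_trans _ _ (C * d * d)).
  apply: le_trans (ler_normB _ _) _; rewrite 2!normrM ger0_norm// [`|p^-1|]ger0_norm ?invr_ge0 ?(ltW p0)//.
  have e1 := ler_wpM2l (_ : 0 <= 2^-1 :> R) b2; have e2 := ler_wpM2l (_ : 0 <= p^-1) tb.
  apply: (le_trans (lerD (e1 _) (e2 _))); rewrite ?invr_ge0 ?ler0n ?(ltW p0)//.
  by apply: eqP_le; rewrite /C; move: (P * _) (p^-1) (d) => x y z; clear; ring.
apply: ler_wpM2r => //; apply: (@le_trans _ _ ((C + 1) * d)); first by rewrite ler_wpM2r// lerDl.
by rewrite mulrC -ler_pdivlMr// ltr_wpDl.
Qed.

Variable G : set 'M[R]_N.
Hypotheses (GO : forall g, G g -> g *m g^T = 1%:M) (GV : forall g, G g -> G g^T)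
  (iO : invariant_set G O) (O0 : O !=set0) (bO : bounded_set O) (oO : open O)
  (infO : forall x, closure O x -> infinite_set (Gorbit G x)).

(** Rescaling trades smallness of the critical value for size of the solution: with t^(p-2) B(y) = 1
    the multiplier disappears and B(t y) = t^2 is large when B(y) is small. *)
Lemma high_energy_solution (K : R) : 0 < K ->
  exists u, [/\ solution O lam u, invariant_fun G u & K < Bf O u].
Proof.
move=> K0; pose q := p - 2; have q0 : 0 < q by rewrite subr_gt0.
have Kq : 0 < (K + 1) `^ q by rewrite powR_gt0// ltr_wpDl// ltW.
have Kq' : 0 < ((K + 1) `^ q)^-1 by rewrite invr_gt0.
have [y [[y1 crit] By Be]] := dg_critical mO fO lam0 hlam GO GV O0 bO oO iO infO Kq'.
have iOx g x : G g -> (x *m g \in O) = (x \in O).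
  move=> Gg; apply/idP/idP; rewrite !inE => h.
    have := iO h (ex_intro2 _ _ g Gg erefl); by rewrite -mulmxA (GO Gg) mulmx1.
  by apply: (iO h); exists g^T; [exact: GV|rewrite trmxK].
have cr := symmetric_criticality mO fO lam0 hlam GO GV iOx crit.
set B := dg_B O y in By Be crit cr.
(* The scale with t^q B = 1, where q = p - 2 is the excess of the degree of dB over that of the
   form. *)
pose t := B `^ (- q^-1); have t0 : 0 < t by exact: powR_gt0.
have tB : t `^ q * B = 1.
  by rewrite /t -powRrM mulNr mulVf ?gt_eqF// powR_inv1 ?(ltW By)// mulVf// gt_eqF.
have Dy := dgP y; pose u x := t * dgfun y x; have [Du _] := D12Z N3 t Dy.
have cu v : D12 v -> dBf O u v = p * ipD O lam u v.
  move=> Dv; have -> : dBf O u v = t `^ q * t * dBf O (dgfun y) v.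
    have h := dB_intg N3 mO (D12_LP N3 Dy) (D12_LP N3 Dv).
    rewrite /dBf mulrCA -(intZ _ h); congr (_ * _); apply: eq_int => x.
    rewrite /phi /u normrM (ger0_norm (ltW t0)) powRM ?(ltW t0)// -/q.
    by move: (t `^ q) (_ `^ q) (Q O x) (v x) (dgfun y x) => *; clear; ring.
  have crv := cr v Dv; transitivity (t `^ q * t * (p * B * ipD O lam (dgfun y) v)); first by congr (_ * _); exact: crv.
  rewrite (ipDZ N3 mO fO lam t Dy Dv).
  move: (ipD O lam (dgfun y) v) (p) => r s.
  have -> : t `^ q * t * (s * B * r) = (t `^ q * B) * (s * (t * r)) by ring.
  by rewrite tB mul1r.
exists u; split; first exact: solution_of_critical Du cu.
  by move=> x z xz; rewrite /u (dgi y xz).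
have Bu : Bf O u = t ^+ 2.
  have pn : p != 0 by rewrite gt_eqF.
  apply: (mulfI pn); transitivity (dBf O u u).
    by congr (_ * _); apply: eq_int => x; rewrite -mulrA phi_mul.
  rewrite (cu u Du); congr (_ * _).
  rewrite (ipDZ N3 mO fO lam t Dy Du) ipDC (ipDZ N3 mO fO lam t Dy Dy) mulrA -expr2.
  have := ipn_sqr (dg_hilbert G mO fO lam0 hlam) y; rewrite y1 expr1n /dg_ip => <-.
  by rewrite mulr1.
have K1t : K + 1 < t.
  rewrite ltNge; apply/negP => tK.
  have : t `^ q <= (K + 1) `^ q by apply: ge0_ler_powR; rewrite ?nnegrE ?(ltW q0) ?(ltW t0) ?addr_ge0 ?(ltW K0).
  move=> h; have := ler_wpM2r (ltW By) h; rewrite tB leNgt => /negP; apply.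
  by rewrite mulrC -ltr_pdivlMr// div1r.
have t1 : 1 < t by apply: lt_trans K1t; rewrite ltrDr.
rewrite Bu expr2; apply: (@lt_trans _ _ t); last by rewrite ltr_pMr.
by apply: lt_trans K1t; rewrite ltrDl.
Qed.

End Solutions.

(** * Infinitely many classes of solutions *)

Lemma finite_set_ubound (R : realDomainType) (A : set R) : finite_set A ->
  exists2 M : R, 0 < M & forall x, A x -> x <= M.
Proof.
move=> /finite_seqP[s ->]; elim: s => [|a s [M M0 hM]]; first by exists 1.
exists (M + `|a|); first by rewrite ltr_wpDr.
move=> x /=; rewrite inE => /predU1P[->|/hM h]; first by have := ler_norm a; lra.
by apply: le_trans h _; rewrite lerDl.
Qed.

Lemma orthogonal_subgroup_tr (R : realType) N (G : set 'M[R]_N) : closed_subgroup_O G ->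
  forall g, G g -> G g^T.
Proof.
move=> [GO _ _ GI _] g Gg; have := GI _ Gg; have gg := GO _ Gg.
have ug : g \in unitmx by case: (mulmx1_unit gg).
by rewrite -[invmx g]mulmx1 -gg mulKmx.
Qed.

Theorem theorem1p5 (R : realType) (N : nat) (G : set 'M[R]_N)
    (Omega : set 'rV[R]_N) (lambda : R) :
  (3 <= N)%N ->
  closed_subgroup_O G ->
  Omega !=set0 -> bounded_set Omega -> open Omega -> smooth_boundary Omega ->
  (- Lambda Omega < lambda%:E)%E -> lambda <= 0 ->
  invariant_set G Omega ->
  (forall x, closure Omega x -> infinite_set (Gorbit G x)) ->
  infinite_set
    [set ae_class u | u in [set u | solution Omega lambda u /\ invariant_fun G u]].
Proof.
case: N G Omega => [|[|[|m]]] G O // N3 GG O0 bO oO _ hlam lam0 iO infO fin.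
have GV := orthogonal_subgroup_tr GG; have [GO _ _ _ _] := GG.
have mO : measurable O by exact: open_measurable_rV.
have fO : (lebesgue_rV m.+3 O < +oo)%E.
  have [r r0 hr] := O_bound bO.
  by apply: (lebesgue_rV_bounded mO (r := r + 1)) => x /hr h; apply: le_lt_trans h _; rewrite ltrDl.
(* Each class is evaluated through a chosen representative in P c. Finitely many classes would bound
   the values of B, whereas [high_energy_solution] exceeds every bound. *)
pose P c := [set u : 'rV[R]_m.+3 -> R | (solution O lambda u /\ invariant_fun G u) /\ ae_class u = c].
have := finite_set_ubound (finite_image (fun c => Bf O (xget (cst 0) (P c))) fin).
move=> [M M0 hM].
have [u [su iu Mu]] := high_energy_solution mO fO lam0 hlam GO GV iO O0 bO oO infO M0.
have := hM (Bf O (xget (cst 0) (P (ae_class u)))).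
move=> /(_ (ex_intro2 _ _ (ae_class u) (ex_intro2 _ _ u (conj su iu) erefl) erefl)).
have /xgetPex := ex_intro (P (ae_class u)) u (conj (conj su iu) erefl).
move=> /(_ (cst 0)); move: (xget _ _) => w [[sw _] uw].
(* The representative w chosen in the class of u equals u almost everywhere, so B takes the same
   value. *)
suff -> : Bf O w = Bf O u by rewrite leNgt Mu.
have : ae_class u w by rewrite -uw; apply: filterE.
move=> wu; apply: int_ae.
- exact: (intg_meas (B_intg mO (D12_LP N3 sw.1))).
- exact: (intg_meas (B_intg mO (D12_LP N3 su.1))).
- by apply: filterS wu => x /(_ Logic.I) ->.
Qed.
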